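(* Let $(\delta,\nu)\in\gamma_+\cup\gamma_-$ and let $\sigma$ be a root of $\mathcal P(\sigma;\delta,\nu)=0$. (i) If $\mathcal P'(\sigma;\delta,\nu)\neq0$, then system (MS) has a solution $(\rho_*(\tau),\psi_*(\tau))$, defined for $\tau\ge0$, with asymptotic expansion of type (E1) with this $\sigma$. (ii) If $\mathcal P'(\sigma;\delta,\nu)=0$ and $\mathcal P''(\sigma;\delta,\nu)<0$, then system (MS) has two different solutions $(\rho_*(\tau),\psi_*(\tau))$, defined for $\tau\ge0$, with asymptotic expansions of type (E2), one with $\psi_1=\phi$ and one with $\psi_1=-\phi$. (iii) If $\mathcal P'(\sigma;\delta,\nu)=0$ and $\mathcal P''(\sigma;\delta,\nu)=0$, then system (MS) has a solution $(\rho_*(\tau),\psi_*(\tau))$, defined for $\tau\ge0$, with asymptotic expansion of type (E3).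
   Context: Let $\lambda>0$, $\nu\in[0,\pi)$, and let $\mu:[0,\infty)\to\mathbb R$ be a smooth function with asymptotic expansion $\mu(\tau)=\tau^{-1/2}\big(\mu_0+\sum_{k\ge1}\mu_k\tau^{-k}\big)$ as $\tau\to\infty$, with constants $\mu_k$. System (MS) for unknown functions $\rho(\tau),\psi(\tau)$, $\tau\ge0$, is $\frac{d\rho}{d\tau}+\mu(\tau)\rho\sin(2\psi+\nu)=\sin\psi$, $\quad\rho\big[\frac{d\psi}{d\tau}-\rho^2+\lambda\tau\big]+\mu(\tau)\rho\cos(2\psi+\nu)=\cos\psi$. Set $\delta:=\mu_0\sqrt\lambda$ and $\mathcal P(\sigma;\delta,\nu):=\delta\sin(2\sigma+\nu)-\sin\sigma$; primes on $\mathcal P$ denote derivatives in $\sigma$. Let $\gamma(\delta,\nu):=(4\delta^2-1)^3-27\delta^2\sin^2\nu$ and $\gamma_\pm:=\{(\delta,\nu)\in\mathbb R\times[0,\pi):\gamma(\delta,\nu)=0,\ \pm\delta>0\}$. Asymptotic expansion types (asymptotic series with constant coefficients as $\tau\to\infty$, $\sigma$ a root of $\mathcal P(\cdot;\delta,\nu)=0$): (E1) $\rho(\tau)\sim\sqrt\lambda\,\tau^{1/2}+\sum_{k\ge1}\rho_k\tau^{-k/2}$, $\psi(\tau)\sim\sigma+\sum_{k\ge1}\psi_k\tau^{-k/2}$ (here $\mathcal P'(\sigma;\delta,\nu)\ne0$, $\rho_1=0$, $\psi_1=-\sqrt\lambda/(2\mathcal P'(\sigma;\delta,\nu))$); (E2)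 $\rho(\tau)\sim\sqrt\lambda\,\tau^{1/2}+\sum_{k\ge2}\rho_k\tau^{-k/4}$, $\psi(\tau)\sim\sigma+\sum_{k\ge1}\psi_k\tau^{-k/4}$ with $\psi_1\in\{\phi,-\phi\}$, where $\phi:=\sqrt{-\sqrt\lambda/\mathcal P''(\sigma;\delta,\nu)}$ (requires $\mathcal P''(\sigma;\delta,\nu)<0$); (E3) $\rho(\tau)\sim\sqrt\lambda\,\tau^{1/2}+\sum_{k\ge2}\rho_k\tau^{-k/6}$, $\psi(\tau)\sim\sigma+\sum_{k\ge1}\psi_k\tau^{-k/6}$ with $\psi_1=-\chi$, $\chi:=\big(3\sqrt\lambda/\mathcal P'''(\sigma;\delta,\nu)\big)^{1/3}$. *)

(* Defs.v *)
From Stdlib Require Import Reals Lra.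
Open Scope R_scope.

Definition deriv_nonneg (f : R -> R) (x l : R) : Prop :=
  forall eps, 0 < eps -> exists d, 0 < d /\
    forall h, h <> 0 -> Rabs h < d -> 0 <= x + h ->
      Rabs ((f (x + h) - f x) / h - l) < eps.

Definition smooth_nonneg (f : R -> R) : Prop :=
  exists D : nat -> R -> R,
    (forall x, 0 <= x -> D 0%nat x = f x) /\
    (forall n x, 0 <= x -> deriv_nonneg (D n) x (D (S n) x)).

Fixpoint psum (c e : nat -> R) (tau : R) (N : nat) : R :=
  match N with
  | O => c 0%nat * Rpower tau (e 0%nat)
  | S n => psum c e tau n + c (S n) * Rpower tau (e (S n))
  end.

Definition asymp (f : R -> R) (c e : nat -> R) : Prop :=
  forall N : nat, exists C T, 0 < T /\
    forall tau, T <= tau ->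
      Rabs (f tau - psum c e tau N) <= C * Rpower tau (e (S N)).

(* P(sigma; delta, nu) and its sigma-derivatives (written out). *)
Definition P0 (s d nu : R) : R := d * sin (2 * s + nu) - sin s.
Definition P1 (s d nu : R) : R := 2 * d * cos (2 * s + nu) - cos s.
Definition P2 (s d nu : R) : R := - 4 * d * sin (2 * s + nu) + sin s.
Definition P3 (s d nu : R) : R := - 8 * d * cos (2 * s + nu) + cos s.

Definition gam (d nu : R) : R :=
  (4 * d ^ 2 - 1) ^ 3 - 27 * d ^ 2 * (sin nu) ^ 2.

Definition in_gamma (d nu : R) : Prop :=
  0 <= nu < PI /\ gam d nu = 0 /\ d <> 0.

Definition cbrt (x : R) : R :=
  if Rle_dec 0 x then Rpower x (1/3)
  else - Rpower (- x) (1/3).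

Definition MS_solution (lam nu : R) (mu rho psi : R -> R) : Prop :=
  exists rho' psi' : R -> R,
    forall tau, 0 <= tau ->
      deriv_nonneg rho tau (rho' tau) /\
      deriv_nonneg psi tau (psi' tau) /\
      rho' tau + mu tau * rho tau * sin (2 * psi tau + nu) = sin (psi tau) /\
      rho tau * (psi' tau - (rho tau) ^ 2 + lam * tau)
        + mu tau * rho tau * cos (2 * psi tau + nu) = cos (psi tau).

Definition expansion (q : R) (lam sigma : R) (rho psi : R -> R)
    (r p : nat -> R) : Prop :=
  r 0%nat = 0 /\ p 0%nat = sigma /\
  asymp (fun tau => rho tau - sqrt lam * Rpower tau (1/2)) r
        (fun k => - INR k / q) /\
  asymp psi p (fun k => - INR k / q).

Definition ExpE1 (lam d nu sigma : R) (rho psi : R -> R) : Prop :=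
  exists r p : nat -> R,
    expansion 2 lam sigma rho psi r p /\
    r 1%nat = 0 /\ p 1%nat = - sqrt lam / (2 * P1 sigma d nu).

Definition ExpE2 (lam sigma psi1 : R) (rho psi : R -> R) : Prop :=
  exists r p : nat -> R,
    expansion 4 lam sigma rho psi r p /\
    r 1%nat = 0 /\ p 1%nat = psi1.

Definition ExpE3 (lam d nu sigma : R) (rho psi : R -> R) : Prop :=
  exists r p : nat -> R,
    expansion 6 lam sigma rho psi r p /\
    r 1%nat = 0 /\ p 1%nat = - cbrt (3 * sqrt lam / P3 sigma d nu).

(* Main.v *)
(* For z = rho e^{i psi} the system becomes z' = i ((|z|^2 - lam t) z + 1 - mu e^{-i nu} conj z), which has global
   solutions; every solution has polar coordinates (rho, psi) that continue smoothly, with a sign change of rho,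
   through the zeros of z, where z' = i. With e = t^{-1/q}, q = 2, 4, 6 according to the multiplicity of the root sigma,
   the formal series are determined recursively, because P'(psi) = A0 e^{q/2-1} + ... with A0 <> 0 along the leading
   terms. The differences of solutions near a partial sum obey, in the frame rotating with it, an almost Hamiltonian
   linear system, a centre for A0 > 0 and a saddle for A0 < 0. In the centre case the quadratic Hamiltonian changes at
   rate O(1/t) only, so solutions starting on a partial sum at time j remain close to it backwards in time, and their
   limit as j tends to infinity is the desired solution; in the saddle case a shooting argument gives a solution that
   remains close to the partial sum. In both cases the same estimates compare this solution with all partial sums. *)
Require Import Defs.
From Stdlib Require Import Reals Lra Lia ClassicalEpsilon.
From Coquelicot Require Import Coquelicot.
Open Scope R_scope.

(** * Global solutions of planar systems *)

(** Three obstacles shape the proof. Equation (MS) for psi degenerates where rho vanishes, and the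
    cubic term is only locally Lipschitz; in z the term i (|z|^2 - lam t) z is a pure rotation, so
    |z| obeys a linear growth bound whatever real factor stands in place of |z|^2, and truncating
    that factor makes Picard iteration global. The formal series need not converge, so only partial
    sums are available, with residuals O(t^-N) for N at will; in the centre case the comparison of
    solutions may therefore lose a fixed power of t, independent of N, which further terms make up,
    whereas no number of terms would make up an exponential factor. The expansion of mu says nothing
    about mu', so A, B, c are not the true linearisation but differentiable truncations of it,
    accurate to O(t^-4). That tolerance dictates the tube of radius t^-5 around a reference partial
    sum of amplitude rho0: the crude bound rho0 = O(t), multiplied by t^-5, is again O(t^-4). *)

Ltac rewrite_derive := repeat match goal with
  | |- context [Derive ?g ?t] =>
    match goal with H : is_derive ?f t ?l |- _ =>
      replace (Derive g t) with l by (symmetry; exact (is_derive_unique f t l H)) end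
  end.

Lemma derive_nonneg_le (f f' : R -> R) (a b : R) :
  a <= b -> (forall t, a <= t <= b -> is_derive f t (f' t)) ->
  (forall t, a <= t <= b -> 0 <= f' t) -> f a <= f b.
Proof.
  intros Hab Hd Hp.
  destruct (MVT_gen f a b f') as [c [Hc E]].
  - intros x Hx. rewrite Rmin_left, Rmax_right in Hx by lra. apply Hd; lra.
  - intros x Hx. rewrite Rmin_left, Rmax_right in Hx by lra.
    apply continuity_pt_filterlim, (ex_derive_continuous f). exists (f' x). apply Hd; lra.
  - rewrite Rmin_left, Rmax_right in Hc by lra.
    pose proof (Hp c Hc). nra.
Qed.

(** The weight reproduces itself under integration up to the factor 1/k, so that a large k makes the
    Picard operator contract. The weight plus [sg] times the integral is monotone for both signs
    [sg], which yields the absolute value; the two sides of t0 are treated separately. *)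
Lemma RInt_exp_weight_le (f : R -> R) (t0 k C t : R) :
  0 < k -> (forall s, continuous f s) ->
  (forall s, Rmin t0 t <= s <= Rmax t0 t -> Rabs (f s) <= C * exp (k * Rabs (s - t0))) ->
  Rabs (RInt f t0 t) <= C / k * exp (k * Rabs (t - t0)).
Proof.
  intros Hk Hc Hb.
  assert (HC : 0 <= C).
  { assert (Hs : Rmin t0 t <= t0 <= Rmax t0 t) by (split; [apply Rmin_l | apply Rmax_l]).
    specialize (Hb _ Hs). rewrite Rminus_diag, Rabs_R0, Rmult_0_r, exp_0 in Hb.
    pose proof (Rabs_pos (f t0)). lra. }
  assert (HCk : 0 <= C / k) by (apply Rdiv_le_0_compat; lra).
  assert (HI : forall s, is_derive (fun t => RInt f t0 t) s (f s)).
  { intros s. apply (is_derive_RInt f (fun t => RInt f t0 t) t0 s); [|apply Hc].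
    apply filter_forall. intros u. apply (RInt_correct f).
    apply (ex_RInt_continuous f). intros; apply Hc. }
  destruct (Rle_dec t0 t) as [Ht|Ht].
  - rewrite Rmin_left, Rmax_right in Hb by lra.
    rewrite (Rabs_pos_eq (t - t0)) by lra.
    assert (Hg : forall sg, sg = 1 \/ sg = -1 ->
       C / k * exp (k * (t0 - t0)) + sg * RInt f t0 t0
        <= C / k * exp (k * (t - t0)) + sg * RInt f t0 t).
    { intros sg Hsg.
      apply (derive_nonneg_le (fun s => C / k * exp (k * (s - t0)) + sg * RInt f t0 s)
               (fun s => C * exp (k * (s - t0)) + sg * f s)); [lra| |].
      - intros s Hs. apply (is_derive_plus (fun s => C / k * exp (k * (s - t0))) (fun s => sg * RInt f t0 s)).
        + auto_derive; [exact I | simpl; unfold Rminus; field; lra].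
        + apply is_derive_scal, HI.
      - intros s Hs. specialize (Hb s Hs). rewrite (Rabs_pos_eq (s - t0)) in Hb by lra.
        apply Rabs_le_between in Hb. destruct Hsg; subst; lra. }
    rewrite (RInt_point t0 f), Rminus_diag, Rmult_0_r, exp_0 in Hg.
    unfold zero in Hg; simpl in Hg.
    apply Rabs_le_between. pose proof (Hg 1 (or_introl eq_refl)). pose proof (Hg (-1) (or_intror eq_refl)).
    lra.
  - rewrite Rmin_right, Rmax_left in Hb by lra.
    rewrite (Rabs_left1 (t - t0)) by lra.
    assert (Hg : forall sg, sg = 1 \/ sg = -1 ->
       - (C / k * exp (k * (t0 - t))) + sg * RInt f t0 t
        <= - (C / k * exp (k * (t0 - t0))) + sg * RInt f t0 t0).
    { intros sg Hsg.
      apply (derive_nonneg_le (fun s => - (C / k * exp (k * (t0 - s))) + sg * RInt f t0 s)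
               (fun s => C * exp (k * (t0 - s)) + sg * f s)); [lra| |].
      - intros s Hs. apply (is_derive_plus (fun s => - (C / k * exp (k * (t0 - s)))) (fun s => sg * RInt f t0 s)).
        + auto_derive; [exact I | simpl; unfold Rminus; field; lra].
        + apply is_derive_scal, HI.
      - intros s Hs. specialize (Hb s Hs). rewrite (Rabs_left1 (s - t0)) in Hb by lra.
        replace (k * - (s - t0)) with (k * (t0 - s)) in Hb by ring.
        apply Rabs_le_between in Hb. destruct Hsg; subst; lra. }
    rewrite (RInt_point t0 f), Rminus_diag, Rmult_0_r, exp_0 in Hg.
    unfold zero in Hg; simpl in Hg.
    replace (k * - (t - t0)) with (k * (t0 - t)) by ring.
    apply Rabs_le_between. pose proof (Hg 1 (or_introl eq_refl)). pose proof (Hg (-1) (or_intror eq_refl)).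
    lra.
Qed.

Lemma geometric_increments_cvg (u : nat -> R) (C : R) :
  (forall n, Rabs (u (S n) - u n) <= C * (1/2) ^ n) ->
  is_lim_seq u (real (Lim_seq u)) /\
  forall n, Rabs (real (Lim_seq u) - u n) <= 2 * C * (1/2) ^ n.
Proof.
  intros H.
  assert (HC : 0 <= C).
  { specialize (H O). simpl in H. pose proof (Rabs_pos (u 1%nat - u O)). lra. }
  (* Keeping the exact partial geometric sum, instead of the bound 2 C (1/2)^n, is what lets the
     induction on k close. *)
  assert (Hk : forall n k, Rabs (u (n + k)%nat - u n) <= 2 * C * (1/2) ^ n - 2 * C * (1/2) ^ (n + k)).
  { intros n k. induction k.
    - rewrite Nat.add_0_r, Rminus_diag, Rabs_R0. lra.
    - replace (n + S k)%nat with (S (n + k)) by lia.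
      specialize (H (n + k)%nat).
      replace (u (S (n + k)) - u n) with ((u (S (n + k)) - u (n + k)%nat) + (u (n + k)%nat - u n)) by ring.
      eapply Rle_trans; [apply Rabs_triang|]. simpl. lra. }
  assert (Hpos : forall n, 0 < (1/2)^n) by (intros; apply pow_lt; lra).
  assert (Hex : ex_finite_lim_seq u).
  { apply ex_lim_seq_cauchy_corr. intros eps.
    destruct (pow_lt_1_zero (1/2) ltac:(rewrite Rabs_pos_eq; lra) (eps / (2 * (2 * C + 1)))) as [N HN].
    { apply Rdiv_lt_0_compat; [apply cond_pos|]. lra. }
    exists N. intros n m Hn Hm.
    specialize (HN N (le_n _)). rewrite Rabs_pos_eq in HN by (left; apply Hpos).
    pose proof (Hk N (n - N)%nat) as H1. pose proof (Hk N (m - N)%nat) as H2.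
    replace (N + (n - N))%nat with n in H1 by lia.
    replace (N + (m - N))%nat with m in H2 by lia.
    replace (u n - u m) with ((u n - u N) - (u m - u N)) by ring.
    eapply Rle_lt_trans; [apply Rabs_triang|]. rewrite Rabs_Ropp.
    assert (E : (2 * C + 1) * ((1/2)^N) < eps / 2).
    { apply Rmult_lt_reg_r with (/ (2 * C + 1)); [apply Rinv_0_lt_compat; lra|].
      replace ((2 * C + 1) * (1 / 2) ^ N * / (2 * C + 1)) with ((1/2)^N) by (field; lra).
      replace (eps / 2 * / (2 * C + 1)) with (eps / (2 * (2 * C + 1))) by (field; lra). exact HN. }
    pose proof (Rmult_le_pos (2*C) ((1/2)^n) ltac:(lra) (Rlt_le _ _ (Hpos n))).
    pose proof (Rmult_le_pos (2*C) ((1/2)^m) ltac:(lra) (Rlt_le _ _ (Hpos m))).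
    pose proof (Hpos N). lra. }
  destruct Hex as [l Hl].
  rewrite (is_lim_seq_unique _ _ Hl). simpl. split; [exact Hl|].
  intros n.
  assert (Hle : Rbar_le (Rabs (l - u n)) (2 * C * (1/2)^n)); [|exact Hle].
  apply (is_lim_seq_le (fun k => Rabs (u (n + k)%nat - u n)) (fun _ => 2 * C * (1/2)^n)).
  - intros k. specialize (Hk n k). 
    pose proof (Rmult_le_pos (2*C) ((1/2)^(n+k)) ltac:(lra) (Rlt_le _ _ (Hpos _))). lra.
  - apply (is_lim_seq_abs (fun k => u (n + k)%nat - u n) (Finite (l - u n))).
    apply is_lim_seq_minus'; [|apply is_lim_seq_const].
    apply (is_lim_seq_ext (fun k => u (k + n)%nat)); [intros; f_equal; lia|].
    apply is_lim_seq_incr_n. exact Hl.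
  - apply is_lim_seq_const.
Qed.

Lemma continuous_abs_bounded (f : R -> R) (a b : R) :
  (forall t, continuous f t) -> exists M, 0 <= M /\ forall t, a <= t <= b -> Rabs (f t) <= M.
Proof.
  intros Hc. destruct (Rle_dec a b) as [Hab|Hab].
  - destruct (continuity_ab_maj (fun t => Rabs (f t)) a b Hab) as [m [Hm _]].
    { intros c _. apply continuity_pt_filterlim. apply (continuous_comp f Rabs); [apply Hc|].
      apply continuous_Rabs. }
    exists (Rabs (f m)). split; [apply Rabs_pos|]. exact Hm.
  - exists 0. split; [lra|]. intros; lra.
Qed.

(** * Picard iteration for planar systems *)

Section Picard.

Variables (F G : R -> R -> R -> R).

(** Joint continuity is only ever used along continuous curves; this form avoids the topology of the
    product. *)
Definition continuous_along (F : R -> R -> R -> R) :=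
  forall x y : R -> R, (forall t, continuous x t) -> (forall t, continuous y t) ->
    forall t, continuous (fun s => F s (x s) (y s)) t.

(** Compactness concerns time alone: the constant is uniform in (x, y), which is what makes
    solutions global. A cubic field satisfies this only after truncation. *)
Definition lipschitz_on_compacts (F : R -> R -> R -> R) :=
  forall T, exists L, 0 <= L /\ forall t, Rabs t <= T -> forall x y x' y',
    Rabs (F t x y - F t x' y') <= L * (Rabs (x - x') + Rabs (y - y')).

Hypotheses (HFc : continuous_along F) (HGc : continuous_along G).
Hypotheses (HFl : lipschitz_on_compacts F) (HGl : lipschitz_on_compacts G).
Variables (t0 x0 y0 : R).

Fixpoint picard (n : nat) : (R -> R) * (R -> R) :=
  match n with
  | O => (fun _ => x0, fun _ => y0)
  | S n => let u := picard n in
     (fun t => x0 + RInt (fun s => F s (fst u s) (snd u s)) t0 t,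
      fun t => y0 + RInt (fun s => G s (fst u s) (snd u s)) t0 t)
  end.

Lemma is_derive_RInt_continuous (f : R -> R) (a c t : R) :
  (forall t, continuous f t) -> is_derive (fun t => c + RInt f a t) t (f t).
Proof.
  intros Hc. rewrite <- (Rplus_0_l (f t)).
  apply (is_derive_plus (fun _ => c) (fun t => RInt f a t)); [apply (is_derive_const c)|].
  apply (is_derive_RInt f (fun t => RInt f a t) a t); [|apply Hc].
  apply filter_forall. intros u. apply (RInt_correct f).
  apply (ex_RInt_continuous f). intros; apply Hc.
Qed.

Lemma picard_continuous n :
  (forall t, continuous (fst (picard n)) t) /\ (forall t, continuous (snd (picard n)) t).
Proof.
  induction n as [|n [IH1 IH2]]; simpl.
  - split; intros; apply continuous_const.
  - split; intros t.
    + apply (ex_derive_continuous (fun t => x0 + RInt (fun s => F s (fst (picard n) s) (snd (picard n) s)) t0 t)).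
      eexists. apply is_derive_RInt_continuous. apply HFc; assumption.
    + apply (ex_derive_continuous (fun t => y0 + RInt (fun s => G s (fst (picard n) s) (snd (picard n) s)) t0 t)).
      eexists. apply is_derive_RInt_continuous. apply HGc; assumption.
Qed.

(** One Picard step measured in the norm sup |.| exp(-k |t - t0|): the Lipschitz constant is divided
    by k. *)
Lemma RInt_lipschitz_diff (K : R -> R -> R -> R) (HK : continuous_along K) (L T k C t : R)
  (x y x' y' : R -> R) :
  (forall t, continuous x t) -> (forall t, continuous y t) ->
  (forall t, continuous x' t) -> (forall t, continuous y' t) -> 0 < k -> 0 <= L ->
  (forall t, Rabs (t - t0) <= T -> forall x y x' y',
    Rabs (K t x y - K t x' y') <= L * (Rabs (x - x') + Rabs (y - y'))) ->
  (forall s, Rabs (s - t0) <= T ->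
     Rabs (x s - x' s) + Rabs (y s - y' s) <= C * exp (k * Rabs (s - t0))) ->
  Rabs (t - t0) <= T ->
  Rabs (RInt (fun s => K s (x s) (y s)) t0 t - RInt (fun s => K s (x' s) (y' s)) t0 t)
    <= L * C / k * exp (k * Rabs (t - t0)).
Proof.
  intros Hx Hy Hx' Hy' Hk HL HKL HC Ht.
  pose proof (HK x y Hx Hy) as H1. pose proof (HK x' y' Hx' Hy') as H2.
  rewrite <- (RInt_minus (fun s => K s (x s) (y s)) (fun s => K s (x' s) (y' s)));
    [|apply (ex_RInt_continuous (fun s => K s (x s) (y s))); intros; apply H1
     |apply (ex_RInt_continuous (fun s => K s (x' s) (y' s))); intros; apply H2].
  apply RInt_exp_weight_le; [exact Hk| |].
  - intros s. apply (continuous_minus (fun s => K s (x s) (y s))); auto.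
  - intros s Hs.
    assert (HsT : Rabs (s - t0) <= T).
    { revert Hs Ht. unfold Rmin, Rmax, Rabs. destruct (Rle_dec t0 t); repeat destruct Rcase_abs; lra. }
    unfold minus, plus, opp; simpl.
    specialize (HKL s HsT (x s) (y s) (x' s) (y' s)). unfold Rminus in HKL at 1.
    eapply Rle_trans; [apply HKL|]. rewrite Rmult_assoc.
    apply Rmult_le_compat_l; [exact HL|]. apply HC, HsT.
Qed.

(* The weight exp (4 L |t - t0|) makes the Picard map a contraction with factor 1/2. *)
Lemma picard_increments T : exists L M, 1 <= L /\ 0 <= M /\
  (forall t, Rabs (t - t0) <= T -> forall x y x' y',
    Rabs (F t x y - F t x' y') <= L * (Rabs (x - x') + Rabs (y - y')) /\
    Rabs (G t x y - G t x' y') <= L * (Rabs (x - x') + Rabs (y - y'))) /\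
  forall n t, Rabs (t - t0) <= T ->
    Rabs (fst (picard (S n)) t - fst (picard n) t) + Rabs (snd (picard (S n)) t - snd (picard n) t)
    <= M * (1/2) ^ n * exp (4 * L * Rabs (t - t0)).
Proof.
  destruct (HFl (T + Rabs t0)) as [L1 [HL1 HF]]. destruct (HGl (T + Rabs t0)) as [L2 [HL2 HG]].
  destruct (continuous_abs_bounded (fun s => F s x0 y0) (t0 - T) (t0 + T)) as [M1 [HM1 HM1b]].
  { apply (HFc (fun _ => x0) (fun _ => y0)); intros; apply continuous_const. }
  destruct (continuous_abs_bounded (fun s => G s x0 y0) (t0 - T) (t0 + T)) as [M2 [HM2 HM2b]].
  { apply (HGc (fun _ => x0) (fun _ => y0)); intros; apply continuous_const. }
  (* The summand 1 keeps the weight 4 L positive and gives m / (4 L) <= m below. *)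
  set (L := 1 + L1 + L2). set (M := M1 + M2).
  assert (HLip : forall t, Rabs (t - t0) <= T -> forall x y x' y',
    Rabs (F t x y - F t x' y') <= L * (Rabs (x - x') + Rabs (y - y')) /\
    Rabs (G t x y - G t x' y') <= L * (Rabs (x - x') + Rabs (y - y'))).
  { intros t Ht x y x' y'.
    assert (Ht' : Rabs t <= T + Rabs t0).
    { replace t with ((t - t0) + t0) by ring. pose proof (Rabs_triang (t - t0) t0). lra. }
    pose proof (Rabs_pos (x - x')). pose proof (Rabs_pos (y - y')).
    split; eapply Rle_trans; [apply HF, Ht'| |apply HG, Ht'|]; apply Rmult_le_compat_r; unfold L; lra. }
  exists L, M. split; [unfold L; lra|]. split; [unfold M; lra|]. split; [exact HLip|].
  intros n. induction n as [|n IH]; intros t Ht.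
  - simpl. rewrite Rmult_1_r.
    assert (Ecancel : forall a b : R, a + b - a = b) by (intros; ring).
    rewrite !Ecancel.
    assert (Hk : 0 < 4 * L) by (unfold L; lra).
    assert (H1 : Rabs (RInt (fun s => F s x0 y0) t0 t) <= M1 / (4 * L) * exp (4 * L * Rabs (t - t0))).
    { apply RInt_exp_weight_le; [exact Hk| |].
      - apply (HFc (fun _ => x0) (fun _ => y0)); intros; apply continuous_const.
      - intros s Hs.
        eapply Rle_trans; [apply HM1b|].
        + apply Rabs_le_between in Ht. revert Hs. unfold Rmin, Rmax. destruct (Rle_dec t0 t); lra.
        + rewrite <- (Rmult_1_r M1) at 1. apply Rmult_le_compat_l; [lra|].
          rewrite <- exp_0.
          destruct (Rle_lt_or_eq_dec 0 (4 * L * Rabs (s - t0))) as [Hlt|He].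
          { apply Rmult_le_pos; [lra|apply Rabs_pos]. }
          { left. apply exp_increasing, Hlt. }
          { rewrite <- He. lra. } }
    assert (H2 : Rabs (RInt (fun s => G s x0 y0) t0 t) <= M2 / (4 * L) * exp (4 * L * Rabs (t - t0))).
    { apply RInt_exp_weight_le; [exact Hk| |].
      - apply (HGc (fun _ => x0) (fun _ => y0)); intros; apply continuous_const.
      - intros s Hs.
        eapply Rle_trans; [apply HM2b|].
        + apply Rabs_le_between in Ht. revert Hs. unfold Rmin, Rmax. destruct (Rle_dec t0 t); lra.
        + rewrite <- (Rmult_1_r M2) at 1. apply Rmult_le_compat_l; [lra|].
          rewrite <- exp_0.
          destruct (Rle_lt_or_eq_dec 0 (4 * L * Rabs (s - t0))) as [Hlt|He].
          { apply Rmult_le_pos; [lra|apply Rabs_pos]. }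
          { left. apply exp_increasing, Hlt. }
          { rewrite <- He. lra. } }
    eapply Rle_trans; [apply Rplus_le_compat; [exact H1|exact H2]|].
    rewrite <- Rmult_plus_distr_r. apply Rmult_le_compat_r; [left; apply exp_pos|].
    assert (Hi : forall m, 0 <= m -> m / (4 * L) <= m).
    { intros m Hm. apply Rmult_le_reg_r with (4 * L); [lra|]. unfold Rdiv. rewrite Rmult_assoc, Rinv_l by lra.
      apply Rmult_le_compat_l; unfold L; lra. }
    unfold M. pose proof (Hi M1 HM1). pose proof (Hi M2 HM2). lra.
  - destruct (picard_continuous n) as [c1 c2]. destruct (picard_continuous (S n)) as [c3 c4].
    assert (Hk : 0 < 4 * L) by (unfold L; lra).
    assert (HB : forall K, continuous_along K -> (forall t, Rabs (t - t0) <= T -> forall x y x' y',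
         Rabs (K t x y - K t x' y') <= L * (Rabs (x - x') + Rabs (y - y'))) ->
       Rabs (RInt (fun s => K s (fst (picard (S n)) s) (snd (picard (S n)) s)) t0 t -
             RInt (fun s => K s (fst (picard n) s) (snd (picard n) s)) t0 t)
        <= L * (M * (1/2)^n) / (4 * L) * exp (4 * L * Rabs (t - t0))).
    { intros K HK HKl. apply RInt_lipschitz_diff with (T := T); auto. unfold L; lra. }
    pose proof (HB F HFc (fun t Ht x y x' y' => proj1 (HLip t Ht x y x' y'))) as H1.
    pose proof (HB G HGc (fun t Ht x y x' y' => proj2 (HLip t Ht x y x' y'))) as H2.
    change (fst (picard (S (S n))) t) with
      (x0 + RInt (fun s => F s (fst (picard (S n)) s) (snd (picard (S n)) s)) t0 t).
    change (snd (picard (S (S n))) t) with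
      (y0 + RInt (fun s => G s (fst (picard (S n)) s) (snd (picard (S n)) s)) t0 t).
    change (fst (picard (S n)) t) with
      (x0 + RInt (fun s => F s (fst (picard n) s) (snd (picard n) s)) t0 t).
    change (snd (picard (S n)) t) with
      (y0 + RInt (fun s => G s (fst (picard n) s) (snd (picard n) s)) t0 t).
    assert (Ecancel : forall a b c : R, a + b - (a + c) = b - c) by (intros; ring).
    match goal with |- Rabs (?a + ?b - (?a + ?c)) + Rabs (?d + ?e - (?d + ?f)) <= _ =>
      rewrite (Ecancel a b c), (Ecancel d e f) end.
    eapply Rle_trans; [apply Rplus_le_compat; [exact H1|exact H2]|].
    (* Each component contributes a quarter of the previous bound, the two together one half. *)
    right. simpl pow. field. unfold L; lra.
Qed.

(** The iterates converge uniformly on compact time intervals, so the limit is continuous and the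
    Lipschitz bound carries the integral equation to the limit; differentiating the integral gives
    the system. *)
Theorem picard_exists : exists x y : R -> R, x t0 = x0 /\ y t0 = y0 /\
  forall t, is_derive x t (F t (x t) (y t)) /\ is_derive y t (G t (x t) (y t)).
Proof.
  set (X := fun t => real (Lim_seq (fun n => fst (picard n) t))).
  set (Y := fun t => real (Lim_seq (fun n => snd (picard n) t))).
  assert (Happ : forall T, exists C, 0 <= C /\ forall n t, Rabs (t - t0) <= T ->
     Rabs (X t - fst (picard n) t) + Rabs (Y t - snd (picard n) t) <= C * (1/2)^n).
  { intros T. destruct (picard_increments T) as (L & M & HL & HM & _ & HI).
    exists (2 * (2 * (M * exp (4 * L * T)))). split.
    { pose proof (exp_pos (4*L*T)). nra. }
    intros n t Ht.
    assert (HE : forall n, Rabs (fst (picard (S n)) t - fst (picard n) t) + Rabs (snd (picard (S n)) t - snd (picard n) t)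
       <= M * exp (4 * L * T) * (1/2)^n).
    { intros k. eapply Rle_trans; [apply HI, Ht|].
      rewrite Rmult_assoc, (Rmult_comm _ (exp _)), <- Rmult_assoc.
      apply Rmult_le_compat_r; [apply pow_le; lra|]. apply Rmult_le_compat_l; [exact HM|].
      destruct (Rle_lt_or_eq_dec _ _ Ht) as [Hlt|He]; [|rewrite He; lra].
      left. apply exp_increasing. apply Rmult_lt_compat_l; lra. }
    destruct (geometric_increments_cvg (fun n => fst (picard n) t) (M * exp (4 * L * T))) as [_ H1].
    { intros k. specialize (HE k). pose proof (Rabs_pos (snd (picard (S k)) t - snd (picard k) t)). lra. }
    destruct (geometric_increments_cvg (fun n => snd (picard n) t) (M * exp (4 * L * T))) as [_ H2].
    { intros k. specialize (HE k). pose proof (Rabs_pos (fst (picard (S k)) t - fst (picard k) t)). lra. }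
    specialize (H1 n). specialize (H2 n). unfold X, Y. lra. }
  assert (Hsmall : forall C eps, 0 <= C -> 0 < eps -> exists n, C * (1/2)^n < eps).
  { intros C eps HC He.
    destruct (pow_lt_1_zero (1/2) ltac:(rewrite Rabs_pos_eq; lra) (eps / (C + 1))) as [N HN].
    { apply Rdiv_lt_0_compat; lra. }
    exists N. specialize (HN N (le_n _)). rewrite Rabs_pos_eq in HN by (apply pow_le; lra).
    apply Rmult_lt_compat_r with (r := C + 1) in HN; [|lra].
    unfold Rdiv in HN. rewrite Rmult_assoc, Rinv_l in HN by lra.
    pose proof (pow_lt (1/2) N ltac:(lra)). lra. }
  assert (Hcont : forall (Z : R -> R) (z : nat -> R -> R), (forall n t, continuous (z n) t) ->
    (forall T, exists C, 0 <= C /\ forall n t, Rabs (t - t0) <= T -> Rabs (Z t - z n t) <= C * (1/2)^n) ->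
    forall t, continuous Z t).
  { intros Z z Hz HZ t. apply continuity_pt_filterlim. intros eps Heps.
    destruct (HZ (Rabs (t - t0) + 1)) as (C & HC & HCb).
    destruct (Hsmall C (eps / 3) HC ltac:(lra)) as [n Hn].
    assert (Hzc : continuity_pt (z n) t) by (apply continuity_pt_filterlim, Hz).
    destruct (Hzc (eps / 3) ltac:(lra)) as (dl & Hdl & Hd).
    exists (Rmin dl 1). split; [apply Rmin_pos; lra|].
    intros s [Hs1 Hs2]. simpl in *. unfold Rdist in *.
    pose proof (Rmin_l dl 1). pose proof (Rmin_r dl 1).
    assert (Rabs (s - t0) <= Rabs (t - t0) + 1).
    { replace (s - t0) with ((s - t) + (t - t0)) by ring. pose proof (Rabs_triang (s - t) (t - t0)). lra. }
    pose proof (HCb n s ltac:(lra)) as B1. pose proof (HCb n t ltac:(lra)) as B2.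
    assert (Hs3 : Rabs (s - t) < dl) by lra.
    specialize (Hd s (conj Hs1 Hs3)).
    replace (Z s - Z t) with ((Z s - z n s) + (z n s - z n t) - (Z t - z n t)) by ring.
    eapply Rle_lt_trans; [apply Rabs_triang|]. rewrite Rabs_Ropp.
    pose proof (Rabs_triang (Z s - z n s) (z n s - z n t)). lra. }
  assert (HXc : forall t, continuous X t).
  { apply (Hcont X (fun n => fst (picard n))); [intros; apply picard_continuous|].
    intros T. destruct (Happ T) as (C & HC & H). exists C. split; [exact HC|]. intros n t Ht.
    specialize (H n t Ht). pose proof (Rabs_pos (Y t - snd (picard n) t)). lra. }
  assert (HYc : forall t, continuous Y t).
  { apply (Hcont Y (fun n => snd (picard n))); [intros; apply picard_continuous|].
    intros T. destruct (Happ T) as (C & HC & H). exists C. split; [exact HC|]. intros n t Ht.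
    specialize (H n t Ht). pose proof (Rabs_pos (X t - fst (picard n) t)). lra. }
  assert (Heq : forall K Z (z0 : R), continuous_along K ->
    (forall T, exists L, 0 <= L /\ (forall t, Rabs (t - t0) <= T -> forall x y x' y',
         Rabs (K t x y - K t x' y') <= L * (Rabs (x - x') + Rabs (y - y')))) ->
    (forall T, exists C, 0 <= C /\ forall n t, Rabs (t - t0) <= T ->
       Rabs (Z t - (z0 + RInt (fun s => K s (fst (picard n) s) (snd (picard n) s)) t0 t)) <= C * (1/2)^n) ->
    forall t, Z t = z0 + RInt (fun s => K s (X s) (Y s)) t0 t).
  { intros K Z z0 HK HKl HZ t. apply Rminus_diag_uniq.
    destruct (HKl (Rabs (t - t0))) as (L & HL & HLb).
    destruct (HZ (Rabs (t - t0))) as (C & HC & HCb).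
    destruct (Happ (Rabs (t - t0))) as (C' & HC' & HCb').
    apply cond_eq. intros eps Heps. rewrite Rminus_0_r.
    set (E := exp (1 * Rabs (t - t0))).
    assert (HE : 0 < E) by apply exp_pos.
    (* The two sides differ by at most (C + L C' E) / 2^n for every n: C comes from the convergence
       to Z, L C' E from the integrals. *)
    destruct (Hsmall (C + L * C' * E) eps ltac:(apply Rplus_le_le_0_compat; [lra|apply Rmult_le_pos; [apply Rmult_le_pos; lra|lra]]) Heps) as [n Hn].
    specialize (HCb n t ltac:(lra)).
    destruct (picard_continuous n) as [c1 c2].
    assert (Hd : Rabs (RInt (fun s => K s (X s) (Y s)) t0 t -
                RInt (fun s => K s (fst (picard n) s) (snd (picard n) s)) t0 t)
          <= L * (C' * (1/2)^n) / 1 * E).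
    { apply RInt_lipschitz_diff with (T := Rabs (t - t0)); auto; try lra.
      intros s Hs. eapply Rle_trans; [apply HCb', Hs|].
      rewrite <- (Rmult_1_r (C' * (1/2)^n)) at 1. apply Rmult_le_compat_l.
      { apply Rmult_le_pos; [lra|apply pow_le; lra]. }
      pose proof (exp_ineq1_le (1 * Rabs (s - t0))). pose proof (Rabs_pos (s - t0)). lra. }
    assert (Esplit : forall a b z z0 : R, z - (z0 + b) = (z - (z0 + a)) - (b - a)) by (intros; ring).
    match goal with |- Rabs (?z - (_ + ?b)) < _ => match type of HCb with Rabs (_ - (_ + ?a)) <= _ =>
      rewrite (Esplit a b z z0) end end.
    eapply Rle_lt_trans; [apply Rabs_triang|]. rewrite Rabs_Ropp. unfold Rdiv in Hd. rewrite Rinv_1 in Hd. lra. }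
  assert (HXe : forall t, X t = x0 + RInt (fun s => F s (X s) (Y s)) t0 t).
  { apply Heq; [exact HFc| |].
    - intros T. destruct (picard_increments T) as (L & M & HL & _ & Hl & _). exists L. split; [lra|]. apply Hl.
    - intros T. destruct (Happ T) as (C & HC & H). exists C. split; [exact HC|]. intros n t Ht.
      specialize (H (S n) t Ht). pose proof (Rabs_pos (Y t - snd (picard (S n)) t)).
      pose proof (Rmult_le_pos C _ HC (pow_le (1/2) n ltac:(lra))).
      change (x0 + RInt (fun s => F s (fst (picard n) s) (snd (picard n) s)) t0 t) with (fst (picard (S n)) t).
      simpl pow in H. lra. }
  assert (HYe : forall t, Y t = y0 + RInt (fun s => G s (X s) (Y s)) t0 t).
  { apply Heq; [exact HGc| |].
    - intros T. destruct (picard_increments T) as (L & M & HL & _ & Hl & _). exists L. split; [lra|]. apply Hl.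
    - intros T. destruct (Happ T) as (C & HC & H). exists C. split; [exact HC|]. intros n t Ht.
      specialize (H (S n) t Ht). pose proof (Rabs_pos (X t - fst (picard (S n)) t)).
      pose proof (Rmult_le_pos C _ HC (pow_le (1/2) n ltac:(lra))).
      change (y0 + RInt (fun s => G s (fst (picard n) s) (snd (picard n) s)) t0 t) with (snd (picard (S n)) t).
      simpl pow in H. lra. }
  exists X, Y. split; [|split].
  - rewrite HXe, (RInt_point t0). apply Rplus_0_r.
  - rewrite HYe, (RInt_point t0). apply Rplus_0_r.
  - intros t. split.
    + apply (is_derive_ext (fun t => x0 + RInt (fun s => F s (X s) (Y s)) t0 t)); [intros; symmetry; apply HXe|].
      apply (is_derive_RInt_continuous (fun s => F s (X s) (Y s))). apply HFc; assumption.
    + apply (is_derive_ext (fun t => y0 + RInt (fun s => G s (X s) (Y s)) t0 t)); [intros; symmetry; apply HYe|].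
      apply (is_derive_RInt_continuous (fun s => G s (X s) (Y s))). apply HGc; assumption.
Qed.

End Picard.

Lemma continuous_Rplus (f g : R -> R) t :
  continuous f t -> continuous g t -> continuous (fun s => f s + g s) t.
Proof. intros; now apply (continuous_plus f g). Qed.

Lemma continuous_Rmult (f g : R -> R) t :
  continuous f t -> continuous g t -> continuous (fun s => f s * g s) t.
Proof. intros; now apply (continuous_mult f g). Qed.

Lemma continuous_Ropp (f : R -> R) t :
  continuous f t -> continuous (fun s => - f s) t.
Proof. intros; now apply (continuous_opp f). Qed.

Lemma continuous_Rminus (f g : R -> R) t :
  continuous f t -> continuous g t -> continuous (fun s => f s - g s) t.
Proof. intros; now apply (continuous_minus f g). Qed.

Lemma continuous_Rabs_comp (f : R -> R) t :
  continuous f t -> continuous (fun s => Rabs (f s)) t.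
Proof. intros; apply (continuous_comp f Rabs); [assumption | apply continuous_Rabs]. Qed.

Lemma continuous_Rmin (f g : R -> R) t :
  continuous f t -> continuous g t -> continuous (fun s => Rmin (f s) (g s)) t.
Proof.
  intros Hf Hg.
  apply (continuous_ext (fun s => (f s + g s + - Rabs (f s - g s)) * (1/2))).
  - intros s. unfold Rmin, Rabs. destruct (Rle_dec (f s) (g s)), Rcase_abs; lra.
  - apply continuous_Rmult; [|apply continuous_const].
    apply continuous_Rplus; [now apply continuous_Rplus|].
    apply continuous_Ropp, continuous_Rabs_comp. now apply continuous_Rminus.
Qed.

Lemma continuous_sqr (f : R -> R) t :
  continuous f t -> continuous (fun s => f s ^ 2) t.
Proof.
  intros H. apply (continuous_ext (fun s => f s * f s)); [intros; simpl; ring|].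
  now apply continuous_Rmult.
Qed.

Lemma continuous_of_derive (f : R -> R) (t l : R) : is_derive f t l -> continuous f t.
Proof. intros H. apply (ex_derive_continuous f). now exists l. Qed.

Ltac cont := repeat (lazymatch goal with
  | |- continuous (fun _ => ?c) _ => apply continuous_const
  | |- continuous (fun s => s) _ => apply continuous_id
  | |- continuous (fun s => @?f s + @?g s) _ => apply (continuous_Rplus f g)
  | |- continuous (fun s => @?f s - @?g s) _ => apply (continuous_Rminus f g)
  | |- continuous (fun s => @?f s * @?g s) _ => apply (continuous_Rmult f g)
  | |- continuous (fun s => - @?f s) _ => apply (continuous_Ropp f)
  | |- continuous (fun s => @?f s ^ 2) _ => apply (continuous_sqr f)
  | |- continuous (fun s => Rmin (@?f s) (@?g s)) _ => apply (continuous_Rmin f g)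
  | |- continuous (fun s => Rabs (@?f s)) _ => apply (continuous_Rabs_comp f)
  | |- _ => first [ eassumption | match goal with H : forall t, continuous _ t |- _ => exact (H _) end ]
  end).

(** Only the scalar factor |z|^2 is truncated, not z, so the truncated field keeps its rotational
    form. With (x, y) the point of smaller norm, the increment of the truncated factor vanishes if
    both are truncated; otherwise |x|, |y| <= k, and the increment is at most 3 k d when the
    distance d is at most k, and at most k^2 <= k d when d > k. *)
Lemma clamped_mult_lipschitz_aux k x y x' y' :
  0 <= k -> x ^ 2 + y ^ 2 <= x' ^ 2 + y' ^ 2 ->
  Rabs (Rmin (x ^ 2 + y ^ 2) (k ^ 2) * x - Rmin (x' ^ 2 + y' ^ 2) (k ^ 2) * x')
    <= 4 * k ^ 2 * (Rabs (x - x') + Rabs (y - y')).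
Proof.
  intros Hk HV. set (d := Rabs (x - x') + Rabs (y - y')).
  set (v := Rmin (x ^ 2 + y ^ 2) (k ^ 2)). set (v' := Rmin (x' ^ 2 + y' ^ 2) (k ^ 2)).
  assert (Hv : v <= v') by (unfold v, v', Rmin; repeat destruct Rle_dec; nra).
  assert (Hv0 : 0 <= v) by (unfold v, Rmin; repeat destruct Rle_dec; nra).
  assert (Hvk : v' <= k ^ 2) by (unfold v', Rmin; repeat destruct Rle_dec; nra).
  pose proof (Rabs_pos (x - x')) as Px. pose proof (Rabs_pos (y - y')) as Py.
  assert (H1 : (v' - v) * Rabs x <= 3 * k ^ 2 * d).
  { destruct (Rle_dec (k ^ 2) (x ^ 2 + y ^ 2)) as [Hc|Hc].
    - assert (v = v') as ->.
      { unfold v, v'. rewrite !Rmin_right; lra. }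
      unfold d. rewrite Rminus_diag, Rmult_0_l.
      apply Rmult_le_pos; [apply Rmult_le_pos; [lra|apply pow2_ge_0]|lra].
    - assert (Hxk : Rabs x <= k).
      { apply Rabs_le_between. split; nra. }
      assert (Hyk : Rabs y <= k).
      { apply Rabs_le_between. split; nra. }
      pose proof (Rabs_pos x) as P1.
      destruct (Rle_dec d k) as [Hd|Hd].
      + assert (Hdv : v' - v <= 3 * k * d).
        { replace v with (x ^ 2 + y ^ 2) by (unfold v; rewrite Rmin_left; lra).
          assert (v' <= x' ^ 2 + y' ^ 2) by (unfold v'; apply Rmin_l).
          assert (E : x' ^ 2 + y' ^ 2 - (x ^ 2 + y ^ 2) =
             (x - x') ^ 2 + (y - y') ^ 2 - 2 * (x * (x - x')) - 2 * (y * (y - y'))) by ring.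
          assert (A1 : - (x * (x - x')) <= k * Rabs (x - x')).
          { eapply Rle_trans; [apply Rle_abs|]. rewrite Rabs_Ropp, Rabs_mult.
            now apply Rmult_le_compat_r. }
          assert (A2 : - (y * (y - y')) <= k * Rabs (y - y')).
          { eapply Rle_trans; [apply Rle_abs|]. rewrite Rabs_Ropp, Rabs_mult.
            now apply Rmult_le_compat_r. }
          rewrite <- (pow2_abs (x - x')), <- (pow2_abs (y - y')) in E.
          unfold d in *. nra. }
        assert (0 <= d) by (unfold d; lra).
        assert ((v' - v) * Rabs x <= 3 * k * d * k) by (apply Rmult_le_compat; lra).
        nra.
      + assert ((v' - v) * Rabs x <= k ^ 2 * k) by (apply Rmult_le_compat; lra).
        pose proof (pow2_ge_0 k). nra. }
  replace (v * x - v' * x') with (v' * (x - x') - (v' - v) * x) by ring.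
  eapply Rle_trans; [apply Rabs_triang|]. rewrite Rabs_Ropp, !Rabs_mult.
  rewrite (Rabs_pos_eq v') by lra. rewrite (Rabs_pos_eq (v' - v)) by lra.
  assert (v' * Rabs (x - x') <= k ^ 2 * d) by (unfold d; nra).
  lra.
Qed.

Lemma clamped_mult_lipschitz k x y x' y' : 0 <= k ->
  Rabs (Rmin (x ^ 2 + y ^ 2) (k ^ 2) * x - Rmin (x' ^ 2 + y' ^ 2) (k ^ 2) * x')
    <= 4 * k ^ 2 * (Rabs (x - x') + Rabs (y - y')).
Proof.
  intros Hk. destruct (Rle_dec (x ^ 2 + y ^ 2) (x' ^ 2 + y' ^ 2)) as [H|H].
  - now apply clamped_mult_lipschitz_aux.
  - rewrite Rabs_minus_sym, (Rabs_minus_sym x), (Rabs_minus_sym y).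
    apply clamped_mult_lipschitz_aux; lra.
Qed.

(** * Global solutions in the coordinate z and continuous dependence *)

Section PlanarSystem.

Variables (lam nu : R) (m : R -> R).
Hypothesis Hm : forall t, continuous m t.

(* In z = x + i y = rho e^{i psi} system (MS) reads z' = i ((|z|^2 - lam t) z + 1 - mu e^{-i nu} conj z);
   the argument v stands for |z|^2 so that it can be truncated. *)
Definition zfx (v t x y : R) : R := - ((v - lam * t) * y + m t * (x * sin nu + y * cos nu)).
Definition zfy (v t x y : R) : R := (v - lam * t) * x + 1 - m t * (x * cos nu - y * sin nu).

Definition zsol (x y : R -> R) : Prop := forall t,
  is_derive x t (zfx (x t ^ 2 + y t ^ 2) t (x t) (y t)) /\
  is_derive y t (zfy (x t ^ 2 + y t ^ 2) t (x t) (y t)).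

(** Exponent of the a priori bound for 1 + |z|^2: the constant 1 accounts for the forcing, since 2
    |y| <= 1 + y^2, and 4 |m| for the term with conj z. *)
Definition growth (t0 t : R) : R := RInt (fun s => 1 + 4 * Rabs (m s)) t0 t.

Lemma growth_derive t0 t : is_derive (growth t0) t (1 + 4 * Rabs (m t)).
Proof.
  apply (is_derive_ext (fun t => 0 + RInt (fun s => 1 + 4 * Rabs (m s)) t0 t)); [intros; apply Rplus_0_l|].
  apply (is_derive_RInt_continuous (fun s => 1 + 4 * Rabs (m s))).
  intros s. cont.
Qed.

(** The rotation with velocity w - lam t drops out of the derivative of |z|^2, so the bound holds
    for any factor w, the truncated one included. The sum of the two exponentials serves both time
    directions. *)
Lemma norm_growth (x y w : R -> R) (t0 : R) :
  (forall t, is_derive x t (zfx (w t) t (x t) (y t)) /\ is_derive y t (zfy (w t) t (x t) (y t))) ->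
  forall t, 1 + (x t ^ 2 + y t ^ 2)
    <= (1 + (x t0 ^ 2 + y t0 ^ 2)) * (exp (growth t0 t) + exp (- growth t0 t)).
Proof.
  intros Hs t.
  set (V := fun s => 1 + (x s ^ 2 + y s ^ 2)).
  assert (HV : forall s, is_derive V s (2 * x s * zfx (w s) s (x s) (y s) + 2 * y s * zfy (w s) s (x s) (y s))).
  { intros s. destruct (Hs s) as [H1 H2]. unfold V.
    auto_derive; [repeat split; eexists; eassumption|].
    rewrite_derive. ring. }
  assert (Hb : forall s, Rabs (2 * x s * zfx (w s) s (x s) (y s) + 2 * y s * zfy (w s) s (x s) (y s))
                 <= (1 + 4 * Rabs (m s)) * V s).
  { intros s. unfold zfx, zfy, V. set (X := x s). set (Y := y s).
    match goal with |- Rabs ?a <= _ =>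
      replace a with (2 * Y - 2 * (m s * (sin nu * (X ^ 2 - Y ^ 2) + cos nu * (2 * X * Y)))) by ring end.
    assert (HQ : Rabs (sin nu * (X ^ 2 - Y ^ 2) + cos nu * (2 * X * Y)) <= 2 * (X ^ 2 + Y ^ 2)).
    { eapply Rle_trans; [apply Rabs_triang|]. rewrite !Rabs_mult.
      assert (Rabs (sin nu) <= 1) by (apply Rabs_le; apply SIN_bound).
      assert (Rabs (cos nu) <= 1) by (apply Rabs_le; apply COS_bound).
      assert (Rabs (X ^ 2 - Y ^ 2) <= X ^ 2 + Y ^ 2) by (pose proof (pow2_ge_0 X); pose proof (pow2_ge_0 Y); apply Rabs_le; lra).
      assert (Rabs 2 * Rabs X * Rabs Y <= X ^ 2 + Y ^ 2).
      { rewrite <- !Rabs_mult. pose proof (pow2_ge_0 (X + Y)). pose proof (pow2_ge_0 (X - Y)).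
        apply Rabs_le; split; nra. }
      pose proof (Rabs_pos (sin nu)). pose proof (Rabs_pos (cos nu)).
      pose proof (Rabs_pos (X ^ 2 - Y ^ 2)).
      assert (0 <= Rabs 2 * Rabs X * Rabs Y) by (rewrite <- !Rabs_mult; apply Rabs_pos).
      nra. }
    eapply Rle_trans; [apply Rabs_triang|]. rewrite Rabs_Ropp, !Rabs_mult, (Rabs_pos_eq 2) by lra.
    pose proof (Rabs_pos (m s)).
    assert (2 * Rabs Y <= 1 + Y ^ 2).
    { rewrite <- (pow2_abs Y). pose proof (pow2_ge_0 (Rabs Y - 1)). nra. }
    assert (Rabs (m s) * Rabs (sin nu * (X ^ 2 - Y ^ 2) + cos nu * (2 * X * Y)) <= Rabs (m s) * (2 * (X ^ 2 + Y ^ 2)))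
      by (now apply Rmult_le_compat_l).
    nra. }
  assert (HVp : forall s, 0 < V s) by (intros s; unfold V; nra).
  fold (V t). fold (V t0).
  assert (Hg0 : growth t0 t0 = 0) by (unfold growth; rewrite RInt_point; reflexivity).
  assert (HD : forall sg s, is_derive (fun s => V s * exp (sg * growth t0 s)) s
     ((2 * x s * zfx (w s) s (x s) (y s) + 2 * y s * zfy (w s) s (x s) (y s)
       + sg * (1 + 4 * Rabs (m s)) * V s) * exp (sg * growth t0 s))).
  { intros sg s. pose proof (growth_derive t0 s) as Hg. specialize (HV s).
    auto_derive; [repeat split; eexists; eassumption|].
    rewrite_derive. ring. }
  pose proof (exp_pos (growth t0 t)). pose proof (exp_pos (- growth t0 t)).
  assert (He : exp (growth t0 t) * exp (- growth t0 t) = 1).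
  { rewrite <- exp_plus, Rplus_opp_r. apply exp_0. }
  destruct (Rle_dec t0 t) as [Ht|Ht].
  - assert (Hle : - (V t0 * exp (-1 * growth t0 t0)) <= - (V t * exp (-1 * growth t0 t))).
    { refine (derive_nonneg_le (fun s => - (V s * exp (-1 * growth t0 s))) _ t0 t Ht _ _).
      - intros s _. apply (is_derive_opp (fun s => V s * exp (-1 * growth t0 s))). apply HD.
      - intros s _. pose proof (exp_pos (-1 * growth t0 s)). specialize (Hb s).
        apply Rabs_le_between in Hb. unfold opp; simpl. nra. }
    rewrite Hg0, Rmult_0_r, exp_0, Rmult_1_r in Hle.
    replace (-1 * growth t0 t) with (- growth t0 t) in Hle by ring.
    pose proof (HVp t0).
    assert (V t <= V t0 * exp (growth t0 t)).
    { replace (V t) with (V t * exp (- growth t0 t) * exp (growth t0 t)) by (rewrite Rmult_assoc, (Rmult_comm (exp _)), He; ring).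
      apply Rmult_le_compat_r; lra. }
    nra.
  - assert (Hle : V t * exp (1 * growth t0 t) <= V t0 * exp (1 * growth t0 t0)).
    { refine (derive_nonneg_le (fun s => V s * exp (1 * growth t0 s)) _ t t0 _ _ _); [lra| |].
      - intros s _. apply HD.
      - intros s _. pose proof (exp_pos (1 * growth t0 s)). specialize (Hb s).
        apply Rabs_le_between in Hb. nra. }
    rewrite Hg0, Rmult_0_r, exp_0, Rmult_1_r, Rmult_1_l in Hle.
    pose proof (HVp t0).
    assert (V t <= V t0 * exp (- growth t0 t)).
    { replace (V t) with (V t * exp (growth t0 t) * exp (- growth t0 t)) by (rewrite Rmult_assoc, He; ring).
      apply Rmult_le_compat_r; lra. }
    nra.
Qed.

Lemma clamped_field_lipschitz k t x y x' y' : 0 <= k ->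
  Rabs (zfx (Rmin (x ^ 2 + y ^ 2) (k ^ 2)) t x y - zfx (Rmin (x' ^ 2 + y' ^ 2) (k ^ 2)) t x' y')
    <= (4 * k ^ 2 + Rabs (lam * t) + Rabs (m t)) * (Rabs (x - x') + Rabs (y - y')) /\
  Rabs (zfy (Rmin (x ^ 2 + y ^ 2) (k ^ 2)) t x y - zfy (Rmin (x' ^ 2 + y' ^ 2) (k ^ 2)) t x' y')
    <= (4 * k ^ 2 + Rabs (lam * t) + Rabs (m t)) * (Rabs (x - x') + Rabs (y - y')).
Proof.
  intros Hk. pose proof (clamped_mult_lipschitz k x y x' y' Hk) as H1.
  pose proof (clamped_mult_lipschitz k y x y' x' Hk) as H2.
  rewrite (Rplus_comm (y ^ 2)), (Rplus_comm (y' ^ 2)) in H2.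
  set (v := Rmin (x ^ 2 + y ^ 2) (k ^ 2)) in *. set (v' := Rmin (x' ^ 2 + y' ^ 2) (k ^ 2)) in *.
  assert (Hs : Rabs (sin nu) <= 1) by (apply Rabs_le; apply SIN_bound).
  assert (Hc : Rabs (cos nu) <= 1) by (apply Rabs_le; apply COS_bound).
  pose proof (Rabs_pos (x - x')) as P1. pose proof (Rabs_pos (y - y')) as P2.
  pose proof (Rabs_pos (lam * t)) as P3. pose proof (Rabs_pos (m t)) as P4.
  assert (Hlin : forall a b, Rabs a <= 1 -> Rabs b <= 1 ->
     Rabs (m t * ((x - x') * a + (y - y') * b)) <= Rabs (m t) * (Rabs (x - x') + Rabs (y - y'))).
  { intros a b Ha Hb. rewrite Rabs_mult. apply Rmult_le_compat_l; [exact P4|].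
    eapply Rle_trans; [apply Rabs_triang|]. rewrite !Rabs_mult. nra. }
  split; unfold zfx, zfy.
  - match goal with |- Rabs ?a <= _ => replace a with
      (- (v * y - v' * y') + (lam * t) * (y - y') + - (m t * ((x - x') * sin nu + (y - y') * cos nu))) by ring end.
    eapply Rle_trans; [apply Rabs_triang|]. eapply Rle_trans; [apply Rplus_le_compat_r, Rabs_triang|].
    rewrite !Rabs_Ropp, (Rabs_mult (lam * t)). specialize (Hlin (sin nu) (cos nu) Hs Hc). nra.
  - match goal with |- Rabs ?a <= _ => replace a with
      ((v * x - v' * x') + - ((lam * t) * (x - x')) + - (m t * ((x - x') * cos nu + (y - y') * - sin nu))) by ring end.
    eapply Rle_trans; [apply Rabs_triang|]. eapply Rle_trans; [apply Rplus_le_compat_r, Rabs_triang|].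
    rewrite !Rabs_Ropp, (Rabs_mult (lam * t)).
    specialize (Hlin (cos nu) (- sin nu) Hc ltac:(now rewrite Rabs_Ropp)). nra.
Qed.

(** The field is truncated at the level [k t] that the growth bound provides for every truncation at
    once; the solution of the truncated system thus never meets its own truncation. *)
Lemma zsol_exists t0 x0 y0 : exists x y, x t0 = x0 /\ y t0 = y0 /\ zsol x y.
Proof.
  set (k := fun t => (1 + (x0 ^ 2 + y0 ^ 2)) * (exp (growth t0 t) + exp (- growth t0 t))).
  assert (Hk : forall t, continuous k t).
  { intros t. pose proof (growth_derive t0 t) as Hg. unfold k.
    apply (ex_derive_continuous (fun t => (1 + (x0 ^ 2 + y0 ^ 2)) * (exp (growth t0 t) + exp (- growth t0 t)))).
    auto_derive; repeat split; eexists; eassumption. }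
  assert (Hk1 : forall t, 1 <= k t).
  { intros t. unfold k.
    assert (He : exp (growth t0 t) * exp (- growth t0 t) = 1).
    { rewrite <- exp_plus, Rplus_opp_r. apply exp_0. }
    pose proof (exp_pos (growth t0 t)). pose proof (exp_pos (- growth t0 t)).
    assert (1 <= exp (growth t0 t) + exp (- growth t0 t)) by nra. nra. }
  set (F := fun t x y => zfx (Rmin (x ^ 2 + y ^ 2) (k t ^ 2)) t x y).
  set (G := fun t x y => zfy (Rmin (x ^ 2 + y ^ 2) (k t ^ 2)) t x y).
  assert (HL : forall T, exists L, 0 <= L /\ forall t, Rabs t <= T -> forall x y x' y',
    Rabs (F t x y - F t x' y') <= L * (Rabs (x - x') + Rabs (y - y')) /\
    Rabs (G t x y - G t x' y') <= L * (Rabs (x - x') + Rabs (y - y'))).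
  { intros T. destruct (continuous_abs_bounded k (-T) T Hk) as (Km & HKm & HK).
    destruct (continuous_abs_bounded m (-T) T Hm) as (Mm & HMm & HM).
    destruct (continuous_abs_bounded (fun t => lam * t) (-T) T) as (Lm & HLm & HLb).
    { intros; cont. }
    exists (4 * Km ^ 2 + Lm + Mm). split; [nra|].
    intros t Ht x y x' y'. apply Rabs_le_between in Ht.
    specialize (HK t Ht). specialize (HM t Ht). specialize (HLb t Ht). simpl in HLb.
    destruct (clamped_field_lipschitz (k t) t x y x' y') as [A1 A2]; [specialize (Hk1 t); lra|].
    assert (Hc : 4 * k t ^ 2 + Rabs (lam * t) + Rabs (m t) <= 4 * Km ^ 2 + Lm + Mm).
    { specialize (Hk1 t). rewrite Rabs_pos_eq in HK by lra. nra. }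
    pose proof (Rabs_pos (x - x')). pose proof (Rabs_pos (y - y')).
    split; (eapply Rle_trans; [eassumption|]); apply Rmult_le_compat_r; lra. }
  assert (HFc : continuous_along F) by (intros x y Hx Hy t; unfold F, zfx; cont).
  assert (HGc : continuous_along G) by (intros x y Hx Hy t; unfold G, zfy; cont).
  assert (HFl : lipschitz_on_compacts F).
  { intros T. destruct (HL T) as (L & HL0 & H). exists L. split; [exact HL0|]. intros t Ht x y x' y'. now apply H. }
  assert (HGl : lipschitz_on_compacts G).
  { intros T. destruct (HL T) as (L & HL0 & H). exists L. split; [exact HL0|]. intros t Ht x y x' y'. now apply H. }
  destruct (picard_exists F G HFc HGc HFl HGl t0 x0 y0) as (x & y & Hx & Hy & Hd).
  exists x, y. split; [exact Hx|]. split; [exact Hy|].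
  assert (Hb := norm_growth x y (fun t => Rmin (x t ^ 2 + y t ^ 2) (k t ^ 2)) t0 Hd).
  rewrite Hx, Hy in Hb. intros t. specialize (Hb t). fold (k t) in Hb.
  destruct (Hd t) as [H1 H2]. unfold F, G in H1, H2.
  (* Here |z|^2 <= k t <= (k t)^2 because k t >= 1, so the minimum is |z|^2. *)
  specialize (Hk1 t). rewrite Rmin_left in H1, H2 by nra. now split.
Qed.

(** Gronwall's inequality for the squared distance: D' <= 4 Lc D. The a priori bound puts both
    solutions where the field coincides with its truncation, whose Lipschitz constant is uniform
    over all initial values in the ball given by B. *)
Lemma zsol_dependence T1 T2 B : T1 <= T2 -> exists L, 0 <= L /\
  forall x y x' y', zsol x y -> zsol x' y' ->
    x T1 ^ 2 + y T1 ^ 2 <= B -> x' T1 ^ 2 + y' T1 ^ 2 <= B ->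
    forall t, T1 <= t <= T2 ->
      (x t - x' t) ^ 2 + (y t - y' t) ^ 2 <= L * ((x T1 - x' T1) ^ 2 + (y T1 - y' T1) ^ 2).
Proof.
  intros HT.
  destruct (continuous_abs_bounded (fun t => exp (growth T1 t) + exp (- growth T1 t)) T1 T2) as (E & HE & HEb).
  { intros t. pose proof (growth_derive T1 t) as Hg.
    apply (ex_derive_continuous (fun t => exp (growth T1 t) + exp (- growth T1 t))).
    auto_derive; repeat split; eexists; eassumption. }
  destruct (continuous_abs_bounded m T1 T2 Hm) as (Mm & HMm & HM).
  destruct (continuous_abs_bounded (fun t => lam * t) T1 T2) as (Lm & HLm & HLb); [intros; cont|].
  (* At least 1, so that a bound of |z|^2 by k is also one by k^2. *)
  set (k := 1 + (1 + Rabs B) * E).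
  assert (Hk : 1 <= k) by (unfold k; pose proof (Rabs_pos B); nra).
  set (Lc := 4 * k ^ 2 + Lm + Mm).
  exists (exp (4 * Lc * (T2 - T1))). split; [left; apply exp_pos|].
  intros x y x' y' Hs Hs' HB HB' t Ht.
  assert (Hbd : forall x y, zsol x y -> x T1 ^ 2 + y T1 ^ 2 <= B -> forall s, T1 <= s <= T2 -> x s ^ 2 + y s ^ 2 <= k ^ 2).
  { clear x y x' y' Hs Hs' HB HB'. intros x y Hs HB s Hs1.
    pose proof (norm_growth x y (fun t => x t ^ 2 + y t ^ 2) T1 Hs s) as Hg.
    specialize (HEb s Hs1). cbv beta in HEb.
    pose proof (exp_pos (growth T1 s)). pose proof (exp_pos (- growth T1 s)).
    rewrite Rabs_pos_eq in HEb by lra.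
    pose proof (Rle_abs B). 
    assert ((1 + (x T1 ^ 2 + y T1 ^ 2)) * (exp (growth T1 s) + exp (- growth T1 s)) <= (1 + Rabs B) * E).
    { apply Rmult_le_compat; try lra. pose proof (pow2_ge_0 (x T1)). pose proof (pow2_ge_0 (y T1)). lra. }
    unfold k in *. nra. }
  set (D := fun s => (x s - x' s) ^ 2 + (y s - y' s) ^ 2).
  set (fx := fun s => zfx (x s ^ 2 + y s ^ 2) s (x s) (y s) - zfx (x' s ^ 2 + y' s ^ 2) s (x' s) (y' s)).
  set (fy := fun s => zfy (x s ^ 2 + y s ^ 2) s (x s) (y s) - zfy (x' s ^ 2 + y' s ^ 2) s (x' s) (y' s)).
  assert (HD : forall s, is_derive (fun s => - (D s * exp (- 4 * Lc * (s - T1)))) s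
     ((4 * Lc * D s - 2 * (x s - x' s) * fx s - 2 * (y s - y' s) * fy s) * exp (-4 * Lc * (s - T1)))).
  { intros s. destruct (Hs s) as [H1 H2]. destruct (Hs' s) as [H3 H4]. unfold D.
    auto_derive; [repeat split; eexists; eassumption|].
    rewrite_derive.
    unfold fx, fy, Rminus. simpl. ring. }
  assert (Hle : - (D T1 * exp (-4 * Lc * (T1 - T1))) <= - (D t * exp (-4 * Lc * (t - T1)))).
  { apply (derive_nonneg_le _ _ T1 t ltac:(lra) (fun s _ => HD s)).
    intros s Hs1. apply Rmult_le_pos; [|left; apply exp_pos].
    pose proof (Hbd x y Hs HB s ltac:(lra)) as V1. pose proof (Hbd x' y' Hs' HB' s ltac:(lra)) as V2.
    destruct (clamped_field_lipschitz k s (x s) (y s) (x' s) (y' s) ltac:(lra)) as [A1 A2].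
    rewrite !Rmin_left in A1, A2 by lra. fold (fx s) in A1. fold (fy s) in A2.
    specialize (HM s ltac:(lra)). specialize (HLb s ltac:(lra)). cbv beta in HLb.
    set (a := x s - x' s) in *. set (b := y s - y' s) in *.
    pose proof (Rabs_pos a). pose proof (Rabs_pos b).
    assert (Hc : (4 * k ^ 2 + Rabs (lam * s) + Rabs (m s)) * (Rabs a + Rabs b) <= Lc * (Rabs a + Rabs b)).
    { apply Rmult_le_compat_r; unfold Lc; lra. }
    assert (HLc : 0 <= Lc) by (unfold Lc; pose proof (pow2_ge_0 k); lra).
    assert (a * fx s <= Rabs a * (Lc * (Rabs a + Rabs b))).
    { eapply Rle_trans; [apply Rle_abs|]. rewrite Rabs_mult. apply Rmult_le_compat_l; lra. }
    assert (b * fy s <= Rabs b * (Lc * (Rabs a + Rabs b))).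
    { eapply Rle_trans; [apply Rle_abs|]. rewrite Rabs_mult. apply Rmult_le_compat_l; lra. }
    assert (D s = Rabs a ^ 2 + Rabs b ^ 2) as -> by (unfold D; fold a; fold b; rewrite !pow2_abs; reflexivity).
    assert (Lc * (Rabs a + Rabs b) ^ 2 <= Lc * (2 * (Rabs a ^ 2 + Rabs b ^ 2))).
    { apply Rmult_le_compat_l; [exact HLc|]. pose proof (pow2_ge_0 (Rabs a - Rabs b)). nra. }
    nra. }
  rewrite Rminus_diag, Rmult_0_r, exp_0, Rmult_1_r in Hle.
  fold (D t). fold (D T1).
  assert (H0 : 0 <= D T1) by (unfold D; pose proof (pow2_ge_0 (x T1 - x' T1)); pose proof (pow2_ge_0 (y T1 - y' T1)); lra).
  assert (HLc : 0 <= Lc) by (unfold Lc; pose proof (pow2_ge_0 k); lra).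
  assert (D t <= D T1 * exp (4 * Lc * (t - T1))).
  { replace (D t) with (D t * exp (-4 * Lc * (t - T1)) * exp (4 * Lc * (t - T1))).
    - apply Rmult_le_compat_r; [left; apply exp_pos|lra].
    - rewrite Rmult_assoc, <- exp_plus. replace (-4 * Lc * (t - T1) + 4 * Lc * (t - T1)) with 0 by ring.
      rewrite exp_0; ring. }
  assert (exp (4 * Lc * (t - T1)) <= exp (4 * Lc * (T2 - T1))).
  { assert (Hl : 4 * Lc * (t - T1) <= 4 * Lc * (T2 - T1)) by (apply Rmult_le_compat_l; lra).
    destruct (Rle_lt_or_eq_dec _ _ Hl) as [Hlt|He]; [left; now apply exp_increasing|rewrite He; lra]. }
  nra.
Qed.

End PlanarSystem.

(** * Polar coordinates through the zeros of z *)

Lemma continuous_eps (f : R -> R) t :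
  (forall eps, 0 < eps -> exists d, 0 < d /\ forall s, Rabs (s - t) < d -> Rabs (f s - f t) <= eps) ->
  continuous f t.
Proof.
  intros H. apply continuity_pt_filterlim. intros eps He.
  destruct (H (eps / 2) ltac:(lra)) as (d & Hd & Hs). exists d. split; [exact Hd|].
  intros s [_ Hsd]. simpl in *. unfold Rdist in *. specialize (Hs s Hsd). lra.
Qed.

Lemma continuous_eps_elim (f : R -> R) t eps : continuous f t -> 0 < eps ->
  exists d, 0 < d /\ forall s, Rabs (s - t) < d -> Rabs (f s - f t) < eps.
Proof.
  intros H He. apply continuity_pt_filterlim in H. destruct (H eps He) as (d & Hd & Hs).
  exists d. split; [exact Hd|]. intros s Hst. destruct (Req_dec s t) as [->|Hne].
  - rewrite Rminus_diag, Rabs_R0. exact He.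
  - apply (Hs s). split; [split; [exact I | congruence]|exact Hst].
Qed.

Lemma is_derive_factor (f g : R -> R) t0 :
  (exists d, 0 < d /\ forall t, Rabs (t - t0) < d -> f t = f t0 + (t - t0) * g t) ->
  continuous g t0 -> is_derive f t0 (g t0).
Proof.
  intros (d & Hd & Hf) Hg. apply is_derive_Reals. intros eps He.
  destruct (continuous_eps_elim g t0 eps Hg He) as (d' & Hd' & Hg').
  assert (Hm : 0 < Rmin d d') by (apply Rmin_pos; lra).
  exists (mkposreal _ Hm). intros h Hh Hhd. simpl in Hhd.
  pose proof (Rmin_l d d'). pose proof (Rmin_r d d').
  rewrite (Hf (t0 + h)) by (replace (t0 + h - t0) with h by ring; lra).
  replace ((f t0 + (t0 + h - t0) * g (t0 + h) - f t0) / h) with (g (t0 + h)) by (field; exact Hh).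
  apply Hg'. replace (t0 + h - t0) with h by ring. lra.
Qed.

Definition quot (f : R -> R) (t0 l t : R) : R := if Req_EM_T t t0 then l else f t / (t - t0).

Lemma quot_spec f t0 l t : f t0 = 0 -> f t = (t - t0) * quot f t0 l t.
Proof.
  intros H. unfold quot. destruct (Req_EM_T t t0) as [->|Hn]; [rewrite H; ring|field; lra].
Qed.

Lemma quot_eq f t0 l : quot f t0 l t0 = l.
Proof. unfold quot. destruct (Req_EM_T t0 t0); [reflexivity|congruence]. Qed.

Lemma quot_continuous f t0 l : f t0 = 0 -> is_derive f t0 l -> continuous (quot f t0 l) t0.
Proof.
  intros H0 Hd. apply is_derive_Reals in Hd. apply continuous_eps. intros eps He.
  destruct (Hd eps He) as [d Hdd]. exists d. split; [apply cond_pos|].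
  intros s Hs. rewrite quot_eq. unfold quot. destruct (Req_EM_T s t0) as [->|Hn].
  - rewrite Rminus_diag, Rabs_R0. lra.
  - specialize (Hdd (s - t0) ltac:(lra) Hs). replace (t0 + (s - t0)) with s in Hdd by ring.
    rewrite H0, Rminus_0_r in Hdd. lra.
Qed.

(** Since f' = (t - t0) g, the difference of f and g(t0)/2 (t - t0)^2 is small compared with (t -
    t0)^2 by the mean value theorem. Only continuity of g at t0 enters, which matters because the
    coefficient [m] is merely continuous. *)
Lemma quot2_continuous (f g : R -> R) t0 : f t0 = 0 ->
  (forall t, is_derive f t ((t - t0) * g t)) -> continuous g t0 ->
  continuous (quot (quot f t0 0) t0 (g t0 / 2)) t0.
Proof.
  intros H0 Hd Hg. apply continuous_eps. intros eps He.
  destruct (continuous_eps_elim g t0 eps Hg He) as (d & Hdp & Hgd).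
  exists d. split; [exact Hdp|]. intros s Hs. rewrite quot_eq.
  unfold quot. destruct (Req_EM_T s t0) as [->|Hn]; [rewrite Rminus_diag, Rabs_R0; lra|].
  destruct (MVT_gen (fun t => f t - g t0 / 2 * (t - t0) ^ 2) t0 s
     (fun t => (t - t0) * (g t - g t0))) as (c & Hc & E).
  - intros t _. specialize (Hd t). auto_derive; [repeat split; eexists; eassumption|].
    rewrite_derive.
    field.
  - intros t _. apply continuity_pt_filterlim.
    apply (continuous_Rminus f (fun t => g t0 / 2 * (t - t0) ^ 2));
      [apply (continuous_of_derive f t _ (Hd t))|cont].
  - rewrite H0 in E. replace (f s / (s - t0) / (s - t0) - g t0 / 2) with
      ((f s - g t0 / 2 * (s - t0) ^ 2 - (0 - g t0 / 2 * (t0 - t0) ^ 2)) / (s - t0) ^ 2) by (field; lra).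
    rewrite E. unfold Rdiv. rewrite Rabs_mult, Rabs_mult, Rabs_mult, Rabs_inv, <- RPow_abs.
    assert (Hcs : Rabs (c - t0) <= Rabs (s - t0)).
    { revert Hc. unfold Rmin, Rmax, Rabs. destruct (Rle_dec t0 s); repeat destruct Rcase_abs; lra. }
    specialize (Hgd c ltac:(lra)).
    assert (Hp : 0 < Rabs (s - t0)) by (apply Rabs_pos_lt; lra).
    set (P := Rabs (s - t0)) in *. set (Q := Rabs (c - t0)) in *.
    assert (0 <= Q) by apply Rabs_pos.
    pose proof (Rabs_pos (g c - g t0)).
    apply Rmult_le_reg_r with (P ^ 2); [nra|]. rewrite Rmult_assoc, Rinv_l by nra.
    assert (Q * Rabs (g c - g t0) <= P * eps) by (apply Rmult_le_compat; lra). nra.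
Qed.

Lemma derive_zero_constant (f : R -> R) : (forall t, is_derive f t 0) -> forall a b, f a = f b.
Proof.
  assert (H : forall f, (forall t, is_derive f t 0) -> forall a b, a <= b -> f a <= f b).
  { intros g Hg a b Hab. apply (derive_nonneg_le g (fun _ => 0)); intros; auto; lra. }
  intros Hf a b.
  assert (Hf' : forall t, is_derive (fun t => - f t) t 0).
  { intros t. rewrite <- Ropp_0. apply (is_derive_opp f), Hf. }
  destruct (Rle_dec a b) as [Hab|Hab].
  - pose proof (H f Hf a b Hab). pose proof (H _ Hf' a b Hab). simpl in *. lra.
  - pose proof (H f Hf b a ltac:(lra)). pose proof (H _ Hf' b a ltac:(lra)). simpl in *. lra.
Qed.

Section PolarLift.

Variables (lam nu : R) (m x y : R -> R).
Hypothesis Hm : forall t, continuous m t.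
Hypothesis Hz : zsol lam nu m x y.

Let V t := x t ^ 2 + y t ^ 2.
(** N + i M is z^2 / |z|^2 = e^(2 i psi). Squaring removes the sign change of rho, so this quantity
    extends continuously through a zero of z; there z' = i and the limit is -1. *)
Let N t := if Req_EM_T (V t) 0 then -1 else (x t ^ 2 - y t ^ 2) / V t.
Let M t := if Req_EM_T (V t) 0 then 0 else 2 * x t * y t / V t.
(* The angular velocity, with its limit value at the zeros of x + i y. *)
Let om t := if Req_EM_T (V t) 0 then (- (lam * t) + m t * cos nu) / 2
  else (V t - lam * t) + x t / V t - m t * (N t * cos nu - M t * sin nu).

Let Hx t : is_derive x t (zfx lam nu m (V t) t (x t) (y t)).
Proof. apply Hz. Qed.
Let Hy t : is_derive y t (zfy lam nu m (V t) t (x t) (y t)).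
Proof. apply Hz. Qed.
Let Hxc t : continuous x t.
Proof. eapply continuous_of_derive, Hx. Qed.
Let Hyc t : continuous y t.
Proof. eapply continuous_of_derive, Hy. Qed.
Let HVc t : continuous V t.
Proof. unfold V. cont. Qed.

Lemma continuous_Rdiv (f g : R -> R) t : g t <> 0 ->
  continuous f t -> continuous g t -> continuous (fun s => f s / g s) t.
Proof.
  intros H0 Hf Hg. apply continuous_Rmult; [exact Hf|].
  apply (continuous_comp g Rinv); [exact Hg|].
  apply continuous_Rinv. exact H0.
Qed.

(** The two derivatives say that N + i M rotates with velocity 2 om. Where V does not vanish this is
    the quotient rule, the case distinctions being constant nearby. *)
Let regular t : V t <> 0 -> continuous om t /\ is_derive N t (- 2 * om t * M t) /\
  is_derive M t (2 * om t * N t).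
Proof.
  intros H0.
  assert (Hloc : exists d, 0 < d /\ forall s, Rabs (s - t) < d -> V s <> 0).
  { destruct (continuous_eps_elim V t (Rabs (V t)) (HVc t) (Rabs_pos_lt _ H0)) as (d & Hd & Hs).
    exists d. split; [exact Hd|]. intros s Hst E. specialize (Hs s Hst).
    rewrite E, Rminus_0_l, Rabs_Ropp in Hs. lra. }
  destruct Hloc as (d & Hd & Hs).
  assert (Hl : forall f g : R -> R, (forall s, V s <> 0 -> f s = g s) -> locally t (fun s => f s = g s)).
  { intros f g Hfg. exists (mkposreal d Hd). intros s Hst. apply Hfg, Hs. exact Hst. }
  assert (EN : forall s, V s <> 0 -> (x s ^ 2 - y s ^ 2) / V s = N s).
  { intros s Hs0. unfold N. destruct (Req_EM_T (V s) 0); [congruence|reflexivity]. }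
  assert (EM : forall s, V s <> 0 -> 2 * x s * y s / V s = M s).
  { intros s Hs0. unfold M. destruct (Req_EM_T (V s) 0); [congruence|reflexivity]. }
  assert (Eo : forall s, V s <> 0 -> (V s - lam * s) + x s / V s
     - m s * ((x s ^ 2 - y s ^ 2) / V s * cos nu - 2 * x s * y s / V s * sin nu) = om s).
  { intros s Hs0. rewrite (EN s Hs0), (EM s Hs0). unfold om.
    destruct (Req_EM_T (V s) 0); [congruence|reflexivity]. }
  assert (HV : is_derive V t (2 * x t * zfx lam nu m (V t) t (x t) (y t)
                              + 2 * y t * zfy lam nu m (V t) t (x t) (y t))).
  { pose proof (Hx t). pose proof (Hy t). unfold V at 1. auto_derive; [repeat split; eexists; eassumption|].
    rewrite_derive.
    ring. }
  split; [|split].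
  - apply (continuous_ext_loc _ _ _ (Hl _ _ Eo)).
    apply continuous_Rminus; [apply continuous_Rplus; [cont|now apply continuous_Rdiv]|].
    apply continuous_Rmult; [apply Hm|].
    apply continuous_Rminus; (apply continuous_Rmult; [apply continuous_Rdiv; [exact H0|cont|apply HVc]|apply continuous_const]).
  - apply (is_derive_ext_loc _ _ _ _ (Hl _ _ EN)).
    rewrite <- (Eo t H0), <- (EM t H0).
    pose proof (Hx t) as H1. pose proof (Hy t) as H2.
    auto_derive; [repeat split; try (eexists; eassumption); exact H0|].
    rewrite_derive.
    unfold zfx, zfy. revert H0. unfold V. intros H0. field. exact H0.
  - apply (is_derive_ext_loc _ _ _ _ (Hl _ _ EM)).
    rewrite <- (Eo t H0), <- (EN t H0).
    pose proof (Hx t) as H1. pose proof (Hy t) as H2.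
    auto_derive; [repeat split; try (eexists; eassumption); exact H0|].
    rewrite_derive.
    unfold zfx, zfy. revert H0. unfold V. intros H0. field. exact H0.
Qed.

(** At a zero, y = (s - t) Y with Y(t) = 1, whereas x vanishes to second order, x = (s - t)^2 X with
    X(t) = -k/2, because z' = i there. Hence V = (s - t)^2 W with W(t) = 1, and the powers of s - t
    cancel in N, M and x / V. *)
Let singular t : V t = 0 -> continuous om t /\ is_derive N t (- 2 * om t * M t) /\
  is_derive M t (2 * om t * N t).
Proof.
  intros H0.
  assert (x0 : x t = 0) by (unfold V in H0; nra).
  assert (y0 : y t = 0) by (unfold V in H0; nra).
  set (k := - (lam * t) + m t * cos nu).
  assert (Dy : is_derive y t 1).
  { pose proof (Hy t) as H. unfold zfy in H. rewrite x0, y0 in H.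
    replace 1 with ((V t - lam * t) * 0 + 1 - m t * (0 * cos nu - 0 * sin nu)) by ring. exact H. }
  assert (Dx : is_derive x t 0).
  { pose proof (Hx t) as H. unfold zfx in H. rewrite x0, y0 in H.
    replace 0 with (- ((V t - lam * t) * 0 + m t * (0 * sin nu + 0 * cos nu))) by ring. exact H. }
  set (Y := quot y t 1). set (X1 := quot x t 0).
  assert (HY : continuous Y t) by now apply quot_continuous.
  assert (HX1 : continuous X1 t) by now apply quot_continuous.
  set (g := fun s => - ((V s - lam * s) * Y s + m s * (X1 s * sin nu + Y s * cos nu))).
  assert (Hg : continuous g t) by (unfold g; cont).
  assert (Eg : g t = - k).
  { unfold g, Y, X1, k. rewrite !quot_eq, H0. ring. }
  assert (Dg : forall s, is_derive x s ((s - t) * g s)).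
  { intros s. replace ((s - t) * g s) with (zfx lam nu m (V s) s (x s) (y s)); [apply Hx|].
    unfold zfx, g. rewrite (quot_spec x t 0 s x0) at 1. rewrite (quot_spec y t 1 s y0) at 1 2.
    fold X1 Y. ring. }
  set (X := quot X1 t (g t / 2)).
  assert (HX : continuous X t) by (now apply quot2_continuous).
  assert (EX : forall s, x s = (s - t) ^ 2 * X s).
  { intros s. rewrite (quot_spec x t 0 s x0). fold X1.
    rewrite (quot_spec X1 t (g t / 2) s (quot_eq x t 0)). fold X. ring. }
  assert (EY : forall s, y s = (s - t) * Y s) by (intros s; now apply quot_spec).
  set (W := fun s => (s - t) ^ 2 * X s ^ 2 + Y s ^ 2).
  assert (HW : continuous W t) by (unfold W; cont).
  assert (EYt : Y t = 1) by apply quot_eq.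
  assert (EXt : X t = - k / 2) by (unfold X; rewrite quot_eq, Eg; reflexivity).
  assert (EWt : W t = 1) by (unfold W; rewrite EYt; ring).
  assert (EV : forall s, V s = (s - t) ^ 2 * W s).
  { intros s. unfold V, W. rewrite EX, EY. ring. }
  destruct (continuous_eps_elim W t 1 HW ltac:(lra)) as (d & Hd & HWd). rewrite EWt in HWd.
  assert (HW0 : forall s, Rabs (s - t) < d -> 0 < W s).
  { intros s Hs. specialize (HWd s Hs). apply Rabs_lt_between in HWd. lra. }
  assert (HV0 : forall s, Rabs (s - t) < d -> s <> t -> V s <> 0).
  { intros s Hs Hn. rewrite EV. specialize (HW0 s Hs).
    assert (s - t <> 0) by lra. apply Rmult_integral_contrapositive_currified; [|lra].
    now apply pow_nonzero. }
  assert (ENs : forall s, Rabs (s - t) < d -> N s = -1 + (s - t) * (2 * (s - t) * X s ^ 2 / W s)).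
  { intros s Hs. unfold N. destruct (Req_EM_T (V s) 0) as [E|E].
    - destruct (Req_dec s t) as [->|Hn]; [rewrite Rminus_diag; ring|]. exfalso. now apply (HV0 s).
    - assert (s - t <> 0) by (intros E'; apply E; rewrite EV, E'; ring).
      rewrite EV, EX, EY. specialize (HW0 s Hs).
      replace (2 * (s - t) * X s ^ 2 / W s) with (2 * (s - t) * X s ^ 2 / W s) by reflexivity.
      apply Rmult_eq_reg_r with (W s); [|lra].
      replace ((((s - t) ^ 2 * X s) ^ 2 - ((s - t) * Y s) ^ 2) / ((s - t) ^ 2 * W s) * W s)
        with ((s - t) ^ 2 * X s ^ 2 - Y s ^ 2) by (field; split; lra).
      replace ((-1 + (s - t) * (2 * (s - t) * X s ^ 2 / W s)) * W s) with
        (- W s + 2 * (s - t) ^ 2 * X s ^ 2) by (field; lra).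
      unfold W. ring. }
  assert (EMs : forall s, Rabs (s - t) < d -> M s = 0 + (s - t) * (2 * X s * Y s / W s)).
  { intros s Hs. unfold M. destruct (Req_EM_T (V s) 0) as [E|E].
    - destruct (Req_dec s t) as [->|Hn]; [rewrite Rminus_diag; ring|]. exfalso. now apply (HV0 s).
    - assert (s - t <> 0) by (intros E'; apply E; rewrite EV, E'; ring).
      rewrite EV, EX, EY. specialize (HW0 s Hs). field. split; lra. }
  assert (Nt : N t = -1) by (unfold N; destruct (Req_EM_T (V t) 0); [reflexivity|congruence]).
  assert (Mt : M t = 0) by (unfold M; destruct (Req_EM_T (V t) 0); [reflexivity|congruence]).
  assert (omt : om t = k / 2) by (unfold om; destruct (Req_EM_T (V t) 0); [reflexivity|congruence]).
  assert (HN : is_derive N t 0).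
  { replace 0 with (2 * (t - t) * X t ^ 2 / W t) by (rewrite Rminus_diag; unfold Rdiv; ring).
    apply (is_derive_factor N (fun s => 2 * (s - t) * X s ^ 2 / W s)).
    - exists d. split; [exact Hd|]. intros s Hs. rewrite Nt. now apply ENs.
    - apply continuous_Rdiv; [rewrite EWt; lra| |exact HW]. cont. }
  assert (HMd : is_derive M t (- k)).
  { replace (- k) with (2 * X t * Y t / W t) by (rewrite EXt, EYt, EWt; field).
    apply (is_derive_factor M (fun s => 2 * X s * Y s / W s)).
    - exists d. split; [exact Hd|]. intros s Hs. rewrite Mt. now apply EMs.
    - apply continuous_Rdiv; [rewrite EWt; lra| |exact HW]. cont. }
  split; [|split].
  - apply (continuous_ext_loc _ (fun s => (V s - lam * s) + X s / W s - m s * (N s * cos nu - M s * sin nu))).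
    + exists (mkposreal d Hd). intros s Hs. simpl in Hs.
      change (Rabs (s - t) < d) in Hs. cbv beta.
      destruct (Req_dec s t) as [->|Hn].
      * rewrite omt, H0, EXt, EWt, Nt, Mt. unfold k. apply Rminus_diag_uniq. field.
      * unfold om. destruct (Req_EM_T (V s) 0) as [E|E]; [exfalso; now apply (HV0 s)|].
        assert (s - t <> 0) by lra. specialize (HW0 s Hs).
        f_equal. f_equal. rewrite EV, (EX s). field. split; lra.
    + apply continuous_Rminus; [apply continuous_Rplus; [cont|apply continuous_Rdiv; [lra|assumption|assumption]]|].
      pose proof (continuous_of_derive _ _ _ HN). pose proof (continuous_of_derive _ _ _ HMd). cont.
  - rewrite Mt, Rmult_0_r. exact HN.
  - rewrite Nt, omt. replace (2 * (k / 2) * -1) with (- k) by field. exact HMd.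
Qed.

(** psi is an integral of om, and E, the cosine of the angle between N + i M and e^(2 i psi), is
    constant and equals 1 at T1. Then 2 (y cos psi - x sin psi)^2 = V (1 - E) = 0, so z stays on the
    line of direction e^(i psi), and rho is its signed coordinate there. *)
Lemma polar_lift (T1 r a : R) : r <> 0 -> x T1 = r * cos a -> y T1 = r * sin a ->
  exists rho psi rho' psi' : R -> R, psi T1 = a /\
    (forall t, x t = rho t * cos (psi t) /\ y t = rho t * sin (psi t)) /\
    forall t, is_derive rho t (rho' t) /\ is_derive psi t (psi' t) /\
      rho' t + m t * rho t * sin (2 * psi t + nu) = sin (psi t) /\
      rho t * (psi' t - rho t ^ 2 + lam * t) + m t * rho t * cos (2 * psi t + nu) = cos (psi t).
Proof.
  intros Hr HxT HyT.
  assert (Hall : forall t, continuous om t /\ is_derive N t (- 2 * om t * M t) /\ is_derive M t (2 * om t * N t)).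
  { intros t. destruct (Req_dec (V t) 0); auto. }
  set (psi := fun t => a + RInt om T1 t).
  assert (Hpsi : forall t, is_derive psi t (om t)).
  { intros t. apply is_derive_RInt_continuous. intros s; apply Hall. }
  assert (HpT : psi T1 = a) by (unfold psi; rewrite RInt_point; apply Rplus_0_r).
  set (E := fun t => N t * cos (2 * psi t) + M t * sin (2 * psi t)).
  assert (HE : forall t, is_derive E t 0).
  { intros t. destruct (Hall t) as (_ & HN & HM). pose proof (Hpsi t) as Hp. unfold E.
    auto_derive; [repeat split; eexists; eassumption|].
    rewrite_derive.
    ring. }
  assert (HVT : V T1 = r ^ 2).
  { unfold V. rewrite HxT, HyT. pose proof (sin2_cos2 a) as H. unfold Rsqr in H.
    replace ((r * cos a) ^ 2 + (r * sin a) ^ 2) with (r ^ 2 * (sin a * sin a + cos a * cos a)) by ring.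
    rewrite H. ring. }
  assert (Hr2 : r ^ 2 <> 0) by now apply pow_nonzero.
  assert (HET : E T1 = 1).
  { unfold E. rewrite HpT. unfold N, M. destruct (Req_EM_T (V T1) 0) as [E0|_]; [congruence|].
    rewrite HVT, HxT, HyT, cos_2a, sin_2a. pose proof (sin2_cos2 a) as H. unfold Rsqr in H.
    replace (((r * cos a) ^ 2 - (r * sin a) ^ 2) / r ^ 2 * (cos a * cos a - sin a * sin a) +
       2 * (r * cos a) * (r * sin a) / r ^ 2 * (2 * sin a * cos a))
      with ((sin a * sin a + cos a * cos a) ^ 2) by (field; exact Hr).
    rewrite H. ring. }
  assert (HE1 : forall t, E t = 1).
  { intros t. rewrite <- HET. now apply derive_zero_constant. }
  assert (Hpar : forall t, y t * cos (psi t) - x t * sin (psi t) = 0).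
  { intros t. specialize (HE1 t). unfold E, N, M in HE1.
    destruct (Req_EM_T (V t) 0) as [H0|H0].
    - assert (x t = 0) as -> by (unfold V in H0; nra). assert (y t = 0) as -> by (unfold V in H0; nra). ring.
    - rewrite cos_2a, sin_2a in HE1. pose proof (sin2_cos2 (psi t)) as H. unfold Rsqr in H.
      set (c := cos (psi t)) in *. set (s := sin (psi t)) in *.
      assert (H1 : (x t ^ 2 - y t ^ 2) * (c * c - s * s) + 2 * x t * y t * (2 * s * c) = V t).
      { rewrite <- (Rmult_1_r (V t)). rewrite <- HE1. field. exact H0. }
      assert (H2 : 2 * (y t * c - x t * s) ^ 2 = 0).
      { replace (2 * (y t * c - x t * s) ^ 2) with
          (V t * (s * s + c * c) - ((x t ^ 2 - y t ^ 2) * (c * c - s * s) + 2 * x t * y t * (2 * s * c)))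
          by (unfold V; ring). rewrite H1, H. ring. }
      nra. }
  set (rho := fun t => x t * cos (psi t) + y t * sin (psi t)).
  assert (Hcs : forall t, sin (psi t) * sin (psi t) + cos (psi t) * cos (psi t) = 1).
  { intros t. apply sin2_cos2. }
  assert (Hxr : forall t, x t = rho t * cos (psi t)).
  { intros t. unfold rho.
    replace ((x t * cos (psi t) + y t * sin (psi t)) * cos (psi t)) with
     (x t * (sin (psi t) * sin (psi t) + cos (psi t) * cos (psi t)) + sin (psi t) * (y t * cos (psi t) - x t * sin (psi t))) by ring.
    rewrite Hcs, Hpar. ring. }
  assert (Hyr : forall t, y t = rho t * sin (psi t)).
  { intros t. unfold rho.
    replace ((x t * cos (psi t) + y t * sin (psi t)) * sin (psi t)) with
     (y t * (sin (psi t) * sin (psi t) + cos (psi t) * cos (psi t)) - cos (psi t) * (y t * cos (psi t) - x t * sin (psi t))) by ring.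
    rewrite Hcs, Hpar. ring. }
  set (fx := fun t => zfx lam nu m (V t) t (x t) (y t)). set (fy := fun t => zfy lam nu m (V t) t (x t) (y t)).
  exists rho, psi, (fun t => fx t * cos (psi t) + fy t * sin (psi t)), om.
  split; [exact HpT|]. split; [intros t; split; auto|].
  intros t. pose proof (Hx t : is_derive x t (fx t)) as H1. pose proof (Hy t : is_derive y t (fy t)) as H2.
  pose proof (Hpsi t) as H3.
  assert (HV : V t = rho t ^ 2).
  { unfold V. rewrite Hxr, Hyr. replace ((rho t * cos (psi t)) ^ 2 + (rho t * sin (psi t)) ^ 2) with
      (rho t ^ 2 * (sin (psi t) * sin (psi t) + cos (psi t) * cos (psi t))) by ring. rewrite Hcs. ring. }
  assert (Hs : sin (2 * psi t + nu) = 2 * sin (psi t) * cos (psi t) * cos nu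
     + (cos (psi t) * cos (psi t) - sin (psi t) * sin (psi t)) * sin nu).
  { now rewrite sin_plus, sin_2a, cos_2a. }
  assert (Hc : cos (2 * psi t + nu) = (cos (psi t) * cos (psi t) - sin (psi t) * sin (psi t)) * cos nu
     - 2 * sin (psi t) * cos (psi t) * sin nu).
  { now rewrite cos_plus, sin_2a, cos_2a. }
  split; [|split; [exact H3|split]].
  - unfold rho at 1. auto_derive; [repeat split; eexists; eassumption|].
    rewrite_derive.
    pose proof (Hpar t) as Hp.
    transitivity (fx t * cos (psi t) + fy t * sin (psi t) + om t * (y t * cos (psi t) - x t * sin (psi t))); [ring|].
    rewrite Hp. ring.
  - unfold fx, fy, zfx, zfy. rewrite Hs.
    set (w := V t - lam * t). rewrite (Hxr t), (Hyr t).
    ring.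
  - assert (Hd : is_derive (fun t => y t * cos (psi t) - x t * sin (psi t)) t
       (fy t * cos (psi t) - fx t * sin (psi t) - om t * rho t)).
    { auto_derive; [repeat split; eexists; eassumption|].
      rewrite_derive.
      unfold rho. ring. }
    (* The relation for rho psi' comes from differentiating y cos psi - x sin psi = 0; no division
       by rho occurs, so it holds at the zeros too. *)
    assert (Hom : om t * rho t = fy t * cos (psi t) - fx t * sin (psi t)).
    { apply (is_derive_ext _ (fun _ => 0)) in Hd; [|exact Hpar].
      apply is_derive_unique in Hd. rewrite Derive_const in Hd. lra. }
    replace (rho t * (om t - rho t ^ 2 + lam * t)) with (om t * rho t - (V t - lam * t) * rho t)
      by (rewrite HV; ring).
    rewrite Hom. unfold fx, fy, zfx, zfy. rewrite Hc.
    set (w := V t - lam * t). rewrite (Hxr t), (Hyr t).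
    transitivity (w * rho t * (sin (psi t) * sin (psi t) + cos (psi t) * cos (psi t)) + cos (psi t) - w * rho t);
      [ring|rewrite Hcs; ring].
Qed.

End PolarLift.

(** * Expansions in fractional powers *)

Fixpoint pola (a : nat -> R) (n : nat) (u : R) : R :=
  match n with O => 0 | S n => pola a n u + a n * u ^ n end.

Lemma pola_ext a b n u : (forall k, (k < n)%nat -> a k = b k) -> pola a n u = pola b n u.
Proof.
  induction n as [|n IH]; intros H; [reflexivity|]. simpl.
  rewrite IH, (H n) by (intros; auto with arith). reflexivity.
Qed.

Lemma pola_derive a n u : is_derive (pola a n) u (pola (fun k => INR (S k) * a (S k)) (pred n) u).
Proof.
  destruct n as [|n]; simpl pred; [apply (is_derive_const 0)|].
  induction n as [|n IH].
  - apply (is_derive_ext (fun _ => a O)); [intros; simpl; ring|]. apply (is_derive_const (a O)).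
  - change (pola (fun k => INR (S k) * a (S k)) (S n) u) with
      (pola (fun k => INR (S k) * a (S k)) n u + INR (S n) * a (S n) * u ^ n).
    apply (is_derive_plus (pola a (S n)) (fun u => a (S n) * u ^ S n)); [exact IH|].
    auto_derive; [exact I|]. change (a (S n) * (1 * (INR (S n) * u ^ n)) = INR (S n) * a (S n) * u ^ n). ring.
Qed.

(** Each integration of an error bound raises its order by one, by the mean value theorem; the
    constant is kept rather than divided by n + 1. *)
Lemma taylor_step (f g F G : R -> R) (K : R) (n : nat) :
  (forall u, is_derive f u (g u)) -> (forall u, is_derive F u (G u)) -> f 0 = F 0 ->
  0 <= K -> (forall u, Rabs (g u - G u) <= K * Rabs u ^ n) ->
  forall u, Rabs (f u - F u) <= K * Rabs u ^ S n.
Proof.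
  intros Hf HF H0 HK0 H u.
  destruct (MVT_gen (fun u => f u - F u) 0 u (fun u => g u - G u)) as (c & Hc & E).
  - intros x _. apply (is_derive_minus f F); auto.
  - intros x _. apply continuity_pt_filterlim. apply (continuous_Rminus f F).
    + apply (continuous_of_derive f x _ (Hf x)).
    + apply (continuous_of_derive F x _ (HF x)).
  - replace (f u - F u) with (f u - F u - (f 0 - F 0)) by (rewrite H0; ring).
    rewrite E, Rminus_0_r, Rabs_mult.
    assert (Hcu : Rabs c <= Rabs u).
    { revert Hc. unfold Rmin, Rmax, Rabs. destruct (Rle_dec 0 u); repeat destruct Rcase_abs; lra. }
    assert (HK : Rabs (g c - G c) <= K * Rabs u ^ n).
    { eapply Rle_trans; [apply H|].
      apply Rmult_le_compat_l; [exact HK0|]. apply pow_incr; split; [apply Rabs_pos|exact Hcu]. }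
    simpl. pose proof (Rabs_pos u). nra.
Qed.

(** Taylor coefficients of sine and cosine at 0, generated jointly because the derivative of each
    function is the other one up to sign. *)
Fixpoint trig_coeffs (n : nat) : R * R :=
  match n with
  | O => (0, 1)
  | S n => let (s, c) := trig_coeffs n in (c / INR (S n), - s / INR (S n))
  end.

Lemma pola_primitive a b n : (forall k, a (S k) = b k / INR (S k)) -> forall u,
  is_derive (pola a (S n)) u (pola b n u).
Proof.
  intros H u. replace (pola b n u) with (pola (fun k => INR (S k) * a (S k)) n u); [apply (pola_derive a (S n))|].
  apply pola_ext. intros k _. rewrite H. field. apply not_0_INR; lia.
Qed.

Lemma pola_opp a n u : pola (fun k => - a k) n u = - pola a n u.
Proof. induction n as [|n IH]; simpl; [ring|rewrite IH; ring]. Qed.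

Lemma pola_0 a n : pola a (S n) 0 = a O.
Proof. induction n as [|n IH]; [simpl; ring|]. change (pola a (S n) 0 + a (S n) * 0 ^ S n = a O). rewrite IH. simpl. ring. Qed.

Lemma trig_taylor n u :
  Rabs (sin u - pola (fun k => fst (trig_coeffs k)) n u) <= 1 * Rabs u ^ n /\
  Rabs (cos u - pola (fun k => snd (trig_coeffs k)) n u) <= 1 * Rabs u ^ n.
Proof.
  revert u. induction n as [|n IH]; intros u.
  - simpl. rewrite !Rminus_0_r, !Rmult_1_r. split; apply Rabs_le; [apply SIN_bound|apply COS_bound].
  - split.
    + apply (taylor_step sin cos _ (pola (fun k => snd (trig_coeffs k)) n)); [apply is_derive_sin| | |lra|apply IH].
      * apply pola_primitive. intros k. simpl trig_coeffs. destruct (trig_coeffs k); reflexivity.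
      * rewrite pola_0. simpl. apply sin_0.
    + apply (taylor_step cos (fun u => - sin u) _ (fun u => - pola (fun k => fst (trig_coeffs k)) n u));
        [apply is_derive_cos| | |lra|].
      * intros v. rewrite <- pola_opp. apply pola_primitive. intros k. simpl trig_coeffs. destruct (trig_coeffs k); reflexivity.
      * rewrite pola_0. simpl. apply cos_0.
      * intros v. destruct (IH v) as [H _].
        replace (- sin v - - pola (fun k => fst (trig_coeffs k)) n v) with
          (- (sin v - pola (fun k => fst (trig_coeffs k)) n v)) by ring. now rewrite Rabs_Ropp.
Qed.

(** * Taylor expansion of P *)

Section Taylor.
Variables (d nu s : R).

(** Bound for the fourth derivative 16 d sin(2 sigma + nu) - sin sigma of P; four integrations then
    serve roots up to order three. *)
Let K := 16 * Rabs d + 1.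
Let HK : 0 <= K.
Proof. unfold K. pose proof (Rabs_pos d). lra. Qed.

Lemma P3_lipschitz u : Rabs (P3 (s + u) d nu - P3 s d nu) <= K * Rabs u ^ 1.
Proof.
  apply (taylor_step (fun u => P3 (s + u) d nu) (fun u => 16 * d * sin (2 * (s + u) + nu) - sin (s + u))
    (fun _ => P3 s d nu) (fun _ => 0)); [| | |exact HK|].
  - intros v. unfold P3. auto_derive; [exact I|]. ring.
  - intros v. apply (is_derive_const (P3 s d nu)).
  - now rewrite Rplus_0_r.
  - intros v. rewrite Rminus_0_r. simpl. rewrite Rmult_1_r. unfold K.
    eapply Rle_trans; [apply Rabs_triang|]. rewrite Rabs_Ropp, !Rabs_mult, (Rabs_pos_eq 16) by lra.
    assert (Rabs (sin (2 * (s + v) + nu)) <= 1) by (apply Rabs_le; apply SIN_bound).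
    assert (Rabs (sin (s + v)) <= 1) by (apply Rabs_le; apply SIN_bound).
    pose proof (Rabs_pos d). nra.
Qed.

Lemma P2_taylor u : Rabs (P2 (s + u) d nu - (P2 s d nu + P3 s d nu * u)) <= K * Rabs u ^ 2.
Proof.
  apply (taylor_step (fun u => P2 (s + u) d nu) (fun u => P3 (s + u) d nu)
    (fun u => P2 s d nu + P3 s d nu * u) (fun _ => P3 s d nu)); [| | |exact HK|apply P3_lipschitz].
  - intros v. unfold P2, P3. auto_derive; [exact I|]. ring.
  - intros v. auto_derive; [exact I|]. ring.
  - rewrite Rplus_0_r. ring.
Qed.

Lemma P1_taylor u : Rabs (P1 (s + u) d nu - (P1 s d nu + P2 s d nu * u + P3 s d nu * u ^ 2 / 2)) <= K * Rabs u ^ 3.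
Proof.
  apply (taylor_step (fun u => P1 (s + u) d nu) (fun u => P2 (s + u) d nu)
    (fun u => P1 s d nu + P2 s d nu * u + P3 s d nu * u ^ 2 / 2) (fun u => P2 s d nu + P3 s d nu * u));
    [| | |exact HK|apply P2_taylor].
  - intros v. unfold P1, P2. auto_derive; [exact I|]. ring.
  - intros v. auto_derive; [exact I|]. field.
  - rewrite Rplus_0_r. field.
Qed.

Lemma P0_taylor u : Rabs (P0 (s + u) d nu - (P0 s d nu + P1 s d nu * u + P2 s d nu * u ^ 2 / 2 + P3 s d nu * u ^ 3 / 6))
  <= K * Rabs u ^ 4.
Proof.
  apply (taylor_step (fun u => P0 (s + u) d nu) (fun u => P1 (s + u) d nu)
    (fun u => P0 s d nu + P1 s d nu * u + P2 s d nu * u ^ 2 / 2 + P3 s d nu * u ^ 3 / 6)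
    (fun u => P1 s d nu + P2 s d nu * u + P3 s d nu * u ^ 2 / 2));
    [| | |exact HK|apply P1_taylor].
  - intros v. unfold P0, P1. auto_derive; [exact I|]. ring.
  - intros v. auto_derive; [exact I|]. field.
  - rewrite Rplus_0_r. field.
Qed.

Lemma P3_bound : Rabs (P3 s d nu) <= K.
Proof.
  unfold P3, K. eapply Rle_trans; [apply Rabs_triang|]. rewrite !Rabs_mult, (Rabs_left (-8)) by lra.
  assert (Rabs (cos (2 * s + nu)) <= 1) by (apply Rabs_le; apply COS_bound).
  assert (Rabs (cos s) <= 1) by (apply Rabs_le; apply COS_bound).
  pose proof (Rabs_pos d). nra.
Qed.

End Taylor.

Lemma sin_lipschitz a b : Rabs (sin a - sin b) <= Rabs (a - b).
Proof.
  destruct (MVT_gen sin b a cos) as (c & _ & E).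
  - intros x _. apply is_derive_sin.
  - intros x _. apply continuity_sin.
  - rewrite E, Rabs_mult. assert (Rabs (cos c) <= 1) by (apply Rabs_le; apply COS_bound).
    pose proof (Rabs_pos (a - b)). nra.
Qed.

Lemma cos_lipschitz a b : Rabs (cos a - cos b) <= Rabs (a - b).
Proof.
  destruct (MVT_gen cos b a (fun x => - sin x)) as (c & _ & E).
  - intros x _. apply is_derive_cos.
  - intros x _. apply continuity_cos.
  - rewrite E, Rabs_mult, Rabs_Ropp. assert (Rabs (sin c) <= 1) by (apply Rabs_le; apply SIN_bound).
    pose proof (Rabs_pos (a - b)). nra.
Qed.

Definition evt (P : R -> Prop) : Prop := exists T, forall t, T <= t -> P t.

Lemma evt_and (P Q : R -> Prop) : evt P -> evt Q -> evt (fun t => P t /\ Q t).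
Proof.
  intros [T1 H1] [T2 H2]. exists (Rmax T1 T2). intros t Ht.
  pose proof (Rmax_l T1 T2). pose proof (Rmax_r T1 T2). split; [apply H1|apply H2]; lra.
Qed.

Lemma evt_imp (P Q : R -> Prop) : (forall t, P t -> Q t) -> evt P -> evt Q.
Proof. intros H [T HT]. exists T. intros t Ht. now apply H, HT. Qed.

Lemma evt_ge T : evt (fun t => T <= t).
Proof. now exists T. Qed.

Lemma evt_all (P : R -> Prop) : (forall t, P t) -> evt P.
Proof. intros H. exists 0. auto. Qed.

(** * Calculus of expansions in powers of a small function e *)

Section Expansions.

Variable e : R -> R.
Hypothesis He : evt (fun t => 0 < e t <= 1).
Hypothesis He0 : forall d, 0 < d -> evt (fun t => e t < d).

Definition bigO (n : nat) (f : R -> R) : Prop :=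
  exists C, 0 <= C /\ evt (fun t => Rabs (f t) <= C * e t ^ n).

(* f has an expansion in powers of e up to an error O(e^n) *)
Fixpoint ps (n : nat) (f : R -> R) : Prop :=
  match n with
  | O => bigO 0 f
  | S n => exists a g, ps n g /\ evt (fun t => f t = a + e t * g t)
  end.

Lemma bigO_ext n f g : evt (fun t => f t = g t) -> bigO n f -> bigO n g.
Proof.
  intros H (C & HC & Hf). exists C. split; [exact HC|].
  refine (evt_imp _ _ _ (evt_and _ _ H Hf)). intros t [E B]. now rewrite <- E.
Qed.

Lemma bigO_ext_all n f g : (forall t, f t = g t) -> bigO n f -> bigO n g.
Proof. intros H. apply bigO_ext. now apply evt_all. Qed.

Lemma epow_pos t n : 0 < e t <= 1 -> 0 < e t ^ n <= 1.
Proof.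
  intros H. split; [apply pow_lt; lra|]. rewrite <- (pow1 n). apply pow_incr. lra.
Qed.

Lemma epow_le t n k : 0 < e t <= 1 -> (n <= k)%nat -> e t ^ k <= e t ^ n.
Proof.
  intros H Hn. replace k with (n + (k - n))%nat by lia. rewrite pow_add.
  pose proof (epow_pos t n H). pose proof (epow_pos t (k - n) H). nra.
Qed.

Lemma bigO_weaken n k f : (n <= k)%nat -> bigO k f -> bigO n f.
Proof.
  intros Hn (C & HC & Hf). exists C. split; [exact HC|].
  refine (evt_imp _ _ _ (evt_and _ _ He Hf)). intros t [E B].
  eapply Rle_trans; [exact B|]. apply Rmult_le_compat_l; [exact HC|]. now apply epow_le.
Qed.

Lemma bigO_plus n f g : bigO n f -> bigO n g -> bigO n (fun t => f t + g t).
Proof.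
  intros (C & HC & Hf) (C' & HC' & Hg). exists (C + C'). split; [lra|].
  refine (evt_imp _ _ _ (evt_and _ _ Hf Hg)). intros t [A B].
  eapply Rle_trans; [apply Rabs_triang|]. lra.
Qed.

Lemma bigO_mult n k l f g : bigO n f -> bigO k g -> (l <= n + k)%nat -> bigO l (fun t => f t * g t).
Proof.
  intros (C & HC & Hf) (C' & HC' & Hg) Hl. apply (bigO_weaken l (n + k)); [exact Hl|].
  exists (C * C'). split; [nra|].
  refine (evt_imp _ _ _ (evt_and _ _ Hf Hg)). intros t [A B].
  rewrite Rabs_mult, pow_add. replace (C * C' * (e t ^ n * e t ^ k)) with ((C * e t ^ n) * (C' * e t ^ k)) by ring.
  apply Rmult_le_compat; auto using Rabs_pos.
Qed.

Lemma bigO_opp n f : bigO n f -> bigO n (fun t => - f t).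
Proof.
  intros (C & HC & Hf). exists C. split; [exact HC|].
  refine (evt_imp _ _ _ Hf). intros t H. now rewrite Rabs_Ropp.
Qed.

Lemma bigO_minus n f g : bigO n f -> bigO n g -> bigO n (fun t => f t - g t).
Proof. intros Hf Hg. apply (bigO_plus n f (fun t => - g t)); [exact Hf|now apply bigO_opp]. Qed.

Lemma bigO_bounded f C : evt (fun t => Rabs (f t) <= C) -> bigO 0 f.
Proof.
  intros H. exists (Rabs C). split; [apply Rabs_pos|]. refine (evt_imp _ _ _ H). intros t Ht. simpl.
  pose proof (Rle_abs C). lra.
Qed.

Lemma bigO_const c : bigO 0 (fun _ => c).
Proof. apply (bigO_bounded _ (Rabs c)). apply evt_all. intros; lra. Qed.

Lemma bigO_epow n k : (n <= k)%nat -> bigO n (fun t => e t ^ k).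
Proof.
  intros H. apply (bigO_weaken n k); [exact H|]. exists 1. split; [lra|].
  refine (evt_imp _ _ _ He). intros t Ht. rewrite Rabs_pos_eq; [lra|]. apply pow_le. lra.
Qed.

Lemma bigO_scal n c f : bigO n f -> bigO n (fun t => c * f t).
Proof. intros H. apply (bigO_mult 0 n n (fun _ => c) f); [apply bigO_const|exact H|lia]. Qed.

Lemma bigO_sin f : bigO 0 (fun t => sin (f t)).
Proof. apply (bigO_bounded _ 1). apply evt_all. intros; apply Rabs_le; apply SIN_bound. Qed.

Lemma bigO_cos f : bigO 0 (fun t => cos (f t)).
Proof. apply (bigO_bounded _ 1). apply evt_all. intros; apply Rabs_le; apply COS_bound. Qed.

Lemma bigO_dominated n f g C : evt (fun t => Rabs (f t) <= C * Rabs (g t)) -> bigO n g -> bigO n f.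
Proof.
  intros Hf (C' & HC' & Hg). exists (Rabs C * C'). split; [pose proof (Rabs_pos C); nra|].
  refine (evt_imp _ _ _ (evt_and _ _ Hf Hg)). intros t [A B].
  pose proof (Rle_abs C). pose proof (Rabs_pos C). pose proof (Rabs_pos (g t)).
  rewrite Rmult_assoc. eapply Rle_trans; [exact A|].
  eapply Rle_trans; [apply Rmult_le_compat_r; [apply Rabs_pos|apply Rle_abs]|].
  now apply Rmult_le_compat_l.
Qed.

Lemma bigO_div n k f : bigO (k + n) f -> bigO n (fun t => f t / e t ^ k).
Proof.
  intros (C & HC & Hf). exists C. split; [exact HC|].
  refine (evt_imp _ _ _ (evt_and _ _ He Hf)). intros t [E B].
  pose proof (epow_pos t k E). unfold Rdiv. rewrite Rabs_mult, Rabs_inv, (Rabs_pos_eq (e t ^ k)) by lra.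
  apply Rmult_le_reg_r with (e t ^ k); [lra|]. rewrite Rmult_assoc, Rinv_l by lra.
  rewrite pow_add in B. lra.
Qed.

Lemma ps_ext n f g : evt (fun t => f t = g t) -> ps n f -> ps n g.
Proof.
  destruct n as [|n]; simpl; intros H Hf.
  - now apply (bigO_ext 0 f).
  - destruct Hf as (a & k & Hk & E). exists a, k. split; [exact Hk|].
    refine (evt_imp _ _ _ (evt_and _ _ H E)). intros t [A B]. congruence.
Qed.

Lemma ps_ext_all n f g : (forall t, f t = g t) -> ps n f -> ps n g.
Proof. intros H. apply ps_ext. now apply evt_all. Qed.

Lemma ps_weaken1 n f : ps (S n) f -> ps n f.
Proof.
  revert f. induction n as [|n IH]; intros f (a & g & Hg & E).
  - apply (bigO_ext 0 (fun t => a + e t ^ 1 * g t)).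
    { refine (evt_imp _ _ _ E). intros t Ht. rewrite Ht. simpl. ring. }
    apply bigO_plus; [apply bigO_const|].
    apply (bigO_mult 0 0); [apply bigO_epow; lia|exact Hg|lia].
  - exists a, g. split; [now apply IH|exact E].
Qed.

Lemma ps_weaken n k f : (n <= k)%nat -> ps k f -> ps n f.
Proof. intros H. induction H; auto. intros. apply IHle, ps_weaken1. assumption. Qed.

Lemma ps_bounded n f : ps n f -> bigO 0 f.
Proof. apply (ps_weaken 0 n). lia. Qed.

Lemma ps_plus n f g : ps n f -> ps n g -> ps n (fun t => f t + g t).
Proof.
  revert f g. induction n as [|n IH]; intros f g Hf Hg.
  - now apply bigO_plus.
  - destruct Hf as (a & f1 & Hf1 & Ef), Hg as (b & g1 & Hg1 & Eg).
    exists (a + b), (fun t => f1 t + g1 t). split; [now apply IH|].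
    refine (evt_imp _ _ _ (evt_and _ _ Ef Eg)). intros t [-> ->]. ring.
Qed.

Lemma ps_epow_mult n k f : ps n f -> ps (k + n) (fun t => e t ^ k * f t).
Proof.
  intros H. induction k as [|k IH].
  - apply (ps_ext_all _ f); [intros; simpl; ring|exact H].
  - exists 0, (fun t => e t ^ k * f t). split; [exact IH|]. apply evt_all. intros; simpl; ring.
Qed.

Lemma ps_bigO n f : bigO n f -> ps n f.
Proof.
  intros H. rewrite <- (Nat.add_0_r n). apply (ps_ext _ (fun t => e t ^ n * (f t / e t ^ n))).
  - refine (evt_imp _ _ _ He). intros t Ht. pose proof (epow_pos t n Ht). field. lra.
  - apply ps_epow_mult. apply bigO_div. now rewrite Nat.add_0_r.
Qed.

Lemma ps_const n c : ps n (fun _ => c).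
Proof.
  destruct n as [|n]; [apply bigO_const|].
  exists c, (fun _ => 0). split; [|apply evt_all; intros; ring].
  apply ps_bigO. exists 0. split; [lra|]. apply evt_all. intros. rewrite Rabs_R0. lra.
Qed.

Lemma ps_mult n f g : ps n f -> ps n g -> ps n (fun t => f t * g t).
Proof.
  revert f g. induction n as [|n IH]; intros f g Hf Hg.
  - now apply (bigO_mult 0 0).
  - destruct Hf as (a & f1 & Hf1 & Ef), Hg as (b & g1 & Hg1 & Eg).
    exists (a * b), (fun t => (a * g1 t + b * f1 t) + e t ^ 1 * (f1 t * g1 t)). split.
    + apply ps_plus; [apply ps_plus; apply IH; auto using ps_const|].
      apply (ps_weaken n (1 + n)); [lia|]. apply ps_epow_mult. now apply IH.
    + refine (evt_imp _ _ _ (evt_and _ _ Ef Eg)). intros t [-> ->]. simpl. ring.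
Qed.

Lemma ps_opp n f : ps n f -> ps n (fun t => - f t).
Proof.
  intros H. apply (ps_ext_all n (fun t => -1 * f t)); [intros; ring|].
  apply ps_mult; [apply ps_const|exact H].
Qed.

Lemma ps_minus n f g : ps n f -> ps n g -> ps n (fun t => f t - g t).
Proof. intros Hf Hg. apply (ps_plus n f (fun t => - g t)); auto using ps_opp. Qed.

Lemma ps_pow n k f : ps n f -> ps n (fun t => f t ^ k).
Proof. intros H. induction k as [|k IH]; simpl; [apply ps_const|now apply ps_mult]. Qed.

Lemma ps_e n : ps n e.
Proof.
  apply (ps_ext_all n (fun t => e t ^ 1 * 1)); [intros; simpl; ring|].
  apply (ps_weaken n (1 + n)); [lia|]. apply ps_epow_mult, ps_const.
Qed.

Lemma ps_pola n a k f : ps n f -> ps n (fun t => pola a k (f t)).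
Proof.
  intros H. induction k as [|k IH]; simpl; [apply ps_const|].
  apply ps_plus; [exact IH|]. apply ps_mult; [apply ps_const|now apply ps_pow].
Qed.

Lemma ps_pola_e n a k : ps n (fun t => pola a k (e t)).
Proof. apply ps_pola, ps_e. Qed.

Lemma bigO_pow_le n k f : bigO n f -> bigO (k * n) (fun t => f t ^ k).
Proof.
  intros H. induction k as [|k IH]; [apply (bigO_const 1)|].
  apply (bigO_mult n (k * n) _ f (fun t => f t ^ k)); [exact H|exact IH|simpl; lia].
Qed.

(** The constant term is split off by the addition theorem; the rest u is O(e), and the Taylor
    polynomial in u of degree n has a remainder |u|^(n+1) = O(e^(n+1)). *)
Lemma ps_sin_cos n f : ps n f -> ps n (fun t => sin (f t)) /\ ps n (fun t => cos (f t)).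
Proof.
  destruct n as [|n]; intros Hf; [split; [apply bigO_sin|apply bigO_cos]|].
  destruct Hf as (a & g & Hg & E).
  set (u := fun t => e t ^ 1 * g t).
  assert (Hu : ps (S n) u) by (apply (ps_epow_mult n 1), Hg).
  assert (Hub : bigO (S n) (fun t => u t ^ S n)).
  { replace (S n) with (S n * 1)%nat at 1 by lia. apply bigO_pow_le.
    apply (bigO_mult 1 0 1); [apply bigO_epow; lia|now apply (ps_bounded n)|lia]. }
  assert (Hsc : ps (S n) (fun t => sin (u t)) /\ ps (S n) (fun t => cos (u t))).
  { split.
    - apply (ps_ext_all _ (fun t => pola (fun k => fst (trig_coeffs k)) (S n) (u t) +
        (sin (u t) - pola (fun k => fst (trig_coeffs k)) (S n) (u t)))); [intros; ring|].
      apply ps_plus; [now apply ps_pola|]. apply ps_bigO.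
      apply (bigO_dominated _ _ (fun t => u t ^ S n) 1); [|exact Hub].
      apply evt_all. intros t. rewrite <- RPow_abs. apply trig_taylor.
    - apply (ps_ext_all _ (fun t => pola (fun k => snd (trig_coeffs k)) (S n) (u t) +
        (cos (u t) - pola (fun k => snd (trig_coeffs k)) (S n) (u t)))); [intros; ring|].
      apply ps_plus; [now apply ps_pola|]. apply ps_bigO.
      apply (bigO_dominated _ _ (fun t => u t ^ S n) 1); [|exact Hub].
      apply evt_all. intros t. rewrite <- RPow_abs. apply trig_taylor. }
  destruct Hsc as [Hs Hc]. split.
  - apply (ps_ext _ (fun t => sin a * cos (u t) + cos a * sin (u t))).
    + refine (evt_imp _ _ _ E). intros t ->. unfold u. rewrite sin_plus, pow_1. reflexivity.
    + apply ps_plus; apply ps_mult; auto using ps_const.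
  - apply (ps_ext _ (fun t => cos a * cos (u t) - sin a * sin (u t))).
    + refine (evt_imp _ _ _ E). intros t ->. unfold u. rewrite cos_plus, pow_1. reflexivity.
    + apply ps_minus; apply ps_mult; auto using ps_const.
Qed.

Lemma ps_sin n f : ps n f -> ps n (fun t => sin (f t)).
Proof. apply ps_sin_cos. Qed.

Lemma ps_cos n f : ps n f -> ps n (fun t => cos (f t)).
Proof. apply ps_sin_cos. Qed.

Lemma bigO_small n f d : (1 <= n)%nat -> bigO n f -> 0 < d -> evt (fun t => Rabs (f t) < d).
Proof.
  intros Hn (C & HC & Hf) Hd.
  assert (Hd' : 0 < d / (C + 1)) by (apply Rdiv_lt_0_compat; lra).
  refine (evt_imp _ _ _ (evt_and _ _ He (evt_and _ _ (He0 _ Hd') Hf))). intros t (A & B & D).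
  eapply Rle_lt_trans; [exact D|].
  assert (e t ^ n <= e t) by (rewrite <- (pow_1 (e t)) at 2; now apply epow_le).
  apply Rmult_lt_compat_r with (r := C + 1) in B; [|lra].
  unfold Rdiv in B. rewrite Rmult_assoc, Rinv_l in B by lra. nra.
Qed.

(** A function that is O(e^k) has vanishing coefficients below k, so e^k can be divided out while n
    orders of the expansion remain. *)
Lemma ps_factor k n f : bigO k f -> ps (k + n) f ->
  exists g, ps n g /\ evt (fun t => f t = e t ^ k * g t).
Proof.
  revert f. induction k as [|k IH]; intros f Hb Hp.
  - exists f. split; [exact Hp|]. apply evt_all; intros; simpl; ring.
  - destruct Hp as (a & g & Hg & E).
    assert (Ha : a = 0).
    (* a = f - e g is O(e) as a function of t, hence smaller than any eps at some time; being
       constant, it vanishes. *)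
    { apply cond_eq. intros eps Heps. rewrite Rminus_0_r.
      assert (Hsm : bigO 1 (fun t => f t - e t ^ 1 * g t)).
      { apply bigO_minus; [apply (bigO_weaken 1 (S k)); [lia|exact Hb]|].
        apply (bigO_mult 1 0); [apply bigO_epow; lia|now apply (ps_bounded (k + n))|lia]. }
      destruct (evt_and _ _ E (bigO_small 1 _ eps (le_n _) Hsm Heps)) as (T & HT).
      destruct (HT T (Rle_refl _)) as [A B]. rewrite A, pow_1 in B.
      replace (a + e T * g T - e T * g T) with a in B by ring. exact B. }
    subst a. destruct (IH g) as (g' & Hg' & E').
    + apply (bigO_ext k (fun t => f t / e t ^ 1)).
      * refine (evt_imp _ _ _ (evt_and _ _ He E)). intros t [A ->]. field. lra.
      * apply bigO_div. exact Hb.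
    + exact Hg.
    + exists g'. split; [exact Hg'|]. refine (evt_imp _ _ _ (evt_and _ _ E E')). intros t [-> ->]. simpl. ring.
Qed.

Lemma ps_leading k f : bigO k f -> ps (S k) f -> exists c, bigO (S k) (fun t => f t - c * e t ^ k).
Proof.
  intros Hb Hp. rewrite <- Nat.add_1_r in Hp.
  destruct (ps_factor k 1 f Hb Hp) as (g & (c & g1 & Hg1 & E1) & E).
  exists c. apply (bigO_ext _ (fun t => e t ^ S k * g1 t)).
  - refine (evt_imp _ _ _ (evt_and _ _ E E1)). intros t [-> ->]. simpl. ring.
  - apply (bigO_mult (S k) 0); [apply bigO_epow; lia|exact Hg1|lia].
Qed.

(** Unfolds the nested form into ordinary coefficients, one leading term at a time. *)
Lemma ps_polynomial n f : ps n f -> exists a, bigO n (fun t => f t - pola a n (e t)).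
Proof.
  intros H. induction n as [|n IH].
  - exists (fun _ => 0). apply (bigO_ext_all _ f); [intros; simpl; ring|exact H].
  - destruct (IH (ps_weaken1 _ _ H)) as (a & Ha).
    destruct (ps_leading n (fun t => f t - pola a n (e t)) Ha) as (c & Hc).
    { apply ps_minus; [exact H|apply ps_pola_e]. }
    exists (fun k => if Nat.eqb k n then c else a k).
    apply (bigO_ext_all _ (fun t => f t - pola a n (e t) - c * e t ^ n)); [|exact Hc].
    intros t. simpl. rewrite Nat.eqb_refl.
    assert (Hext : pola (fun k => if Nat.eqb k n then c else a k) n (e t) = pola a n (e t)).
    { apply pola_ext. intros k Hk. destruct (Nat.eqb_spec k n); [lia|reflexivity]. }
    rewrite Hext. ring.
Qed.

Lemma pola_tail a n k : (n <= k)%nat -> bigO n (fun t => pola a k (e t) - pola a n (e t)).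
Proof.
  intros H. induction H as [|k H IH].
  - apply (bigO_ext_all _ (fun t => 0 * e t ^ n)); [intros; ring|]. apply bigO_scal, bigO_epow. lia.
  - apply (bigO_ext_all _ (fun t => (pola a k (e t) - pola a n (e t)) + a k * e t ^ k)); [intros; simpl; ring|].
    apply bigO_plus; [exact IH|]. apply bigO_scal, bigO_epow. lia.
Qed.

Lemma bigO_sin_diff n f g : bigO n (fun t => f t - g t) -> bigO n (fun t => sin (f t) - sin (g t)).
Proof.
  apply (bigO_dominated n _ _ 1). apply evt_all. intros t. rewrite Rmult_1_l. apply sin_lipschitz.
Qed.

Lemma bigO_cos_diff n f g : bigO n (fun t => f t - g t) -> bigO n (fun t => cos (f t) - cos (g t)).
Proof.
  apply (bigO_dominated n _ _ 1). apply evt_all. intros t. rewrite Rmult_1_l. apply cos_lipschitz.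
Qed.

Lemma bigO_mult_l n f g : bigO n f -> bigO 0 g -> bigO n (fun t => f t * g t).
Proof. intros Hf Hg. apply (bigO_mult n 0); [exact Hf|exact Hg|lia]. Qed.

Lemma bigO_mult_r n f g : bigO 0 f -> bigO n g -> bigO n (fun t => f t * g t).
Proof. intros Hf Hg. apply (bigO_mult 0 n); [exact Hf|exact Hg|lia]. Qed.

Lemma bigO_bounded_pow k f : bigO 0 f -> bigO 0 (fun t => f t ^ k).
Proof. intros Hf. pose proof (bigO_pow_le 0 k f Hf) as H. now rewrite Nat.mul_0_r in H. Qed.

Lemma pola_first_two a n : (1 <= n)%nat ->
  bigO 2 (fun t => pola a (S n) (e t) - (a 0%nat + a 1%nat * e t)).
Proof.
  intros Hn. apply (bigO_ext_all _ (fun t => pola a (S n) (e t) - pola a 2 (e t))).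
  - intros t. simpl pola at 2. ring.
  - apply pola_tail. lia.
Qed.

End Expansions.

(** * The formal series *)

Section Formal.

Variable e : R -> R.
Hypothesis He : evt (fun t => 0 < e t <= 1).
Hypothesis He0 : forall d, 0 < d -> evt (fun t => e t < d).

Local Notation O := (bigO e).
Local Notation S_ := (ps e).

Variables (h : nat) (sl nu sg d mu0 p1 A0 : R) (mm : R -> R).
Hypothesis Hh : (1 <= h <= 3)%nat.
Hypothesis Hsl : 0 < sl.
Hypothesis Hd : d = mu0 * sl.
Hypothesis Hmm : O (2 * h) (fun t => mm t - mu0).
Hypothesis Hmps : forall n, S_ n mm.
Hypothesis HA0 : A0 <> 0.
(** The order h of the root enters through these three conditions. The first is the leading balance
    of the rho-equation: (sl t^(1/2))' = sl/2 e^h must cancel against P, which fixes p1. The others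
    give the sizes of P' and P'' along every curve that shares the terms sg + p1 e; the truncated
    difference h - 2 is 0 for h <= 2. *)
Hypothesis H1 : O (S h) (fun t => P0 (sg + p1 * e t) d nu + sl / 2 * e t ^ h).
Hypothesis H2 : forall psi, O 2 (fun t => psi t - (sg + p1 * e t)) ->
  O h (fun t => P1 (psi t) d nu - A0 * e t ^ (h - 1)).
Hypothesis H3 : forall psi, O 2 (fun t => psi t - (sg + p1 * e t)) ->
  O (h - 2) (fun t => P2 (psi t) d nu).

(* The left-hand minus right-hand sides of (MS), the second one multiplied by e^(2h), for e = t^(-1/(2h)),
   mu = mm e^h, rho = (sl + e^h r) / e^h; tr and tp stand for e dr/de and e dpsi/de. *)
Definition res1 (psi tr r t : R) : R :=
  sl / 2 * e t ^ h - / (2 * INR h) * e t ^ (2 * h) * tr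
  + mm t * (sl + e t ^ h * r) * sin (2 * psi + nu) - sin psi.
Definition res2 (psi tp r t : R) : R :=
  (sl + e t ^ h * r) * (- / (2 * INR h) * e t ^ (3 * h) * tp - 2 * sl * r - e t ^ h * r ^ 2)
  + e t ^ (2 * h) * (mm t * (sl + e t ^ h * r) * cos (2 * psi + nu) - cos psi).

(** Coefficients of e d/de applied to the series a; with e = t^(-1/(2h)), the time derivative is
    -1/(2h) e^(2h) times this operator. *)
Definition theta (a : nat -> R) (k : nat) : R := INR k * a k.

(** The orders are those at which a correction by v e^(n+1) in psi and w e^(n+1) in r first acts: v
    through P' ~ A0 e^(h-1) at order n + h, w through the coefficient -2 sl^2 at order n + 1. *)
Definition formal_stage (n : nat) (p r : nat -> R) : Prop :=
  O (n + h) (fun t => res1 (pola p (S n) (e t)) (pola (theta r) (S n) (e t)) (pola r (S n) (e t)) t) /\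
  O (S n) (fun t => res2 (pola p (S n) (e t)) (pola (theta p) (S n) (e t)) (pola r (S n) (e t)) t).

Let mm_bounded : O 0 mm.
Proof. apply (ps_bounded e He 0), Hmps. Qed.

Ltac bnd := repeat first [ assumption | exact mm_bounded | apply (bigO_const e) | apply (bigO_epow e He); lia
  | apply (bigO_sin e) | apply (bigO_cos e) | apply (bigO_opp e) | apply (bigO_bounded_pow e He)
  | apply (bigO_plus e) | apply (bigO_minus e) | apply (bigO_mult_l e He 0) ].

(** w is always accompanied by e^h or e^(2h), and the quadratic and cubic Taylor terms of P have
    order at least n + 1 + h, thanks to n >= 1 and the size of P'' given by [H3]. Only A0 v survives
    at order n + h, so v and w decouple. *)
Lemma res1_step n psi tr r v w : (1 <= n)%nat -> O 0 r ->
  O 2 (fun t => psi t - (sg + p1 * e t)) ->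
  O (S n + h) (fun t => res1 (psi t + v * e t ^ S n) (tr t + INR (S n) * w * e t ^ S n) (r t + w * e t ^ S n) t
     - res1 (psi t) (tr t) (r t) t - A0 * v * e t ^ (n + h)).
Proof.
  intros Hn Hr Hpsi.
  set (E := fun t => e t ^ S n). set (psi' := fun t => psi t + v * E t).
  assert (HE : O (S n) E) by (apply (bigO_epow e He); lia).
  assert (Hu : O (S n) (fun t => v * E t)) by (now apply bigO_scal).
  assert (Hdiff : O (S n) (fun t => sin (2 * psi' t + nu) - sin (2 * psi t + nu))).
  { apply bigO_sin_diff. apply (bigO_ext_all e _ (fun t => 2 * (v * E t))); [intros; unfold psi'; ring|].
    now apply bigO_scal. }
  set (u := fun t => v * E t). fold u in Hu.
  assert (Hu2 : O (2 * S n) (fun t => u t ^ 2)) by (now apply bigO_pow_le).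
  assert (Hu3 : O (3 * S n) (fun t => u t ^ 3)) by (now apply bigO_pow_le).
  assert (Hu4 : O (4 * S n) (fun t => u t ^ 4)) by (now apply bigO_pow_le).
  (* Taylor's formula isolates P' u, from which A0 v e^(n+h) is subtracted; the first group collects
     the effects of w, the deviation of mu rho from d, and the Taylor remainder. *)
  apply (bigO_ext_all e _ (fun t =>
    (- / (2 * INR h) * (INR (S n) * w) * (e t ^ (2 * h) * E t)
    + (w * mm t * sin (2 * psi' t + nu)) * (e t ^ h * E t)
    + (sl * (mm t - mu0) + (mm t * r t) * e t ^ h) * (sin (2 * psi' t + nu) - sin (2 * psi t + nu))
    + (P0 (psi t + u t) d nu - (P0 (psi t) d nu + P1 (psi t) d nu * u t + P2 (psi t) d nu * u t ^ 2 / 2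
         + P3 (psi t) d nu * u t ^ 3 / 6)))
    + ((P1 (psi t) d nu - A0 * e t ^ (h - 1)) * u t
    + (P2 (psi t) d nu * u t ^ 2) * (1 / 2)
    + (P3 (psi t) d nu * (1 / 6)) * u t ^ 3))).
  { intros t. unfold res1. fold (E t). fold (psi' t).
    assert (Ep : e t ^ (n + h) = e t ^ (h - 1) * E t).
    { unfold E. rewrite <- pow_add. f_equal. lia. }
    rewrite Ep. change (psi t + u t) with (psi' t). unfold u, P0. rewrite Hd. field.
    apply not_0_INR. lia. }
  apply (bigO_plus e).
  - apply (bigO_plus e); [apply (bigO_plus e); [apply (bigO_plus e)|]|].
    + apply (bigO_mult_r e He); [bnd|]. apply (bigO_mult e He (2 * h) (S n)); [apply (bigO_epow e He); lia|exact HE|lia].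
    + apply (bigO_mult_r e He); [bnd|]. apply (bigO_mult e He h (S n)); [apply (bigO_epow e He); lia|exact HE|lia].
    + apply (bigO_mult e He h (S n)); [|exact Hdiff|lia]. apply (bigO_plus e).
      * apply bigO_scal; [exact He|]. apply (bigO_weaken e He h (2 * h)); [lia|exact Hmm].
      * apply (bigO_mult_r e He); [bnd|]. apply (bigO_epow e He); lia.
    + apply (bigO_weaken e He _ (4 * S n)); [lia|].
      apply (bigO_dominated e _ _ (fun t => u t ^ 4) (16 * Rabs d + 1)); [|exact Hu4].
      apply evt_all. intros t. rewrite <- RPow_abs. apply P0_taylor.
  - apply (bigO_plus e); [apply (bigO_plus e)|].
    + apply (bigO_mult e He h (S n)); [now apply H2|exact Hu|lia].
    + apply (bigO_mult_l e He); [|bnd]. apply (bigO_mult e He (h - 2) (2 * S n)); [now apply H3|exact Hu2|lia].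
    + apply (bigO_mult e He 0 (3 * S n)); [|exact Hu3|lia].
      apply (bigO_mult_l e He); [|bnd]. apply (bigO_bounded e _ (16 * Rabs d + 1)). apply evt_all. intros t. apply P3_bound.
Qed.

(** The only term of order n + 1 is sl times -2 sl w; every other occurrence of v and w carries at
    least one more factor e. *)
Lemma res2_step n psi tp r v w : O 0 r -> O 0 tp ->
  O (S (S n)) (fun t => res2 (psi t + v * e t ^ S n) (tp t + INR (S n) * v * e t ^ S n) (r t + w * e t ^ S n) t
     - res2 (psi t) (tp t) (r t) t + 2 * sl ^ 2 * w * e t ^ S n).
Proof.
  intros Hr Htp.
  set (E := fun t => e t ^ S n). set (psi' := fun t => psi t + v * E t).
  assert (HE : O (S n) E) by (apply (bigO_epow e He); lia).
  assert (HE0 : O 0 E) by (apply (bigO_epow e He); lia).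
  assert (Hd1 : O (S n) (fun t => cos (2 * psi' t + nu) - cos (2 * psi t + nu))).
  { apply bigO_cos_diff. apply (bigO_ext_all e _ (fun t => 2 * v * E t)); [intros; unfold psi'; ring|].
    now apply bigO_scal. }
  assert (Hd2 : O (S n) (fun t => cos (psi' t) - cos (psi t))).
  { apply bigO_cos_diff. apply (bigO_ext_all e _ (fun t => v * E t)); [intros; unfold psi'; ring|].
    now apply bigO_scal. }
  set (c := / (2 * INR h)).
  assert (Hk : forall k f, (1 <= k)%nat -> O 0 f -> O (S (S n)) (fun t => f t * (e t ^ k * E t))).
  { intros k f Hk Hf. apply (bigO_mult_r e He); [exact Hf|].
    apply (bigO_mult e He k (S n)); [apply (bigO_epow e He); lia|exact HE|lia]. }
  apply (bigO_ext_all e _ (fun t =>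
    ((w * (- c * e t ^ (3 * h) * (tp t + INR (S n) * v * E t) - 2 * sl * (r t + w * E t)
            - e t ^ h * (r t + w * E t) ^ 2)) * (e t ^ h * E t)
    + ((sl + e t ^ h * r t) * (- c * (INR (S n) * v))) * (e t ^ (3 * h) * E t)
    + (- 2 * sl * r t * w) * (e t ^ h * E t)
    + (- (sl + e t ^ h * r t) * (2 * r t * w + w ^ 2 * E t)) * (e t ^ h * E t))
    + e t ^ (2 * h) * ((mm t * w * cos (2 * psi' t + nu) * e t ^ h) * E t
       + (mm t * (sl + e t ^ h * r t)) * (cos (2 * psi' t + nu) - cos (2 * psi t + nu))
       - (cos (psi' t) - cos (psi t))))).
  { intros t. unfold res2. fold (E t). fold (psi' t). fold c. ring. }
  apply (bigO_plus e).
  - apply (bigO_plus e); [apply (bigO_plus e); [apply (bigO_plus e)|]|]; apply Hk; try lia; bnd.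
  - apply (bigO_mult e He (2 * h) (S n)); [apply (bigO_epow e He); lia| |lia].
    apply (bigO_minus e); [apply (bigO_plus e)|exact Hd2]; apply (bigO_mult_r e He); bnd.
Qed.

Definition update (a : nat -> R) (k : nat) (v : R) (j : nat) : R := if Nat.eqb j k then v else a j.

Lemma pola_update a k v u : pola (update a k v) (S k) u = pola a k u + v * u ^ k.
Proof.
  simpl. unfold update at 2. rewrite Nat.eqb_refl. f_equal.
  apply pola_ext. intros j Hj. unfold update. destruct (Nat.eqb_spec j k); [lia|reflexivity].
Qed.

Lemma pola_theta_update a k v u : pola (theta (update a k v)) (S k) u = pola (theta a) k u + INR k * v * u ^ k.
Proof.
  simpl. unfold theta at 2, update at 2. rewrite Nat.eqb_refl. f_equal.
  apply pola_ext. intros j Hj. unfold theta, update. destruct (Nat.eqb_spec j k); [lia|reflexivity].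
Qed.

Lemma ps_res1 n p r k : S_ n (fun t => res1 (pola p k (e t)) (pola (theta r) k (e t)) (pola r k (e t)) t).
Proof.
  assert (Hp : forall a, S_ n (fun t => pola a k (e t))) by (intros; now apply ps_pola_e).
  unfold res1.
  repeat first [ exact He | apply ps_const | apply Hp | apply Hmps | apply ps_minus | apply ps_plus
    | apply ps_sin | apply ps_mult | apply ps_pow | apply ps_e ].
Qed.

Lemma ps_res2 n p r k : S_ n (fun t => res2 (pola p k (e t)) (pola (theta p) k (e t)) (pola r k (e t)) t).
Proof.
  assert (Hp : forall a, S_ n (fun t => pola a k (e t))) by (intros; now apply ps_pola_e).
  unfold res2.
  repeat first [ exact He | apply ps_const | apply Hp | apply Hmps | apply ps_minus | apply ps_plus
    | apply ps_cos | apply ps_mult | apply ps_pow | apply ps_e ].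
Qed.

Lemma formal_step n p r : (1 <= n)%nat -> p 0%nat = sg -> p 1%nat = p1 -> formal_stage n p r ->
  exists v w, formal_stage (S n) (update p (S n) v) (update r (S n) w).
Proof.
  intros Hn E0 E1 [S1 S2].
  assert (Hb : forall a k, O 0 (fun t => pola a k (e t))) by (intros; apply (ps_bounded e He 0); now apply ps_pola_e).
  destruct (ps_leading e He He0 _ _ S1) as (c1 & Hc1); [apply ps_res1|].
  destruct (ps_leading e He He0 _ _ S2) as (c2 & Hc2); [apply ps_res2|].
  (* Chosen to annihilate the leading coefficients: A0 v + c1 = 0 and -2 sl^2 w + c2 = 0. *)
  exists (- c1 / A0), (c2 / (2 * sl ^ 2)).
  set (v := - c1 / A0). set (w := c2 / (2 * sl ^ 2)).
  assert (Hpsi : O 2 (fun t => pola p (S n) (e t) - (sg + p1 * e t))).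
  { rewrite <- E0, <- E1. now apply pola_first_two. }
  pose proof (res1_step n _ (fun t => pola (theta r) (S n) (e t)) (fun t => pola r (S n) (e t)) v w Hn (Hb r (S n))
    Hpsi) as D1.
  pose proof (res2_step n (fun t => pola p (S n) (e t)) _ _ v w (Hb r (S n)) (Hb (theta p) (S n))) as D2.
  split.
  - refine (bigO_ext_all e _ _ _ _ (bigO_plus e _ _ _ D1 Hc1)). intros t. cbv beta.
    rewrite pola_theta_update, !pola_update. unfold v. field. exact HA0.
  - refine (bigO_ext_all e _ _ _ _ (bigO_plus e _ _ _ D2 Hc2)). intros t. cbv beta.
    rewrite pola_theta_update, !pola_update. unfold w. field. lra.
Qed.

(** Stage 1 reads the indices 0 and 1 only; the values beyond are placeholders, overwritten before
    they are read. *)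
Definition formal_base : (nat -> R) * (nat -> R) :=
  (fun k => match k with 0%nat => sg | S _ => p1 end, fun _ => 0).

Lemma formal_base_stage : formal_stage 1 (fst formal_base) (snd formal_base).
Proof.
  assert (Ez : forall t, pola (fun _ => 0) 2 (e t) = 0) by (intros; simpl; ring).
  assert (Ezt : forall t, pola (theta (fun _ => 0)) 2 (e t) = 0) by (intros; unfold theta; simpl; ring).
  assert (Ep : forall t, pola (fst formal_base) 2 (e t) = sg + p1 * e t) by (intros; simpl; ring).
  split.
  - refine (bigO_ext_all e _ (fun t => (P0 (sg + p1 * e t) d nu + sl / 2 * e t ^ h)
       + sl * (mm t - mu0) * sin (2 * (sg + p1 * e t) + nu)) _ _ _).
    + intros t. rewrite Ep. simpl snd. rewrite Ez, Ezt. unfold res1, P0. rewrite Hd. ring.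
    + apply (bigO_plus e); [exact H1|].
      apply (bigO_mult_l e He); [|apply (bigO_sin e)]. apply bigO_scal; [exact He|].
      apply (bigO_weaken e He _ (2 * h)); [lia|exact Hmm].
  - refine (bigO_ext_all e _ (fun t => (sl * (- / (2 * INR h) * pola (theta (fst formal_base)) 2 (e t))) * e t ^ (3 * h)
       + (mm t * sl * cos (2 * (sg + p1 * e t) + nu) - cos (sg + p1 * e t)) * e t ^ (2 * h)) _ _ _).
    + intros t. rewrite Ep. simpl snd. rewrite Ez. unfold res2. ring.
    + apply (bigO_plus e); apply (bigO_mult_r e He); try (apply (bigO_epow e He); lia).
      * apply bigO_scal; [exact He|]. apply bigO_scal; [exact He|]. apply (ps_bounded e He 0); now apply ps_pola_e.
      * bnd.
Qed.

(** Entry n is a pair at stage n + 1, since corrections are available from stage 1 on. They are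
    picked by [epsilon] because the leading coefficients are known only to exist; the default (0, 0)
    merely inhabits the type. *)
Fixpoint formal_seq (n : nat) : (nat -> R) * (nat -> R) :=
  match n with
  | 0%nat => formal_base
  | S n => let u := formal_seq n in
      let vw := epsilon (inhabits (0, 0)) (fun vw =>
        formal_stage (S (S n)) (update (fst u) (S (S n)) (fst vw)) (update (snd u) (S (S n)) (snd vw))) in
      (update (fst u) (S (S n)) (fst vw), update (snd u) (S (S n)) (snd vw))
  end.

Lemma formal_seq_spec n : fst (formal_seq n) 0%nat = sg /\ fst (formal_seq n) 1%nat = p1 /\
  formal_stage (S n) (fst (formal_seq n)) (snd (formal_seq n)).
Proof.
  induction n as [|n (E0 & E1 & IH)].
  - split; [reflexivity|split; [reflexivity|apply formal_base_stage]].
  - simpl formal_seq. cbv zeta. split; [exact E0|split; [exact E1|]].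
    match goal with |- context [epsilon ?i ?P] => assert (HP : P (epsilon i P)) end.
    { apply epsilon_spec. destruct (formal_step (S n) _ _ ltac:(lia) E0 E1 IH) as (v & w & H). now exists (v, w). }
    exact HP.
Qed.

Lemma formal_seq_stable n k j : (j <= S n)%nat ->
  fst (formal_seq (n + k)) j = fst (formal_seq n) j /\ snd (formal_seq (n + k)) j = snd (formal_seq n) j.
Proof.
  intros Hj. induction k as [|k [IH1 IH2]]; [rewrite Nat.add_0_r; auto|].
  rewrite Nat.add_succ_r. simpl formal_seq. cbv zeta. simpl fst. simpl snd. unfold update.
  destruct (Nat.eqb_spec j (S (S (n + k)))); [lia|]. split; assumption.
Qed.

(** The diagonal of [formal_seq]: stage n reads coefficients up to index n only, and later steps
    leave these unchanged. *)
Lemma formal_solution : exists p r : nat -> R, p 0%nat = sg /\ p 1%nat = p1 /\ r 0%nat = 0 /\ r 1%nat = 0 /\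
  forall n, (1 <= n)%nat -> formal_stage n p r.
Proof.
  set (p := fun k => fst (formal_seq k) k). set (r := fun k => snd (formal_seq k) k).
  exists p, r. split; [reflexivity|].
  split; [apply (formal_seq_stable 0 1 1); lia|]. split; [reflexivity|].
  split; [apply (formal_seq_stable 0 1 1); lia|].
  intros n Hn. destruct n as [|n]; [lia|].
  destruct (formal_seq_spec n) as (_ & _ & H).
  assert (Es : forall j, (j < S (S n))%nat -> p j = fst (formal_seq n) j /\ r j = snd (formal_seq n) j).
  { intros j Hj. unfold p, r. destruct (Compare_dec.le_lt_dec j n) as [Hl|Hl].
    - destruct (formal_seq_stable j (n - j) j ltac:(lia)) as [A B].
      replace (j + (n - j))%nat with n in A, B by lia. split; congruence.
    - replace j with (n + 1)%nat by lia. apply formal_seq_stable. lia. }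
  assert (E1 : forall u, pola p (S (S n)) u = pola (fst (formal_seq n)) (S (S n)) u)
    by (intros; apply pola_ext; intros; now apply Es).
  assert (E2 : forall u, pola r (S (S n)) u = pola (snd (formal_seq n)) (S (S n)) u)
    by (intros; apply pola_ext; intros; now apply Es).
  assert (E3 : forall u, pola (theta p) (S (S n)) u = pola (theta (fst (formal_seq n))) (S (S n)) u)
    by (intros; apply pola_ext; intros k Hk; unfold theta; f_equal; now apply Es).
  assert (E4 : forall u, pola (theta r) (S (S n)) u = pola (theta (snd (formal_seq n))) (S (S n)) u)
    by (intros; apply pola_ext; intros k Hk; unfold theta; f_equal; now apply Es).
  destruct H as [A B]. split; [refine (bigO_ext_all e _ _ _ _ A)|refine (bigO_ext_all e _ _ _ _ B)];
    intros t; rewrite ?E1, ?E2, ?E3, ?E4; reflexivity.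
Qed.

End Formal.

(** * Differences of approximate solutions *)

Lemma derive_ex_nonneg_le (f : R -> R) (a b : R) :
  a <= b -> (forall t, a <= t <= b -> exists l, is_derive f t l /\ 0 <= l) -> f a <= f b.
Proof.
  intros Hab H. apply (derive_nonneg_le f (Derive f) a b Hab); intros t Ht; destruct (H t Ht) as (l & Hl & H0).
  - apply Derive_correct. now exists l.
  - now rewrite (is_derive_unique _ _ _ Hl).
Qed.

Definition dist2 (x1 y1 x2 y2 : R -> R) (t : R) : R := (x1 t - x2 t) ^ 2 + (y1 t - y2 t) ^ 2.

Lemma dist2_nonneg x1 y1 x2 y2 t : 0 <= dist2 x1 y1 x2 y2 t.
Proof. unfold dist2. pose proof (pow2_ge_0 (x1 t - x2 t)). pose proof (pow2_ge_0 (y1 t - y2 t)). lra. Qed.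

Lemma dist2_triangle x1 y1 x2 y2 x3 y3 t :
  dist2 x1 y1 x3 y3 t <= 2 * dist2 x1 y1 x2 y2 t + 2 * dist2 x2 y2 x3 y3 t.
Proof.
  unfold dist2. pose proof (pow2_ge_0 ((x1 t - x2 t) - (x2 t - x3 t))).
  pose proof (pow2_ge_0 ((y1 t - y2 t) - (y2 t - y3 t))). nra.
Qed.

Lemma dist2_sym x1 y1 x2 y2 t : dist2 x1 y1 x2 y2 t = dist2 x2 y2 x1 y1 t.
Proof. unfold dist2. ring. Qed.

Lemma pow_ge_1 t n : 1 <= t -> 1 <= t ^ n.
Proof. intros H. rewrite <- (pow1 n). apply pow_incr. lra. Qed.

Lemma pow_mono t n k : 1 <= t -> (n <= k)%nat -> t ^ n <= t ^ k.
Proof. intros H Hn. now apply Rle_pow. Qed.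

Lemma inv_pow_mono t n k : 1 <= t -> (n <= k)%nat -> / t ^ k <= / t ^ n.
Proof. intros H Hn. apply Rinv_le_contravar; [apply pow_lt; lra|now apply pow_mono]. Qed.

Lemma sqr_le_abs a b : 0 <= b -> a ^ 2 <= b ^ 2 -> Rabs a <= b.
Proof. intros Hb H. apply Rabs_le_between. split; nra. Qed.

(** * Linearisation in the rotating frame *)

Section Frame.

Variables (lam nu : R) (m : R -> R).

Definition approx_at (x y fx fy : R -> R) (t : R) : Prop :=
  is_derive x t (zfx lam nu m (x t ^ 2 + y t ^ 2) t (x t) (y t) + fx t) /\
  is_derive y t (zfy lam nu m (x t ^ 2 + y t ^ 2) t (x t) (y t) + fy t).

Lemma zsol_approx x y t : zsol lam nu m x y -> approx_at x y (fun _ => 0) (fun _ => 0) t.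
Proof. intros H. destruct (H t) as [H1 H2]. split; now rewrite Rplus_0_r. Qed.

Variables (rho0 psi0 g A B c A' B' c' : R -> R) (k K T0 : R).

(* In coordinates p + i q = (z1 - z2) e^{-i psi0} the difference of two solutions near rho0 e^{i psi0} satisfies
   p' = -c p - B q, q' = A p + c q up to small errors; A, B, c approximate the exact linearisation (fr_A0, fr_B0,
   fr_c0) and have derivatives of relative size O(1/t). The system is of centre type for B > 0, a saddle for B < 0. *)
Set Implicit Arguments.
Record frame : Prop := {
  fr_T0 : 1 <= T0;
  fr_k : 0 < k;
  fr_K : 1 <= K;
  fr_psi : forall t, T0 <= t -> is_derive psi0 t (g t);
  fr_rhoc : forall t, T0 <= t -> continuous rho0 t;
  fr_rho : forall t, T0 <= t -> Rabs (rho0 t) <= K * t;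
  fr_dA : forall t, T0 <= t -> is_derive A t (A' t);
  fr_dB : forall t, T0 <= t -> is_derive B t (B' t);
  fr_dc : forall t, T0 <= t -> is_derive c t (c' t);
  fr_A1 : forall t, T0 <= t -> k * t <= A t <= K * t;
  fr_B1 : forall t, T0 <= t -> k / t <= Rabs (B t) <= K;
  fr_c1 : forall t, T0 <= t -> Rabs (c t) <= 1;
  fr_AB : forall t, T0 <= t -> 16 <= A t * Rabs (B t);
  fr_A2 : forall t, T0 <= t -> Rabs (A' t) <= K / t * A t;
  fr_B2 : forall t, T0 <= t -> Rabs (B' t) <= K / t * Rabs (B t);
  fr_c2 : forall t, T0 <= t -> Rabs (c' t) <= K / t;
  fr_A0 : forall t, T0 <= t ->
    Rabs (3 * rho0 t ^ 2 - lam * t - g t - m t * cos (2 * psi0 t + nu) - A t) <= K / t ^ 4;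
  fr_B0 : forall t, T0 <= t ->
    Rabs (rho0 t ^ 2 - lam * t - g t + m t * cos (2 * psi0 t + nu) - B t) <= K / t ^ 4;
  fr_c0 : forall t, T0 <= t -> Rabs (m t * sin (2 * psi0 t + nu) - c t) <= K / t ^ 4
}.
Unset Implicit Arguments.

Hypothesis HF : frame.

Definition fx0 (t : R) : R := rho0 t * cos (psi0 t).
Definition fy0 (t : R) : R := rho0 t * sin (psi0 t).

(** A tube of radius t^-5. Inside it |z|^2 differs from rho0^2 by a constant multiple of K t^-4 at
    most, the size of the tolerance allowed to A, B and c. *)
Definition trap (x y : R -> R) (t : R) : Prop := t ^ 10 * dist2 x y fx0 fy0 t <= 1.

Definition frP (x1 y1 x2 y2 : R -> R) (t : R) : R :=
  (x1 t - x2 t) * cos (psi0 t) + (y1 t - y2 t) * sin (psi0 t).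
Definition frQ (x1 y1 x2 y2 : R -> R) (t : R) : R :=
  (y1 t - y2 t) * cos (psi0 t) - (x1 t - x2 t) * sin (psi0 t).

Lemma frPQ_norm x1 y1 x2 y2 t :
  frP x1 y1 x2 y2 t ^ 2 + frQ x1 y1 x2 y2 t ^ 2 = dist2 x1 y1 x2 y2 t.
Proof.
  unfold frP, frQ, dist2. pose proof (sin2_cos2 (psi0 t)) as H. unfold Rsqr in H.
  set (s := sin (psi0 t)) in *. set (q := cos (psi0 t)) in *.
  set (dx := x1 t - x2 t). set (dy := y1 t - y2 t).
  transitivity ((dx ^ 2 + dy ^ 2) * (s * s + q * q)); [ring|rewrite H; ring].
Qed.

Lemma trap_coords x y t : T0 <= t -> trap x y t ->
  Rabs (x t * cos (psi0 t) + y t * sin (psi0 t) - rho0 t) <= / t ^ 5 /\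
  Rabs (y t * cos (psi0 t) - x t * sin (psi0 t)) <= / t ^ 5.
Proof.
  intros Ht H. pose proof (fr_T0 HF).
  assert (Hp : 0 < t ^ 5) by (apply pow_lt; lra).
  pose proof (frPQ_norm x y fx0 fy0 t) as Hn.
  assert (EP : frP x y fx0 fy0 t = x t * cos (psi0 t) + y t * sin (psi0 t) - rho0 t).
  { unfold frP, fx0, fy0. pose proof (sin2_cos2 (psi0 t)) as E. unfold Rsqr in E.
    set (s := sin (psi0 t)) in *. set (q := cos (psi0 t)) in *.
    transitivity (x t * q + y t * s - rho0 t * (s * s + q * q)); [ring|rewrite E; ring]. }
  assert (EQ : frQ x y fx0 fy0 t = y t * cos (psi0 t) - x t * sin (psi0 t)).
  { unfold frQ, fx0, fy0. ring. }
  rewrite EP, EQ in Hn. unfold trap in H.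
  set (a := x t * cos (psi0 t) + y t * sin (psi0 t) - rho0 t) in *.
  set (b := y t * cos (psi0 t) - x t * sin (psi0 t)) in *.
  assert (Hd : dist2 x y fx0 fy0 t <= (/ t ^ 5) ^ 2).
  { apply Rmult_le_reg_l with (t ^ 10); [apply pow_lt; lra|].
    replace (t ^ 10 * (/ t ^ 5) ^ 2) with 1; [lra|]. field. lra. }
  assert (0 < / t ^ 5) by now apply Rinv_0_lt_compat.
  split; apply sqr_le_abs; try lra; rewrite <- Hn in Hd; nra.
Qed.

(** Every nonlinear term is the product of a factor controlled by the radius of the tube and a
    factor linear in P and Q. The error is thus proportional to the difference of the two solutions,
    however small that is, apart from the residual of the second one. *)
Lemma pair_linear x1 y1 x2 y2 fx fy t : T0 <= t ->
  approx_at x1 y1 (fun _ => 0) (fun _ => 0) t -> approx_at x2 y2 fx fy t ->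
  trap x1 y1 t -> trap x2 y2 t ->
  let P := frP x1 y1 x2 y2 in let Q := frQ x1 y1 x2 y2 in
  exists e1 e2, is_derive P t (- c t * P t - B t * Q t + e1) /\
    is_derive Q t (A t * P t + c t * Q t + e2) /\
    Rabs e1 <= 20 * K / t ^ 4 * (Rabs (P t) + Rabs (Q t)) + (Rabs (fx t) + Rabs (fy t)) /\
    Rabs e2 <= 20 * K / t ^ 4 * (Rabs (P t) + Rabs (Q t)) + (Rabs (fx t) + Rabs (fy t)).
Proof.
  intros Ht [X1 Y1] [X2 Y2] TR1 TR2 P Q.
  pose proof (fr_T0 HF) as HT0. pose proof (fr_K HF) as HK.
  destruct (trap_coords _ _ _ Ht TR1) as [a1 b1]. destruct (trap_coords _ _ _ Ht TR2) as [a2 b2].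
  pose proof (fr_psi HF Ht) as Hg. pose proof (fr_rho HF Ht) as Hr.
  pose proof (fr_A0 HF Ht) as HA0. pose proof (fr_B0 HF Ht) as HB0. pose proof (fr_c0 HF Ht) as Hc0.
  set (co := cos (psi0 t)) in *. set (si := sin (psi0 t)) in *.
  assert (Hcs : si * si + co * co = 1) by apply (sin2_cos2 (psi0 t)).
  set (p1 := x1 t * co + y1 t * si) in *. set (q1 := y1 t * co - x1 t * si) in *.
  set (p2 := x2 t * co + y2 t * si) in *. set (q2 := y2 t * co - x2 t * si) in *.
  set (r := rho0 t) in *.
  assert (EP : P t = p1 - p2) by (unfold P, frP, p1, p2; fold co si; ring).
  assert (EQ : Q t = q1 - q2) by (unfold Q, frQ, q1, q2; fold co si; ring).
  assert (EH1 : x1 t ^ 2 + y1 t ^ 2 = p1 ^ 2 + q1 ^ 2).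
  { unfold p1, q1. transitivity ((x1 t ^ 2 + y1 t ^ 2) * (si * si + co * co)); [rewrite Hcs; ring|ring]. }
  assert (EH2 : x2 t ^ 2 + y2 t ^ 2 = p2 ^ 2 + q2 ^ 2).
  { unfold p2, q2. transitivity ((x2 t ^ 2 + y2 t ^ 2) * (si * si + co * co)); [rewrite Hcs; ring|ring]. }
  set (SF := sin (2 * psi0 t + nu)) in *. set (CF := cos (2 * psi0 t + nu)) in *.
  assert (ES : SF = si * (co * cos nu - si * sin nu) + co * (si * cos nu + co * sin nu)).
  { unfold SF. replace (2 * psi0 t + nu) with (psi0 t + (psi0 t + nu)) by ring.
    rewrite (sin_plus (psi0 t) (psi0 t + nu)), sin_plus, cos_plus. reflexivity. }
  assert (EC : CF = co * (co * cos nu - si * sin nu) - si * (si * cos nu + co * sin nu)).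
  { unfold CF. replace (2 * psi0 t + nu) with (psi0 t + (psi0 t + nu)) by ring.
    rewrite (cos_plus (psi0 t) (psi0 t + nu)), sin_plus, cos_plus. reflexivity. }
  set (dx := x1 t - x2 t). set (dy := y1 t - y2 t).
  assert (EPS : P t * SF + Q t * CF = dx * (si * cos nu + co * sin nu) + dy * (co * cos nu - si * sin nu)).
  { rewrite ES, EC. unfold P, Q, frP, frQ. fold co si dx dy.
    transitivity ((dx * (si * cos nu + co * sin nu) + dy * (co * cos nu - si * sin nu)) * (si * si + co * co));
      [ring|rewrite Hcs; ring]. }
  assert (EPC : P t * CF - Q t * SF = dx * (co * cos nu - si * sin nu) - dy * (si * cos nu + co * sin nu)).
  { rewrite ES, EC. unfold P, Q, frP, frQ. fold co si dx dy.
    transitivity ((dx * (co * cos nu - si * sin nu) - dy * (si * cos nu + co * sin nu)) * (si * si + co * co));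
      [ring|rewrite Hcs; ring]. }
  set (H1 := p1 ^ 2 + q1 ^ 2) in *. set (H2 := p2 ^ 2 + q2 ^ 2) in *.
  set (fp := fx t * co + fy t * si). set (fq := fy t * co - fx t * si).
  set (dA := 3 * r ^ 2 - lam * t - g t - m t * CF - A t) in *.
  set (dB := r ^ 2 - lam * t - g t + m t * CF - B t) in *.
  set (dc := m t * SF - c t) in *.
  (* From H1 q1 - H2 q2 = H1 Q + (H1 - H2) q2, and likewise for p; in the latter (H1 - H2) p2 is
     close to 2 r^2 P, which raises r^2 to the 3 r^2 of A. *)
  exists (- ((H1 - r ^ 2) * Q t + (H1 - H2) * q2) - dB * Q t - dc * P t - fp).
  exists ((H1 - r ^ 2) * P t + ((H1 - H2) * p2 - 2 * r ^ 2 * P t) + dA * P t + dc * Q t - fq).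
  rewrite EH1 in X1, Y1. rewrite EH2 in X2, Y2.
  assert (Hcos : Rabs co <= 1) by (apply Rabs_le; apply COS_bound).
  assert (Hsin : Rabs si <= 1) by (apply Rabs_le; apply SIN_bound).
  assert (Hfp : Rabs fp <= Rabs (fx t) + Rabs (fy t)).
  { unfold fp. eapply Rle_trans; [apply Rabs_triang|]. rewrite !Rabs_mult.
    pose proof (Rabs_pos (fx t)). pose proof (Rabs_pos (fy t)). nra. }
  assert (Hfq : Rabs fq <= Rabs (fx t) + Rabs (fy t)).
  { unfold fq. eapply Rle_trans; [apply Rabs_triang|]. rewrite Rabs_Ropp, !Rabs_mult.
    pose proof (Rabs_pos (fx t)). pose proof (Rabs_pos (fy t)). nra. }
  assert (Ht4 : 0 < / t ^ 4) by (apply Rinv_0_lt_compat, pow_lt; lra).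
  assert (Ht5 : 0 < / t ^ 5) by (apply Rinv_0_lt_compat, pow_lt; lra).
  assert (E45 : t * / t ^ 5 = / t ^ 4) by (field; lra).
  assert (L45 : / t ^ 5 <= / t ^ 4) by (apply inv_pow_mono; [lra|lia]).
  assert (L51 : / t ^ 5 <= 1).
  { rewrite <- Rinv_1. apply Rinv_le_contravar; [lra|apply pow_ge_1; lra]. }
  set (eta := / t ^ 5) in *. set (z4 := / t ^ 4) in *.
  unfold Rdiv in HA0, HB0, Hc0. fold z4 in HA0, HB0, Hc0.
  pose proof (Rabs_pos (P t)) as PP. pose proof (Rabs_pos (Q t)) as PQ.
  assert (Kz : 0 < K * z4) by nra.
  assert (Krt : Rabs r * eta <= K * z4).
  { rewrite <- E45. replace (K * (t * eta)) with ((K * t) * eta) by ring.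
    apply Rmult_le_compat_r; lra. }
  assert (bH1 : Rabs (H1 - r ^ 2) <= 4 * (K * z4)).
  { replace (H1 - r ^ 2) with (2 * (r * (p1 - r)) + (p1 - r) * (p1 - r) + q1 * q1) by (unfold H1; ring).
    eapply Rle_trans; [apply Rabs_triang|]. eapply Rle_trans; [apply Rplus_le_compat_r, Rabs_triang|].
    rewrite !Rabs_mult, (Rabs_pos_eq 2) by lra.
    pose proof (Rabs_pos (p1 - r)). pose proof (Rabs_pos q1). pose proof (Rabs_pos r).
    assert (Rabs r * Rabs (p1 - r) <= Rabs r * eta) by (apply Rmult_le_compat_l; lra).
    assert (Rabs (p1 - r) * Rabs (p1 - r) <= eta * 1) by (apply Rmult_le_compat; lra).
    assert (Rabs q1 * Rabs q1 <= eta * 1) by (apply Rmult_le_compat; lra).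
    nra. }
  assert (bp2 : Rabs p2 <= Rabs r + eta).
  { replace p2 with (r + (p2 - r)) by ring. eapply Rle_trans; [apply Rabs_triang|]. lra. }
  assert (bp1 : Rabs p1 <= Rabs r + eta).
  { replace p1 with (r + (p1 - r)) by ring. eapply Rle_trans; [apply Rabs_triang|]. lra. }
  assert (EH12 : H1 - H2 = (p1 + p2) * P t + (q1 + q2) * Q t).
  { rewrite EP, EQ. unfold H1, H2. ring. }
  assert (b1a : Rabs ((H1 - H2) * q2) <= 6 * (K * z4) * (Rabs (P t) + Rabs (Q t))).
  { rewrite EH12. replace (((p1 + p2) * P t + (q1 + q2) * Q t) * q2) with
      (((p1 + p2) * q2) * P t + ((q1 + q2) * q2) * Q t) by ring.
    eapply Rle_trans; [apply Rabs_triang|]. rewrite (Rabs_mult _ (P t)), (Rabs_mult _ (Q t)).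
    assert (Rabs ((p1 + p2) * q2) <= 6 * (K * z4)).
    { rewrite Rabs_mult. eapply Rle_trans; [apply Rmult_le_compat; [apply Rabs_pos|apply Rabs_pos|apply Rabs_triang|exact b2]|].
      nra. }
    assert (Rabs ((q1 + q2) * q2) <= 6 * (K * z4)).
    { rewrite Rabs_mult. eapply Rle_trans; [apply Rmult_le_compat; [apply Rabs_pos|apply Rabs_pos|apply Rabs_triang|exact b2]|].
      nra. }
    nra. }
  assert (b2a : Rabs ((H1 - H2) * p2 - 2 * r ^ 2 * P t) <= 12 * (K * z4) * (Rabs (P t) + Rabs (Q t))).
  { rewrite EH12. replace (((p1 + p2) * P t + (q1 + q2) * Q t) * p2 - 2 * r ^ 2 * P t) with
      (((p1 - r) * p2 + (p2 - r) * p2 + 2 * (r * (p2 - r))) * P t + ((q1 + q2) * p2) * Q t) by ring.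
    eapply Rle_trans; [apply Rabs_triang|]. rewrite (Rabs_mult _ (P t)), (Rabs_mult _ (Q t)).
    assert (X : forall w, Rabs w <= eta -> Rabs (w * p2) <= 2 * (K * z4)).
    { intros w Hw. rewrite Rabs_mult. pose proof (Rabs_pos w). pose proof (Rabs_pos p2).
      assert (Rabs w * Rabs p2 <= eta * (Rabs r + eta)) by (apply Rmult_le_compat; lra). nra. }
    pose proof (X _ a1). pose proof (X _ a2). pose proof (X _ b1). pose proof (X _ b2).
    assert (Rabs ((p1 - r) * p2 + (p2 - r) * p2 + 2 * (r * (p2 - r))) <= 12 * (K * z4)).
    { eapply Rle_trans; [apply Rabs_triang|]. eapply Rle_trans; [apply Rplus_le_compat_r, Rabs_triang|].
      rewrite (Rabs_mult 2), (Rabs_mult r), (Rabs_pos_eq 2) by lra.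
      pose proof (Rabs_pos r). assert (Rabs r * Rabs (p2 - r) <= Rabs r * eta) by (apply Rmult_le_compat_l; lra). lra. }
    assert (Rabs ((q1 + q2) * p2) <= 12 * (K * z4)).
    { rewrite Rmult_plus_distr_r. eapply Rle_trans; [apply Rabs_triang|]. lra. }
    nra. }
  split; [|split; [|split]].
  - unfold P, frP.
    auto_derive; [repeat split; eexists; eassumption|].
    rewrite_derive.
    fold co si. fold dx dy. unfold zfx, zfy.
    change (dx * co + dy * si) with (P t). change (y1 t * co - x1 t * si) with q1. 
    transitivity (- (H1 - lam * t - g t) * q1 + (H2 - lam * t - g t) * q2
       - m t * (dx * (si * cos nu + co * sin nu) + dy * (co * cos nu - si * sin nu)) - fp).
    { unfold q1, q2, fp, dx, dy. ring. }
    rewrite <- EPS. unfold dB, dc. rewrite EP, EQ. ring.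
  - unfold Q, frQ.
    auto_derive; [repeat split; eexists; eassumption|].
    rewrite_derive.
    fold co si. fold dx dy. unfold zfx, zfy.
    transitivity ((H1 - lam * t - g t) * p1 - (H2 - lam * t - g t) * p2
       - m t * (dx * (co * cos nu - si * sin nu) - dy * (si * cos nu + co * sin nu)) - fq).
    { unfold p1, p2, fq, dx, dy. ring. }
    rewrite <- EPC. unfold dA, dc. change (dy * co - dx * si) with (Q t). rewrite EP, EQ. ring.
  - unfold Rdiv. replace (20 * K * / t ^ 4) with (20 * (K * z4)) by (unfold z4; ring).
    unfold Rminus. eapply Rle_trans; [apply Rabs_triang|]. rewrite (Rabs_Ropp fp).
    apply Rplus_le_compat; [|exact Hfp].
    eapply Rle_trans; [apply Rabs_triang|]. eapply Rle_trans; [apply Rplus_le_compat_r, Rabs_triang|].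
    rewrite !Rabs_Ropp. eapply Rle_trans; [apply Rplus_le_compat_r, Rplus_le_compat_r, Rabs_triang|].
    rewrite (Rabs_mult _ (Q t)), (Rabs_mult dB), (Rabs_mult dc).
    change (H1 + - r ^ 2) with (H1 - r ^ 2). change (H1 + - H2) with (H1 - H2). nra.
  - unfold Rdiv. replace (20 * K * / t ^ 4) with (20 * (K * z4)) by (unfold z4; ring).
    unfold Rminus at 1. eapply Rle_trans; [apply Rabs_triang|]. rewrite (Rabs_Ropp fq).
    apply Rplus_le_compat; [|exact Hfq].
    eapply Rle_trans; [apply Rabs_triang|]. eapply Rle_trans; [apply Rplus_le_compat_r, Rabs_triang|].
    eapply Rle_trans; [apply Rplus_le_compat_r, Rplus_le_compat_r, Rabs_triang|].
    rewrite (Rabs_mult _ (P t)), (Rabs_mult dA), (Rabs_mult dc). nra.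
Qed.

End Frame.

Ltac frame_constants HF :=
  pose proof (fr_T0 HF) as HT0; pose proof (fr_k HF) as Hk; pose proof (fr_K HF) as HK.

Ltac frame_at HF t Ht0 :=
  pose proof (fr_dA HF Ht0) as DA; pose proof (fr_dB HF Ht0) as DB; pose proof (fr_dc HF Ht0) as Dc;
  pose proof (fr_A1 HF Ht0) as HA1; pose proof (fr_B1 HF Ht0) as HB1; pose proof (fr_c1 HF Ht0) as Hc1;
  pose proof (fr_AB HF Ht0) as HAB; pose proof (fr_A2 HF Ht0) as HA2; pose proof (fr_B2 HF Ht0) as HB2;
  pose proof (fr_c2 HF Ht0) as Hc2.

(** Continuation principle: the largest point where f >= 1 would satisfy f = 1 there and f <= 1 to
    its right, which the improvement hypothesis forbids. *)
Lemma bootstrap_backward (f : R -> R) (a b : R) :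
  (forall t, a <= t <= b -> continuous f t) -> f b < 1 ->
  (forall c, a <= c <= b -> (forall t, c <= t <= b -> f t <= 1) -> f c < 1) ->
  forall t, a <= t <= b -> f t < 1.
Proof.
  intros Hc Hb H t0 Ht0. destruct (Rlt_dec (f t0) 1) as [|Hn]; [assumption|exfalso].
  destruct (completeness (fun t => a <= t <= b /\ 1 <= f t)) as (s & Hub & Hlub).
  - exists b. intros t [Ht _]. lra.
  - exists t0. split; lra.
  - assert (Hs : a <= s <= b).
    { split; [pose proof (Hub t0 (conj Ht0 (Rnot_lt_le _ _ Hn))); lra|]. apply Hlub. intros t [Ht _]; lra. }
    assert (H1 : forall t, s < t <= b -> f t < 1).
    { intros t Ht. destruct (Rlt_dec (f t) 1) as [|Hn']; [assumption|exfalso].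
      assert (Ht' : a <= t <= b) by lra.
      pose proof (Hub t (conj Ht' (Rnot_lt_le _ _ Hn'))). lra. }
    assert (Hge : 1 <= f s).
    { destruct (Rle_dec 1 (f s)) as [|Hlt]; [assumption|exfalso].
      destruct (continuous_eps_elim f s (1 - f s) (Hc s Hs) ltac:(lra)) as (d & Hd & Hdd).
      assert (s <= s - d); [|lra]. apply Hlub. intros t [Ht Hft].
      destruct (Rle_dec t (s - d)) as [|Hgt]; [assumption|exfalso].
      assert (t <= s) by (apply Hub; split; assumption).
      specialize (Hdd t ltac:(rewrite Rabs_left1; lra)). apply Rabs_lt_between in Hdd. lra. }
    assert (Hle : f s <= 1).
    { destruct (Rle_dec (f s) 1) as [|Hgt]; [assumption|exfalso].
      assert (Hsb : s < b) by (destruct (Req_dec s b); [subst; lra|lra]).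
      destruct (continuous_eps_elim f s (f s - 1) (Hc s Hs) ltac:(lra)) as (d & Hd & Hdd).
      set (t := s + Rmin (d / 2) (b - s)).
      pose proof (Rmin_l (d / 2) (b - s)). pose proof (Rmin_r (d / 2) (b - s)).
      assert (0 < Rmin (d / 2) (b - s)) by (apply Rmin_pos; lra).
      specialize (H1 t ltac:(unfold t; lra)).
      specialize (Hdd t ltac:(unfold t; rewrite Rabs_pos_eq; lra)). apply Rabs_lt_between in Hdd. lra. }
    assert (f s < 1); [|lra]. apply H; [exact Hs|]. intros t Ht.
    destruct (Req_dec t s) as [->|]; [exact Hle|]. left. apply H1. lra.
Qed.

Lemma le_of_le_plus_div (X Y D a : R) : 0 < a -> (forall b, a <= b -> X <= Y + D / b) -> X <= Y.
Proof.
  intros Ha H. destruct (Rle_dec X Y) as [|Hn]; [assumption|exfalso].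
  set (b := Rmax a ((Rabs D + 1) / (X - Y))).
  assert (Hb1 : a <= b) by apply Rmax_l.
  assert (Hb2 : (Rabs D + 1) / (X - Y) <= b) by apply Rmax_r.
  specialize (H b Hb1). pose proof (Rle_abs D).
  assert (D / b < X - Y); [|lra].
  apply Rmult_lt_reg_r with b; [lra|]. unfold Rdiv. rewrite Rmult_assoc, Rinv_l by lra.
  apply Rmult_le_compat_r with (r := X - Y) in Hb2; [|lra].
  unfold Rdiv in Hb2. rewrite Rmult_assoc, Rinv_l in Hb2 by lra. lra.
Qed.

(** * Bounds for the quadratic form W *)

Section LinearEstimates.

Variables (k K t A B P Q e1 e2 F : R).
Hypotheses (Hk : 0 < k) (HK : 1 <= K) (Ht : 1 <= t).
Hypotheses (HA : k * t <= A <= K * t) (HB : k / t <= Rabs B <= K) (HAB : 16 <= A * Rabs B).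

(** The absolute value of B lets one positive form serve both the centre and the saddle. *)
Let W := A * P ^ 2 + Rabs B * Q ^ 2.
Let s := Rabs P + Rabs Q.

Lemma W_lower : k / t * (P ^ 2 + Q ^ 2) <= W.
Proof.
  unfold W. assert (k / t <= A).
  { apply Rle_trans with (k * t); [|lra]. unfold Rdiv. apply Rmult_le_compat_l; [lra|].
    apply Rle_trans with 1; [|lra]. rewrite <- Rinv_1. apply Rinv_le_contravar; lra. }
  pose proof (pow2_ge_0 P). pose proof (pow2_ge_0 Q). nra.
Qed.

Lemma W_upper : W <= K * t * (P ^ 2 + Q ^ 2).
Proof.
  unfold W. pose proof (pow2_ge_0 P). pose proof (pow2_ge_0 Q).
  assert (K <= K * t) by nra.
  assert (A * P ^ 2 <= K * t * P ^ 2) by (apply Rmult_le_compat_r; lra).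
  assert (Rabs B * Q ^ 2 <= K * t * Q ^ 2) by (apply Rmult_le_compat_r; lra). lra.
Qed.

(** Arithmetic-geometric mean: W >= 2 sqrt(A |B|) |P Q|, and A |B| >= 16. The factor 8 later absorbs
    the cross terms with c. *)
Lemma PQ_le_W : 8 * Rabs (P * Q) <= W.
Proof.
  assert (HApos : 0 < A) by nra. assert (HBpos : 0 < Rabs B).
  { apply Rlt_le_trans with (k / t); [apply Rdiv_lt_0_compat; lra|lra]. }
  assert (0 <= W) by (unfold W; pose proof (pow2_ge_0 P); pose proof (pow2_ge_0 Q); nra).
  rewrite <- (Rabs_pos_eq 8), <- Rabs_mult by lra. apply sqr_le_abs; [assumption|].
  unfold W. pose proof (pow2_ge_0 (A * P ^ 2 - Rabs B * Q ^ 2)).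
  pose proof (pow2_ge_0 (P * Q)). nra.
Qed.

Lemma s_sqr_le : s ^ 2 <= 2 * t / k * W.
Proof.
  pose proof W_lower as H. unfold s.
  assert ((Rabs P + Rabs Q) ^ 2 <= 2 * (P ^ 2 + Q ^ 2)).
  { rewrite <- (pow2_abs P), <- (pow2_abs Q). pose proof (pow2_ge_0 (Rabs P - Rabs Q)). nra. }
  assert (P ^ 2 + Q ^ 2 <= t / k * W); [|unfold Rdiv in *; nra].
  apply Rmult_le_reg_l with (k / t); [apply Rdiv_lt_0_compat; lra|].
  replace (k / t * (t / k * W)) with W by (field; lra). exact H.
Qed.

Hypothesis HF0 : 0 <= F.
Hypothesis He1 : Rabs e1 <= 20 * K / t ^ 4 * s + F.
Hypothesis He2 : Rabs e2 <= 20 * K / t ^ 4 * s + F.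

(** Here (2 u, 2 v) stands for the gradient of a quadratic form with coefficients of size K t.
    Young's inequality is weighted so that the part charged to W costs only the relative rate
    O(1/t), leaving t^4 F^2 for the residual. *)
Lemma error_term_le u v : Rabs u <= K * t * s -> Rabs v <= K * t * s ->
  Rabs (2 * u * e1 + 2 * v * e2) <= 164 * K ^ 2 / k / t * W + 2 * K * t ^ 4 * F ^ 2.
Proof.
  intros Hu Hv.
  assert (Hs : 0 <= s) by (unfold s; pose proof (Rabs_pos P); pose proof (Rabs_pos Q); lra).
  set (z := / t). assert (Hz : 0 < z) by (apply Rinv_0_lt_compat; lra).
  assert (Hz1 : z <= 1) by (unfold z; rewrite <- Rinv_1; apply Rinv_le_contravar; lra).
  assert (Etz : t * z = 1) by (unfold z; field; lra).
  assert (E4 : 20 * K / t ^ 4 = 20 * K * z ^ 4) by (unfold z; field; lra).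
  rewrite E4 in He1, He2.
  assert (H1 : Rabs (2 * u * e1 + 2 * v * e2) <= 4 * (K * t * s) * (20 * K * z ^ 4 * s + F)).
  { eapply Rle_trans; [apply Rabs_triang|]. rewrite !Rabs_mult, (Rabs_pos_eq 2) by lra.
    pose proof (Rabs_pos u). pose proof (Rabs_pos v). pose proof (Rabs_pos e1). pose proof (Rabs_pos e2).
    assert (Rabs u * Rabs e1 <= (K * t * s) * (20 * K * z ^ 4 * s + F)) by (apply Rmult_le_compat; lra).
    assert (Rabs v * Rabs e2 <= (K * t * s) * (20 * K * z ^ 4 * s + F)) by (apply Rmult_le_compat; lra).
    lra. }
  assert (H2 : 4 * (K * t * s) * (20 * K * z ^ 4 * s + F) <= 82 * K ^ 2 * z ^ 2 * s ^ 2 + 2 * K * t ^ 4 * F ^ 2).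
  { replace (4 * (K * t * s) * (20 * K * z ^ 4 * s + F)) with
      (80 * K ^ 2 * s ^ 2 * (z ^ 2 * z) * (t * z) + 4 * K * (t * s * F)) by ring.
    rewrite Etz.
    assert (A1 : 80 * K ^ 2 * s ^ 2 * (z ^ 2 * z) * 1 <= 80 * K ^ 2 * s ^ 2 * z ^ 2).
    { rewrite Rmult_1_r. apply Rmult_le_compat_l; [pose proof (pow2_ge_0 s); nra|]. pose proof (pow2_ge_0 z). nra. }
    assert (A2 : 2 * (t * s * F) <= z ^ 2 * s ^ 2 + t ^ 4 * F ^ 2).
    { pose proof (pow2_ge_0 (z * s - t ^ 2 * F)) as X.
      replace ((z * s - t ^ 2 * F) ^ 2) with (z ^ 2 * s ^ 2 + t ^ 4 * F ^ 2 - 2 * ((t * z) * (t * s * F))) in X by ring.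
      rewrite Etz in X. lra. }
    assert (A3 : 2 * K * (z ^ 2 * s ^ 2) <= 2 * K ^ 2 * (z ^ 2 * s ^ 2)).
    { apply Rmult_le_compat_r; [|nra]. pose proof (pow2_ge_0 (z * s)). nra. }
    nra. }
  assert (H3 : 82 * K ^ 2 * z ^ 2 * s ^ 2 <= 164 * K ^ 2 / k / t * W).
  { pose proof s_sqr_le as X.
    apply Rle_trans with (82 * K ^ 2 * z ^ 2 * (2 * t / k * W)).
    - apply Rmult_le_compat_l; [|exact X]. pose proof (pow2_ge_0 z). nra.
    - right. unfold z. field. lra. }
  lra.
Qed.

(** The same estimate for the error in the derivative of P Q, where no factor K t enters. *)
Lemma product_error_le : Rabs (e1 * Q + e2 * P) <= 42 * K / k / t * W + t ^ 2 * F ^ 2.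
Proof.
  assert (Hs : 0 <= s) by (unfold s; pose proof (Rabs_pos P); pose proof (Rabs_pos Q); lra).
  set (z := / t). assert (Hz : 0 < z) by (apply Rinv_0_lt_compat; lra).
  assert (Hz1 : z <= 1) by (unfold z; rewrite <- Rinv_1; apply Rinv_le_contravar; lra).
  assert (Etz : t * z = 1) by (unfold z; field; lra).
  assert (E4 : 20 * K / t ^ 4 = 20 * K * z ^ 4) by (unfold z; field; lra).
  rewrite E4 in He1, He2.
  assert (H1 : Rabs (e1 * Q + e2 * P) <= s * (20 * K * z ^ 4 * s + F)).
  { eapply Rle_trans; [apply Rabs_triang|]. rewrite !Rabs_mult.
    pose proof (Rabs_pos P). pose proof (Rabs_pos Q). unfold s in *. nra. }
  assert (A2 : s * F <= z ^ 2 * s ^ 2 + t ^ 2 * F ^ 2).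
  { pose proof (pow2_ge_0 (z * s - t * F)) as X.
    replace ((z * s - t * F) ^ 2) with (z ^ 2 * s ^ 2 + t ^ 2 * F ^ 2 - 2 * ((t * z) * (s * F))) in X by ring.
    rewrite Etz in X. nra. }
  assert (A1 : s * (20 * K * z ^ 4 * s) <= 20 * K * (z ^ 2 * s ^ 2)).
  { replace (s * (20 * K * z ^ 4 * s)) with (20 * K * (z ^ 2 * s ^ 2) * z ^ 2) by ring.
    rewrite <- (Rmult_1_r (20 * K * (z ^ 2 * s ^ 2))) at 2.
    apply Rmult_le_compat_l; [|nra]. pose proof (pow2_ge_0 (z * s)). nra. }
  assert (A3 : z ^ 2 * s ^ 2 <= 2 / k / t * W).
  { pose proof s_sqr_le as X.
    apply Rle_trans with (z ^ 2 * (2 * t / k * W)).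
    - apply Rmult_le_compat_l; [apply pow2_ge_0|exact X].
    - right. unfold z. field. lra. }
  assert (A4 : z ^ 2 * s ^ 2 + 20 * K * (z ^ 2 * s ^ 2) <= 42 * K / k / t * W).
  { apply Rle_trans with (21 * K * (z ^ 2 * s ^ 2)).
    - pose proof (pow2_ge_0 (z * s)). nra.
    - apply Rle_trans with (21 * K * (2 / k / t * W)); [apply Rmult_le_compat_l; lra|]. right. field. lra. }
  lra.
Qed.

End LinearEstimates.

(** * The centre case *)

Lemma is_derive_tpow n t : is_derive (fun t : R => t ^ n) t (INR n * t ^ pred n).
Proof.
  pose proof (is_derive_pow (fun t : R => t) n t 1 (is_derive_id t)) as H. rewrite Rmult_1_r in H. exact H.
Qed.

Lemma is_derive_inv_tpow n t : 0 < t -> is_derive (fun t : R => / t ^ n) t (- (INR n / t ^ S n)).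
Proof.
  intros Ht. assert (0 < t ^ n) by now apply pow_lt.
  assert (H1 : t ^ n <> 0) by lra.
  pose proof (is_derive_inv (fun t : R => t ^ n) t _ (is_derive_tpow n t) H1) as H0.
  replace (- (INR n / t ^ S n)) with (- (INR n * t ^ pred n) / (t ^ n) ^ 2); [exact H0|].
  destruct n as [|n]; [simpl; field; lra|]. simpl pred. rewrite <- !tech_pow_Rmult.
  field. repeat split; try (apply pow_nonzero; lra); lra.
Qed.

Lemma derive_weighted (u v E : R -> R) (t lu lv lE : R) :
  is_derive u t lu -> is_derive v t lv -> is_derive E t lE ->
  is_derive (fun t => u t * E t - v t) t (lu * E t + u t * lE - lv).
Proof.
  intros Hu Hv HE. auto_derive; [repeat split; eexists; eassumption|].
  rewrite_derive. ring.
Qed.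

Section Family.

Variables (lam nu : R) (m rho0 psi0 : R -> R) (xs ys fxs fys : nat -> R -> R).

Set Implicit Arguments.
(** Constants and starting times may depend on n, as befits partial sums of a possibly divergent
    series; only n0 is tied to the order N. The margin 1/16 leaves room for triangle inequalities,
    each of which doubles squared distances. *)
Record family : Prop := {
  fam_res : forall N, exists n0, forall n, (n0 <= n)%nat -> exists C T, 0 <= C /\ forall t, T <= t ->
    approx_at lam nu m (xs n) (ys n) (fxs n) (fys n) t /\ Rabs (fxs n t) + Rabs (fys n t) <= C / t ^ N;
  fam_close : forall N, exists n0, forall n n', (n0 <= n)%nat -> (n0 <= n')%nat -> exists C T, 0 <= C /\
    forall t, T <= t -> dist2 (xs n) (ys n) (xs n') (ys n') t <= C / t ^ N;
  fam_trap : exists n0, forall n, (n0 <= n)%nat -> exists T, forall t, T <= t ->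
    t ^ 10 * dist2 (xs n) (ys n) (fx0 rho0 psi0) (fy0 rho0 psi0) t <= 1 / 16
}.
Unset Implicit Arguments.

(** Agreement with the family to all orders: the form that an asymptotic expansion takes for z. *)
Definition tracked (x y : R -> R) : Prop := zsol lam nu m x y /\
  forall N, exists n0, forall n, (n0 <= n)%nat -> exists C T, 0 <= C /\ forall t, T <= t ->
    dist2 x y (xs n) (ys n) t <= C / t ^ N.

End Family.

Section Center.

Variables (lam nu : R) (m : R -> R).
Variables (rho0 psi0 g A B c A' B' c' : R -> R) (k K T0 : R).
Hypothesis HF : frame lam nu m rho0 psi0 g A B c A' B' c' k K T0.

Local Notation approx := (approx_at lam nu m).
Local Notation X0 := (fx0 rho0 psi0).
Local Notation Y0 := (fy0 rho0 psi0).
Local Notation trapped := (trap rho0 psi0).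

Lemma dist2_frame_continuous x y t : T0 <= t -> zsol lam nu m x y -> continuous (dist2 x y X0 Y0) t.
Proof.
  intros Ht Hz. destruct (Hz t) as [H1 H2].
  pose proof (continuous_of_derive _ _ _ H1). pose proof (continuous_of_derive _ _ _ H2).
  pose proof (fr_rhoc HF Ht).
  pose proof (continuous_of_derive _ _ _ (fr_psi HF Ht)) as Hp.
  assert (continuous (fun s => cos (psi0 s)) t).
  { apply (continuous_comp psi0 cos); [exact Hp|]. apply continuity_pt_filterlim, continuity_cos. }
  assert (continuous (fun s => sin (psi0 s)) t).
  { apply (continuous_comp psi0 sin); [exact Hp|]. apply continuity_pt_filterlim, continuity_sin. }
  unfold dist2, fx0, fy0. cont.
Qed.

Hypothesis HB : forall t, T0 <= t -> 0 < B t.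

(* The quadratic form E is the Hamiltonian of the frozen linear system, so |E'| = O(E/t) up to residuals; this is
   why the error exponent L does not depend on the accuracy of the approximate solution. *)
Lemma center_monotone : exists L : nat, (1 <= L)%nat /\ forall N J C x1 y1 x2 y2 fx fy a b,
  (L + 6 + J <= 2 * N)%nat -> 0 <= C -> T0 <= a <= b -> zsol lam nu m x1 y1 ->
  (forall t, a <= t <= b -> approx x2 y2 fx fy t /\ Rabs (fx t) + Rabs (fy t) <= C / t ^ N /\
      trapped x1 y1 t /\ trapped x2 y2 t) ->
  let E t := A t * frP psi0 x1 y1 x2 y2 t ^ 2 + 2 * c t * frP psi0 x1 y1 x2 y2 t * frQ psi0 x1 y1 x2 y2 t
     + B t * frQ psi0 x1 y1 x2 y2 t ^ 2 in
  a ^ L * E a - INR L * C ^ 2 / a ^ S J <= b ^ L * E b - INR L * C ^ 2 / b ^ S J.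
Proof.
  frame_constants HF.
  (* L exceeds the relative rate at which E can decrease, with a reserve for E >= 3/4 W; it depends
     on the frame only. *)
  destruct (INR_unbounded (4 * (164 * K ^ 2 / k + 3 * K))) as (L & HL).
  assert (Hkk : 0 <= 164 * K ^ 2 / k) by (apply Rdiv_le_0_compat; nra).
  assert (HL1 : (1 <= L)%nat) by (apply INR_le; simpl; lra).
  exists L. split; [exact HL1|].
  intros N J C x1 y1 x2 y2 fx fy a b HN HC Hab Hz Hap E.
  set (P := frP psi0 x1 y1 x2 y2) in *. set (Q := frQ psi0 x1 y1 x2 y2) in *.
  apply (derive_ex_nonneg_le (fun t => t ^ L * E t - INR L * C ^ 2 / t ^ S J)); [lra|].
  intros t Ht. destruct (Hap t Ht) as (Ha2 & Hres & Tr1 & Tr2).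
  assert (Ht0 : T0 <= t) by lra. assert (Ht1 : 1 <= t) by lra.
  destruct (pair_linear _ _ _ _ _ _ _ _ _ _ _ _ _ _ _ HF x1 y1 x2 y2 fx fy t Ht0
     (zsol_approx _ _ _ _ _ t Hz) Ha2 Tr1 Tr2) as (e1 & e2 & DP & DQ & b1 & b2).
  fold P in DP, DQ, b1, b2. fold Q in DP, DQ, b1, b2.
  frame_at HF t Ht0.
  set (F := Rabs (fx t) + Rabs (fy t)) in *.
  assert (HF0 : 0 <= F) by (unfold F; pose proof (Rabs_pos (fx t)); pose proof (Rabs_pos (fy t)); lra).
  pose proof (PQ_le_W k K t (A t) (B t) (P t) (Q t) Hk Ht1 HA1 HB1 HAB) as HPQ.
  pose proof (Rabs_pos (P t)) as PP. pose proof (Rabs_pos (Q t)) as PQ0.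
  assert (HKt : K <= K * t) by nra.
  assert (HApos : 0 < A t) by nra.
  assert (Hs : 0 <= Rabs (P t) + Rabs (Q t)) by lra.
  assert (Hu : Rabs (A t * P t + c t * Q t) <= K * t * (Rabs (P t) + Rabs (Q t))).
  { eapply Rle_trans; [apply Rabs_triang|]. rewrite !Rabs_mult, (Rabs_pos_eq (A t)) by lra.
    assert (A t * Rabs (P t) <= K * t * Rabs (P t)) by (apply Rmult_le_compat_r; lra).
    assert (Rabs (c t) * Rabs (Q t) <= K * t * Rabs (Q t)) by (apply Rmult_le_compat_r; lra). lra. }
  assert (Hv : Rabs (c t * P t + B t * Q t) <= K * t * (Rabs (P t) + Rabs (Q t))).
  { eapply Rle_trans; [apply Rabs_triang|]. rewrite !Rabs_mult.
    assert (Rabs (c t) * Rabs (P t) <= K * t * Rabs (P t)) by (apply Rmult_le_compat_r; lra).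
    assert (Rabs (B t) * Rabs (Q t) <= K * t * Rabs (Q t)) by (apply Rmult_le_compat_r; lra). lra. }
  pose proof (error_term_le k K t (A t) (B t) (P t) (Q t) e1 e2 F Hk HK Ht1 HA1 HB1 b1 b2 _ _ Hu Hv) as Herr.
  set (W := A t * P t ^ 2 + Rabs (B t) * Q t ^ 2) in *.
  assert (HW0 : 0 <= W) by (pose proof (Rabs_pos (P t * Q t)); lra).
  assert (EB : Rabs (B t) = B t) by (apply Rabs_pos_eq; left; now apply HB).
  (* The cross term is at most W / 4, because |c| <= 1 and 8 |P Q| <= W. *)
  assert (HEW : 3 / 4 * W <= E t).
  { assert (Rabs (2 * (c t * (P t * Q t))) <= 1 / 4 * W).
    { rewrite !Rabs_mult, (Rabs_pos_eq 2), <- Rabs_mult by lra. pose proof (Rabs_pos (P t * Q t)). nra. }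
    apply Rabs_le_between in H. unfold E, W in *. rewrite EB in *. nra. }
  set (dE := A' t * P t ^ 2 + 2 * c' t * (P t * Q t) + B' t * Q t ^ 2
     + (2 * (A t * P t + c t * Q t) * e1 + 2 * (c t * P t + B t * Q t) * e2)).
  assert (DE : is_derive E t dE).
  { unfold E. auto_derive; [repeat split; eexists; eassumption|].
    rewrite_derive.
    unfold dE. ring. }
  assert (HdE : - (INR L / t * E t + INR L * t ^ 4 * F ^ 2) <= dE).
  { assert (X1 : Rabs (A' t * P t ^ 2 + 2 * c' t * (P t * Q t) + B' t * Q t ^ 2) <= 2 * K / t * W).
    { eapply Rle_trans; [apply Rabs_triang|]. eapply Rle_trans; [apply Rplus_le_compat_r, Rabs_triang|].
      rewrite (Rabs_mult (A' t)), (Rabs_mult (2 * c' t)), (Rabs_mult 2), (Rabs_mult (B' t)), (Rabs_pos_eq 2) by lra.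
      rewrite !(Rabs_pos_eq (_ ^ 2)) by apply pow2_ge_0.
      assert (0 < K / t) by (apply Rdiv_lt_0_compat; lra).
      assert (Y1 : Rabs (A' t) * P t ^ 2 <= K / t * (A t * P t ^ 2)).
      { rewrite <- Rmult_assoc. apply Rmult_le_compat_r; [apply pow2_ge_0|exact HA2]. }
      assert (Y2 : Rabs (B' t) * Q t ^ 2 <= K / t * (Rabs (B t) * Q t ^ 2)).
      { rewrite <- Rmult_assoc. apply Rmult_le_compat_r; [apply pow2_ge_0|exact HB2]. }
      assert (Y3 : Rabs (c' t) * Rabs (P t * Q t) <= K / t * (1 / 8 * W)).
      { apply Rmult_le_compat; try apply Rabs_pos; lra. }
      replace (2 * K / t * W) with (K / t * (A t * P t ^ 2) + K / t * (Rabs (B t) * Q t ^ 2) + K / t * W)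
        by (unfold W; field; lra).
      assert (0 <= K / t * W) by (apply Rmult_le_pos; lra). lra. }
    apply Rabs_le_between in X1. apply Rabs_le_between in Herr.
    set (z := / t) in *. assert (Hz0 : 0 < z) by (apply Rinv_0_lt_compat; lra).
    unfold Rdiv in X1, Herr |- *. fold z in X1, Herr |- *.
    assert (Hmain : 2 * K * z * W + 164 * K ^ 2 * / k * z * W <= INR L * z * E t).
    { apply Rle_trans with (INR L * z * (3 / 4 * W)).
      - replace (2 * K * z * W + 164 * K ^ 2 * / k * z * W) with ((2 * K + 164 * K ^ 2 / k) * (z * W)) by (unfold Rdiv; ring).
        replace (INR L * z * (3 / 4 * W)) with (3 / 4 * INR L * (z * W)) by ring.
        apply Rmult_le_compat_r; [apply Rmult_le_pos; lra|lra].
      - apply Rmult_le_compat_l; [|exact HEW]. apply Rmult_le_pos; [apply pos_INR|lra]. }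
    assert (HF2 : 2 * K * t ^ 4 * F ^ 2 <= INR L * t ^ 4 * F ^ 2).
    { rewrite !Rmult_assoc. rewrite <- Rmult_assoc. apply Rmult_le_compat_r; [|lra].
      apply Rmult_le_pos; [apply pow_le; lra|apply pow2_ge_0]. }
    unfold dE. lra. }
  eexists. split.
  - apply (derive_weighted (fun t => t ^ L) (fun t => INR L * C ^ 2 / t ^ S J) E); [apply is_derive_tpow| |exact DE].
    apply (is_derive_scal (fun t => / t ^ S J)). apply is_derive_inv_tpow. lra.
  - destruct L as [|L']; [lia|]. simpl pred. set (L := S L') in *.
    assert (Hp : 0 < t ^ L) by (apply pow_lt; lra).
    assert (HpL : t ^ L = t * t ^ L') by reflexivity.
    (* Since F^2 <= C^2 / t^(2N) and 2 N >= L + 6 + J, the residual contributes at most L C^2 /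
       t^(J+2), which the derivative of the subtracted term L C^2 / t^(J+1) compensates. *)
    assert (HFN : t ^ L * t ^ 4 * F ^ 2 <= C ^ 2 / t ^ S (S J)).
    { assert (F ^ 2 <= C ^ 2 / t ^ (L + 6 + J)).
      { apply Rle_trans with ((C / t ^ N) ^ 2); [apply pow_incr; lra|].
        unfold Rdiv. rewrite Rpow_mult_distr. apply Rmult_le_compat_l; [apply pow2_ge_0|].
        rewrite pow_inv, <- pow_mult. apply inv_pow_mono; [exact Ht1|lia]. }
      replace (C ^ 2 / t ^ S (S J)) with (t ^ L * t ^ 4 * (C ^ 2 / t ^ (L + 6 + J))).
      - apply Rmult_le_compat_l; [|assumption]. apply Rmult_le_pos; apply pow_le; lra.
      - replace (t ^ (L + 6 + J)) with (t ^ L * t ^ 4 * t ^ S (S J)) by (rewrite <- !pow_add; f_equal; lia).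
        field. repeat split; try (apply pow_nonzero; lra); lra. }
    assert (Hm1 : t ^ L * dE >= - (INR L * t ^ L' * E t + INR L * (t ^ L * t ^ 4 * F ^ 2))).
    { replace (INR L * t ^ L' * E t) with (t ^ L * (INR L / t * E t)) by (rewrite HpL; field; lra).
      apply Rle_ge. apply Rle_trans with (t ^ L * - (INR L / t * E t + INR L * t ^ 4 * F ^ 2)); [right; ring|].
      apply Rmult_le_compat_l; lra. }
    assert (HL0 : 0 <= INR L) by apply pos_INR.
    assert (INR L * (t ^ L * t ^ 4 * F ^ 2) <= INR L * (C ^ 2 / t ^ S (S J))) by now apply Rmult_le_compat_l.
    assert (Hlast : INR L * (C ^ 2 / t ^ S (S J)) <= INR (S J) * (INR L * (C ^ 2 / t ^ S (S J)))).
    { rewrite <- (Rmult_1_l (INR L * _)) at 1. apply Rmult_le_compat_r.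
      - apply Rmult_le_pos; [lra|]. apply Rdiv_le_0_compat; [apply pow2_ge_0|apply pow_lt; lra].
      - rewrite S_INR. pose proof (pos_INR J). lra. }
    replace (INR L * C ^ 2 * - (INR (S J) / t ^ S (S J))) with (- (INR (S J) * (INR L * (C ^ 2 / t ^ S (S J)))))
      by (field; repeat split; try (apply pow_nonzero; lra); lra).
    change (0 <= INR L * t ^ L' * E t + t ^ L * dE - - (INR (S J) * (INR L * (C ^ 2 / t ^ S (S J))))).
    lra.
Qed.

(** The monotone quantity is read backwards from b to a, with E exchanged for the squared distance:
    up to constants their ratio lies between k / t and K t, which is the origin of the extra power
    of b and of the factor a. *)
Lemma center_decay : exists (L : nat) C0, (1 <= L)%nat /\ 0 <= C0 /\ forall N J C x1 y1 x2 y2 fx fy a b,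
  (L + 6 + J <= 2 * N)%nat -> 0 <= C -> T0 <= a <= b -> zsol lam nu m x1 y1 ->
  (forall t, a <= t <= b -> approx x2 y2 fx fy t /\ Rabs (fx t) + Rabs (fy t) <= C / t ^ N /\
      trapped x1 y1 t /\ trapped x2 y2 t) ->
  a ^ L * dist2 x1 y1 x2 y2 a <= C0 * a * (b ^ S L * dist2 x1 y1 x2 y2 b + C ^ 2 / a ^ S J).
Proof.
  frame_constants HF.
  destruct center_monotone as (L & HL1 & HM).
  assert (HL0 : 0 <= INR L) by apply pos_INR.
  set (C0 := 4 / 3 / k * (5 / 4 * K + INR L)).
  assert (HC0 : 0 <= C0).
  { unfold C0. apply Rmult_le_pos; [|lra]. apply Rdiv_le_0_compat; lra. }
  exists L, C0. split; [exact HL1|]. split; [exact HC0|].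
  intros N J C x1 y1 x2 y2 fx fy a b HN HC Hab Hz Hap.
  specialize (HM N J C x1 y1 x2 y2 fx fy a b HN HC Hab Hz Hap). cbv zeta beta in HM.
  assert (Hbounds : forall t, T0 <= t ->
    let E := A t * frP psi0 x1 y1 x2 y2 t ^ 2 + 2 * c t * frP psi0 x1 y1 x2 y2 t * frQ psi0 x1 y1 x2 y2 t
     + B t * frQ psi0 x1 y1 x2 y2 t ^ 2 in
    3 / 4 * (k / t * dist2 x1 y1 x2 y2 t) <= E <= 5 / 4 * (K * t * dist2 x1 y1 x2 y2 t)).
  { intros t Ht0 E. assert (Ht1 : 1 <= t) by lra.
    frame_at HF t Ht0.
    rewrite <- (frPQ_norm psi0 x1 y1 x2 y2 t).
    set (P := frP psi0 x1 y1 x2 y2 t) in *. set (Q := frQ psi0 x1 y1 x2 y2 t) in *.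
    pose proof (PQ_le_W k K t (A t) (B t) P Q Hk Ht1 HA1 HB1 HAB) as HPQ.
    pose proof (W_lower k K t (A t) (B t) P Q Hk Ht1 HA1 HB1) as Hl.
    pose proof (W_upper k K t (A t) (B t) P Q HK Ht1 HA1 HB1) as Hup.
    assert (EB : Rabs (B t) = B t) by (apply Rabs_pos_eq; left; now apply HB).
    set (W := A t * P ^ 2 + Rabs (B t) * Q ^ 2) in *.
    assert (HX : Rabs (2 * (c t * (P * Q))) <= 1 / 4 * W).
    { rewrite !Rabs_mult, (Rabs_pos_eq 2), <- Rabs_mult by lra. pose proof (Rabs_pos (P * Q)). nra. }
    apply Rabs_le_between in HX.
    assert (EE : E = W + 2 * (c t * (P * Q))) by (unfold E, W; rewrite EB; ring).
    rewrite EE. lra. }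
  destruct (Hbounds a ltac:(lra)) as [Ba _]. destruct (Hbounds b ltac:(lra)) as [_ Bb]. cbv zeta in Ba, Bb.
  match type of Ba with _ <= ?e => set (Ea := e) in * end.
  match type of Bb with ?e <= _ => set (Eb := e) in * end.
  assert (Ha : 1 <= a) by lra. assert (Hb : 1 <= b) by lra.
  assert (HaL : 0 < a ^ L) by (apply pow_lt; lra). assert (HbL : 0 < b ^ L) by (apply pow_lt; lra).
  assert (HaJ : 0 < a ^ S J) by (apply pow_lt; lra). assert (HbJ : 0 < b ^ S J) by (apply pow_lt; lra).
  set (Da := dist2 x1 y1 x2 y2 a) in *. set (Db := dist2 x1 y1 x2 y2 b) in *.
  assert (Dbp : 0 <= Db) by apply dist2_nonneg.
  assert (X0 : 0 <= INR L * C ^ 2 / b ^ S J).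
  { apply Rdiv_le_0_compat; [|lra]. apply Rmult_le_pos; [lra|apply pow2_ge_0]. }
  assert (X1 : a ^ L * (3 / 4 * (k / a * Da)) <= b ^ L * (5 / 4 * (K * b * Db)) + INR L * C ^ 2 / a ^ S J).
  { assert (a ^ L * (3 / 4 * (k / a * Da)) <= a ^ L * Ea) by (apply Rmult_le_compat_l; lra).
    assert (b ^ L * Eb <= b ^ L * (5 / 4 * (K * b * Db))) by (apply Rmult_le_compat_l; lra). lra. }
  apply Rmult_le_compat_l with (r := 4 / 3 / k * a) in X1;
    [|apply Rmult_le_pos; [apply Rdiv_le_0_compat; lra|lra]].
  replace (4 / 3 / k * a * (a ^ L * (3 / 4 * (k / a * Da)))) with (a ^ L * Da) in X1 by (field; lra).
  eapply Rle_trans; [exact X1|].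
  replace (4 / 3 / k * a * (b ^ L * (5 / 4 * (K * b * Db)) + INR L * C ^ 2 / a ^ S J)) with
    (4 / 3 / k * (5 / 4 * K) * (a * (b ^ S L * Db)) + 4 / 3 / k * INR L * (a * (C ^ 2 / a ^ S J)))
    by (change (b ^ S L) with (b * b ^ L); field; repeat split; lra).
  replace (C0 * a * (b ^ S L * Db + C ^ 2 / a ^ S J)) with
    (C0 * (a * (b ^ S L * Db)) + C0 * (a * (C ^ 2 / a ^ S J))) by ring.
  assert (Hc3 : 0 <= 4 / 3 / k) by (apply Rdiv_le_0_compat; lra).
  apply Rplus_le_compat; apply Rmult_le_compat_r.
  - apply Rmult_le_pos; [lra|]. apply Rmult_le_pos; [apply pow_le; lra|exact Dbp].
  - unfold C0. apply Rmult_le_compat_l; lra.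
  - apply Rmult_le_pos; [lra|]. apply Rdiv_le_0_compat; [apply pow2_ge_0|lra].
  - unfold C0. apply Rmult_le_compat_l; lra.
Qed.

End Center.

Ltac nz := repeat split; try (apply pow_nonzero; lra); lra.

Lemma cauchy_of_inv_bound (u : nat -> R) (D : R) (j0 : nat) : 0 <= D ->
  (forall i j, (j0 <= i)%nat -> (i <= j)%nat -> (u i - u j) ^ 2 <= D / INR (S i)) ->
  exists l, is_lim_seq u (Finite l).
Proof.
  intros HD H.
  assert (Hex : ex_finite_lim_seq u); [|destruct Hex as [l Hl]; now exists l].
  apply ex_lim_seq_cauchy_corr. intros eps.
  destruct (INR_unbounded (4 * D / eps ^ 2)) as (i0 & Hi0).
  pose proof (cond_pos eps) as He.
  assert (He2 : 0 < eps ^ 2) by (apply pow_lt; lra).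
  set (i := max j0 i0).
  assert (Hi : forall j, (i <= j)%nat -> Rabs (u i - u j) < eps / 2).
  { intros j Hj. specialize (H i j ltac:(lia) Hj).
    assert (Hii : INR i0 <= INR (S i)) by (apply le_INR; lia).
    assert (HS : 0 < INR (S i)) by (apply lt_0_INR; lia).
    assert (D / INR (S i) < (eps / 2) ^ 2).
    { apply Rmult_lt_reg_r with (INR (S i)); [exact HS|].
      unfold Rdiv. rewrite Rmult_assoc, Rinv_l, Rmult_1_r by lra.
      assert (4 * D / eps ^ 2 < INR (S i)) as Hlt by lra.
      apply Rmult_lt_compat_r with (r := eps ^ 2) in Hlt; [|exact He2].
      unfold Rdiv in Hlt. rewrite Rmult_assoc, Rinv_l, Rmult_1_r in Hlt by lra. nra. }
    apply Rabs_lt_between. split; nra. }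
  exists i. intros n k Hn Hk. pose proof (Hi n Hn) as H1. pose proof (Hi k Hk) as H2.
  replace (u n - u k) with (- (u i - u n) + (u i - u k)) by ring.
  eapply Rle_lt_trans; [apply Rabs_triang|]. rewrite Rabs_Ropp. lra.
Qed.

Lemma is_lim_seq_evt_close (u : nat -> R) (l eps : R) : is_lim_seq u (Finite l) -> 0 < eps ->
  exists n0, forall n, (n0 <= n)%nat -> Rabs (u n - l) < eps.
Proof.
  intros H He. apply is_lim_seq_spec in H. destruct (H (mkposreal eps He)) as [n0 Hn0].
  exists n0. exact Hn0.
Qed.

Section CenterExistence.

Variables (lam nu : R) (m : R -> R).
Hypothesis Hm : forall t, continuous m t.
Variables (rho0 psi0 g A B c A' B' c' : R -> R) (k K T0 : R).
Hypothesis HF : frame lam nu m rho0 psi0 g A B c A' B' c' k K T0.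
Variables (xs ys fxs fys : nat -> R -> R).
Hypothesis Hfam : family lam nu m rho0 psi0 xs ys fxs fys.

Local Notation X0 := (fx0 rho0 psi0).
Local Notation Y0 := (fy0 rho0 psi0).
Local Notation trapped := (trap rho0 psi0).
Local Notation null := (fun _ : R => 0).

Lemma inv_pow_le_inv a n : 1 <= a -> (1 <= n)%nat -> / a ^ n <= / a.
Proof. intros Ha Hn. rewrite <- (pow_1 a) at 2. now apply inv_pow_mono. Qed.

Hypothesis HB : forall t, T0 <= t -> 0 < B t.

(* Solutions u_j that agree with a good approximation at t = j stay close to it on [T1, j]; their values at T1
   form a Cauchy sequence. *)
Lemma center_tracked : exists x y, tracked lam nu m xs ys x y.
Proof.
  pose proof (fr_T0 HF) as HT0.
  destruct (center_decay _ _ _ _ _ _ _ _ _ _ _ _ _ _ _ HF HB) as (L & C0 & HL & HC0 & HD).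
  (* This accuracy bounds the squared distance by D1 / t^(L+20), enough to beat both the t^10 of the
     tube and the weight b^(L+1) in the second comparison. *)
  destruct (fam_res Hfam (L + 20)) as (na & Hna).
  destruct (fam_close Hfam (L + 2)) as (nb & Hnb).
  destruct (fam_trap Hfam) as (nc & Hnc).
  set (n1 := max na (max nb nc)).
  destruct (Hna n1 ltac:(lia)) as (C & Ta & HC & Hres).
  destruct (Hnc n1 ltac:(lia)) as (Tc & Htr).
  set (D1 := C0 * C ^ 2).
  assert (HD1 : 0 <= D1) by (apply Rmult_le_pos; [exact HC0|apply pow2_ge_0]).
  (* The entry 64 D1 + 1 gives 4 D1 / t <= 1/16, as [Hsmall] requires. *)
  set (T1 := Rmax T0 (Rmax Ta (Rmax Tc (64 * D1 + 1)))).
  assert (HT1 : T0 <= T1 /\ Ta <= T1 /\ Tc <= T1 /\ 64 * D1 + 1 <= T1).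
  { unfold T1. pose proof (Rmax_l T0 (Rmax Ta (Rmax Tc (64 * D1 + 1)))).
    pose proof (Rmax_r T0 (Rmax Ta (Rmax Tc (64 * D1 + 1)))).
    pose proof (Rmax_l Ta (Rmax Tc (64 * D1 + 1))). pose proof (Rmax_r Ta (Rmax Tc (64 * D1 + 1))).
    pose proof (Rmax_l Tc (64 * D1 + 1)). pose proof (Rmax_r Tc (64 * D1 + 1)). lra. }
  destruct HT1 as (HT10 & HT1a & HT1c & HT1d). clearbody T1.
  assert (Hsmall : forall t, T1 <= t -> t ^ 10 * (4 * (D1 / t ^ (L + 20))) <= 1 / 16).
  { intros t Ht. assert (0 < t ^ 10) by (apply pow_lt; lra).
    replace (t ^ 10 * (4 * (D1 / t ^ (L + 20)))) with (4 * D1 * / t ^ (L + 10)).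
    - assert (/ t ^ (L + 10) <= / t) by (apply inv_pow_le_inv; [lra|lia]).
      apply Rle_trans with (4 * D1 * / t); [apply Rmult_le_compat_l; lra|].
      apply Rmult_le_reg_r with t; [lra|]. rewrite Rmult_assoc, Rinv_l by lra. lra.
    - replace (L + 20)%nat with (10 + (L + 10))%nat by lia. rewrite (pow_add t 10). field.
      nz. }
  assert (HU : forall j : nat, {p : (R -> R) * (R -> R) |
     fst p (INR j) = xs n1 (INR j) /\ snd p (INR j) = ys n1 (INR j) /\ zsol lam nu m (fst p) (snd p)}).
  { intros j. apply constructive_indefinite_description.
    destruct (zsol_exists lam nu m Hm (INR j) (xs n1 (INR j)) (ys n1 (INR j))) as (x & y & H).
    now exists (x, y). }
  set (xu := fun j => fst (proj1_sig (HU j))). set (yu := fun j => snd (proj1_sig (HU j))).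
  assert (HUz : forall j, zsol lam nu m (xu j) (yu j)) by (intros j; apply (proj2_sig (HU j))).
  assert (HU0 : forall j, dist2 (xu j) (yu j) (xs n1) (ys n1) (INR j) = 0).
  { intros j. destruct (proj2_sig (HU j)) as (E1 & E2 & _). unfold dist2, xu, yu. rewrite E1, E2. ring. }
  assert (Hdec : forall j a, T1 <= a <= INR j ->
     (forall t, a <= t <= INR j -> trapped (xu j) (yu j) t) ->
     dist2 (xu j) (yu j) (xs n1) (ys n1) a <= D1 / a ^ (L + 20)).
  { intros j a Ha Htrap.
    assert (Hx := HD (L + 20)%nat (L + 20)%nat C (xu j) (yu j) (xs n1) (ys n1) (fxs n1) (fys n1) a (INR j)
      ltac:(lia) HC ltac:(lra) (HUz j)).
    rewrite HU0, Rmult_0_r, Rplus_0_l in Hx.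
    assert (Hxx : a ^ L * dist2 (xu j) (yu j) (xs n1) (ys n1) a <= C0 * a * (C ^ 2 / a ^ S (L + 20))).
    { apply Hx. intros t Ht. destruct (Hres t ltac:(lra)) as [H1 H2].
      split; [exact H1|split; [exact H2|split; [now apply Htrap|]]].
      unfold trap. specialize (Htr t ltac:(lra)). lra. }
    replace (D1 / a ^ (L + 20)) with (C0 * a * (C ^ 2 / a ^ S (L + 20))).
    - eapply Rle_trans; [|exact Hxx]. rewrite <- (Rmult_1_l (dist2 _ _ _ _ a)) at 1.
      apply Rmult_le_compat_r; [apply dist2_nonneg|]. apply pow_ge_1; lra.
    - unfold D1. change (a ^ S (L + 20)) with (a * a ^ (L + 20)). field. nz. }
  (* The bound of [Hdec] needs the tube and implies it strictly, so it propagates backwards from t =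
     j, where the solution agrees with the approximation. *)
  assert (Hin : forall j t, T1 <= t <= INR j -> trapped (xu j) (yu j) t).
  { intros j t Ht. left.
    apply (bootstrap_backward (fun t => t ^ 10 * dist2 (xu j) (yu j) X0 Y0 t) T1 (INR j)); [| | |lra].
    - intros s Hs. apply continuous_Rmult.
      + apply (continuous_of_derive _ _ _ (is_derive_tpow 10 s)).
      + apply (dist2_frame_continuous _ _ _ _ _ _ _ _ _ _ _ _ _ _ _ HF); [lra|apply HUz].
    - pose proof (dist2_triangle (xu j) (yu j) (xs n1) (ys n1) X0 Y0 (INR j)) as Hd.
      rewrite HU0 in Hd. specialize (Htr (INR j) ltac:(lra)).
      assert (0 < INR j ^ 10) by (apply pow_lt; lra). nra.
    - intros a Ha Hle. pose proof (Hdec j a Ha Hle) as Hd1.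
      pose proof (dist2_triangle (xu j) (yu j) (xs n1) (ys n1) X0 Y0 a) as Hd.
      specialize (Htr a ltac:(lra)). specialize (Hsmall a ltac:(lra)).
      assert (0 < a ^ 10) by (apply pow_lt; lra).
      assert (a ^ 10 * dist2 (xu j) (yu j) X0 Y0 a <= a ^ 10 * (2 * (D1 / a ^ (L + 20))
         + 2 * dist2 (xs n1) (ys n1) X0 Y0 a)) by (apply Rmult_le_compat_l; lra).
      lra. }
  assert (HS1 : forall j t, T1 <= t <= INR j -> dist2 (xu j) (yu j) (xs n1) (ys n1) t <= D1 / t ^ (L + 20)).
  { intros j t Ht. apply Hdec; [exact Ht|]. intros s Hs. apply Hin. lra. }
  destruct (INR_unbounded T1) as (j0 & Hj0).
  set (D2 := 2 * (C0 * T1 * D1)).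
  assert (HD2 : 0 <= D2) by (unfold D2; apply Rmult_le_pos; [lra|apply Rmult_le_pos; [apply Rmult_le_pos; lra|lra]]).
  (* Two exact solutions are compared, hence the residual is 0. At t = i the first equals the
     approximation, so the distance there is that of u_j from the approximation, and i^(L+1) times
     its square is still O(1/i). *)
  assert (Hcau : forall i j, (j0 <= i)%nat -> (i <= j)%nat -> dist2 (xu i) (yu i) (xu j) (yu j) T1 <= D2 / INR (S i)).
  { intros i j Hi Hij. assert (Hi1 : T1 <= INR i) by (apply Rle_trans with (INR j0); [lra|now apply le_INR]).
    assert (Hij' : INR i <= INR j) by now apply le_INR.
    assert (Hx := HD (L + 20)%nat 0%nat 0 (xu i) (yu i) (xu j) (yu j) null null T1 (INR i)
      ltac:(lia) (Rle_refl 0) ltac:(lra) (HUz i)).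
    assert (Hxx : T1 ^ L * dist2 (xu i) (yu i) (xu j) (yu j) T1 <=
      C0 * T1 * (INR i ^ S L * dist2 (xu i) (yu i) (xu j) (yu j) (INR i) + 0 ^ 2 / T1 ^ 1)).
    { apply Hx. intros t Ht. split; [now apply zsol_approx|]. rewrite Rabs_R0. split; [unfold Rdiv; lra|].
      split; apply Hin; lra. }
    assert (Ed : dist2 (xu i) (yu i) (xu j) (yu j) (INR i) = dist2 (xu j) (yu j) (xs n1) (ys n1) (INR i)).
    { destruct (proj2_sig (HU i)) as (E1 & E2 & _). unfold dist2, xu, yu in *. rewrite E1, E2. ring. }
    rewrite Ed in Hxx. pose proof (HS1 j (INR i) ltac:(lra)) as Hb.
    assert (Hip : 1 <= INR i) by lra.
    assert (HSi : INR (S i) <= 2 * INR i) by (rewrite S_INR; lra).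
    assert (HSi0 : 0 < INR (S i)) by (apply lt_0_INR; lia).
    assert (Hb2 : INR i ^ S L * dist2 (xu j) (yu j) (xs n1) (ys n1) (INR i) <= D1 * / INR i).
    { apply Rle_trans with (INR i ^ S L * (D1 / INR i ^ (L + 20))).
      - apply Rmult_le_compat_l; [apply pow_le; lra|exact Hb].
      - replace (L + 20)%nat with (S L + 19)%nat by lia. rewrite pow_add.
        replace (INR i ^ S L * (D1 / (INR i ^ S L * INR i ^ 19))) with (D1 * / INR i ^ 19)
          by (field; nz).
        apply Rmult_le_compat_l; [lra|]. apply inv_pow_le_inv; [exact Hip|lia]. }
    assert (HTL : 1 <= T1 ^ L) by (apply pow_ge_1; lra).
    pose proof (dist2_nonneg (xu i) (yu i) (xu j) (yu j) T1) as Hnn.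
    apply Rle_trans with (T1 ^ L * dist2 (xu i) (yu i) (xu j) (yu j) T1); [nra|].
    eapply Rle_trans; [exact Hxx|].
    apply Rle_trans with (C0 * T1 * (D1 * / INR i)).
    - apply Rmult_le_compat_l; [apply Rmult_le_pos; lra|]. unfold Rdiv. lra.
    - unfold D2. replace (2 * (C0 * T1 * D1) / INR (S i)) with (C0 * T1 * (D1 * (2 / INR (S i)))) by (field; lra).
      apply Rmult_le_compat_l; [apply Rmult_le_pos; lra|]. apply Rmult_le_compat_l; [lra|].
      apply Rmult_le_reg_r with (INR i * INR (S i)); [apply Rmult_lt_0_compat; lra|].
      replace (/ INR i * (INR i * INR (S i))) with (INR (S i)) by (field; lra).
      replace (2 / INR (S i) * (INR i * INR (S i))) with (2 * INR i) by (field; lra). exact HSi. }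
  destruct (cauchy_of_inv_bound (fun j => xu j T1) D2 j0 HD2) as (xl & Hxl).
  { intros i j Hi Hij. specialize (Hcau i j Hi Hij). unfold dist2 in Hcau. pose proof (pow2_ge_0 (yu i T1 - yu j T1)). lra. }
  destruct (cauchy_of_inv_bound (fun j => yu j T1) D2 j0 HD2) as (yl & Hyl).
  { intros i j Hi Hij. specialize (Hcau i j Hi Hij). unfold dist2 in Hcau. pose proof (pow2_ge_0 (xu i T1 - xu j T1)). lra. }
  destruct (zsol_exists lam nu m Hm T1 xl yl) as (x & y & Ex & Ey & Hz).
  (* The bound passes to the limit at each fixed t by continuous dependence on [T1, t]; the factor 2
     comes from the triangle inequality. *)
  assert (HSx : forall t, T1 <= t -> dist2 x y (xs n1) (ys n1) t <= 2 * (D1 / t ^ (L + 20))).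
  { intros t Ht. apply le_epsilon. intros eps Heps.
    set (Bd := (Rabs xl + 1) ^ 2 + (Rabs yl + 1) ^ 2).
    destruct (zsol_dependence lam nu m Hm T1 t Bd Ht) as (Ld & HLd & Hdep).
    set (del := Rmin 1 (eps / (4 * (Ld + 1)))).
    assert (Hdel : 0 < del).
    { apply Rmin_pos; [lra|]. apply Rdiv_lt_0_compat; lra. }
    assert (Hdel1 : del <= 1) by apply Rmin_l.
    assert (Hdel2 : del <= eps / (4 * (Ld + 1))) by apply Rmin_r.
    destruct (is_lim_seq_evt_close _ _ del Hxl Hdel) as (ja & Hja).
    destruct (is_lim_seq_evt_close _ _ del Hyl Hdel) as (jb & Hjb).
    destruct (INR_unbounded t) as (jc & Hjc).
    set (j := max ja (max jb jc)).
    specialize (Hja j ltac:(lia)). specialize (Hjb j ltac:(lia)).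
    assert (Htj : t <= INR j) by (apply Rle_trans with (INR jc); [lra|apply le_INR; lia]).
    assert (Hq : forall u v, Rabs (u - v) < del -> u ^ 2 <= (Rabs v + 1) ^ 2).
    { intros u v Huv. rewrite <- (pow2_abs u). apply pow_incr. split; [apply Rabs_pos|].
      replace u with ((u - v) + v) by ring. pose proof (Rabs_triang (u - v) v). lra. }
    assert (Hsq : forall u, Rabs u < del -> u ^ 2 <= del).
    { intros u Hu. rewrite <- (pow2_abs u). pose proof (Rabs_pos u). nra. }
    specialize (Hdep x y (xu j) (yu j) Hz (HUz j)).
    rewrite Ex, Ey in Hdep.
    assert (Hdep' : dist2 x y (xu j) (yu j) t <= Ld * ((xl - xu j T1) ^ 2 + (yl - yu j T1) ^ 2)).
    { apply Hdep; [| |lra].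
      - unfold Bd. apply Rplus_le_compat; apply Hq; rewrite Rminus_diag, Rabs_R0; exact Hdel.
      - unfold Bd. apply Rplus_le_compat; apply Hq; assumption. }
    rewrite Rabs_minus_sym in Hja, Hjb. apply Hsq in Hja. apply Hsq in Hjb.
    pose proof (dist2_triangle x y (xu j) (yu j) (xs n1) (ys n1) t) as Htri.
    pose proof (HS1 j t ltac:(lra)) as Hj.
    assert (Ld * ((xl - xu j T1) ^ 2 + (yl - yu j T1) ^ 2) <= eps / 2).
    { apply Rle_trans with (Ld * (2 * (eps / (4 * (Ld + 1))))); [apply Rmult_le_compat_l; lra|].
      replace (Ld * (2 * (eps / (4 * (Ld + 1))))) with (eps / 2 * (Ld / (Ld + 1))) by (field; lra).
      rewrite <- (Rmult_1_r (eps / 2)) at 2. apply Rmult_le_compat_l; [lra|].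
      apply Rmult_le_reg_r with (Ld + 1); [lra|]. unfold Rdiv. rewrite Rmult_assoc, Rinv_l; lra. }
    lra. }
  assert (Htrx : forall t, T1 <= t -> trapped x y t).
  { intros t Ht. pose proof (dist2_triangle x y (xs n1) (ys n1) X0 Y0 t) as Htri.
    specialize (HSx t Ht). specialize (Hsmall t Ht). specialize (Htr t ltac:(lra)).
    assert (0 < t ^ 10) by (apply pow_lt; lra). unfold trap.
    assert (t ^ 10 * dist2 x y X0 Y0 t <= t ^ 10 * (4 * (D1 / t ^ (L + 20)) + 2 * dist2 (xs n1) (ys n1) X0 Y0 t))
      by (apply Rmult_le_compat_l; lra). lra. }
  exists x, y. split; [exact Hz|].
  intros N. destruct (fam_res Hfam (L + 6 + N)) as (n2 & Hn2).
  exists (max n1 n2). intros n Hn.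
  destruct (Hn2 n ltac:(lia)) as (C' & Tr & HC' & Hres').
  destruct (Hnc n ltac:(lia)) as (Tt & Htr').
  destruct (Hnb n1 n ltac:(lia) ltac:(lia)) as (Cc & Tcc & HCc & Hclose).
  set (T2 := Rmax T1 (Rmax Tr (Rmax Tt Tcc))).
  assert (HT2 : T1 <= T2 /\ Tr <= T2 /\ Tt <= T2 /\ Tcc <= T2).
  { unfold T2. pose proof (Rmax_l T1 (Rmax Tr (Rmax Tt Tcc))). pose proof (Rmax_r T1 (Rmax Tr (Rmax Tt Tcc))).
    pose proof (Rmax_l Tr (Rmax Tt Tcc)). pose proof (Rmax_r Tr (Rmax Tt Tcc)).
    pose proof (Rmax_l Tt Tcc). pose proof (Rmax_r Tt Tcc). lra. }
  exists (C0 * C' ^ 2), T2. split; [apply Rmult_le_pos; [lra|apply pow2_ge_0]|].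
  intros a Ha. assert (Ha1 : 1 <= a) by lra.
  (* b tends to infinity: the closeness O(b^-(L+2)) already known at b beats the weight b^(L+1), and
     only the residual of the n-th approximation remains. *)
  apply (le_of_le_plus_div _ _ (C0 * a * (4 * D1 + 2 * Cc)) a); [lra|].
  intros b Hab.
  assert (Hx := HD (L + 6 + N)%nat N C' x y (xs n) (ys n) (fxs n) (fys n) a b ltac:(lia) HC' ltac:(lra) Hz).
  assert (Hxx : a ^ L * dist2 x y (xs n) (ys n) a <= C0 * a * (b ^ S L * dist2 x y (xs n) (ys n) b + C' ^ 2 / a ^ S N)).
  { apply Hx. intros t Ht. destruct (Hres' t ltac:(lra)) as [H1 H2].
    split; [exact H1|split; [exact H2|split; [apply Htrx; lra|]]].
    unfold trap. specialize (Htr' t ltac:(lra)). lra. }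
  assert (Hb1 : 1 <= b) by lra.
  assert (Hbd : b ^ S L * dist2 x y (xs n) (ys n) b <= (4 * D1 + 2 * Cc) / b).
  { pose proof (dist2_triangle x y (xs n1) (ys n1) (xs n) (ys n) b) as Htri.
    specialize (HSx b ltac:(lra)). specialize (Hclose b ltac:(lra)).
    assert (D1 / b ^ (L + 20) <= D1 / b ^ (L + 2)).
    { apply Rmult_le_compat_l; [lra|]. apply inv_pow_mono; [lra|lia]. }
    replace ((4 * D1 + 2 * Cc) / b) with (b ^ S L * (4 * (D1 / b ^ (L + 2)) + 2 * (Cc / b ^ (L + 2)))).
    - apply Rmult_le_compat_l; [apply pow_le; lra|lra].
    - replace (L + 2)%nat with (S L + 1)%nat by lia. rewrite pow_add, pow_1. field.
      nz. }
  assert (Hfin : C0 * a * ((4 * D1 + 2 * Cc) / b + C' ^ 2 / a ^ S N) =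
     C0 * C' ^ 2 / a ^ N + C0 * a * (4 * D1 + 2 * Cc) / b).
  { change (a ^ S N) with (a * a ^ N). field. nz. }
  rewrite <- Hfin. eapply Rle_trans; [|apply Rmult_le_compat_l; [apply Rmult_le_pos; lra|apply Rplus_le_compat_r; exact Hbd]].
  eapply Rle_trans; [|exact Hxx]. rewrite <- (Rmult_1_l (dist2 _ _ _ _ a)) at 1.
  apply Rmult_le_compat_r; [apply dist2_nonneg|]. apply pow_ge_1; lra.
Qed.

End CenterExistence.

(** * The saddle case *)

Lemma bootstrap_forward (f : R -> R) (a b : R) :
  (forall t, a <= t <= b -> continuous f t) -> f a < 1 ->
  (forall c, a <= c <= b -> (forall t, a <= t <= c -> f t <= 1) -> f c < 1) ->
  forall t, a <= t <= b -> f t < 1.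
Proof.
  intros Hc Ha H t Ht.
  replace t with (- - t) by ring.
  apply (bootstrap_backward (fun s => f (- s)) (- b) (- a)); [| | |lra].
  - intros s Hs. apply (continuous_comp (fun s => - s) f); [cont|]. apply Hc. lra.
  - now rewrite Ropp_involutive.
  - intros c Hcc Hle. apply H; [lra|]. intros s Hs. specialize (Hle (- s) ltac:(lra)).
    now rewrite Ropp_involutive in Hle.
Qed.

(** Connectedness of [-s0, s0], through the supremum of the set where Em holds. Each exit event
    comes in two strengths because it need not be open: H persists under perturbation only in the
    weaker form E, and it is the weak forms that exclude each other. *)
Lemma shooting (s0 : R) (Ep Em Hp Hm : R -> Prop) : 0 <= s0 ->
  (forall s, Rabs s <= s0 -> Hp s -> exists d, 0 < d /\ forall s', Rabs s' <= s0 -> Rabs (s' - s) < d -> Ep s') ->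
  (forall s, Rabs s <= s0 -> Hm s -> exists d, 0 < d /\ forall s', Rabs s' <= s0 -> Rabs (s' - s) < d -> Em s') ->
  (forall s, Rabs s <= s0 -> Ep s -> Em s -> False) -> Ep s0 -> Em (- s0) ->
  exists s, Rabs s <= s0 /\ ~ Hp s /\ ~ Hm s.
Proof.
  intros H0 Hpo Hmo Hdis Hep Hem.
  destruct (completeness (fun s => Rabs s <= s0 /\ Em s)) as (s & Hub & Hlub).
  - exists s0. intros s [Hs _]. apply Rabs_le_between in Hs. lra.
  - exists (- s0). split; [rewrite Rabs_Ropp, Rabs_pos_eq; lra|exact Hem].
  - assert (Hs : Rabs s <= s0).
    { apply Rabs_le. split.
      - apply Hub. split; [rewrite Rabs_Ropp, Rabs_pos_eq; lra|exact Hem].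
      - apply Hlub. intros t [Ht _]. apply Rabs_le_between in Ht. lra. }
    exists s. split; [exact Hs|]. pose proof Hs as Hs'. apply Rabs_le_between in Hs'. split.
    + intros Hps. destruct (Hpo s Hs Hps) as (d & Hd & Hdd).
      assert (s <= s - d); [|lra]. apply Hlub. intros t [Ht Hmt].
      destruct (Rle_dec t (s - d)) as [|Hn]; [assumption|exfalso].
      assert (t <= s) by (apply Hub; split; assumption).
      apply (Hdis t Ht); [|exact Hmt]. apply Hdd; [exact Ht|]. rewrite Rabs_left1; lra.
    + intros Hms. destruct (Hmo s Hs Hms) as (d & Hd & Hdd).
      destruct (Req_dec s s0) as [->|Hne].
      * apply (Hdis s0 Hs Hep). apply Hdd; [exact Hs|]. rewrite Rminus_diag, Rabs_R0. exact Hd.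
      * set (t := s + Rmin (d / 2) (s0 - s)).
        assert (0 < Rmin (d / 2) (s0 - s)) by (apply Rmin_pos; lra).
        pose proof (Rmin_l (d / 2) (s0 - s)). pose proof (Rmin_r (d / 2) (s0 - s)).
        assert (Ht : Rabs t <= s0) by (apply Rabs_le; unfold t; lra).
        assert (t <= s); [|unfold t in *; lra]. apply Hub. split; [exact Ht|].
        apply Hdd; [exact Ht|]. unfold t. rewrite Rabs_pos_eq; lra.
Qed.

(** exp t is the (n+1)-st power of exp (t / (n + 1)), which is at least t / (n + 1). *)
Lemma exp_ge_pow n t : 0 <= t -> (t / INR (S n)) ^ S n <= exp t.
Proof.
  intros Ht. assert (HS : 0 < INR (S n)) by (apply lt_0_INR; lia).
  assert (E : exp t = exp (t / INR (S n)) ^ S n).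
  { assert (X : forall k u, exp u ^ k = exp (INR k * u)).
    { intros j u. induction j as [|j IH]; [simpl; now rewrite Rmult_0_l, exp_0|].
      rewrite S_INR, <- tech_pow_Rmult, IH, <- exp_plus. f_equal. ring. }
    rewrite X. f_equal. field. lra. }
  rewrite E. apply pow_incr. split; [apply Rdiv_le_0_compat; lra|].
  pose proof (exp_ineq1_le (t / INR (S n))). lra.
Qed.

Lemma exp_neg_le_inv_pow n : exists C, 0 <= C /\ forall t, 1 <= t -> exp (- t) <= C / t ^ n.
Proof.
  assert (HS : 0 < INR (S n)) by (apply lt_0_INR; lia).
  exists (INR (S n) ^ S n). split; [apply pow_le; lra|]. intros t Ht.
  assert (Htp : 0 < t ^ S n) by (apply pow_lt; lra).
  assert (Hn : 0 < t ^ n) by (apply pow_lt; lra).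
  pose proof (exp_ge_pow n t ltac:(lra)) as H.
  rewrite exp_Ropp. unfold Rdiv in H. rewrite Rpow_mult_distr, pow_inv in H.
  assert (HSp : 0 < INR (S n) ^ S n) by (apply pow_lt; lra).
  apply Rle_trans with (INR (S n) ^ S n / t ^ S n).
  - replace (INR (S n) ^ S n / t ^ S n) with (/ (t ^ S n * / INR (S n) ^ S n)) by (field; lra).
    apply Rinv_le_contravar; [|exact H]. apply Rmult_lt_0_compat; [exact Htp|now apply Rinv_0_lt_compat].
  - apply Rmult_le_compat_l; [lra|]. apply inv_pow_mono; [exact Ht|lia].
Qed.

Ltac unfold_fr := unfold frP, frQ.

Section Saddle.

Variables (lam nu : R) (m : R -> R).
Hypothesis Hm : forall t, continuous m t.
Variables (rho0 psi0 g A B c A' B' c' : R -> R) (k K T0 : R).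
Hypothesis HF : frame lam nu m rho0 psi0 g A B c A' B' c' k K T0.
Hypothesis HB : forall t, T0 <= t -> B t < 0.

Local Notation approx := (approx_at lam nu m).
Local Notation X0 := (fx0 rho0 psi0).
Local Notation Y0 := (fy0 rho0 psi0).
Local Notation trapped := (trap rho0 psi0).
Local Notation frP := (frP psi0).
Local Notation frQ := (frQ psi0).

(* For B < 0 the derivative of V = p q is W up to errors and W dominates |V|: a solution with V > 0 leaves the trap,
   and along a trapped one both V and Y = W - Lam t V are eventually negligible. *)
Definition hypW (x1 y1 x2 y2 : R -> R) (t : R) : R :=
  A t * frP x1 y1 x2 y2 t ^ 2 - B t * frQ x1 y1 x2 y2 t ^ 2.
Definition hypV (x1 y1 x2 y2 : R -> R) (t : R) : R := frP x1 y1 x2 y2 t * frQ x1 y1 x2 y2 t.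
Definition hypY (Lam : R) (x1 y1 x2 y2 : R -> R) (t : R) : R :=
  hypW x1 y1 x2 y2 t - Lam * t * hypV x1 y1 x2 y2 t.

Lemma hypW_bounds x1 y1 x2 y2 t : T0 <= t ->
  k / t * dist2 x1 y1 x2 y2 t <= hypW x1 y1 x2 y2 t <= K * t * dist2 x1 y1 x2 y2 t /\
  8 * Rabs (hypV x1 y1 x2 y2 t) <= hypW x1 y1 x2 y2 t.
Proof.
  intros Ht0.
  frame_constants HF.
  frame_at HF t Ht0.
  assert (Ht1 : 1 <= t) by lra.
  rewrite <- (frPQ_norm psi0 x1 y1 x2 y2 t). unfold hypW, hypV.
  set (P := frP x1 y1 x2 y2 t) in *. set (Q := frQ x1 y1 x2 y2 t) in *.
  pose proof (PQ_le_W k K t (A t) (B t) P Q Hk Ht1 HA1 HB1 HAB) as HPQ.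
  pose proof (W_lower k K t (A t) (B t) P Q Hk Ht1 HA1 HB1) as Hl.
  pose proof (W_upper k K t (A t) (B t) P Q HK Ht1 HA1 HB1) as Hup.
  rewrite (Rabs_left (B t)) in HPQ, Hl, Hup by now apply HB. lra.
Qed.

(** V' equals W up to a relative error of at most 1/2 for large t and a residual, and |V| <= W/8,
    whence V' >= V minus the residual. The derivative of W has no sign, its term -4 A B P Q being
    possibly of size t W; subtracting Lam t V, whose derivative contributes about Lam t W/2, turns
    W' <= L t W into Y' <= -Y up to residuals. *)
Lemma saddle_step : exists T1 Lam D, T0 <= T1 /\ 0 <= Lam /\ 0 <= D /\
  forall x1 y1 x2 y2 fx fy t, T1 <= t -> zsol lam nu m x1 y1 -> approx x2 y2 fx fy t ->
    trapped x1 y1 t -> trapped x2 y2 t ->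
    exists lV lY, is_derive (hypV x1 y1 x2 y2) t lV /\ is_derive (hypY Lam x1 y1 x2 y2) t lY /\
      hypV x1 y1 x2 y2 t - t ^ 4 * (Rabs (fx t) + Rabs (fy t)) ^ 2 <= lV /\
      lY <= - hypY Lam x1 y1 x2 y2 t + D * (t ^ 4 * (Rabs (fx t) + Rabs (fy t)) ^ 2).
Proof.
  frame_constants HF.
  assert (Hkk : 0 <= 164 * K ^ 2 / k) by (apply Rdiv_le_0_compat; nra).
  set (L := 3 * K + 2 + K ^ 2 + 164 * K ^ 2 / k).
  assert (HL : 0 <= L) by (unfold L; nra).
  (* Large enough for L t + Lam/8 - 3/8 Lam t + 1 <= 0 whenever t >= 1. *)
  set (Lam := 4 * (L + 2)).
  (* From t = 84 K / k on, the relative error 42 K / (k t) in V' is at most 1/2. *)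
  exists (Rmax T0 (84 * K / k)), Lam, (L + Lam).
  split; [apply Rmax_l|]. split; [unfold Lam; lra|]. split; [unfold Lam; lra|].
  intros x1 y1 x2 y2 fx fy t Ht Hz Ha2 Tr1 Tr2.
  assert (Ht0 : T0 <= t) by (pose proof (Rmax_l T0 (84 * K / k)); lra).
  assert (HtK : 84 * K / k <= t) by (pose proof (Rmax_r T0 (84 * K / k)); lra).
  assert (Ht1 : 1 <= t) by lra.
  destruct (pair_linear _ _ _ _ _ _ _ _ _ _ _ _ _ _ _ HF x1 y1 x2 y2 fx fy t Ht0
     (zsol_approx _ _ _ _ _ t Hz) Ha2 Tr1 Tr2) as (e1 & e2 & DP & DQ & b1 & b2).
  frame_at HF t Ht0.
  destruct (hypW_bounds x1 y1 x2 y2 t Ht0) as [_ HVW].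
  set (F := Rabs (fx t) + Rabs (fy t)) in *.
  set (P := frP x1 y1 x2 y2) in *. set (Q := frQ x1 y1 x2 y2) in *.
  assert (EB : Rabs (B t) = - B t) by (apply Rabs_left; now apply HB).
  assert (EW : hypW x1 y1 x2 y2 t = A t * P t ^ 2 + Rabs (B t) * Q t ^ 2).
  { unfold hypW. fold P Q. rewrite EB. ring. }
  assert (HKt : K <= K * t) by nra.
  assert (HApos : 0 < A t) by nra.
  pose proof (Rabs_pos (P t)) as PP. pose proof (Rabs_pos (Q t)) as PQ0.
  assert (Hs : 0 <= Rabs (P t) + Rabs (Q t)) by lra.
  assert (Hu : Rabs (A t * P t) <= K * t * (Rabs (P t) + Rabs (Q t))).
  { rewrite !Rabs_mult, (Rabs_pos_eq (A t)) by lra. apply Rmult_le_compat; lra. }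
  assert (Hv : Rabs (- (B t * Q t)) <= K * t * (Rabs (P t) + Rabs (Q t))).
  { rewrite Rabs_Ropp, !Rabs_mult. apply Rmult_le_compat; try lra. apply Rabs_pos. }
  pose proof (error_term_le k K t (A t) (B t) (P t) (Q t) e1 e2 F Hk HK Ht1 HA1 HB1 b1 b2 _ _ Hu Hv) as Herr.
  pose proof (product_error_le k K t (A t) (B t) (P t) (Q t) e1 e2 F Hk HK Ht1 HA1 HB1 b1 b2) as Hper.
  rewrite <- EW in Herr, Hper.
  set (W := hypW x1 y1 x2 y2 t) in *.
  set (V := hypV x1 y1 x2 y2 t) in *.
  assert (EV : V = P t * Q t) by reflexivity.
  assert (HW0 : 0 <= W) by (pose proof (Rabs_pos V); lra).
  set (z := / t) in *. assert (Hz0 : 0 < z) by (apply Rinv_0_lt_compat; lra).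
  assert (Hz1 : z <= 1) by (unfold z; rewrite <- Rinv_1; apply Rinv_le_contravar; lra).
  assert (Etz : t * z = 1) by (unfold z; field; lra).
  assert (HF2 : t ^ 2 * F ^ 2 <= t ^ 4 * F ^ 2).
  { apply Rmult_le_compat_r; [apply pow2_ge_0|]. apply pow_mono; [lra|lia]. }
  assert (HF3 : 0 <= t ^ 4 * F ^ 2) by (apply Rmult_le_pos; [apply pow_le; lra|apply pow2_ge_0]).
  set (lV := A t * P t ^ 2 - B t * Q t ^ 2 + (e1 * Q t + e2 * P t)).
  set (lW := A' t * P t ^ 2 - B' t * Q t ^ 2 - 2 * c t * (A t * P t ^ 2 + B t * Q t ^ 2)
     - 4 * (A t * B t) * (P t * Q t) + (2 * (A t * P t) * e1 + 2 * (- (B t * Q t)) * e2)).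
  assert (DV : is_derive (hypV x1 y1 x2 y2) t lV).
  { unfold hypV. fold P Q. auto_derive; [repeat split; eexists; eassumption|].
    rewrite_derive.
    unfold lV. ring. }
  assert (DW : is_derive (hypW x1 y1 x2 y2) t lW).
  { unfold hypW. fold P Q. auto_derive; [repeat split; eexists; eassumption|].
    rewrite_derive.
    unfold lW. ring. }
  assert (Hk84 : 42 * K / k * z <= 1 / 2).
  { apply Rmult_le_reg_r with t; [lra|]. rewrite Rmult_assoc, (Rmult_comm z), Etz. unfold Rdiv in *. lra. }
  assert (HlV : W / 2 - t ^ 2 * F ^ 2 <= lV).
  { apply Rabs_le_between in Hper. change (42 * K / k / t) with (42 * K / k * z) in Hper.
    assert (42 * K / k * z * W <= 1 / 2 * W) by (now apply Rmult_le_compat_r).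
    assert (W = A t * P t ^ 2 - B t * Q t ^ 2) by reflexivity. unfold lV. lra. }
  assert (HlW : lW <= L * t * W + L * (t ^ 4 * F ^ 2)).
  { apply Rabs_le_between in Herr. change (164 * K ^ 2 / k / t) with (164 * K ^ 2 / k * z) in Herr.
    assert (X1 : A' t * P t ^ 2 - B' t * Q t ^ 2 <= K * W).
    { apply Rabs_le_between in HA2. apply Rabs_le_between in HB2.
      unfold Rdiv in HA2, HB2. fold z in HA2, HB2. pose proof (pow2_ge_0 (P t)). pose proof (pow2_ge_0 (Q t)).
      assert (Y1 : A' t * P t ^ 2 <= K * z * A t * P t ^ 2) by (apply Rmult_le_compat_r; lra).
      assert (Y2 : - B' t * Q t ^ 2 <= K * z * Rabs (B t) * Q t ^ 2) by (apply Rmult_le_compat_r; lra).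
      assert (Y3 : K * z * W <= K * W).
      { rewrite Rmult_assoc. apply Rmult_le_compat_l; [lra|]. rewrite <- (Rmult_1_l W) at 2. now apply Rmult_le_compat_r. }
      rewrite EW in Y3 |- *. lra. }
    assert (X2 : - (2 * c t * (A t * P t ^ 2 + B t * Q t ^ 2)) <= 2 * W).
    { assert (Rabs (c t * (A t * P t ^ 2 + B t * Q t ^ 2)) <= 1 * W).
      { rewrite Rabs_mult. apply Rmult_le_compat; try apply Rabs_pos; [exact Hc1|].
        rewrite EW, EB. pose proof (pow2_ge_0 (P t)). pose proof (pow2_ge_0 (Q t)).
        pose proof (HB t Ht0).
        assert (0 <= A t * P t ^ 2) by (apply Rmult_le_pos; lra).
        assert (0 <= - B t * Q t ^ 2) by (apply Rmult_le_pos; lra).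
        apply Rabs_le; lra. }
      apply Rabs_le_between in H. lra. }
    assert (X3 : - (4 * (A t * B t) * (P t * Q t)) <= K ^ 2 * t * W).
    { assert (HAB' : A t * Rabs (B t) <= K * t * K) by (apply Rmult_le_compat; try lra; apply Rabs_pos).
      assert (Rabs ((A t * B t) * (P t * Q t)) <= (K * t * K) * (1 / 8 * W)).
      { rewrite Rabs_mult. apply Rmult_le_compat; try apply Rabs_pos.
        - rewrite Rabs_mult, (Rabs_pos_eq (A t)) by lra. exact HAB'.
        - rewrite <- EV. lra. }
      apply Rabs_le_between in H. assert (0 <= K * t * K * W) by (apply Rmult_le_pos; [nra|lra]). nra. }
    assert (HtW : W <= t * W) by nra.
    assert (X4 : 164 * K ^ 2 / k * z * W <= 164 * K ^ 2 / k * (t * W)).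
    { rewrite Rmult_assoc. apply Rmult_le_compat_l; [exact Hkk|].
      assert (z * W <= 1 * W) by (apply Rmult_le_compat_r; lra). lra. }
    assert (X5 : 2 * K * (t ^ 4 * F ^ 2) <= L * (t ^ 4 * F ^ 2)).
    { apply Rmult_le_compat_r; [exact HF3|]. unfold L. nra. }
    assert (X6 : (K + 2) * W <= (K + 2) * (t * W)) by (apply Rmult_le_compat_l; lra).
    assert (X7 : 0 <= K * (t * W)) by (apply Rmult_le_pos; lra).
    replace (L * t * W) with ((K + 2) * (t * W) + 2 * (K * (t * W)) + K ^ 2 * t * W + 164 * K ^ 2 / k * (t * W))
      by (unfold L; ring).
    unfold lW. lra. }
  exists lV, (lW - (Lam * V + Lam * t * lV)). split; [exact DV|]. split; [|split].
  - unfold hypY. apply (is_derive_minus (hypW x1 y1 x2 y2) (fun t => Lam * t * hypV x1 y1 x2 y2 t)); [exact DW|].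
    auto_derive; [repeat split; eexists; eassumption|].
    rewrite_derive.
    fold V. ring.
  - pose proof (Rle_abs V). lra.
  - unfold hypY. fold W V.
    assert (HLt : 0 <= Lam * t) by (unfold Lam; nra).
    assert (HV8 : Rabs V <= W / 8) by lra. apply Rabs_le_between in HV8.
    assert (HLam : 0 <= Lam) by (unfold Lam; lra).
    assert (Z1 : Lam * (- V) <= Lam * (W / 8)) by (apply Rmult_le_compat_l; lra).
    assert (Z2 : Lam * t * (W / 2 - t ^ 2 * F ^ 2) <= Lam * t * lV) by (apply Rmult_le_compat_l; lra).
    assert (Z3 : Lam * t * (- V) <= Lam * t * (W / 8)) by (apply Rmult_le_compat_l; lra).
    assert (Z4 : Lam * t * (t ^ 2 * F ^ 2) <= Lam * (t ^ 4 * F ^ 2)).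
    { replace (Lam * t * (t ^ 2 * F ^ 2)) with (Lam * (t ^ 3 * F ^ 2)) by ring.
      apply Rmult_le_compat_l; [exact HLam|]. apply Rmult_le_compat_r; [apply pow2_ge_0|].
      apply pow_mono; [lra|lia]. }
    assert (Z5 : W * (L * t + Lam / 8 - 3 / 8 * (Lam * t) + 1) <= 0).
    { assert (L * t + Lam / 8 - 3 / 8 * (Lam * t) + 1 <= 0) by (unfold Lam; nra). nra. }
    lra.
Qed.

Definition even_pow (t : R) (N : nat) : R := t ^ (2 * N).

(** The two differential inequalities in integrated form. The term C^2 / t^(2N) dominates t^4 F^2
    and is decreasing, which suits V; for Y its slope must stay below half its size, hence the
    condition 4 N <= a. *)
Lemma saddle_window : exists T1 Lam D, T0 <= T1 /\ 0 <= Lam /\ 0 <= D /\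
  forall N C x1 y1 x2 y2 fx fy a b, 0 <= C -> T1 <= a <= b -> zsol lam nu m x1 y1 ->
  (forall t, a <= t <= b -> approx x2 y2 fx fy t /\ Rabs (fx t) + Rabs (fy t) <= C / t ^ (N + 2) /\
      trapped x1 y1 t /\ trapped x2 y2 t) ->
  (hypV x1 y1 x2 y2 a - C ^ 2 / even_pow a N) * exp (- a) <= (hypV x1 y1 x2 y2 b - C ^ 2 / even_pow b N) * exp (- b) /\
  (INR (4 * N) <= a ->
   (hypY Lam x1 y1 x2 y2 b - 2 * D * (C ^ 2 / even_pow b N)) * exp b
     <= (hypY Lam x1 y1 x2 y2 a - 2 * D * (C ^ 2 / even_pow a N)) * exp a).
Proof.
  pose proof (fr_T0 HF) as HT0.
  destruct saddle_step as (T1 & Lam & D & HT1 & HLam & HD & Hst).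
  exists T1, Lam, D. split; [exact HT1|]. split; [exact HLam|]. split; [exact HD|].
  intros N C x1 y1 x2 y2 fx fy a b HC Hab Hz Hap.
  set (r := fun t => C ^ 2 / t ^ (2 * N)).
  set (r' := fun t => C ^ 2 * - (INR (2 * N) / t ^ S (2 * N))).
  assert (Hr : forall t, 0 < t -> is_derive r t (r' t)).
  { intros t Ht. apply (is_derive_scal (fun t => / t ^ (2 * N))). now apply is_derive_inv_tpow. }
  assert (Hr0 : forall t, 0 < t -> 0 <= r t).
  { intros t Ht. apply Rdiv_le_0_compat; [apply pow2_ge_0|now apply pow_lt]. }
  assert (Hr' : forall t, 0 < t -> r' t = - (INR (2 * N) / t * r t)).
  { intros t Ht. unfold r', r. change (t ^ S (2 * N)) with (t * t ^ (2 * N)). field. nz. }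
  assert (Hr'0 : forall t, 0 < t -> r' t <= 0).
  { intros t Ht. rewrite Hr' by exact Ht.
    assert (0 <= INR (2 * N) / t * r t); [|lra].
    apply Rmult_le_pos; [apply Rdiv_le_0_compat; [apply pos_INR|exact Ht]|now apply Hr0]. }
  assert (HG : forall t, a <= t <= b -> t ^ 4 * (Rabs (fx t) + Rabs (fy t)) ^ 2 <= r t).
  { intros t Ht. destruct (Hap t Ht) as (_ & H & _). assert (Ht1 : 1 <= t) by lra.
    pose proof (Rabs_pos (fx t)). pose proof (Rabs_pos (fy t)).
    apply Rle_trans with (t ^ 4 * (C / t ^ (N + 2)) ^ 2).
    - apply Rmult_le_compat_l; [apply pow_le; lra|]. apply pow_incr. lra.
    - right. unfold r. replace (t ^ (2 * N)) with (t ^ N * t ^ N) by (rewrite <- pow_add; f_equal; lia).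
      rewrite pow_add. field. nz. }
  assert (Hde : forall (sg : R) (f : R -> R) t l, is_derive f t l ->
     is_derive (fun t => f t * exp (sg * t)) t ((l + sg * f t) * exp (sg * t))).
  { intros sg f t l Hf. auto_derive; [repeat split; eexists; eassumption|].
    rewrite_derive. ring. }
  unfold even_pow. fold (r a) (r b). split.
  - assert (X : (hypV x1 y1 x2 y2 a - r a) * exp (-1 * a) <= (hypV x1 y1 x2 y2 b - r b) * exp (-1 * b)).
    { apply (derive_ex_nonneg_le (fun t => (hypV x1 y1 x2 y2 t - r t) * exp (-1 * t))); [lra|].
      intros t Ht. destruct (Hap t Ht) as (H1 & H2 & H3 & H4).
      destruct (Hst x1 y1 x2 y2 fx fy t ltac:(lra) Hz H1 H3 H4) as (lV & lY & DV & _ & B1 & _).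
      eexists. split.
      - apply Hde. apply (is_derive_minus (hypV x1 y1 x2 y2) r); [exact DV|apply Hr; lra].
      - apply Rmult_le_pos; [|left; apply exp_pos]. specialize (HG t Ht). specialize (Hr'0 t ltac:(lra)).
        change (0 <= lV - r' t + -1 * (hypV x1 y1 x2 y2 t - r t)). lra. }
    replace (-1 * a) with (- a) in X by ring. replace (-1 * b) with (- b) in X by ring. exact X.
  - intros Ha4.
    assert (X : - ((hypY Lam x1 y1 x2 y2 a - 2 * D * r a) * exp (1 * a)) <= - ((hypY Lam x1 y1 x2 y2 b - 2 * D * r b) * exp (1 * b))).
    { apply (derive_ex_nonneg_le (fun t => - ((hypY Lam x1 y1 x2 y2 t - 2 * D * r t) * exp (1 * t)))); [lra|].
      intros t Ht. destruct (Hap t Ht) as (H1 & H2 & H3 & H4).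
      destruct (Hst x1 y1 x2 y2 fx fy t ltac:(lra) Hz H1 H3 H4) as (lV & lY & _ & DY & _ & B2).
      assert (Ht0 : 0 < t) by lra.
      eexists. split.
      - apply (is_derive_opp (fun t => (hypY Lam x1 y1 x2 y2 t - 2 * D * r t) * exp (1 * t))).
        apply Hde. apply (is_derive_minus (hypY Lam x1 y1 x2 y2) (fun t => 2 * D * r t)); [exact DY|].
        apply is_derive_scal. apply Hr; lra.
      - specialize (HG t Ht).
        change (0 <= - ((lY - 2 * D * r' t + 1 * (hypY Lam x1 y1 x2 y2 t - 2 * D * r t)) * exp (1 * t))).
        assert (Y1 : D * (t ^ 4 * (Rabs (fx t) + Rabs (fy t)) ^ 2) <= D * r t) by (apply Rmult_le_compat_l; lra).
        assert (Y2 : - (2 * D * r' t) <= D * r t).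
        { rewrite Hr' by exact Ht0.
          assert (INR (2 * N) / t <= 1 / 2).
          { apply Rmult_le_reg_r with t; [lra|]. unfold Rdiv. rewrite Rmult_assoc, Rinv_l by lra.
            rewrite mult_INR in Ha4 |- *. simpl in Ha4 |- *. lra. }
          replace (- (2 * D * - (INR (2 * N) / t * r t))) with (INR (2 * N) / t * (2 * (D * r t))) by ring.
          assert (0 <= D * r t) by (apply Rmult_le_pos; [exact HD|now apply Hr0]). nra. }
        pose proof (exp_pos (1 * t)). nra. }
    rewrite !Rmult_1_l in X. lra.
Qed.

Lemma pow_exp_decreasing n a b : INR n <= a -> 1 <= a -> a <= b -> b ^ n * exp (- b) <= a ^ n * exp (- a).
Proof.
  intros Hn Ha Hab.
  assert (X : - (a ^ n * exp (- a)) <= - (b ^ n * exp (- b))); [|lra].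
  apply (derive_ex_nonneg_le (fun t => - (t ^ n * exp (- t)))); [exact Hab|].
  intros t Ht. exists (- (INR n * t ^ pred n * exp (- t) - t ^ n * exp (- t))). split.
  - pose proof (is_derive_tpow n t) as H. set (u := fun t : R => t ^ n) in *.
    change (is_derive (fun t => - (u t * exp (- t))) t (- (INR n * t ^ pred n * exp (- t) - u t * exp (- t)))).
    auto_derive; [repeat split; eexists; eassumption|].
    rewrite_derive. ring.
  - pose proof (exp_pos (- t)).
    assert (INR n * t ^ pred n <= t ^ n).
    { destruct n as [|n]; [simpl; lra|]. simpl pred. rewrite <- tech_pow_Rmult.
      apply Rmult_le_compat_r; [apply pow_le; lra|lra]. }
    nra.
Qed.

Variables (xs ys fxs fys : nat -> R -> R).
Hypothesis Hfam : family lam nu m rho0 psi0 xs ys fxs fys.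

(** If V exceeded C^2 / t^(2N) once, the excess would grow like e^t, while the tube allows only a
    constant times K t. With V thus bounded, Y decays to the size of the residual, and W = Y + Lam t
    V bounds the distance. *)
Lemma saddle_decay x y T : T0 <= T -> zsol lam nu m x y -> (forall t, T <= t -> trapped x y t) ->
  tracked lam nu m xs ys x y.
Proof.
  frame_constants HF.
  (* One order in reserve: the passage from V and Y to the squared distance costs t^2. *)
  intros HT Hz Htr. split; [exact Hz|]. intros N0. set (N := S N0).
  destruct saddle_window as (T1 & Lam & D & HT1 & HLam & HD & Hw).
  destruct (fam_res Hfam (N + 2)) as (na & Hna).
  destruct (fam_trap Hfam) as (nc & Hnc).
  exists (max na nc). intros n Hn.
  destruct (Hna n ltac:(lia)) as (C & Ta & HC & Hres).
  destruct (Hnc n ltac:(lia)) as (Tc & Htrn).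
  set (T2 := Rmax (Rmax T T1) (Rmax (INR (4 * N)) (Rmax Ta Tc))).
  assert (HT2 : T <= T2 /\ T1 <= T2 /\ INR (4 * N) <= T2 /\ Ta <= T2 /\ Tc <= T2).
  { unfold T2. pose proof (Rmax_l (Rmax T T1) (Rmax (INR (4 * N)) (Rmax Ta Tc))).
    pose proof (Rmax_r (Rmax T T1) (Rmax (INR (4 * N)) (Rmax Ta Tc))).
    pose proof (Rmax_l T T1). pose proof (Rmax_r T T1).
    pose proof (Rmax_l (INR (4 * N)) (Rmax Ta Tc)). pose proof (Rmax_r (INR (4 * N)) (Rmax Ta Tc)).
    pose proof (Rmax_l Ta Tc). pose proof (Rmax_r Ta Tc). lra. }
  clearbody T2. destruct HT2 as (HT2a & HT2b & HT2c & HT2d & HT2e).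
  set (X := xs n) in *. set (Y := ys n) in *.
  assert (HS : forall t, T2 <= t -> dist2 x y X Y t <= 4).
  { intros t Ht. pose proof (dist2_triangle x y X0 Y0 X Y t) as H.
    specialize (Htr t ltac:(lra)). unfold trap in Htr. specialize (Htrn t ltac:(lra)).
    rewrite (dist2_sym X0 Y0) in H.
    assert (1 <= t ^ 10) by (apply pow_ge_1; lra).
    pose proof (dist2_nonneg x y X0 Y0 t). pose proof (dist2_nonneg X Y X0 Y0 t). nra. }
  assert (Hwin : forall a b, T2 <= a <= b ->
    (hypV x y X Y a - C ^ 2 / even_pow a N) * exp (- a) <= (hypV x y X Y b - C ^ 2 / even_pow b N) * exp (- b) /\
    (hypY Lam x y X Y b - 2 * D * (C ^ 2 / even_pow b N)) * exp b
     <= (hypY Lam x y X Y a - 2 * D * (C ^ 2 / even_pow a N)) * exp a).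
  { intros a b Hab. destruct (Hw N C x y X Y (fxs n) (fys n) a b HC ltac:(lra) Hz) as [W1 W2].
    - intros t Ht. destruct (Hres t ltac:(lra)) as [R1 R2]. split; [exact R1|]. split; [exact R2|].
      split; [apply Htr; lra|]. unfold trap. specialize (Htrn t ltac:(lra)). fold X Y in Htrn. lra.
    - split; [exact W1|apply W2; lra]. }
  assert (Hr0 : forall t, T2 <= t -> 0 <= C ^ 2 / even_pow t N).
  { intros t Ht. apply Rdiv_le_0_compat; [apply pow2_ge_0|apply pow_lt; lra]. }
  assert (HV : forall a, T2 <= a -> hypV x y X Y a <= C ^ 2 / even_pow a N).
  { intros a Ha. apply Rminus_le. 
    destruct (Rle_dec (hypV x y X Y a - C ^ 2 / even_pow a N) 0) as [|Hpos]; [assumption|exfalso].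
    assert (H0 : (hypV x y X Y a - C ^ 2 / even_pow a N) * exp (- a) <= 0).
    { destruct (exp_neg_le_inv_pow 2) as (E & HE0 & HE).
      apply (le_of_le_plus_div _ _ (4 * K * E) a); [lra|]. intros b Hab. rewrite Rplus_0_l.
      destruct (Hwin a b ltac:(lra)) as [W1 _]. eapply Rle_trans; [exact W1|].
      destruct (hypW_bounds x y X Y b ltac:(lra)) as [[_ Wb] Vb].
      specialize (HS b ltac:(lra)). specialize (Hr0 b ltac:(lra)).
      pose proof (Rle_abs (hypV x y X Y b)). pose proof (Rabs_pos (hypV x y X Y b)).
      assert (K * b * dist2 x y X Y b <= K * b * 4) by (apply Rmult_le_compat_l; [nra|exact HS]).
      pose proof (exp_pos (- b)). specialize (HE b ltac:(lra)).
      apply Rle_trans with (4 * K * b * (E / b ^ 2)).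
      - apply Rle_trans with (4 * K * b * exp (- b)); [apply Rmult_le_compat_r; lra|].
        apply Rmult_le_compat_l; [nra|exact HE].
      - right. field. lra. }
    pose proof (exp_pos (- a)). nra. }
  destruct (exp_neg_le_inv_pow (2 * N)) as (E & HE0 & HE).
  set (M := Rabs ((hypY Lam x y X Y T2 - 2 * D * (C ^ 2 / even_pow T2 N)) * exp T2)).
  assert (HM : 0 <= M) by apply Rabs_pos.
  set (G := / k * (2 * D * C ^ 2 + M * E + Lam * C ^ 2)).
  assert (HG : 0 <= G).
  { unfold G. apply Rmult_le_pos; [left; now apply Rinv_0_lt_compat|].
    pose proof (pow2_ge_0 C). pose proof (Rmult_le_pos D (C^2) HD H). pose proof (Rmult_le_pos M E HM HE0).
    pose proof (Rmult_le_pos Lam (C^2) HLam H). lra. }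
  exists G, T2. split; [exact HG|]. intros t Ht. assert (Ht1 : 1 <= t) by lra.
  destruct (Hwin T2 t ltac:(lra)) as [_ W2]. fold (even_pow t N) in W2.
  assert (Htp : 0 < even_pow t N) by (apply pow_lt; lra).
  assert (HY : hypY Lam x y X Y t <= 2 * D * (C ^ 2 / even_pow t N) + M * (E / even_pow t N)).
  { apply Rle_trans with (2 * D * (C ^ 2 / even_pow t N) + M * exp (- t)).
    - assert (hypY Lam x y X Y t - 2 * D * (C ^ 2 / even_pow t N) <= M * exp (- t)); [|lra].
      apply Rmult_le_reg_r with (exp t); [apply exp_pos|].
      rewrite (Rmult_assoc M), <- exp_plus, Rplus_opp_l, exp_0, Rmult_1_r.
      eapply Rle_trans; [exact W2|]. apply Rle_abs.
    - apply Rplus_le_compat_l. apply Rmult_le_compat_l; [exact HM|]. apply HE. lra. }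
  destruct (hypW_bounds x y X Y t ltac:(lra)) as [[Wl _] _].
  specialize (HV t Ht).
  assert (HWt : hypW x y X Y t <= t * (k * G / even_pow t N)).
  { replace (hypW x y X Y t) with (hypY Lam x y X Y t + Lam * t * hypV x y X Y t) by (unfold hypY; ring).
    assert (Lam * t * hypV x y X Y t <= Lam * t * (C ^ 2 / even_pow t N)) by (apply Rmult_le_compat_l; [nra|exact HV]).
    assert (E1 : t * (k * G / even_pow t N) = t * (2 * D * (C ^ 2 / even_pow t N) + M * (E / even_pow t N)) + Lam * t * (C ^ 2 / even_pow t N)).
    { unfold G. field. lra. }
    rewrite E1.
    assert (0 <= 2 * D * (C ^ 2 / even_pow t N) + M * (E / even_pow t N)).
    { specialize (Hr0 t Ht). assert (0 <= E / even_pow t N) by (apply Rdiv_le_0_compat; lra). nra. }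
    nra. }
  assert (HSt : dist2 x y X Y t <= t * t * (G / even_pow t N)).
  { apply Rmult_le_reg_l with (k / t); [apply Rdiv_lt_0_compat; lra|].
    eapply Rle_trans; [exact Wl|]. eapply Rle_trans; [exact HWt|]. right. field. lra. }
  eapply Rle_trans; [exact HSt|].
  unfold even_pow, N. replace (2 * S N0)%nat with (2 + (N0 + N0))%nat by lia. rewrite pow_add.
  replace (t * t * (G / (t ^ 2 * t ^ (N0 + N0)))) with (G * / t ^ (N0 + N0)) by (field; nz).
  apply Rmult_le_compat_l; [exact HG|]. apply inv_pow_mono; [exact Ht1|lia].
Qed.

Lemma frPQ_continuous x y x' y' t : T0 <= t ->
  continuous x t -> continuous y t -> continuous x' t -> continuous y' t ->
  continuous (frP x y x' y') t /\ continuous (frQ x y x' y') t.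
Proof.
  intros Ht C1 C2 C3 C4.
  pose proof (continuous_of_derive _ _ _ (fr_psi HF Ht)) as Hp.
  assert (continuous (fun s => cos (psi0 s)) t).
  { apply (continuous_comp psi0 cos); [exact Hp|]. apply continuity_pt_filterlim, continuity_cos. }
  assert (continuous (fun s => sin (psi0 s)) t).
  { apply (continuous_comp psi0 sin); [exact Hp|]. apply continuity_pt_filterlim, continuity_sin. }
  split; unfold_fr; cont.
Qed.

(* Shooting from the diagonal p = q = s at t = T: solutions that leave the trap do so with V > 0 and a definite sign
   of p, which depends on s openly; the margin 4 in Ex leaves room for the perturbation. *)
Lemma saddle_tracked : exists x y, tracked lam nu m xs ys x y.
Proof.
  frame_constants HF.
  destruct saddle_window as (T1 & Lam & D & HT1 & HLam & HD & Hw).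
  (* With N = 8 the residual level is r = C^2 / t^16; its share of t^10 [dist2], a multiple of t^12
     r, still decays. *)
  destruct (fam_res Hfam (8 + 2)) as (na & Hna).
  destruct (fam_trap Hfam) as (nc & Hnc).
  set (n := max na nc).
  destruct (Hna n ltac:(lia)) as (C & Ta & HC & Hres).
  destruct (Hnc n ltac:(lia)) as (Tc & Htrn).
  set (X := xs n) in *. set (Y := ys n) in *.
  set (M := / k * ((2 * D + Lam) * C ^ 2 + (2 * K + Lam))).
  (* C^2 + 1 gives r T < s0^2, so both end points of the shooting segment start beyond the level r.
     64 M + 64 gives M / T < 1/16 and exceeds the thresholds 32 = 4 N and 11 that occur below. *)
  set (T := Rmax (Rmax T1 (C ^ 2 + 1)) (Rmax (64 * M + 64) (Rmax Ta Tc))).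
  assert (HT : T1 <= T /\ C ^ 2 + 1 <= T /\ 64 * M + 64 <= T /\ Ta <= T /\ Tc <= T).
  { unfold T. pose proof (Rmax_l (Rmax T1 (C ^ 2 + 1)) (Rmax (64 * M + 64) (Rmax Ta Tc))).
    pose proof (Rmax_r (Rmax T1 (C ^ 2 + 1)) (Rmax (64 * M + 64) (Rmax Ta Tc))).
    pose proof (Rmax_l T1 (C ^ 2 + 1)). pose proof (Rmax_r T1 (C ^ 2 + 1)).
    pose proof (Rmax_l (64 * M + 64) (Rmax Ta Tc)). pose proof (Rmax_r (64 * M + 64) (Rmax Ta Tc)).
    pose proof (Rmax_l Ta Tc). pose proof (Rmax_r Ta Tc). lra. }
  clearbody T. destruct HT as (HTa & HTb & HTc & HTd & HTe).
  pose proof (pow2_ge_0 C) as HC2.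
  assert (HM : 0 <= M).
  { unfold M. apply Rmult_le_pos; [left; now apply Rinv_0_lt_compat|].
    pose proof (Rmult_le_pos (2 * D + Lam) (C ^ 2) ltac:(lra) HC2). lra. }
  assert (HT32 : 64 <= T) by lra.
  set (r := fun t => C ^ 2 / even_pow t 8).
  assert (Hr0 : forall t, T <= t -> 0 <= r t).
  { intros t Ht. apply Rdiv_le_0_compat; [exact HC2|apply pow_lt; lra]. }
  (* Small enough for T^10 s0^2 and T^12 s0^2 to be negative powers of T, yet s0^2 = T^-14 exceeds r
     T, which is C^2 T^-16. *)
  set (s0 := / T ^ 7). assert (Hs0 : 0 < s0) by (apply Rinv_0_lt_compat, pow_lt; lra).
  set (co := cos (psi0 T)). set (si := sin (psi0 T)).
  assert (Hcs : si * si + co * co = 1) by apply (sin2_cos2 (psi0 T)).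
  assert (HU : forall s : R, {p : (R -> R) * (R -> R) |
     fst p T = X T + s * (co - si) /\ snd p T = Y T + s * (si + co) /\ zsol lam nu m (fst p) (snd p)}).
  { intros s. apply constructive_indefinite_description.
    destruct (zsol_exists lam nu m Hm T (X T + s * (co - si)) (Y T + s * (si + co))) as (x & y & H).
    now exists (x, y). }
  set (xu := fun s => fst (proj1_sig (HU s))). set (yu := fun s => snd (proj1_sig (HU s))).
  assert (HUz : forall s, zsol lam nu m (xu s) (yu s)) by (intros s; apply (proj2_sig (HU s))).
  assert (HUx : forall s, xu s T = X T + s * (co - si)) by (intros s; apply (proj2_sig (HU s))).
  assert (HUy : forall s, yu s T = Y T + s * (si + co)) by (intros s; apply (proj2_sig (HU s))).
  clearbody xu yu.
  set (P := fun s => frP (xu s) (yu s) X Y). set (Q := fun s => frQ (xu s) (yu s) X Y).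
  set (V := fun s => hypV (xu s) (yu s) X Y). set (S := fun s => dist2 (xu s) (yu s) X Y).
  set (f := fun s t => t ^ 10 * dist2 (xu s) (yu s) X0 Y0 t).
  assert (HPT : forall s, P s T = s).
  { intros s. unfold P; unfold_fr. rewrite HUx, HUy. fold co si.
    transitivity (s * (si * si + co * co)); [ring|rewrite Hcs; ring]. }
  assert (HQT : forall s, Q s T = s).
  { intros s. unfold Q; unfold_fr. rewrite HUx, HUy. fold co si.
    transitivity (s * (si * si + co * co)); [ring|rewrite Hcs; ring]. }
  assert (HST : forall s, S s T = 2 * s ^ 2).
  { intros s. unfold S. rewrite <- (frPQ_norm psi0). change (P s T ^ 2 + Q s T ^ 2 = 2 * s ^ 2).
    rewrite HPT, HQT. ring. }
  assert (HVT : forall s, V s T = s ^ 2).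
  { intros s. change (P s T * Q s T = s ^ 2). rewrite HPT, HQT. ring. }
  assert (Hss : forall s, Rabs s <= s0 -> s ^ 2 <= s0 ^ 2).
  { intros s Hs. rewrite <- (pow2_abs s). apply pow_incr. split; [apply Rabs_pos|exact Hs]. }
  assert (Hxc : forall s t, continuous (xu s) t).
  { intros s t. destruct (HUz s t) as [H _]. exact (continuous_of_derive _ _ _ H). }
  assert (Hyc : forall s t, continuous (yu s) t).
  { intros s t. destruct (HUz s t) as [_ H]. exact (continuous_of_derive _ _ _ H). }
  assert (HXc : forall t, T <= t -> continuous X t /\ continuous Y t).
  { intros t Ht. destruct (Hres t ltac:(lra)) as [[R1 R2] _].
    split; eapply continuous_of_derive; eassumption. }
  assert (HPc : forall s t, T <= t -> continuous (P s) t /\ continuous (Q s) t).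
  { intros s t Ht. destruct (HXc t Ht). apply frPQ_continuous; auto. lra. }
  assert (Hwin : forall s b, T <= b -> (forall t, T <= t <= b -> f s t <= 1) -> forall a, T <= a <= b ->
    (V s a - r a) * exp (- a) <= (V s b - r b) * exp (- b) /\
    (hypY Lam (xu s) (yu s) X Y b - 2 * D * r b) * exp b
     <= (hypY Lam (xu s) (yu s) X Y a - 2 * D * r a) * exp a).
  { intros s b Hb Hf a Ha. destruct (Hw 8%nat C (xu s) (yu s) X Y (fxs n) (fys n) a b HC ltac:(lra) (HUz s)) as [W1 W2].
    - intros t Ht. destruct (Hres t ltac:(lra)) as [R1 R2]. split; [exact R1|]. split; [exact R2|].
      split; [apply Hf; lra|]. unfold trap. specialize (Htrn t ltac:(lra)). fold X Y in Htrn. lra.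
    - split; [exact W1|apply W2]. simpl INR. lra. }
  (* While V stays below r, the decay of Y keeps the solution strictly inside the tube, so leaving
     it requires V > r. *)
  assert (Hstrict : forall s c, Rabs s <= s0 -> T <= c -> (forall t, T <= t <= c -> f s t <= 1) ->
     V s c <= r c -> c ^ 10 * S s c < 1 / 16).
  { intros s c0 Hs Hc Hf HVc.
    destruct (Hwin s c0 Hc Hf T ltac:(lra)) as [_ W2].
    destruct (hypW_bounds (xu s) (yu s) X Y T ltac:(lra)) as [[_ WT] VT].
    destruct (hypW_bounds (xu s) (yu s) X Y c0 ltac:(lra)) as [[Wl _] _].
    change (dist2 (xu s) (yu s) X Y T) with (S s T) in WT. rewrite HST in WT.
    change (hypV (xu s) (yu s) X Y T) with (V s T) in VT. rewrite HVT in VT.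
    change (dist2 (xu s) (yu s) X Y c0) with (S s c0) in Wl.
    specialize (Hss s Hs). pose proof (pow2_ge_0 s) as Hs2.
    assert (HYT : hypY Lam (xu s) (yu s) X Y T <= (2 * K + Lam) * (T * s0 ^ 2)).
    { unfold hypY. change (hypV (xu s) (yu s) X Y T) with (V s T). rewrite HVT.
      assert (0 <= Lam * T * s ^ 2) by (apply Rmult_le_pos; [nra|exact Hs2]).
      assert (K * T * (2 * s ^ 2) <= K * T * (2 * s0 ^ 2)) by (apply Rmult_le_compat_l; nra).
      assert (0 <= Lam * (T * s0 ^ 2)) by (apply Rmult_le_pos; [lra|]; apply Rmult_le_pos; [lra|apply pow2_ge_0]).
      nra. }
    pose proof (Hr0 T (Rle_refl _)) as HrT. pose proof (Hr0 c0 Hc) as Hrc.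
    assert (HYc : hypY Lam (xu s) (yu s) X Y c0 <= 2 * D * r c0 + (2 * K + Lam) * (T * s0 ^ 2) * (exp T * exp (- c0))).
    { assert (hypY Lam (xu s) (yu s) X Y c0 - 2 * D * r c0 <= (2 * K + Lam) * (T * s0 ^ 2) * (exp T * exp (- c0))); [|lra].
      apply Rmult_le_reg_r with (exp c0); [apply exp_pos|].
      replace ((2 * K + Lam) * (T * s0 ^ 2) * (exp T * exp (- c0)) * exp c0) with
        ((2 * K + Lam) * (T * s0 ^ 2) * exp T * (exp (- c0) * exp c0)) by ring.
      rewrite <- exp_plus, Rplus_opp_l, exp_0, Rmult_1_r.
      eapply Rle_trans; [exact W2|]. apply Rmult_le_compat_r; [left; apply exp_pos|].
      assert (0 <= 2 * D * r T) by (apply Rmult_le_pos; lra). lra. }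
    assert (HWc : hypW (xu s) (yu s) X Y c0 <= (2 * D + Lam) * (c0 * r c0)
        + (2 * K + Lam) * (T * s0 ^ 2) * (exp T * exp (- c0))).
    { replace (hypW (xu s) (yu s) X Y c0) with (hypY Lam (xu s) (yu s) X Y c0 + Lam * c0 * V s c0) by (unfold hypY, V; ring).
      assert (Lam * c0 * V s c0 <= Lam * c0 * r c0) by (apply Rmult_le_compat_l; [nra|exact HVc]).
      assert (2 * D * r c0 <= 2 * D * (c0 * r c0)) by (apply Rmult_le_compat_l; [lra|nra]). lra. }
    assert (Hcp : 0 < c0 ^ 11) by (apply pow_lt; lra).
    assert (Hfin : c0 ^ 10 * S s c0 <= M / T).
    { apply Rle_trans with (/ k * (c0 ^ 11 * hypW (xu s) (yu s) X Y c0)).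
      - apply Rmult_le_reg_l with (k / c0); [apply Rdiv_lt_0_compat; lra|].
        replace (k / c0 * (/ k * (c0 ^ 11 * hypW (xu s) (yu s) X Y c0))) with (c0 ^ 10 * hypW (xu s) (yu s) X Y c0)
          by (field; lra).
        replace (k / c0 * (c0 ^ 10 * S s c0)) with (c0 ^ 10 * (k / c0 * S s c0)) by ring.
        apply Rmult_le_compat_l; [apply pow_le; lra|exact Wl].
      - unfold M. replace (/ k * ((2 * D + Lam) * C ^ 2 + (2 * K + Lam)) / T) with
          (/ k * ((2 * D + Lam) * (C ^ 2 / T) + (2 * K + Lam) * / T)) by (field; lra).
        apply Rmult_le_compat_l; [left; now apply Rinv_0_lt_compat|].
        apply Rle_trans with (c0 ^ 11 * ((2 * D + Lam) * (c0 * r c0)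
          + (2 * K + Lam) * (T * s0 ^ 2) * (exp T * exp (- c0)))); [apply Rmult_le_compat_l; lra|].
        rewrite Rmult_plus_distr_l. apply Rplus_le_compat.
        + replace (c0 ^ 11 * ((2 * D + Lam) * (c0 * r c0))) with ((2 * D + Lam) * (C ^ 2 * / c0 ^ 4)).
          * apply Rmult_le_compat_l; [lra|]. apply Rmult_le_compat_l; [exact HC2|].
            apply Rle_trans with (/ c0); [apply inv_pow_le_inv; [lra|lia]|]. apply Rinv_le_contravar; lra.
          * unfold r, even_pow. change (2 * 8)%nat with 16%nat. field. lra.
        + replace (c0 ^ 11 * ((2 * K + Lam) * (T * s0 ^ 2) * (exp T * exp (- c0)))) with
            ((2 * K + Lam) * (T * s0 ^ 2 * exp T * (c0 ^ 11 * exp (- c0)))) by ring.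
          apply Rmult_le_compat_l; [lra|].
          apply Rle_trans with (T * s0 ^ 2 * exp T * (T ^ 11 * exp (- T))).
          * apply Rmult_le_compat_l.
            { apply Rmult_le_pos; [|left; apply exp_pos]. apply Rmult_le_pos; [lra|apply pow2_ge_0]. }
            apply pow_exp_decreasing; [simpl INR; lra|lra|exact Hc].
          * replace (T * s0 ^ 2 * exp T * (T ^ 11 * exp (- T))) with (T * s0 ^ 2 * T ^ 11 * (exp T * exp (- T))) by ring.
            rewrite <- exp_plus, Rplus_opp_r, exp_0, Rmult_1_r.
            replace (T * s0 ^ 2 * T ^ 11) with (/ T ^ 2) by (unfold s0; field; lra).
            apply inv_pow_le_inv; [lra|lia]. }
    eapply Rle_lt_trans; [exact Hfin|].
    apply Rmult_lt_reg_r with T; [lra|]. unfold Rdiv. rewrite Rmult_assoc, Rinv_l by lra. lra. }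
  assert (HfS : forall s t, T <= t -> f s t <= 2 * (t ^ 10 * S s t) + 1 / 8).
  { intros s t Ht. pose proof (dist2_triangle (xu s) (yu s) X Y X0 Y0 t) as H.
    specialize (Htrn t ltac:(lra)). unfold f, S.
    assert (0 < t ^ 10) by (apply pow_lt; lra).
    assert (t ^ 10 * dist2 (xu s) (yu s) X0 Y0 t <= t ^ 10 * (2 * dist2 (xu s) (yu s) X Y t + 2 * dist2 X Y X0 Y0 t))
      by (apply Rmult_le_compat_l; lra). lra. }
  assert (HfT : forall s, Rabs s <= s0 -> 4 * f s T < 1).
  { intros s Hs. pose proof (HfS s T (Rle_refl _)) as H. rewrite HST in H.
    assert (T ^ 10 * (2 * s ^ 2) <= 2 * / T).
    { apply Rle_trans with (T ^ 10 * (2 * s0 ^ 2)).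
      - apply Rmult_le_compat_l; [apply pow_le; lra|]. specialize (Hss s Hs). lra.
      - replace (T ^ 10 * (2 * s0 ^ 2)) with (2 * / T ^ 4) by (unfold s0; field; lra).
        apply Rmult_le_compat_l; [lra|]. apply inv_pow_le_inv; [lra|lia]. }
    assert (/ T <= / 64) by (apply Rinv_le_contravar; lra). lra. }
  set (Ex := fun (b sg s : R) => exists t1, T <= t1 /\ (forall t, T <= t <= t1 -> b * f s t <= 1) /\
    r t1 < V s t1 /\ 0 < sg * P s t1).
  assert (Hpert : forall s t1 eps, T <= t1 -> Rabs s <= s0 -> 0 < eps -> exists d, 0 < d /\
     forall s', Rabs s' <= s0 -> Rabs (s' - s) < d -> forall t, T <= t <= t1 ->
       dist2 (xu s') (yu s') (xu s) (yu s) t <= eps).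
  { intros s t1 eps Ht1 Hs Heps.
    set (Bd := (Rabs (X T) + 2 * s0) ^ 2 + (Rabs (Y T) + 2 * s0) ^ 2).
    destruct (zsol_dependence lam nu m Hm T t1 Bd Ht1) as (Ld & HLd & Hdep).
    assert (Hbd : forall s, Rabs s <= s0 -> xu s T ^ 2 + yu s T ^ 2 <= Bd).
    { clear s Hs. intros s Hs. rewrite HUx, HUy.
      assert (Hco : Rabs co <= 1) by (apply Rabs_le; apply COS_bound).
      assert (Hsi : Rabs si <= 1) by (apply Rabs_le; apply SIN_bound).
      assert (Hq : forall u w, Rabs w <= 2 -> (u + s * w) ^ 2 <= (Rabs u + 2 * s0) ^ 2).
      { intros u w Hw'. rewrite <- (pow2_abs (u + s * w)). apply pow_incr. split; [apply Rabs_pos|].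
        eapply Rle_trans; [apply Rabs_triang|]. rewrite Rabs_mult.
        pose proof (Rabs_pos s). pose proof (Rabs_pos w). nra. }
      unfold Bd. apply Rplus_le_compat; apply Hq.
      - eapply Rle_trans; [apply Rabs_triang|]. rewrite Rabs_Ropp. lra.
      - eapply Rle_trans; [apply Rabs_triang|]. lra. }
    set (d := Rmin 1 (eps / (2 * (Ld + 1)))).
    assert (Hd : 0 < d) by (apply Rmin_pos; [lra|]; apply Rdiv_lt_0_compat; lra).
    assert (Hd1 : d <= 1) by apply Rmin_l. assert (Hd2 : d <= eps / (2 * (Ld + 1))) by apply Rmin_r.
    exists d. split; [exact Hd|]. intros s' Hs' Hss' t Ht.
    eapply Rle_trans; [apply (Hdep _ _ _ _ (HUz s') (HUz s) (Hbd s' Hs') (Hbd s Hs) t Ht)|].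
    rewrite !HUx, !HUy.
    replace ((X T + s' * (co - si) - (X T + s * (co - si))) ^ 2 + (Y T + s' * (si + co) - (Y T + s * (si + co))) ^ 2)
      with (2 * (s' - s) ^ 2 * (si * si + co * co)) by ring.
    rewrite Hcs, Rmult_1_r.
    assert (Hsq : (s' - s) ^ 2 <= d).
    { rewrite <- (pow2_abs (s' - s)). pose proof (Rabs_pos (s' - s)). nra. }
    apply Rle_trans with ((Ld + 1) * (2 * d)); [pose proof (pow2_ge_0 (s' - s)); apply Rmult_le_compat; lra|].
    apply Rle_trans with ((Ld + 1) * (2 * (eps / (2 * (Ld + 1))))); [apply Rmult_le_compat_l; lra|].
    right. field. lra. }
  assert (Hopen : forall sg s, sg ^ 2 = 1 -> Rabs s <= s0 -> Ex 4 sg s -> exists d, 0 < d /\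
     forall s', Rabs s' <= s0 -> Rabs (s' - s) < d -> Ex 1 sg s').
  { intros sg s Hsg Hs (t1 & Ht1 & Hf & HV & HP).
    assert (Ht1p : 0 < t1 ^ 5) by (apply pow_lt; lra).
    assert (Habs : Rabs sg = 1).
    { destruct (Rle_dec 0 sg); [rewrite Rabs_pos_eq|rewrite Rabs_left1]; nra. }
    set (v := Rabs (P s t1) + Rabs (Q s t1) + 1).
    assert (Hv : 1 <= v) by (unfold v; pose proof (Rabs_pos (P s t1)); pose proof (Rabs_pos (Q s t1)); lra).
    (* The four bounds keep, in turn, Q bounded, t^10 [dist2] below 1 given 4 f <= 1, the sign of P,
       and V above r. *)
    set (eta := Rmin (Rmin 1 (/ (2 * t1 ^ 5))) (Rmin (sg * P s t1 / 2) ((V s t1 - r t1) / (2 * v)))).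
    assert (Heta : 0 < eta).
    { unfold eta. apply Rmin_pos; apply Rmin_pos; try lra.
      - apply Rinv_0_lt_compat. lra.
      - apply Rdiv_lt_0_compat; lra. }
    assert (He1 : eta <= 1) by (eapply Rle_trans; [apply Rmin_l|apply Rmin_l]).
    assert (He2 : eta <= / (2 * t1 ^ 5)) by (eapply Rle_trans; [apply Rmin_l|apply Rmin_r]).
    assert (He3 : eta <= sg * P s t1 / 2) by (eapply Rle_trans; [apply Rmin_r|apply Rmin_l]).
    assert (He4 : eta <= (V s t1 - r t1) / (2 * v)) by (eapply Rle_trans; [apply Rmin_r|apply Rmin_r]).
    clearbody eta.
    destruct (Hpert s t1 (eta ^ 2) Ht1 Hs ltac:(apply pow_lt; lra)) as (d & Hd & Hdd).
    exists d. split; [exact Hd|]. intros s' Hs' Hss'. specialize (Hdd s' Hs' Hss').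
    exists t1. split; [exact Ht1|].
    pose proof (Hdd t1 ltac:(lra)) as Hd1. rewrite <- (frPQ_norm psi0) in Hd1.
    assert (EP : frP (xu s') (yu s') (xu s) (yu s) t1 = P s' t1 - P s t1) by (unfold P; unfold_fr; ring).
    assert (EQ : frQ (xu s') (yu s') (xu s) (yu s) t1 = Q s' t1 - Q s t1) by (unfold Q; unfold_fr; ring).
    rewrite EP, EQ in Hd1.
    assert (HdP : Rabs (P s' t1 - P s t1) <= eta) by (apply sqr_le_abs; [lra|]; pose proof (pow2_ge_0 (Q s' t1 - Q s t1)); lra).
    assert (HdQ : Rabs (Q s' t1 - Q s t1) <= eta) by (apply sqr_le_abs; [lra|]; pose proof (pow2_ge_0 (P s' t1 - P s t1)); lra).
    split; [|split].
    - intros t Ht. rewrite Rmult_1_l. specialize (Hdd t Ht). specialize (Hf t Ht).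
      pose proof (dist2_triangle (xu s') (yu s') (xu s) (yu s) X0 Y0 t) as H.
      unfold f in *. assert (0 < t ^ 10) by (apply pow_lt; lra).
      assert (Hte : t ^ 10 * eta ^ 2 <= 1 / 4).
      { apply Rle_trans with (t1 ^ 10 * (/ (2 * t1 ^ 5)) ^ 2).
        - apply Rmult_le_compat; [lra|apply pow2_ge_0|apply pow_incr; lra|apply pow_incr; lra].
        - right. field. lra. }
      assert (t ^ 10 * dist2 (xu s') (yu s') X0 Y0 t <= t ^ 10 * (2 * eta ^ 2 + 2 * dist2 (xu s) (yu s) X0 Y0 t))
        by (apply Rmult_le_compat_l; lra). lra.
    - assert (EV : V s' t1 - V s t1 = (P s' t1 - P s t1) * Q s' t1 + P s t1 * (Q s' t1 - Q s t1)) by (unfold V, hypV; fold (P s' t1); unfold P, Q; ring).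
      assert (HQ' : Rabs (Q s' t1) <= Rabs (Q s t1) + 1).
      { replace (Q s' t1) with ((Q s' t1 - Q s t1) + Q s t1) by ring. eapply Rle_trans; [apply Rabs_triang|]. lra. }
      assert (HdV : Rabs (V s' t1 - V s t1) <= eta * v).
      { rewrite EV. eapply Rle_trans; [apply Rabs_triang|]. rewrite !Rabs_mult.
        pose proof (Rabs_pos (P s t1)). pose proof (Rabs_pos (Q s' t1)).
        assert (Rabs (P s' t1 - P s t1) * Rabs (Q s' t1) <= eta * (Rabs (Q s t1) + 1)) by (apply Rmult_le_compat; try lra; apply Rabs_pos).
        assert (Rabs (P s t1) * Rabs (Q s' t1 - Q s t1) <= Rabs (P s t1) * eta) by (apply Rmult_le_compat_l; lra).
        unfold v. lra. }
      assert (eta * v <= (V s t1 - r t1) / 2).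
      { apply Rle_trans with ((V s t1 - r t1) / (2 * v) * v); [apply Rmult_le_compat_r; lra|]. right. field. lra. }
      apply Rabs_le_between in HdV. lra.
    - assert (Rabs (sg * (P s' t1 - P s t1)) <= eta) by (rewrite Rabs_mult, Habs; lra).
      apply Rabs_le_between in H. lra. }
  (* Once V > r, the quantity (V - r) e^(-t) does not decrease, so P Q > 0 and P cannot change sign;
     hence the two exits exclude each other. *)
  assert (Hpersist : forall sg s t1 t2, sg ^ 2 = 1 -> T <= t1 <= t2 -> (forall t, T <= t <= t2 -> 1 * f s t <= 1) ->
     r t1 < V s t1 -> 0 < sg * P s t1 -> 0 < sg * P s t2).
  { intros sg s t1 t2 Hsg Ht Hf HV HP.
    assert (HVr : forall t, t1 <= t <= t2 -> r t < V s t).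
    { intros t Htt. destruct (Hwin s t ltac:(lra) ltac:(intros u Hu; specialize (Hf u ltac:(lra)); lra) t1 ltac:(lra)) as [W1 _].
      pose proof (exp_pos (- t1)). pose proof (exp_pos (- t)).
      assert (0 < (V s t1 - r t1) * exp (- t1)) by (apply Rmult_lt_0_compat; lra).
      assert (0 < (V s t - r t) * exp (- t)) by lra.
      destruct (Rle_dec (V s t - r t) 0); [exfalso; nra|lra]. }
    assert (1 - sg * P s t2 < 1); [|lra].
    apply (bootstrap_forward (fun t => 1 - sg * P s t) t1 t2); [| | |lra].
    - intros t Htt. destruct (HPc s t ltac:(lra)) as [HPt _].
      apply (continuous_Rminus (fun _ => 1) (fun t => sg * P s t)); [apply continuous_const|].
      apply (continuous_Rmult (fun _ => sg) (P s)); [apply continuous_const|exact HPt].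
    - lra.
    - intros c0 Hc0 Hle. specialize (Hle c0 ltac:(lra)). specialize (HVr c0 Hc0). specialize (Hr0 c0 ltac:(lra)).
      destruct (Req_dec (sg * P s c0) 0) as [E|E]; [exfalso|lra].
      assert (P s c0 = 0) by (replace (P s c0) with (sg * (sg * P s c0)) by (rewrite <- Rmult_assoc; replace (sg * sg) with 1 by (rewrite <- Hsg; ring); ring); rewrite E; ring).
      assert (V s c0 = 0) by (change (P s c0 * Q s c0 = 0); rewrite H; ring). lra. }
  assert (Hr_T : r T < s0 ^ 2).
  { unfold r, even_pow, s0. change (2 * 8)%nat with 16%nat.
    replace ((/ T ^ 7) ^ 2) with (T ^ 2 / T ^ 16) by (field; lra).
    apply Rmult_lt_compat_r; [apply Rinv_0_lt_compat, pow_lt; lra|]. nra. }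
  destruct (shooting s0 (Ex 1 1) (Ex 1 (-1)) (Ex 4 1) (Ex 4 (-1))) as (s & Hs & Hnp & Hnm).
  - lra.
  - intros s Hs H. apply (Hopen 1 s); [ring|exact Hs|exact H].
  - intros s Hs H. apply (Hopen (-1) s); [ring|exact Hs|exact H].
  - intros s Hs (t1 & Ht1 & Hf1 & HV1 & HP1) (t2 & Ht2 & Hf2 & HV2 & HP2).
    destruct (Rle_dec t1 t2) as [Hle|Hle].
    + pose proof (Hpersist 1 s t1 t2 ltac:(ring) ltac:(lra) Hf2 HV1 HP1). lra.
    + pose proof (Hpersist (-1) s t2 t1 ltac:(ring) ltac:(lra) Hf1 HV2 HP2). lra.
  - exists T. split; [lra|]. split; [|split].
    + intros t Ht. replace t with T by lra. specialize (HfT s0 ltac:(rewrite Rabs_pos_eq; lra)).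
      assert (0 <= f s0 T) by (unfold f; apply Rmult_le_pos; [apply pow_le; lra|apply dist2_nonneg]). lra.
    + rewrite HVT. exact Hr_T.
    + rewrite HPT. lra.
  - exists T. split; [lra|]. split; [|split].
    + intros t Ht. replace t with T by lra. specialize (HfT (- s0) ltac:(rewrite Rabs_Ropp, Rabs_pos_eq; lra)).
      assert (0 <= f (- s0) T) by (unfold f; apply Rmult_le_pos; [apply pow_le; lra|apply dist2_nonneg]). lra.
    + rewrite HVT. replace ((- s0) ^ 2) with (s0 ^ 2) by ring. exact Hr_T.
    + rewrite HPT. lra.
  (* For the surviving s, V never exceeds r while 4 f <= 1, since otherwise the sign of P would make
     it one of the two exits; [Hstrict] then closes the bootstrap. *)
  - exists (xu s), (yu s). apply (saddle_decay _ _ T); [lra|apply HUz|].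
    intros t Ht. assert (H4 : 4 * f s t < 1); [|unfold trap; fold (f s t); assert (0 <= f s t) by
      (unfold f; apply Rmult_le_pos; [apply pow_le; lra|apply dist2_nonneg]); lra].
    apply (bootstrap_forward (fun t => 4 * f s t) T t); [| | |lra].
    + intros u Hu. unfold f. apply (continuous_Rmult (fun _ => 4) (fun t => t ^ 10 * dist2 (xu s) (yu s) X0 Y0 t)); [apply continuous_const|].
      apply continuous_Rmult.
      * apply (continuous_of_derive _ _ _ (is_derive_tpow 10 u)).
      * apply (dist2_frame_continuous _ _ _ _ _ _ _ _ _ _ _ _ _ _ _ HF); [lra|apply HUz].
    + now apply HfT.
    + intros c0 Hc0 Hle.
      assert (HVc : V s c0 <= r c0).
      { destruct (Rle_dec (V s c0) (r c0)) as [|Hgt]; [assumption|exfalso].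
        specialize (Hr0 c0 ltac:(lra)).
        destruct (Rtotal_order (P s c0) 0) as [Hlt|[Heq|Hgt']].
        - apply Hnm. exists c0. split; [lra|]. split; [exact Hle|]. split; lra.
        - assert (V s c0 = 0) by (change (P s c0 * Q s c0 = 0); rewrite Heq; ring). lra.
        - apply Hnp. exists c0. split; [lra|]. split; [exact Hle|]. split; lra. }
      assert (Hle' : forall u, T <= u <= c0 -> f s u <= 1).
      { intros u Hu. specialize (Hle u Hu). simpl in Hle.
        assert (0 <= f s u) by (unfold f; apply Rmult_le_pos; [apply pow_le; lra|apply dist2_nonneg]). lra. }
      pose proof (Hstrict s c0 Hs ltac:(lra) Hle' HVc). pose proof (HfS s c0 ltac:(lra)). lra.
Qed.

End Saddle.

(** * Existence *)

Section Epsilon.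

Variable h : nat.
Hypothesis Hh : (1 <= h <= 3)%nat.

Definition ep (t : R) : R := Rpower t (- / (2 * INR h)).

Let Hh0 : 0 < INR h.
Proof. apply lt_0_INR. lia. Qed.

Lemma ep_pos t : 0 < ep t.
Proof. apply exp_pos. Qed.

Lemma ep_pow k t : ep t ^ k = Rpower t (- INR k / (2 * INR h)).
Proof.
  induction k as [|k IH].
  - simpl. unfold Rdiv. unfold Rpower. now rewrite Ropp_0, !Rmult_0_l, exp_0.
  - rewrite <- tech_pow_Rmult, IH. unfold ep. rewrite <- Rpower_plus. f_equal. rewrite S_INR. field. lra.
Qed.

Lemma ep_pow_2h t : 0 < t -> ep t ^ (2 * h) = / t.
Proof.
  intros Ht. rewrite ep_pow, mult_INR. simpl (INR 2).
  replace (- ((1 + 1) * INR h) / (2 * INR h)) with (Ropp 1) by (field; lra).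
  now rewrite Rpower_Ropp, Rpower_1.
Qed.

Lemma ep_derive t : 0 < t -> is_derive ep t (- / (2 * INR h) * ep t ^ (2 * h) * ep t).
Proof.
  intros Ht. rewrite ep_pow_2h by exact Ht. unfold ep, Rpower.
  auto_derive; [exact Ht|]. field. lra.
Qed.

Lemma ep_le_1 : evt (fun t => 0 < ep t <= 1).
Proof.
  exists 1. intros t Ht. split; [apply ep_pos|]. unfold ep.
  apply Rle_trans with (Rpower t 0); [|rewrite Rpower_O; lra].
  apply Rle_Rpower; [exact Ht|]. assert (0 < / (2 * INR h)) by (apply Rinv_0_lt_compat; lra). lra.
Qed.

Lemma ep_small d : 0 < d -> evt (fun t => ep t < d).
Proof.
  intros Hd. assert (Hp : 0 < d ^ (2 * h)) by now apply pow_lt.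
  exists (/ (d ^ (2 * h)) + 1). intros t Ht.
  assert (0 < / d ^ (2 * h)) by now apply Rinv_0_lt_compat.
  destruct (Rlt_dec (ep t) d) as [|Hn]; [assumption|exfalso].
  assert (d ^ (2 * h) <= ep t ^ (2 * h)) by (apply pow_incr; lra).
  rewrite ep_pow_2h in H0 by lra.
  apply Rinv_le_contravar in H0; [|exact Hp]. rewrite Rinv_inv in H0. lra.
Qed.

Lemma pola_theta_shift a n u : u * pola (fun k => INR (S k) * a (S k)) n u = pola (theta a) (S n) u.
Proof.
  induction n as [|n IH].
  - simpl. unfold theta. simpl. ring.
  - change (pola (theta a) (S (S n)) u) with (pola (theta a) (S n) u + theta a (S n) * u ^ S n).
    rewrite <- IH. cbn [pola]. unfold theta. rewrite <- tech_pow_Rmult. ring.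
Qed.

Lemma pola_ep_derive a n t : 0 < t ->
  is_derive (fun t => pola a (S n) (ep t)) t (- / (2 * INR h) * ep t ^ (2 * h) * pola (theta a) (S n) (ep t)).
Proof.
  intros Ht. rewrite <- pola_theta_shift.
  replace (- / (2 * INR h) * ep t ^ (2 * h) * (ep t * pola (fun k => INR (S k) * a (S k)) n (ep t)))
    with ((- / (2 * INR h) * ep t ^ (2 * h) * ep t) * pola (fun k => INR (S k) * a (S k)) n (ep t)) by ring.
  apply (is_derive_comp (pola a (S n)) ep); [apply (pola_derive a (S n))|now apply ep_derive].
Qed.

Lemma ep_pow_derive k t : 0 < t ->
  is_derive (fun t => ep t ^ k) t (- (INR k / (2 * INR h)) * ep t ^ (2 * h) * ep t ^ k).
Proof.
  intros Ht. pose proof (ep_pos t) as Hp.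
  pose proof (is_derive_pow ep k t _ (ep_derive t Ht)) as H.
  replace (- (INR k / (2 * INR h)) * ep t ^ (2 * h) * ep t ^ k) with
    (INR k * (- / (2 * INR h) * ep t ^ (2 * h) * ep t) * ep t ^ pred k); [exact H|].
  destruct k as [|k]; [simpl INR; simpl pred; unfold Rdiv; ring|].
  simpl pred. rewrite <- tech_pow_Rmult. field. lra.
Qed.

Lemma bigO_inv_tpow N f : bigO ep (2 * h * N) f -> exists C T, 0 <= C /\ forall t, T <= t -> Rabs (f t) <= C / t ^ N.
Proof.
  intros (C & HC & T & HT). exists C, (Rmax T 1). split; [exact HC|]. intros t Ht.
  pose proof (Rmax_l T 1). pose proof (Rmax_r T 1).
  eapply Rle_trans; [apply HT; lra|]. rewrite pow_mult, ep_pow_2h, pow_inv by lra. right. reflexivity.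
Qed.

(* The expansion of mu cannot be differentiated, so the coefficients of the linearised system are replaced
   by truncations of their expansions. *)
Lemma differentiable_truncation (F : R -> R) (j k M : nat) (a0 : R) : a0 <> 0 ->
  (forall n, ps ep n (fun t => ep t ^ j * F t)) -> bigO ep (S k) (fun t => ep t ^ j * F t - a0 * ep t ^ k) ->
  exists F1 F1', evt (fun t => is_derive F1 t (F1' t)) /\
    (exists C, 0 <= C /\ evt (fun t => Rabs (F t - F1 t) <= C * ep t ^ M)) /\
    (exists C, 0 <= C /\ evt (fun t => Rabs (F1' t) <= C / t * Rabs (F1 t))) /\
    evt (fun t => Rabs (ep t ^ j * F1 t - a0 * ep t ^ k) <= Rabs a0 / 2 * ep t ^ k).
Proof.
  intros Ha0 Hps Hlead.
  pose proof ep_le_1 as He. pose proof ep_small as He0.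
  assert (Hb : bigO ep k (fun t => ep t ^ j * F t)).
  { apply (bigO_ext_all ep _ (fun t => (ep t ^ j * F t - a0 * ep t ^ k) + a0 * ep t ^ k)); [intros; ring|].
    apply (bigO_plus ep); [apply (bigO_weaken ep He k (S k)); [lia|exact Hlead]|].
    apply (bigO_scal ep He), (bigO_epow ep He); lia. }
  (* The division by e^j costs j orders; the successor keeps n positive, as the derivative formula
     and the leading term require. *)
  set (n := S (M + j)).
  destruct (ps_factor ep He He0 k n _ Hb (Hps (k + n)%nat)) as (G & HG & EG).
  destruct (ps_polynomial ep He He0 n G HG) as (a & Ha).
  assert (HGlead : bigO ep 1 (fun t => pola a n (ep t) - a0)).
  { apply (bigO_ext ep _ (fun t => (ep t ^ j * F t - a0 * ep t ^ k) / ep t ^ k - (G t - pola a n (ep t)))).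
    - refine (evt_imp _ _ _ EG). intros t ->. field. apply pow_nonzero. pose proof (ep_pos t). lra.
    - apply (bigO_minus ep); [|apply (bigO_weaken ep He 1 n); [unfold n; lia|exact Ha]].
      apply (bigO_div ep He). replace (k + 1)%nat with (S k) by lia. exact Hlead. }
  set (F1 := fun t => ep t ^ k * pola a n (ep t) / ep t ^ j).
  set (F1' := fun t => - / (2 * INR h) * ep t ^ (2 * h) *
    ((INR k - INR j) * pola a n (ep t) + pola (theta a) n (ep t)) * ep t ^ k / ep t ^ j).
  assert (Hsm := bigO_small ep He He0 1 _ (Rabs a0 / 2) (le_n _) HGlead ltac:(pose proof (Rabs_pos_lt _ Ha0); lra)).
  assert (Ha0p : 0 < Rabs a0) by now apply Rabs_pos_lt.
  exists F1, F1'. split; [|split; [|split]].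
  - refine (evt_imp _ _ _ (evt_ge 1)). intros t Ht. pose proof (ep_pos t) as Hp.
    assert (Hpj : 0 < ep t ^ j) by now apply pow_lt.
    assert (Ht0 : 0 < t) by lra.
    pose proof (ep_pow_derive k t Ht0) as Dk. pose proof (ep_pow_derive j t Ht0) as Dj.
    pose proof (pola_ep_derive a (M + j) t Ht0) as Dp. fold n in Dp.
    set (u := fun t => ep t ^ k) in *. set (v := fun t => ep t ^ j) in *. set (w := fun t => pola a n (ep t)) in *.
    change (is_derive (fun t => u t * w t / v t) t (F1' t)).
    auto_derive; [repeat split; try (eexists; eassumption); change (ep t ^ j <> 0); lra|].
    rewrite_derive.
    unfold F1', u, v, w. field. split; [lra|]. apply pow_nonzero; lra.
  - destruct Ha as (C & HC & HCe). exists C. split; [exact HC|].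
    refine (evt_imp _ _ _ (evt_and _ _ He (evt_and _ _ EG HCe))). intros t (E1 & E2 & E3).
    assert (Hpj : 0 < ep t ^ j) by (apply pow_lt; lra).
    assert (Hpk : 0 < ep t ^ k <= 1) by (now apply epow_pos).
    replace (F t - F1 t) with (ep t ^ k * (G t - pola a n (ep t)) / ep t ^ j).
    + unfold Rdiv. rewrite !Rabs_mult, Rabs_inv, (Rabs_pos_eq (ep t ^ k)), (Rabs_pos_eq (ep t ^ j)) by lra.
      apply Rmult_le_reg_r with (ep t ^ j); [lra|]. rewrite Rmult_assoc, Rinv_l, Rmult_1_r by lra.
      assert (En : ep t ^ n <= ep t ^ M * ep t ^ j).
      { rewrite <- pow_add. apply epow_le; [exact E1|unfold n; lia]. }
      pose proof (Rabs_pos (G t - pola a n (ep t))).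
      apply Rle_trans with (1 * (C * ep t ^ n)); [apply Rmult_le_compat; lra|].
      rewrite Rmult_1_l, Rmult_assoc. now apply Rmult_le_compat_l.
    + unfold F1. replace (F t) with (ep t ^ j * F t / ep t ^ j) by (field; lra). rewrite E2. field. lra.
  - assert (Hbd : bigO ep 0 (fun t => - / (2 * INR h) * ((INR k - INR j) * pola a n (ep t) + pola (theta a) n (ep t)))).
    { apply (bigO_scal ep He). apply (bigO_plus ep); [apply (bigO_scal ep He)|];
        apply (ps_bounded ep He 0); now apply ps_pola_e. }
    destruct Hbd as (C & HC & HCe). exists (2 * C / Rabs a0).
    split; [apply Rdiv_le_0_compat; lra|].
    refine (evt_imp _ _ _ (evt_and _ _ (evt_ge 1) (evt_and _ _ Hsm HCe))). intros t (E1 & E2 & E3).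
    rewrite pow_O, Rmult_1_r in E3.
    pose proof (ep_pos t) as Hp.
    assert (Hpj : 0 < ep t ^ j) by (apply pow_lt; lra). assert (Hpk : 0 < ep t ^ k) by (apply pow_lt; lra).
    assert (Elow : Rabs a0 / 2 <= Rabs (pola a n (ep t))).
    { pose proof (Rabs_triang_inv a0 (a0 - pola a n (ep t))) as H. rewrite Rabs_minus_sym in E2.
      replace (a0 - (a0 - pola a n (ep t))) with (pola a n (ep t)) in H by ring. lra. }
    unfold F1', F1. rewrite ep_pow_2h by lra.
    replace (- / (2 * INR h) * / t * ((INR k - INR j) * pola a n (ep t) + pola (theta a) n (ep t)) * ep t ^ k / ep t ^ j)
      with ((- / (2 * INR h) * ((INR k - INR j) * pola a n (ep t) + pola (theta a) n (ep t))) * (/ t * (ep t ^ k / ep t ^ j)))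
      by (field; repeat split; lra).
    replace (ep t ^ k * pola a n (ep t) / ep t ^ j) with (pola a n (ep t) * (ep t ^ k / ep t ^ j)) by (field; lra).
    assert (Hq : 0 < ep t ^ k / ep t ^ j) by (apply Rdiv_lt_0_compat; lra).
    rewrite Rabs_mult, (Rabs_mult (pola a n (ep t))), (Rabs_pos_eq (ep t ^ k / ep t ^ j)) by lra.
    rewrite (Rabs_pos_eq (/ t * (ep t ^ k / ep t ^ j))) by (apply Rmult_le_pos; [left; apply Rinv_0_lt_compat|]; lra).
    replace (2 * C / Rabs a0 / t * (Rabs (pola a n (ep t)) * (ep t ^ k / ep t ^ j))) with
      (2 * C / Rabs a0 * Rabs (pola a n (ep t)) * (/ t * (ep t ^ k / ep t ^ j))) by (field; repeat split; lra).
    apply Rmult_le_compat_r; [apply Rmult_le_pos; [left; apply Rinv_0_lt_compat|]; lra|].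
    apply Rle_trans with C; [exact E3|].
    apply Rle_trans with (2 * C / Rabs a0 * (Rabs a0 / 2)); [right; field; lra|].
    apply Rmult_le_compat_l; [apply Rdiv_le_0_compat; lra|exact Elow].
  - refine (evt_imp _ _ _ Hsm). intros t E. pose proof (ep_pos t) as Hp.
    assert (Hpj : 0 < ep t ^ j) by (apply pow_lt; lra). assert (Hpk : 0 < ep t ^ k) by (apply pow_lt; lra).
    unfold F1. replace (ep t ^ j * (ep t ^ k * pola a n (ep t) / ep t ^ j) - a0 * ep t ^ k) with
      ((pola a n (ep t) - a0) * ep t ^ k) by (field; lra).
    rewrite Rabs_mult, (Rabs_pos_eq (ep t ^ k)) by lra. apply Rmult_le_compat_r; lra.
Qed.

(** Variant for the coefficient c, whose leading coefficient may vanish, so that no relative bound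
    is available; the absolute bounds |F1| <= 1 and |F1'| <= C / t suffice for the cross term. *)
Lemma differentiable_truncation_small (F : R -> R) (M : nat) :
  (forall n, ps ep n F) -> bigO ep 1 F ->
  exists F1 F1', evt (fun t => is_derive F1 t (F1' t)) /\
    (exists C, 0 <= C /\ evt (fun t => Rabs (F t - F1 t) <= C * ep t ^ M)) /\
    (exists C, 0 <= C /\ evt (fun t => Rabs (F1' t) <= C / t)) /\
    evt (fun t => Rabs (F1 t) <= 1).
Proof.
  intros Hps Hb. pose proof ep_le_1 as He. pose proof ep_small as He0.
  destruct (ps_polynomial ep He He0 (S M) F (Hps _)) as (a & Ha).
  exists (fun t => pola a (S M) (ep t)), (fun t => - / (2 * INR h) * ep t ^ (2 * h) * pola (theta a) (S M) (ep t)).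
  split; [|split; [|split]].
  - refine (evt_imp _ _ _ (evt_ge 1)). intros t Ht. apply pola_ep_derive. lra.
  - destruct (bigO_weaken ep He M (S M) _ ltac:(lia) Ha) as (C & HC & H). exists C. now split.
  - assert (Hbd : bigO ep 0 (fun t => - / (2 * INR h) * pola (theta a) (S M) (ep t))).
    { apply (bigO_scal ep He). apply (ps_bounded ep He 0); now apply ps_pola_e. }
    destruct Hbd as (C & HC & HCe). exists C. split; [exact HC|].
    refine (evt_imp _ _ _ (evt_and _ _ (evt_ge 1) HCe)). intros t (E1 & E2).
    rewrite ep_pow_2h by lra.
    replace (- / (2 * INR h) * / t * pola (theta a) (S M) (ep t)) with
      ((- / (2 * INR h) * pola (theta a) (S M) (ep t)) * / t) by ring.
    rewrite Rabs_mult, (Rabs_pos_eq (/ t)) by (left; apply Rinv_0_lt_compat; lra).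
    apply Rmult_le_compat_r; [left; apply Rinv_0_lt_compat; lra|]. rewrite pow_O, Rmult_1_r in E2. exact E2.
  - assert (H1 : bigO ep 1 (fun t => pola a (S M) (ep t))).
    { apply (bigO_ext_all ep _ (fun t => F t - (F t - pola a (S M) (ep t)))); [intros; ring|].
      apply (bigO_minus ep); [exact Hb|]. apply (bigO_weaken ep He 1 (S M)); [lia|exact Ha]. }
    refine (evt_imp _ _ _ (bigO_small ep He He0 1 _ 1 (le_n _) H1 Rlt_0_1)). intros t Ht. lra.
Qed.

End Epsilon.

(** * Partial sums as approximate solutions *)

Section ApproximateSolutions.

Variable h : nat.
Hypothesis Hh : (1 <= h <= 3)%nat.
Variables (lam nu sl sg d mu0 p1 A0 : R) (m : R -> R) (p r : nat -> R).
Hypothesis Hsl : 0 < sl.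
Hypothesis Hlam : lam = sl ^ 2.
Hypothesis Hd : d = mu0 * sl.

Local Notation e := (ep h).
Local Notation O := (bigO e).
Local Notation mm := (fun t => m t / e t ^ h).

Hypothesis Hmm : O (2 * h) (fun t => mm t - mu0).
Hypothesis Hmps : forall n, ps e n mm.
Hypothesis HA0 : A0 <> 0.
Hypothesis H2 : forall psi, O 2 (fun t => psi t - (sg + p1 * e t)) ->
  O h (fun t => P1 (psi t) d nu - A0 * e t ^ (h - 1)).
Hypothesis Hp0 : p 0%nat = sg.
Hypothesis Hp1 : p 1%nat = p1.
Hypothesis Hstage : forall n, (1 <= n)%nat -> formal_stage e h sl nu mm n p r.

Definition apsi (n : nat) (t : R) : R := pola p (S n) (e t).
Definition ar (n : nat) (t : R) : R := pola r (S n) (e t).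
Definition aR (n : nat) (t : R) : R := sl + e t ^ h * ar n t.
Definition arho (n : nat) (t : R) : R := sl * / e t ^ h + ar n t.
Definition ag (n : nat) (t : R) : R := - / (2 * INR h) * e t ^ (2 * h) * pola (theta p) (S n) (e t).
Definition ares1 (n : nat) (t : R) : R := res1 e h sl nu mm (apsi n t) (pola (theta r) (S n) (e t)) (ar n t) t.
Definition ares2 (n : nat) (t : R) : R := res2 e h sl nu mm (apsi n t) (pola (theta p) (S n) (e t)) (ar n t) t.
Definition axs (n : nat) (t : R) : R := arho n t * cos (apsi n t).
Definition ays (n : nat) (t : R) : R := arho n t * sin (apsi n t).
(** Together with [afy], the real and imaginary parts of ([ares1] + i [ares2] / e^(2h)) e^(i psi):
    the residuals of (MS) are the polar components of the residual of z, once the scaling by e^(2h)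
    is undone. *)
Definition afx (n : nat) (t : R) : R := ares1 n t * cos (apsi n t) - ares2 n t / e t ^ (2 * h) * sin (apsi n t).
Definition afy (n : nat) (t : R) : R := ares1 n t * sin (apsi n t) + ares2 n t / e t ^ (2 * h) * cos (apsi n t).

Let Hh0 : 0 < INR h.
Proof. apply lt_0_INR. lia. Qed.
Let He := ep_le_1 h Hh.
Let He0 := ep_small h Hh.

Lemma arho_aR n t : arho n t = aR n t / e t ^ h.
Proof. unfold arho, aR. pose proof (pow_lt _ h (ep_pos h t)). field. lra. Qed.

Lemma apsi_derive n t : 0 < t -> is_derive (apsi n) t (ag n t).
Proof. intros Ht. apply (pola_ep_derive h Hh p n t Ht). Qed.

Lemma arho_derive n t : 0 < t ->
  is_derive (arho n) t (sl / 2 * e t ^ h - / (2 * INR h) * e t ^ (2 * h) * pola (theta r) (S n) (e t)).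
Proof.
  intros Ht. pose proof (pow_lt _ h (ep_pos h t)) as HE.
  pose proof (ep_pow_derive h Hh h t Ht) as D1. pose proof (pola_ep_derive h Hh r n t Ht) as D2.
  assert (E2 : e t ^ (2 * h) = e t ^ h * e t ^ h) by (rewrite <- pow_add; f_equal; lia).
  change (is_derive (ar n) t (- / (2 * INR h) * e t ^ (2 * h) * pola (theta r) (S n) (e t))) in D2.
  set (u := fun t => e t ^ h) in *. set (w := ar n) in *.
  change (is_derive (fun t => sl * / u t + w t) t
    (sl / 2 * e t ^ h - / (2 * INR h) * e t ^ (2 * h) * pola (theta r) (S n) (e t))).
  auto_derive; [repeat split; try (eexists; eassumption); change (e t ^ h <> 0); lra|].
  rewrite_derive.
  unfold u. rewrite E2. field. split; lra.
Qed.

Lemma approximate_solution n t : 0 < t -> approx_at lam nu m (axs n) (ays n) (afx n) (afy n) t.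
Proof.
  intros Ht. pose proof (apsi_derive n t Ht) as Dp. pose proof (arho_derive n t Ht) as Dr.
  set (E := e t ^ h). assert (HE : 0 < E) by (apply pow_lt, ep_pos).
  assert (E2 : e t ^ (2 * h) = E * E) by (unfold E; rewrite <- pow_add; f_equal; lia).
  assert (E3 : e t ^ (3 * h) = E * E * E) by (unfold E; rewrite <- !pow_add; f_equal; lia).
  assert (Elt : lam * t = sl ^ 2 / (E * E)).
  { rewrite Hlam, <- E2, ep_pow_2h by assumption. field. lra. }
  set (c := cos (apsi n t)). set (s := sin (apsi n t)).
  assert (Hcs : s * s + c * c = 1) by apply (sin2_cos2 (apsi n t)).
  set (SF := sin (2 * apsi n t + nu)). set (CF := cos (2 * apsi n t + nu)).
  assert (ES : c * sin nu + s * cos nu = SF * c - CF * s).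
  { unfold SF, CF, c, s. rewrite <- sin_minus. replace (2 * apsi n t + nu - apsi n t) with (apsi n t + nu) by ring.
    rewrite sin_plus. ring. }
  assert (EC : c * cos nu - s * sin nu = CF * c + SF * s).
  { unfold SF, CF, c, s. rewrite <- cos_minus. replace (2 * apsi n t + nu - apsi n t) with (apsi n t + nu) by ring.
    rewrite cos_plus. ring. }
  assert (EV : axs n t ^ 2 + ays n t ^ 2 = arho n t ^ 2).
  { unfold axs, ays. fold c s. transitivity (arho n t ^ 2 * (s * s + c * c)); [ring|rewrite Hcs; ring]. }
  assert (R1 : sl / 2 * E - / (2 * INR h) * (E * E) * pola (theta r) (S n) (e t)
     = ares1 n t - m t * arho n t * SF + s).
  { unfold ares1, res1. fold E SF s. rewrite E2, arho_aR. unfold aR. fold E. field. split; lra. }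
  assert (R2 : arho n t * ag n t = ares2 n t / (E * E) + arho n t * (arho n t ^ 2 - lam * t) - m t * arho n t * CF + c).
  { unfold ares2, res2, ag. fold E CF c. rewrite E2, E3, Elt, arho_aR. unfold aR. fold E. field. split; lra. }
  unfold approx_at. rewrite EV. unfold axs, ays, afx, afy. fold c s. rewrite E2 in *.
  change (e t ^ h) with E in Dr. rewrite R1 in Dr. split.
  - auto_derive; [repeat split; eexists; eassumption|].
    rewrite_derive.
    fold c s. unfold zfx.
    transitivity ((ares1 n t - m t * arho n t * SF + s) * c - (arho n t * ag n t) * s); [ring|].
    rewrite R2. 
    transitivity (- ((arho n t ^ 2 - lam * t) * (arho n t * s) + m t * arho n t * (SF * c - CF * s))
      + (ares1 n t * c - ares2 n t / (E * E) * s)); [ring|rewrite <- ES; ring].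
  - auto_derive; [repeat split; eexists; eassumption|].
    rewrite_derive.
    fold c s. unfold zfy.
    transitivity ((ares1 n t - m t * arho n t * SF + s) * s + (arho n t * ag n t) * c); [ring|].
    rewrite R2.
    transitivity ((arho n t ^ 2 - lam * t) * (arho n t * c) + (s * s + c * c) - m t * arho n t * (CF * c + SF * s)
      + (ares1 n t * s + ares2 n t / (E * E) * c)); [ring|rewrite <- EC, Hcs; ring].
Qed.

Lemma apsi_close n0 n n' : (n0 <= n)%nat -> (n0 <= n')%nat -> O (S n0) (fun t => apsi n t - apsi n' t).
Proof.
  intros Hn Hn'. apply (bigO_ext_all e _ (fun t => (pola p (S n) (e t) - pola p (S n0) (e t)) - (pola p (S n') (e t) - pola p (S n0) (e t)))).
  - intros; unfold apsi; ring.
  - apply (bigO_minus e); apply (pola_tail e He); lia.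
Qed.

Lemma ar_close n0 n n' : (n0 <= n)%nat -> (n0 <= n')%nat -> O (S n0) (fun t => ar n t - ar n' t).
Proof.
  intros Hn Hn'. apply (bigO_ext_all e _ (fun t => (pola r (S n) (e t) - pola r (S n0) (e t)) - (pola r (S n') (e t) - pola r (S n0) (e t)))).
  - intros; unfold ar; ring.
  - apply (bigO_minus e); apply (pola_tail e He); lia.
Qed.

Lemma ps_apsi k n : ps e k (apsi n).
Proof. now apply ps_pola_e. Qed.
Lemma ps_ar k n : ps e k (ar n).
Proof. now apply ps_pola_e. Qed.
Lemma ps_aR k n : ps e k (aR n).
Proof.
  apply ps_plus; [now apply ps_const|]. apply ps_mult; [exact He|apply ps_pow; [exact He|now apply ps_e]|apply ps_ar].
Qed.

Lemma aR_bounded n : O 0 (aR n).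
Proof. apply (ps_bounded e He 0), ps_aR. Qed.
Lemma ar_bounded n : O 0 (ar n).
Proof. apply (ps_bounded e He 0), ps_ar. Qed.

(** The amplitude rho is of size e^(-h), so the phases must agree to h more orders than the wanted 2
    h N, where e^(2h) is 1 / t. *)
Lemma dist2_close N n n' : (2 * h * N + h <= n)%nat -> (2 * h * N + h <= n')%nat -> exists C T, 0 <= C /\
  forall t, T <= t -> dist2 (axs n) (ays n) (axs n') (ays n') t <= C / t ^ N.
Proof.
  intros Hn Hn'. set (n0 := (2 * h * N + h)%nat) in *.
  assert (Htrig : forall f : R -> R, O 0 (fun t => f (apsi n t)) ->
     O (S n0) (fun t => f (apsi n t) - f (apsi n' t)) ->
     O (2 * h * N) (fun t => arho n t * f (apsi n t) - arho n' t * f (apsi n' t))).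
  { intros f Hf Hdf.
    apply (bigO_ext_all e _ (fun t => ((ar n t - ar n' t) * e t ^ h * f (apsi n t)
        + aR n' t * (f (apsi n t) - f (apsi n' t))) / e t ^ h)).
    - intros t. rewrite !arho_aR. unfold aR. pose proof (pow_lt _ h (ep_pos h t)). field. lra.
    - apply (bigO_div e He). replace (h + 2 * h * N)%nat with n0 by (unfold n0; lia).
      apply (bigO_weaken e He n0 (S n0)); [lia|]. apply (bigO_plus e).
      + apply (bigO_mult_l e He); [|exact Hf].
        apply (bigO_mult_l e He); [now apply ar_close|]. apply (bigO_epow e He). lia.
      + apply (bigO_mult_r e He); [apply aR_bounded|exact Hdf]. }
  assert (Hx : O (2 * h * N) (fun t => axs n t - axs n' t)).
  { apply (Htrig cos); [apply (bigO_cos e)|]. apply bigO_cos_diff. now apply apsi_close. }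
  assert (Hy : O (2 * h * N) (fun t => ays n t - ays n' t)).
  { apply (Htrig sin); [apply (bigO_sin e)|]. apply bigO_sin_diff. now apply apsi_close. }
  destruct (bigO_inv_tpow h Hh N (dist2 (axs n) (ays n) (axs n') (ays n'))) as (C & T & HC & HT).
  { unfold dist2. apply (bigO_plus e).
    - apply (bigO_ext_all e _ (fun t => (axs n t - axs n' t) * (axs n t - axs n' t))); [intros; ring|].
      apply (bigO_mult e He _ _ _ _ _ Hx Hx). lia.
    - apply (bigO_ext_all e _ (fun t => (ays n t - ays n' t) * (ays n t - ays n' t))); [intros; ring|].
      apply (bigO_mult e He _ _ _ _ _ Hy Hy). lia. }
  exists C, T. split; [exact HC|]. intros t Ht. eapply Rle_trans; [apply Rle_abs|]. now apply HT.
Qed.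

(** Chosen so that later partial sums differ from the reference one by O(t^-11) in squared distance,
    against the t^10 of the tube. *)
Definition frame_index : nat := (2 * h * 11 + h)%nat.

Lemma approximate_family : family lam nu m (arho frame_index) (apsi frame_index) axs ays afx afy.
Proof.
  split.
  (* The surplus 2 h is lost when the second residual is divided by e^(2h). *)
  - intros N. exists (2 * h * N + 2 * h)%nat. intros n Hn.
    destruct (Hstage n ltac:(lia)) as [S1 S2].
    assert (Q1 : O (2 * h * N) (ares1 n)) by (apply (bigO_weaken e He _ (n + h)); [lia|exact S1]).
    assert (Q2 : O (2 * h * N) (fun t => ares2 n t / e t ^ (2 * h))).
    { apply (bigO_div e He). apply (bigO_weaken e He _ (S n)); [lia|exact S2]. }
    destruct (bigO_inv_tpow h Hh N (afx n)) as (C1 & T1 & HC1 & HT1).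
    { apply (bigO_minus e); apply (bigO_mult_l e He); auto; [apply (bigO_cos e)|apply (bigO_sin e)]. }
    destruct (bigO_inv_tpow h Hh N (afy n)) as (C2 & T2 & HC2 & HT2).
    { apply (bigO_plus e); apply (bigO_mult_l e He); auto; [apply (bigO_sin e)|apply (bigO_cos e)]. }
    exists (C1 + C2), (Rmax 1 (Rmax T1 T2)). split; [lra|]. intros t Ht.
    pose proof (Rmax_l 1 (Rmax T1 T2)). pose proof (Rmax_r 1 (Rmax T1 T2)).
    pose proof (Rmax_l T1 T2). pose proof (Rmax_r T1 T2).
    split; [apply approximate_solution; lra|].
    specialize (HT1 t ltac:(lra)). specialize (HT2 t ltac:(lra)). unfold Rdiv in *. lra.
  - intros N. exists (2 * h * N + h)%nat. intros n n' Hn Hn'. now apply dist2_close.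
  - exists frame_index. intros n Hn.
    destruct (dist2_close 11 n frame_index Hn (le_n _)) as (C & T & HC & HT).
    exists (Rmax T (16 * C + 1)). intros t Ht.
    pose proof (Rmax_l T (16 * C + 1)). pose proof (Rmax_r T (16 * C + 1)).
    specialize (HT t ltac:(lra)).
    change (dist2 (axs n) (ays n) (fx0 (arho frame_index) (apsi frame_index)) (fy0 (arho frame_index) (apsi frame_index)) t)
      with (dist2 (axs n) (ays n) (axs frame_index) (ays frame_index) t).
    assert (Hp : 0 < t ^ 10) by (apply pow_lt; lra).
    apply Rle_trans with (t ^ 10 * (C / t ^ 11)); [apply Rmult_le_compat_l; lra|].
    replace (t ^ 10 * (C / t ^ 11)) with (C / t) by (field; lra).
    apply Rmult_le_reg_r with t; [lra|]. unfold Rdiv. rewrite Rmult_assoc, Rinv_l by lra. lra.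
Qed.

Lemma aR_lower n : evt (fun t => sl / 2 <= aR n t).
Proof.
  assert (Hb : O 1 (fun t => e t ^ h * ar n t)).
  { apply (bigO_mult_l e He); [apply (bigO_epow e He); lia|apply ar_bounded]. }
  refine (evt_imp _ _ _ (bigO_small e He He0 1 _ (sl / 2) (le_n _) Hb ltac:(lra))).
  intros t Ht. apply Rabs_lt_between in Ht. unfold aR. lra.
Qed.

Let nf := frame_index.
(** The exact coefficients of the linearisation at the reference partial sum; as they contain mu,
    nothing is known about the size of their derivatives. *)
Let FA (t : R) : R := 3 * arho nf t ^ 2 - lam * t - ag nf t - m t * cos (2 * apsi nf t + nu).
Let FB (t : R) : R := arho nf t ^ 2 - lam * t - ag nf t + m t * cos (2 * apsi nf t + nu).
Let Fc (t : R) : R := m t * sin (2 * apsi nf t + nu).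

Let epow2 t : e t ^ (2 * h) = e t ^ h * e t ^ h.
Proof. rewrite <- pow_add; f_equal; lia. Qed.

Let lam_t t : 0 < t -> lam * t = sl ^ 2 / (e t ^ h * e t ^ h).
Proof. intros Ht. rewrite Hlam, <- epow2, ep_pow_2h by assumption. field. lra. Qed.

Let FA_eq t : 0 < t -> e t ^ (2 * h) * FA t = 3 * aR nf t ^ 2 - sl ^ 2 - e t ^ (2 * h) * ag nf t
   - e t ^ h * e t ^ (2 * h) * (mm t * cos (2 * apsi nf t + nu)).
Proof.
  intros Ht. unfold FA. rewrite lam_t, arho_aR, epow2 by exact Ht.
  pose proof (pow_lt _ h (ep_pos h t)). field. lra.
Qed.

Let FB_eq t : 0 < t -> e t ^ h * FB t = 2 * sl * ar nf t + e t ^ h * ar nf t ^ 2 - e t ^ h * ag nf t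
   + e t ^ h * e t ^ h * (mm t * cos (2 * apsi nf t + nu)).
Proof.
  intros Ht. unfold FB. rewrite lam_t, arho_aR by exact Ht. unfold aR.
  pose proof (pow_lt _ h (ep_pos h t)). field. lra.
Qed.

Ltac psauto := repeat first [ exact He | apply ps_const | apply ps_ar | apply ps_apsi | apply ps_aR | apply Hmps
  | apply ps_pola_e | apply ps_minus | apply ps_plus | apply ps_opp | apply ps_sin | apply ps_cos | apply ps_mult | apply ps_pow | apply ps_e ].

Let ps_ag k n : ps e k (ag n).
Proof. unfold ag. apply ps_mult; [exact He| |now apply ps_pola_e]. psauto. Qed.

Let ps_FA k : ps e k (fun t => e t ^ (2 * h) * FA t).
Proof.
  apply (ps_ext e k (fun t => 3 * aR nf t ^ 2 - sl ^ 2 - e t ^ (2 * h) * ag nf t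
   - e t ^ h * e t ^ (2 * h) * (mm t * cos (2 * apsi nf t + nu)))).
  - refine (evt_imp _ _ _ (evt_ge 1)). intros t Ht. symmetry. apply FA_eq. lra.
  - repeat first [apply ps_ag | progress psauto].
Qed.

Let ps_FB k : ps e k (fun t => e t ^ h * FB t).
Proof.
  apply (ps_ext e k (fun t => 2 * sl * ar nf t + e t ^ h * ar nf t ^ 2 - e t ^ h * ag nf t
   + e t ^ h * e t ^ h * (mm t * cos (2 * apsi nf t + nu)))).
  - refine (evt_imp _ _ _ (evt_ge 1)). intros t Ht. symmetry. apply FB_eq. lra.
  - repeat first [apply ps_ag | progress psauto].
Qed.

Let ps_Fc k : ps e k Fc.
Proof.
  apply (ps_ext_all e k (fun t => e t ^ h * mm t * sin (2 * apsi nf t + nu))).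
  - intros t. unfold Fc. pose proof (pow_lt _ h (ep_pos h t)). field. lra.
  - psauto.
Qed.

Let Fc_small : O 1 Fc.
Proof.
  apply (bigO_ext_all e _ (fun t => e t ^ h * (mm t * sin (2 * apsi nf t + nu)))).
  - intros t. unfold Fc. pose proof (pow_lt _ h (ep_pos h t)). field. lra.
  - apply (bigO_mult_l e He); [apply (bigO_epow e He); lia|].
    apply (bigO_mult_l e He); [apply (ps_bounded e He 0), Hmps|apply (bigO_sin e)].
Qed.

Let FA_lead : O 1 (fun t => e t ^ (2 * h) * FA t - 2 * sl ^ 2 * e t ^ 0).
Proof.
  apply (bigO_ext e _ (fun t => (6 * sl * ar nf t + 3 * e t ^ h * ar nf t ^ 2 - e t ^ h * ag nf t
     - e t ^ (2 * h) * (mm t * cos (2 * apsi nf t + nu))) * e t ^ h)).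
  - refine (evt_imp _ _ _ (evt_ge 1)). intros t Ht. rewrite FA_eq by lra. rewrite epow2. unfold aR. ring.
  - apply (bigO_mult_r e He); [|apply (bigO_epow e He); lia].
    apply (ps_bounded e He 0). repeat first [apply ps_ag | progress psauto].
Qed.

(** The second equation gives rho^2 - lam t - psi' = (mu rho cos(2 psi + nu) - cos psi) / rho up to
    the residual; adding mu cos(2 psi + nu) and using mu rho ~ d turns the numerator into P'(psi).
    So B is P'(psi) / rho ~ (A0 / sl) e^(2h-1), which ties its sign to that of A0. *)
Let FB_lead : O (3 * h) (fun t => e t ^ h * FB t - A0 / sl * e t ^ (3 * h - 1)).
Proof.
  destruct (Hstage nf ltac:(unfold nf, frame_index; lia)) as [_ S2].
  fold (apsi nf) in S2.
  assert (HS2 : O (3 * h) (ares2 nf)).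
  { apply (bigO_weaken e He _ (S nf)); [unfold nf, frame_index; lia|exact S2]. }
  assert (HP : O h (fun t => P1 (apsi nf t) d nu - A0 * e t ^ (h - 1))).
  { apply H2. rewrite <- Hp0, <- Hp1. apply (pola_first_two e He). unfold nf, frame_index. lia. }
  assert (Hmb : O 0 mm) by (apply (ps_bounded e He 0), Hmps).
  assert (HmR : O h (fun t => mm t * aR nf t - d)).
  { apply (bigO_ext_all e _ (fun t => sl * (mm t - mu0) + e t ^ h * (mm t * ar nf t))).
    - intros t. unfold aR. rewrite Hd. ring.
    - apply (bigO_plus e).
      + apply (bigO_scal e He). apply (bigO_weaken e He h (2 * h)); [lia|exact Hmm].
      + apply (bigO_mult_l e He); [apply (bigO_epow e He); lia|].
        apply (bigO_mult_l e He); [exact Hmb|apply ar_bounded]. }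
  assert (HRi : O 0 (fun t => / aR nf t)).
  { apply (bigO_bounded e _ (2 / sl)). refine (evt_imp _ _ _ (aR_lower nf)). intros t Ht.
    rewrite Rabs_pos_eq by (left; apply Rinv_0_lt_compat; lra).
    replace (2 / sl) with (/ (sl / 2)) by (field; lra). apply Rinv_le_contravar; lra. }
  apply (bigO_ext e _ (fun t => (- ares2 nf t
     + (e t ^ (2 * h) * ((P1 (apsi nf t) d nu - A0 * e t ^ (h - 1)) + 2 * ((mm t * aR nf t - d) * cos (2 * apsi nf t + nu)))
     - (ar nf t * (A0 / sl)) * (e t ^ h * e t ^ (3 * h - 1)))) * / aR nf t)).
  - refine (evt_imp _ _ _ (evt_and _ _ (evt_ge 1) (aR_lower nf))). intros t [Ht HRl].
    rewrite FB_eq by lra.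
    assert (E1 : e t ^ (3 * h - 1) = e t ^ h * e t ^ h * e t ^ (h - 1)) by (rewrite <- !pow_add; f_equal; lia).
    rewrite E1. unfold ares2, res2, P1.
    assert (Eg : - / (2 * INR h) * e t ^ (3 * h) * pola (theta p) (S nf) (e t) = e t ^ h * ag nf t).
    { unfold ag. replace (3 * h)%nat with (h + 2 * h)%nat by lia. rewrite pow_add. ring. }
    rewrite Eg. change (sl + e t ^ h * ar nf t) with (aR nf t). rewrite epow2.
    apply Rmult_eq_reg_r with (aR nf t); [|lra].
    rewrite (Rmult_assoc _ (/ aR nf t)), Rinv_l, Rmult_1_r by lra.
    unfold aR. field. split; [lra|]. apply pow_nonzero. pose proof (ep_pos h t). lra.
  - apply (bigO_mult_l e He); [|exact HRi].
    apply (bigO_plus e); [apply (bigO_opp e); exact HS2|]. apply (bigO_minus e).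
    + apply (bigO_mult e He (2 * h) h); [apply (bigO_epow e He); lia| |lia].
      apply (bigO_plus e); [exact HP|]. apply (bigO_scal e He). apply (bigO_mult_l e He); [exact HmR|apply (bigO_cos e)].
    + apply (bigO_mult_r e He); [apply (bigO_mult_l e He); [apply ar_bounded|apply (bigO_const e)]|].
      apply (bigO_mult e He h (3 * h - 1)); [apply (bigO_epow e He); lia|apply (bigO_epow e He); lia|lia].
Qed.

Lemma approximate_frame : exists A B c A' B' c' k K T0,
  frame lam nu m (arho frame_index) (apsi frame_index) (ag frame_index) A B c A' B' c' k K T0 /\
  ((0 < A0 /\ forall t, T0 <= t -> 0 < B t) \/ (A0 < 0 /\ forall t, T0 <= t -> B t < 0)).
Proof.
  fold nf.
  assert (Ha0 : 2 * sl ^ 2 <> 0) by (apply Rgt_not_eq; pose proof (pow_lt sl 2 Hsl); lra).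
  assert (Hb0 : A0 / sl <> 0) by (apply Rmult_integral_contrapositive_currified; [exact HA0|apply Rinv_neq_0_compat; lra]).
  (* Order 8 h in e is order 4 in 1 / t, the tolerance of the frame. *)
  destruct (differentiable_truncation h Hh FA (2 * h) 0 (8 * h) (2 * sl ^ 2) Ha0 ps_FA FA_lead)
    as (A & A' & DA & (CA & HCA & EA) & (CA' & HCA' & EA') & LA).
  assert (FBl : O (S (3 * h - 1)) (fun t => e t ^ h * FB t - A0 / sl * e t ^ (3 * h - 1))).
  { replace (S (3 * h - 1)) with (3 * h)%nat by lia. exact FB_lead. }
  destruct (differentiable_truncation h Hh FB h (3 * h - 1) (8 * h) (A0 / sl) Hb0 ps_FB FBl)
    as (B & B' & DB & (CB & HCB & EB) & (CB' & HCB' & EB') & LB).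
  destruct (differentiable_truncation_small h Hh Fc (8 * h) ps_Fc Fc_small)
    as (c & c' & Dc & (Cc & HCc & Ec) & (Cc' & HCc' & Ec') & Lc).
  destruct (aR_bounded nf) as (CR & HCR & ER).
  set (b0 := Rabs (A0 / sl)) in *.
  assert (Hb0p : 0 < b0) by (now apply Rabs_pos_lt).
  assert (Hsl2 : 0 < sl ^ 2) by (now apply pow_lt).
  (* Threshold for A |B| >= 16: the product is at least sl^2 t (b0 / 2) e^(2h-1) = sl^2 b0 / (2
     e). *)
  assert (Hes : 0 < sl ^ 2 * b0 / 32) by (apply Rdiv_lt_0_compat; [now apply Rmult_lt_0_compat|lra]).
  destruct (evt_and _ _ (evt_ge 1) (evt_and _ _ He (evt_and _ _ DA (evt_and _ _ EA (evt_and _ _ EA' (evt_and _ _ LA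
    (evt_and _ _ DB (evt_and _ _ EB (evt_and _ _ EB' (evt_and _ _ LB (evt_and _ _ Dc (evt_and _ _ Ec (evt_and _ _ Ec'
    (evt_and _ _ Lc (evt_and _ _ ER (He0 _ Hes)))))))))))))))) as (T0 & HT0).
  set (k := Rmin (sl ^ 2) (b0 / 2)).
  (* One constant for all upper bounds: 3 sl^2 covers A and 2 b0 covers the factor 3/2 b0 in the
     bound of B. *)
  set (K := 1 + CA + CA' + CB + CB' + Cc + Cc' + CR + 3 * sl ^ 2 + 2 * b0).
  assert (Hk1 : k <= sl ^ 2) by apply Rmin_l. assert (Hk2 : k <= b0 / 2) by apply Rmin_r.
  assert (Hkp : 0 < k) by (apply Rmin_pos; lra).
  clearbody k.
  assert (Hfacts : forall t, T0 <= t -> 1 <= t /\ 0 < e t <= 1 /\ e t < sl ^ 2 * b0 / 32 /\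
     sl ^ 2 * t <= A t <= 3 * sl ^ 2 * t /\
     b0 / 2 * e t ^ (2 * h - 1) <= Rabs (B t) <= 3 / 2 * b0 * e t ^ (2 * h - 1) /\
     (0 < A0 / sl -> 0 < B t) /\ (A0 / sl < 0 -> B t < 0)).
  { intros t Ht. destruct (HT0 t Ht) as (U1 & U2 & _ & _ & _ & U6 & _ & _ & _ & U10 & _ & _ & _ & _ & _ & U16).
    split; [exact U1|]. split; [exact U2|]. split; [exact U16|].
    rewrite pow_O, !Rmult_1_r, ep_pow_2h in U6 by (assumption || lra).
    rewrite (Rabs_pos_eq (2 * sl ^ 2)) in U6 by lra. apply Rabs_le_between in U6.
    assert (Hti : t * / t = 1) by (field; lra).
    assert (Hti0 : 0 < / t) by (apply Rinv_0_lt_compat; lra).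
    split.
    { split; apply Rmult_le_reg_l with (/ t); try exact Hti0.
      - replace (/ t * (sl ^ 2 * t)) with (sl ^ 2) by (field; lra). lra.
      - replace (/ t * (3 * sl ^ 2 * t)) with (3 * sl ^ 2) by (field; lra). lra. }
    assert (HE : 0 < e t ^ h) by (apply pow_lt; lra).
    assert (Hw : 0 < e t ^ (2 * h - 1)) by (apply pow_lt; lra).
    assert (Ew : e t ^ (3 * h - 1) = e t ^ h * e t ^ (2 * h - 1)) by (rewrite <- pow_add; f_equal; lia).
    rewrite Ew in U10. set (w := e t ^ (2 * h - 1)) in *. set (E := e t ^ h) in *.
    assert (Edist : forall u v : R, E * u - v * (E * w) = E * (u - v * w)) by (intros; ring). rewrite Edist in U10.
    rewrite Rabs_mult, (Rabs_pos_eq E) in U10 by lra. fold b0 in U10.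
    assert (U : Rabs (B t - A0 / sl * w) <= b0 / 2 * w).
    { apply Rmult_le_reg_l with E; [exact HE|]. lra. }
    assert (Hbw : Rabs (A0 / sl * w) = b0 * w) by (rewrite Rabs_mult, (Rabs_pos_eq w) by lra; reflexivity).
    split; [split|split].
    - pose proof (Rabs_triang_inv (A0 / sl * w) (A0 / sl * w - B t)) as H.
      assert (Ecan : forall u v : R, u - (u - v) = v) by (intros; ring). rewrite Ecan in H.
      rewrite (Rabs_minus_sym _ (B t)), Hbw in H. lra.
    - pose proof (Rabs_triang_inv (B t) (A0 / sl * w)) as H. rewrite Hbw in H. lra.
    - intros Hpos. apply Rabs_le_between in U. unfold b0 in U. rewrite (Rabs_pos_eq (A0 / sl)) in U by lra.
      assert (0 < A0 / sl * w) by (now apply Rmult_lt_0_compat). lra.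
    - intros Hneg. apply Rabs_le_between in U. unfold b0 in U. rewrite (Rabs_left (A0 / sl)) in U by lra.
      assert (0 < - (A0 / sl) * w) by (apply Rmult_lt_0_compat; lra). lra. }
  assert (H84 : forall t, 1 <= t -> e t ^ (8 * h) = / t ^ 4).
  { intros t Ht. replace (8 * h)%nat with (2 * h * 4)%nat by lia. rewrite pow_mult, ep_pow_2h, pow_inv by (assumption || lra). reflexivity. }
  exists A, B, c, A', B', c', k, K, (Rmax T0 1). split.
  - assert (HTm : forall t, Rmax T0 1 <= t -> T0 <= t) by (intros t Ht; pose proof (Rmax_l T0 1); lra).
    assert (Hdiv : forall t C, 1 <= t -> C <= K -> C / t <= K / t).
    { intros t C Ht HC. apply Rmult_le_compat_r; [left; apply Rinv_0_lt_compat; lra|exact HC]. }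
    assert (Herr : forall t C (F : R), 1 <= t -> C <= K -> F <= C * e t ^ (8 * h) -> F <= K / t ^ 4).
    { intros t C F Ht HC HFc. rewrite H84 in HFc by exact Ht. eapply Rle_trans; [exact HFc|].
      apply Rmult_le_compat_r; [left; apply Rinv_0_lt_compat, pow_lt; lra|exact HC]. }
    split.
    + apply Rmax_r.
    + exact Hkp.
    + unfold K. lra.
    + intros t Ht. apply apsi_derive. pose proof (Rmax_r T0 1). lra.
    + intros t Ht. eapply continuous_of_derive, arho_derive. pose proof (Rmax_r T0 1). lra.
    + intros t Ht. destruct (Hfacts t (HTm t Ht)) as (U1 & U2 & _).
      destruct (HT0 t (HTm t Ht)) as (_ & _ & _ & _ & _ & _ & _ & _ & _ & _ & _ & _ & _ & _ & U15 & _).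
      rewrite pow_O, Rmult_1_r in U15. rewrite arho_aR. unfold Rdiv.
      assert (HE : 0 < e t ^ h) by (apply pow_lt; lra).
      rewrite Rabs_mult, Rabs_inv, (Rabs_pos_eq (e t ^ h)) by lra.
      apply Rmult_le_compat; [apply Rabs_pos|left; now apply Rinv_0_lt_compat|unfold K; lra|].
      assert (Et : t = / e t ^ (2 * h)) by (rewrite ep_pow_2h, Rinv_inv by (assumption || lra); reflexivity).
      rewrite Et at 2. apply Rinv_le_contravar; [apply pow_lt; lra|]. apply epow_le; [exact U2|lia].
    + intros t Ht. apply (HT0 t (HTm t Ht)).
    + intros t Ht. apply (HT0 t (HTm t Ht)).
    + intros t Ht. apply (HT0 t (HTm t Ht)).
    + intros t Ht. destruct (Hfacts t (HTm t Ht)) as (U1 & _ & _ & U4 & _).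
      split; [apply Rle_trans with (sl ^ 2 * t)|apply Rle_trans with (3 * sl ^ 2 * t)]; try lra;
        apply Rmult_le_compat_r; unfold K; lra.
    + intros t Ht. destruct (Hfacts t (HTm t Ht)) as (U1 & U2 & _ & _ & U5 & _).
      assert (W1 : 0 < e t ^ (2 * h - 1) <= 1) by (now apply epow_pos).
      assert (W2 : / t <= e t ^ (2 * h - 1)).
      { rewrite <- (ep_pow_2h h Hh t) by lra. apply epow_le; [exact U2|lia]. }
      assert (0 < / t) by (apply Rinv_0_lt_compat; lra).
      split.
      * apply Rle_trans with (b0 / 2 * e t ^ (2 * h - 1)); [|lra]. apply Rmult_le_compat; lra.
      * apply Rle_trans with (3 / 2 * b0 * e t ^ (2 * h - 1)); [lra|].
        apply Rle_trans with (3 / 2 * b0 * 1); [apply Rmult_le_compat_l; lra|unfold K; lra].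
    + intros t Ht. apply (HT0 t (HTm t Ht)).
    + intros t Ht. destruct (Hfacts t (HTm t Ht)) as (U1 & U2 & U3 & U4 & U5 & _).
      assert (Hw : 0 < e t ^ (2 * h - 1)) by (apply pow_lt; lra).
      assert (Htw : t * e t ^ (2 * h - 1) = / e t).
      { assert (X : e t ^ (2 * h - 1) * e t = / t).
        { rewrite <- (ep_pow_2h h Hh t) by lra. replace (2 * h)%nat with (2 * h - 1 + 1)%nat at 2 by lia.
          rewrite pow_add, pow_1. reflexivity. }
        apply Rmult_eq_reg_r with (e t); [|lra]. rewrite Rmult_assoc, X. field. lra. }
      apply Rle_trans with ((sl ^ 2 * t) * (b0 / 2 * e t ^ (2 * h - 1))).
      * replace ((sl ^ 2 * t) * (b0 / 2 * e t ^ (2 * h - 1))) with (sl ^ 2 * b0 / 2 * (t * e t ^ (2 * h - 1))) by field.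
        rewrite Htw. apply Rmult_le_reg_r with (e t); [lra|]. rewrite Rmult_assoc, Rinv_l by lra. lra.
      * apply Rmult_le_compat; try lra; apply Rmult_le_pos; lra.
    + intros t Ht. destruct (HT0 t (HTm t Ht)) as (U1 & _ & _ & _ & U5 & _).
      destruct (Hfacts t (HTm t Ht)) as (_ & _ & _ & U4 & _).
      rewrite (Rabs_pos_eq (A t)) in U5 by nra.
      eapply Rle_trans; [exact U5|]. apply Rmult_le_compat_r; [nra|]. apply Hdiv; [exact U1|unfold K; lra].
    + intros t Ht. destruct (HT0 t (HTm t Ht)) as (U1 & _ & _ & _ & _ & _ & _ & _ & U9 & _).
      eapply Rle_trans; [exact U9|]. apply Rmult_le_compat_r; [apply Rabs_pos|]. apply Hdiv; [exact U1|unfold K; lra].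
    + intros t Ht. destruct (HT0 t (HTm t Ht)) as (U1 & _ & _ & _ & _ & _ & _ & _ & _ & _ & _ & _ & U13 & _).
      eapply Rle_trans; [exact U13|]. apply Hdiv; [exact U1|unfold K; lra].
    + intros t Ht. destruct (HT0 t (HTm t Ht)) as (U1 & _ & _ & U4 & _).
      apply (Herr t CA); [exact U1|unfold K; lra|exact U4].
    + intros t Ht. destruct (HT0 t (HTm t Ht)) as (U1 & _ & _ & _ & _ & _ & _ & U8 & _).
      apply (Herr t CB); [exact U1|unfold K; lra|exact U8].
    + intros t Ht. destruct (HT0 t (HTm t Ht)) as (U1 & _ & _ & _ & _ & _ & _ & _ & _ & _ & _ & U12 & _).
      apply (Herr t Cc); [exact U1|unfold K; lra|exact U12].
  - destruct (Rtotal_order A0 0) as [Hneg|[H0|Hpos]]; [right|now exfalso|left].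
    + split; [exact Hneg|]. intros t Ht. pose proof (Rmax_l T0 1).
      destruct (Hfacts t ltac:(lra)) as (_ & _ & _ & _ & _ & _ & U). apply U.
      apply Ropp_lt_cancel. rewrite Ropp_0. unfold Rdiv. rewrite Ropp_mult_distr_l.
      apply Rmult_lt_0_compat; [lra|now apply Rinv_0_lt_compat].
    + split; [exact Hpos|]. intros t Ht. pose proof (Rmax_l T0 1).
      destruct (Hfacts t ltac:(lra)) as (_ & _ & _ & _ & _ & U & _). apply U.
      apply Rdiv_lt_0_compat; lra.
Qed.

Lemma tracked_exists : (forall t, continuous m t) -> exists x y, tracked lam nu m axs ays x y.
Proof.
  intros Hm. destruct approximate_frame as (A & B & c & A' & B' & c' & k & K & T0 & HF & [[_ HB]|[_ HB]]).
  - apply (center_tracked _ _ _ Hm _ _ _ _ _ _ _ _ _ _ _ _ HF _ _ _ _ approximate_family HB).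
  - apply (saddle_tracked _ _ _ Hm _ _ _ _ _ _ _ _ _ _ _ _ HF HB _ _ _ _ approximate_family).
Qed.

End ApproximateSolutions.

Lemma atan_le_abs u : Rabs (atan u) <= Rabs u.
Proof.
  destruct (MVT_gen atan 0 u (fun v => / (1 + v²))) as (c & _ & E).
  - intros v _. apply is_derive_atan.
  - intros v _. apply continuity_pt_filterlim. eapply continuous_of_derive, is_derive_atan.
  - rewrite atan_0, !Rminus_0_r in E. rewrite E, Rabs_mult.
    assert (0 < / (1 + c²) <= 1).
    { pose proof (Rle_0_sqr c). split; [apply Rinv_0_lt_compat; lra|].
      rewrite <- Rinv_1. apply Rinv_le_contravar; lra. }
    rewrite (Rabs_pos_eq (/ _)) by lra. pose proof (Rabs_pos u). nra.
Qed.

(** The bound |th| < PI / 2 selects the branch and makes rho positive; then th = atan(q / p) with p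
    >= 1, and 0 <= rho - p <= |q| follows from rho^2 = p^2 + q^2. *)
Lemma polar_angle_bound rho th p q : Rabs th < PI / 2 -> 1 <= p -> rho * cos th = p -> rho * sin th = q ->
  Rabs th <= Rabs q /\ Rabs (rho - p) <= Rabs q.
Proof.
  intros Hth Hp Hc Hs. apply Rabs_lt_between in Hth.
  assert (Hcos : 0 < cos th) by (apply cos_gt_0; lra).
  assert (Hrho : 0 < rho).
  { destruct (Rlt_dec 0 rho) as [|Hn]; [assumption|]. nra. }
  split.
  - assert (Et : tan th = q / p).
    { unfold tan. rewrite <- Hs, <- Hc. field. split; lra. }
    rewrite <- (atan_tan th) by lra. rewrite Et.
    eapply Rle_trans; [apply atan_le_abs|]. unfold Rdiv. rewrite Rabs_mult, Rabs_inv, (Rabs_pos_eq p) by lra.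
    rewrite <- (Rmult_1_r (Rabs q)) at 2. apply Rmult_le_compat_l; [apply Rabs_pos|].
    rewrite <- Rinv_1. apply Rinv_le_contravar; lra.
  - assert (E : rho ^ 2 = p ^ 2 + Rabs q ^ 2).
    { rewrite pow2_abs, <- Hc, <- Hs. pose proof (sin2_cos2 th) as H. unfold Rsqr in H.
      transitivity (rho ^ 2 * (sin th * sin th + cos th * cos th)); [rewrite H; ring|ring]. }
    pose proof (Rabs_pos q).
    assert (p <= rho) by nra. assert (Rabs q <= rho) by nra.
    rewrite Rabs_pos_eq by lra.
    destruct (Rle_dec (rho - p) (Rabs q)) as [|Hn]; [assumption|]. nra.
Qed.

(** * From z back to polar coordinates *)

Section PolarExpansion.

Variable h : nat.
Hypothesis Hh : (1 <= h <= 3)%nat.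
Variables (lam nu sl : R) (m : R -> R) (p r : nat -> R).
Hypothesis Hsl : 0 < sl.
Hypothesis Hm : forall t, continuous m t.

Local Notation e := (ep h).
Local Notation rhon := (arho h sl r).
Local Notation psin := (apsi h p).
Local Notation xs := (axs h sl p r).
Local Notation ys := (ays h sl p r).

Let He := ep_le_1 h Hh.
Let He0 := ep_small h Hh.

Lemma arho_ge_2 n : evt (fun t => 2 <= rhon n t).
Proof.
  refine (evt_imp _ _ _ (evt_and _ _ He (evt_and _ _ (He0 (sl / 4) ltac:(lra)) (aR_lower h Hh sl r Hsl n)))).
  intros t (E1 & E2 & E3). rewrite arho_aR by assumption.
  assert (Hp : 0 < e t ^ h) by (apply pow_lt; lra).
  assert (e t ^ h <= e t) by (rewrite <- (pow_1 (e t)) at 2; apply epow_le; [exact E1|lia]).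
  apply Rmult_le_reg_r with (e t ^ h); [exact Hp|]. unfold Rdiv. rewrite Rmult_assoc, Rinv_l by lra. lra.
Qed.

Lemma polar_dist2 (x y rho psi : R -> R) n t :
  x t = rho t * cos (psi t) -> y t = rho t * sin (psi t) ->
  (rho t * cos (psi t - psin n t) - rhon n t) ^ 2 + (rho t * sin (psi t - psin n t)) ^ 2
   = dist2 x y (xs n) (ys n) t.
Proof.
  intros Hx Hy. unfold dist2, axs, ays. rewrite Hx, Hy, cos_minus, sin_minus.
  set (c := cos (psi t)). set (s := sin (psi t)).
  pose proof (sin2_cos2 (psin n t)) as H. unfold Rsqr in H.
  set (c1 := cos (psin n t)) in *. set (s1 := sin (psin n t)) in *.
  set (a := rho t). set (b := rhon n t).
  transitivity (a ^ 2 * (c ^ 2 + s ^ 2) * (s1 * s1 + c1 * c1) - 2 * a * b * (c * c1 + s * s1) + b ^ 2); [ring|].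
  transitivity (a ^ 2 * (c ^ 2 + s ^ 2) - 2 * a * b * (c * c1 + s * s1) + b ^ 2 * (s1 * s1 + c1 * c1));
    [rewrite H; ring|ring].
Qed.

Variables (x y : R -> R).
Hypothesis Htr : tracked lam nu m xs ys x y.

Lemma dist2_evt_small n0 N eps : 0 < eps -> (1 <= N)%nat ->
  (forall n, (n0 <= n)%nat -> exists C T, 0 <= C /\ forall t, T <= t -> dist2 x y (xs n) (ys n) t <= C / t ^ N) ->
  forall n, (n0 <= n)%nat -> evt (fun t => dist2 x y (xs n) (ys n) t <= eps).
Proof.
  intros Heps HN H n Hn. destruct (H n Hn) as (C & T & HC & HT).
  exists (Rmax T (C / eps + 1)). intros t Ht.
  pose proof (Rmax_l T (C / eps + 1)). pose proof (Rmax_r T (C / eps + 1)).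
  assert (0 <= C / eps) by (apply Rdiv_le_0_compat; lra).
  eapply Rle_trans; [apply HT; lra|].
  apply Rle_trans with (C * / t); [apply Rmult_le_compat_l; [exact HC|]; apply inv_pow_le_inv; [lra|exact HN]|].
  apply Rmult_le_reg_r with t; [lra|]. rewrite Rmult_assoc, Rinv_l, Rmult_1_r by lra.
  apply Rle_trans with (eps * (C / eps)); [right; field; lra|]. apply Rmult_le_compat_l; lra.
Qed.

(** The lift is started at T1 within PI / 2 of the phase psi_n of a partial sum. As rho cos(psi -
    psi_n) >= 1 from then on, the cosine never vanishes and the branch is kept, which rules out an
    offset of psi by a multiple of PI. *)
Lemma polar_expansion : exists rho psi rho' psi' : R -> R,
  (forall t, is_derive rho t (rho' t) /\ is_derive psi t (psi' t) /\
      rho' t + m t * rho t * sin (2 * psi t + nu) = sin (psi t) /\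
      rho t * (psi' t - rho t ^ 2 + lam * t) + m t * rho t * cos (2 * psi t + nu) = cos (psi t)) /\
  forall N, bigO e (S N) (fun t => psi t - pola p (S N) (e t)) /\
            bigO e (S N) (fun t => rho t - (sl * / e t ^ h + pola r (S N) (e t))).
Proof.
  destruct Htr as [Hz Hdist].
  destruct (Hdist 1%nat) as (n1 & Hn1).
  pose proof (dist2_evt_small n1 1 (1 / 4) ltac:(lra) (le_n _) Hn1) as Hsmall.
  destruct (evt_and _ _ (Hsmall n1 (le_n _)) (evt_and _ _ (arho_ge_2 n1) (evt_ge 1))) as (T1 & HT1).
  assert (PI1 : 1 < PI / 2) by (pose proof PI2_1; lra).
  set (P := x T1 * cos (psin n1 T1) + y T1 * sin (psin n1 T1)).
  set (Q := y T1 * cos (psin n1 T1) - x T1 * sin (psin n1 T1)).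
  assert (HP : 1 <= P).
  { destruct (HT1 T1 (Rle_refl _)) as (D1 & D2 & _).
    assert (En : (P - rhon n1 T1) ^ 2 + Q ^ 2 = dist2 x y (xs n1) (ys n1) T1).
    { unfold P, Q, dist2, axs, ays. pose proof (sin2_cos2 (psin n1 T1)) as H. unfold Rsqr in H.
      set (c := cos (psin n1 T1)) in *. set (s := sin (psin n1 T1)) in *. set (b := rhon n1 T1).
      transitivity ((x T1 ^ 2 + y T1 ^ 2) * (s * s + c * c) - 2 * b * (x T1 * c + y T1 * s) + b ^ 2); [ring|].
      transitivity ((x T1 ^ 2 + y T1 ^ 2) - 2 * b * (x T1 * c + y T1 * s) + b ^ 2 * (s * s + c * c)); [rewrite H; ring|ring]. }
    pose proof (pow2_ge_0 Q). assert (Rabs (P - rhon n1 T1) <= 1) by (apply sqr_le_abs; lra).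
    apply Rabs_le_between in H0. lra. }
  set (th1 := atan (Q / P)).
  assert (Hth1 : - PI / 2 < th1 < PI / 2) by apply atan_bound.
  assert (Hcth : 0 < cos th1) by (apply cos_gt_0; lra).
  assert (HQ : P / cos th1 * sin th1 = Q).
  { assert (Htan : tan th1 = Q / P) by apply tan_atan. unfold tan in Htan.
    replace (P / cos th1 * sin th1) with (P * (sin th1 / cos th1)) by (field; lra). rewrite Htan. field. lra. }
  assert (HPc : P / cos th1 * cos th1 = P) by (field; lra).
  assert (Hr0 : P / cos th1 <> 0).
  { assert (0 < P / cos th1) by (apply Rdiv_lt_0_compat; lra). lra. }
  destruct (polar_lift lam nu m x y Hm Hz T1 (P / cos th1) (psin n1 T1 + th1) Hr0) as
    (rho & psi & rho' & psi' & Hpsi1 & Hxy & Hode).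
  { rewrite cos_plus. pose proof (sin2_cos2 (psin n1 T1)) as H. unfold Rsqr in H.
    transitivity ((P / cos th1 * cos th1) * cos (psin n1 T1) - (P / cos th1 * sin th1) * sin (psin n1 T1)); [|ring].
    rewrite HPc, HQ. unfold P, Q.
    transitivity (x T1 * (sin (psin n1 T1) * sin (psin n1 T1) + cos (psin n1 T1) * cos (psin n1 T1))); [rewrite H; ring|ring]. }
  { rewrite sin_plus. pose proof (sin2_cos2 (psin n1 T1)) as H. unfold Rsqr in H.
    transitivity ((P / cos th1 * cos th1) * sin (psin n1 T1) + (P / cos th1 * sin th1) * cos (psin n1 T1)); [|ring].
    rewrite HPc, HQ. unfold P, Q.
    transitivity (y T1 * (sin (psin n1 T1) * sin (psin n1 T1) + cos (psin n1 T1) * cos (psin n1 T1))); [rewrite H; ring|ring]. }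
  exists rho, psi, rho', psi'. split; [exact Hode|].
  assert (Hcoord : forall n t, dist2 x y (xs n) (ys n) t <= 1 -> 2 <= rhon n t ->
     1 <= rho t * cos (psi t - psin n t)).
  { intros n t D1 D2. destruct (Hxy t) as [Hx Hy].
    pose proof (polar_dist2 x y rho psi n t Hx Hy) as H.
    pose proof (pow2_ge_0 (rho t * sin (psi t - psin n t))).
    assert (Rabs (rho t * cos (psi t - psin n t) - rhon n t) <= 1) by (apply sqr_le_abs; lra).
    apply Rabs_le_between in H1. lra. }
  assert (Hbase : forall t, T1 <= t -> Rabs (psi t - psin n1 t) < PI / 2).
  (* The square of the phase difference, scaled so that the threshold PI / 2 becomes 1. *)
  { intros t Ht. set (f := fun s => ((psi s - psin n1 s) * (2 / PI)) ^ 2).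
    assert (HPI : 0 < PI) by lra.
    assert (Hiff1 : forall s, f s < 1 -> Rabs (psi s - psin n1 s) < PI / 2).
    { intros s Hs. unfold f in Hs.
      assert (Hs' : Rabs ((psi s - psin n1 s) * (2 / PI)) < 1) by (apply Rabs_lt_between; split; nra).
      assert (H2P : 0 < 2 / PI) by (apply Rdiv_lt_0_compat; lra).
      rewrite Rabs_mult, (Rabs_pos_eq (2 / PI)) in Hs' by lra.
      apply Rmult_lt_reg_r with (2 / PI); [exact H2P|]. replace (PI / 2 * (2 / PI)) with 1 by (field; lra). exact Hs'. }
    apply Hiff1.
    apply (bootstrap_forward f T1 t); [| | |lra].
    - intros s Hs. destruct (HT1 s ltac:(lra)) as (_ & _ & Hs1).
      unfold f. apply continuous_sqr. apply (continuous_Rmult (fun s => psi s - psin n1 s)); [|apply continuous_const].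
      apply (continuous_Rminus psi (psin n1)).
      + destruct (Hode s) as (_ & H & _). apply (continuous_of_derive _ _ _ H).
      + eapply continuous_of_derive. apply apsi_derive; [exact Hh|lra].
    - unfold f. rewrite Hpsi1. replace (psin n1 T1 + th1 - psin n1 T1) with th1 by ring.
      assert (H2P : 0 < 2 / PI) by (apply Rdiv_lt_0_compat; lra).
      assert (-1 < th1 * (2 / PI) < 1); [|nra].
      split.
      + apply Rmult_lt_reg_r with (PI / 2); [lra|]. replace (th1 * (2 / PI) * (PI / 2)) with th1 by (field; lra). lra.
      + apply Rmult_lt_reg_r with (PI / 2); [lra|]. replace (th1 * (2 / PI) * (PI / 2)) with th1 by (field; lra). lra.
    - intros c Hc Hle. specialize (Hle c ltac:(lra)).
      destruct (HT1 c ltac:(lra)) as (D1 & D2 & _).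
      pose proof (Hcoord n1 c ltac:(lra) D2) as Hp.
      destruct Hle as [|Heq]; [assumption|exfalso].
      assert (Hz0 : cos (psi c - psin n1 c) = 0); [|rewrite Hz0 in Hp; lra].
      unfold f in Heq. set (th := psi c - psin n1 c) in *.
      assert (Hcase : th * (2 / PI) = 1 \/ th * (2 / PI) = -1).
      { assert ((th * (2 / PI) - 1) * (th * (2 / PI) + 1) = 0) by (ring_simplify; ring_simplify in Heq; lra).
        apply Rmult_integral in H. destruct H; [left|right]; lra. }
      destruct Hcase as [Hc1|Hc1].
      + replace th with (PI / 2); [apply cos_PI2|]. transitivity (th * (2 / PI) * (PI / 2)); [rewrite Hc1; ring|field; lra].
      + replace th with (- (PI / 2)); [rewrite cos_neg; apply cos_PI2|].
        transitivity (th * (2 / PI) * (PI / 2)); [rewrite Hc1; ring|field; lra]. }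
  assert (Hpol : forall n t, dist2 x y (xs n) (ys n) t <= 1 -> 2 <= rhon n t -> Rabs (psi t - psin n t) < PI / 2 ->
     Rabs (psi t - psin n t) ^ 2 <= dist2 x y (xs n) (ys n) t /\
     Rabs (rho t - rhon n t) ^ 2 <= 4 * dist2 x y (xs n) (ys n) t).
  { intros n t D1 D2 D3. destruct (Hxy t) as [Hx Hy].
    pose proof (Hcoord n t D1 D2) as Hc.
    destruct (polar_angle_bound (rho t) (psi t - psin n t) _ _ D3 Hc eq_refl eq_refl) as [B1 B2].
    pose proof (polar_dist2 x y rho psi n t Hx Hy) as H.
    set (u := rho t * cos (psi t - psin n t)) in *. set (v := rho t * sin (psi t - psin n t)) in *.
    pose proof (Rabs_pos (psi t - psin n t)). pose proof (Rabs_pos (rho t - u)).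
    rewrite <- (pow2_abs v) in H. pose proof (pow2_ge_0 (u - rhon n t)).
    split; [nra|].
    rewrite pow2_abs. replace (rho t - rhon n t) with ((rho t - u) + (u - rhon n t)) by ring.
    assert ((rho t - u) ^ 2 <= Rabs v ^ 2) by (rewrite <- (pow2_abs (rho t - u)); apply pow_incr; lra).
    pose proof (pow2_ge_0 ((rho t - u) - (u - rhon n t))). nra. }
  intros N. destruct (Hdist (S N)) as (n2 & Hn2).
  (* n may exceed N; the surplus terms are O(e^(N+1)) and are removed at the end. *)
  set (n := max N (max n1 n2)).
  destruct (Hn2 n ltac:(lia)) as (C & T & HC & HT).
  pose proof (dist2_evt_small n2 (S N) 1 ltac:(lra) ltac:(lia) Hn2 n ltac:(lia)) as Hsm.
  assert (Hcl : evt (fun t => Rabs (psin n1 t - psin n t) < 1 / 2)).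
  { apply (bigO_small e He He0 (S n1)); [lia| |lra]. apply apsi_close; [exact Hh|lia|lia]. }
  assert (Hkey : evt (fun t => Rabs (psi t - psin n t) <= (1 + C) * e t ^ (S N) /\
                               Rabs (rho t - rhon n t) <= (2 + 2 * C) * e t ^ (S N))).
  { refine (evt_imp _ _ _ (evt_and _ _ (evt_and _ _ (evt_ge T) He) (evt_and _ _ Hsm (evt_and _ _ Hcl
      (evt_and _ _ (arho_ge_2 n) (evt_and _ _ (evt_ge T1) (Hsmall n1 (le_n _)))))))).
    intros t ((E0 & E0') & E1 & E2 & E3 & E4 & E5).
    destruct (HT1 t E4) as (D1 & D2 & Ht1).
    destruct (Hpol n1 t ltac:(lra) D2 (Hbase t E4)) as [B1 _].
    assert (B2 : Rabs (psi t - psin n1 t) <= 1 / 2).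
    { rewrite <- (Rabs_pos_eq (Rabs (psi t - psin n1 t))) by apply Rabs_pos. apply sqr_le_abs; lra. }
    assert (B3 : Rabs (psi t - psin n t) < PI / 2).
    { replace (psi t - psin n t) with ((psi t - psin n1 t) + (psin n1 t - psin n t)) by ring.
      eapply Rle_lt_trans; [apply Rabs_triang|]. lra. }
    destruct (Hpol n t E1 E3 B3) as [B4 B5].
    specialize (HT t E0).
    (* 1 / t^(N+1) = e^(2h(N+1)) is at most the square of e^(N+1), so the bound for the squared
       distance has the right order for the distance. *)
    assert (HE : C / t ^ S N <= C * (e t ^ S N) ^ 2).
    { unfold Rdiv. apply Rmult_le_compat_l; [exact HC|].
      rewrite <- pow_inv, <- (ep_pow_2h h Hh t), <- !pow_mult by lra. apply epow_le; [exact E0'|nia]. }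
    assert (Hpn : 0 < e t ^ S N) by (apply pow_lt; lra).
    split.
    - rewrite <- (Rabs_pos_eq (Rabs (psi t - psin n t))) by apply Rabs_pos.
      apply sqr_le_abs; [apply Rmult_le_pos; lra|]. rewrite Rpow_mult_distr.
      assert (C * (e t ^ S N) ^ 2 <= (1 + C) ^ 2 * (e t ^ S N) ^ 2) by (apply Rmult_le_compat_r; [apply pow2_ge_0|nra]). lra.
    - rewrite <- (Rabs_pos_eq (Rabs (rho t - rhon n t))) by apply Rabs_pos.
      apply sqr_le_abs; [apply Rmult_le_pos; lra|]. rewrite Rpow_mult_distr.
      assert (4 * (C * (e t ^ S N) ^ 2) <= (2 + 2 * C) ^ 2 * (e t ^ S N) ^ 2).
      { rewrite <- Rmult_assoc. apply Rmult_le_compat_r; [apply pow2_ge_0|nra]. } lra. }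
  split.
  - apply (bigO_ext_all e _ (fun t => (psi t - psin n t) + (psin n t - pola p (S N) (e t)))); [intros; ring|].
    apply (bigO_plus e).
    + exists (1 + C). split; [lra|]. refine (evt_imp _ _ _ Hkey). intros t [H _]. exact H.
    + apply (pola_tail e He). unfold n. lia.
  - apply (bigO_ext_all e _ (fun t => (rho t - rhon n t) + (pola r (S n) (e t) - pola r (S N) (e t)))).
    + intros t. unfold arho, ar. ring.
    + apply (bigO_plus e).
      * exists (2 + 2 * C). split; [lra|]. refine (evt_imp _ _ _ Hkey). intros t [_ H]. exact H.
      * apply (pola_tail e He). unfold n. lia.
Qed.

End PolarExpansion.

(** Continuing mu by its value at 0 to negative times gives a continuous coefficient on the whole
    line, as the global existence theory expects; the equations are read off for t >= 0. *)
Lemma smooth_nonneg_continuous (mu : R -> R) : smooth_nonneg mu ->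
  forall t, continuous (fun s => mu (Rmax s 0)) t.
Proof.
  intros (D & HD0 & HD) t. apply continuous_eps. intros eps Heps.
  set (x := Rmax t 0). assert (Hx : 0 <= x) by apply Rmax_r.
  destruct (HD 0%nat x Hx 1 Rlt_0_1) as (d & Hd & Hdd).
  set (l := D 1%nat x) in *. pose proof (Rabs_pos l) as Hl.
  exists (Rmin d (eps / (Rabs l + 1))). split; [apply Rmin_pos; [lra|apply Rdiv_lt_0_compat; lra]|].
  intros s Hs.
  pose proof (Rmin_l d (eps / (Rabs l + 1))). pose proof (Rmin_r d (eps / (Rabs l + 1))).
  set (y := Rmax s 0). assert (Hy : 0 <= y) by apply Rmax_r.
  assert (Hyx : Rabs (y - x) <= Rabs (s - t)).
  { unfold x, y, Rmax. repeat destruct Rle_dec; unfold Rabs; repeat destruct Rcase_abs; lra. }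
  rewrite <- !HD0 by assumption.
  destruct (Req_dec y x) as [->|Hne]; [rewrite Rminus_diag, Rabs_R0; lra|].
  specialize (Hdd (y - x) ltac:(lra) ltac:(lra)). replace (x + (y - x)) with y in Hdd by ring.
  specialize (Hdd Hy).
  assert (Hq : Rabs ((D 0%nat y - D 0%nat x) / (y - x)) <= Rabs l + 1).
  { replace ((D 0%nat y - D 0%nat x) / (y - x)) with (((D 0%nat y - D 0%nat x) / (y - x) - l) + l) by ring.
    eapply Rle_trans; [apply Rabs_triang|]. lra. }
  replace (D 0%nat y - D 0%nat x) with ((D 0%nat y - D 0%nat x) / (y - x) * (y - x)) by (field; lra).
  rewrite Rabs_mult. apply Rle_trans with ((Rabs l + 1) * (eps / (Rabs l + 1))).
  - apply Rmult_le_compat; try apply Rabs_pos; lra.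
  - right. field. lra.
Qed.

Lemma is_derive_deriv_nonneg (f : R -> R) x l : is_derive f x l -> deriv_nonneg f x l.
Proof.
  intros H eps Heps. apply is_derive_Reals in H. destruct (H eps Heps) as [d Hd].
  exists d. split; [apply cond_pos|]. intros u Hu Hud _. now apply Hd.
Qed.

(** * A solution with prescribed leading terms *)

Section Existence.

Variables (h : nat) (lam nu d sg p1 A0 : R) (mu : R -> R) (muk : nat -> R).
Hypothesis Hh : (1 <= h <= 3)%nat.
Hypothesis Hlam : 0 < lam.
Hypothesis Hmu : smooth_nonneg mu.
Hypothesis Hmuk : asymp mu muk (fun k => - (1/2) - INR k).
Hypothesis Hd : d = muk 0%nat * sqrt lam.
Hypothesis HA0 : A0 <> 0.

Local Notation e := (ep h).

Hypothesis H1 : bigO e (S h) (fun t => P0 (sg + p1 * e t) d nu + sqrt lam / 2 * e t ^ h).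
Hypothesis H2 : forall psi, bigO e 2 (fun t => psi t - (sg + p1 * e t)) ->
  bigO e h (fun t => P1 (psi t) d nu - A0 * e t ^ (h - 1)).
Hypothesis H3 : forall psi, bigO e 2 (fun t => psi t - (sg + p1 * e t)) ->
  bigO e (h - 2) (fun t => P2 (psi t) d nu).

Let m (t : R) : R := mu (Rmax t 0).
Let He := ep_le_1 h Hh.
Let He0 := ep_small h Hh.
Let Hh0 : 0 < INR h.
Proof. apply lt_0_INR. lia. Qed.

Let Rpower_half k t : Rpower t (- (1/2) - INR k) = e t ^ h * (e t ^ (2 * h)) ^ k.
Proof.
  rewrite <- pow_mult, <- pow_add, ep_pow by exact Hh. f_equal.
  rewrite plus_INR, !mult_INR. simpl (INR 2). field. lra.
Qed.

Let psum_mu t N : psum muk (fun k => - (1/2) - INR k) t N = e t ^ h * pola muk (S N) (e t ^ (2 * h)).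
Proof.
  induction N as [|N IH].
  - cbn [psum pola]. rewrite Rpower_half. ring.
  - cbn [psum]. rewrite IH, Rpower_half. cbn [pola]. ring.
Qed.

Let mm_expansion N : bigO e (2 * h * S N) (fun t => m t / e t ^ h - pola muk (S N) (e t ^ (2 * h))).
Proof.
  destruct (Hmuk N) as (C & T & HT & HC). exists (Rabs C). split; [apply Rabs_pos|].
  refine (evt_imp _ _ _ (evt_and _ _ (evt_ge T) He)). intros t [Ht Het].
  assert (HE : 0 < e t ^ h) by (apply pow_lt; lra).
  assert (Em : m t = mu t) by (unfold m; rewrite Rmax_left; [reflexivity|lra]).
  specialize (HC t Ht). rewrite psum_mu, Rpower_half in HC. rewrite Em.
  replace (mu t / e t ^ h - pola muk (S N) (e t ^ (2 * h))) with
    ((mu t - e t ^ h * pola muk (S N) (e t ^ (2 * h))) / e t ^ h) by (field; lra).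
  unfold Rdiv. rewrite Rabs_mult, Rabs_inv, (Rabs_pos_eq (e t ^ h)) by lra.
  apply Rmult_le_reg_r with (e t ^ h); [exact HE|]. rewrite Rmult_assoc, Rinv_l, Rmult_1_r by lra.
  eapply Rle_trans; [exact HC|]. rewrite (pow_mult (e t) (2 * h) (S N)).
  assert (0 <= e t ^ h * (e t ^ (2 * h)) ^ S N).
  { apply Rmult_le_pos; [lra|]. apply pow_le, pow_le. lra. }
  pose proof (Rle_abs C). nra.
Qed.

Let mm_ps n : ps e n (fun t => m t / e t ^ h).
Proof.
  apply (ps_ext_all e n (fun t => pola muk (S n) (e t ^ (2 * h)) + (m t / e t ^ h - pola muk (S n) (e t ^ (2 * h))))).
  - intros; ring.
  - apply ps_plus.
    + apply (ps_pola e He). apply ps_pow; [exact He|]. now apply ps_e.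
    + apply (ps_bigO e He). apply (bigO_weaken e He n (2 * h * S n)); [nia|apply mm_expansion].
Qed.

Let psum_pola a t N : psum a (fun k => - INR k / (2 * INR h)) t N = pola a (S N) (e t).
Proof.
  induction N as [|N IH].
  - cbn [psum pola]. rewrite <- (ep_pow h Hh 0). ring.
  - cbn [psum]. rewrite IH, <- (ep_pow h Hh (S N)). cbn [pola]. ring.
Qed.

Lemma asymp_of_bigO f a : (forall N, bigO e (S N) (fun t => f t - pola a (S N) (e t))) ->
  asymp f a (fun k => - INR k / (2 * INR h)).
Proof.
  intros H N. destruct (H N) as (C & HC & T & HT). exists C, (Rmax T 1).
  pose proof (Rmax_l T 1). pose proof (Rmax_r T 1). split; [lra|].
  intros t Ht. rewrite psum_pola, <- (ep_pow h Hh). apply HT. lra.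
Qed.

Lemma expansion_exists : exists rho psi r p, MS_solution lam nu mu rho psi /\
  expansion (2 * INR h) lam sg rho psi r p /\ r 1%nat = 0 /\ p 1%nat = p1.
Proof.
  assert (Hsl : 0 < sqrt lam) by now apply sqrt_lt_R0.
  assert (Hsl2 : lam = sqrt lam ^ 2) by (rewrite pow2_sqrt; lra).
  assert (Hm : forall t, continuous m t) by (apply smooth_nonneg_continuous; exact Hmu).
  assert (Hmm : bigO e (2 * h) (fun t => m t / e t ^ h - muk 0%nat)).
  { pose proof (mm_expansion 0) as H. rewrite Nat.mul_1_r in H.
    refine (bigO_ext_all e _ _ _ _ H). intros t. simpl. ring. }
  destruct (formal_solution e He He0 h (sqrt lam) nu sg d (muk 0%nat) p1 A0 (fun t => m t / e t ^ h)
     Hh Hsl Hd Hmm mm_ps HA0 H1 H2 H3) as (p & r & Hp0 & Hp1 & Hr0 & Hr1 & Hst).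
  destruct (tracked_exists h Hh lam nu (sqrt lam) sg d (muk 0%nat) p1 A0 m p r Hsl Hsl2 Hd Hmm mm_ps HA0 H2
     Hp0 Hp1 Hst Hm) as (x & y & Htr).
  destruct (polar_expansion h Hh lam nu (sqrt lam) m p r Hsl Hm x y Htr) as (rho & psi & rho' & psi' & Hode & Hexp).
  exists rho, psi, r, p. split; [|split; [split; [exact Hr0|split; [exact Hp0|split]]|split; [exact Hr1|exact Hp1]]].
  - exists rho', psi'. intros t Ht. destruct (Hode t) as (D1 & D2 & E1 & E2).
    assert (Em : m t = mu t) by (unfold m; rewrite Rmax_left; [reflexivity|lra]).
    rewrite Em in E1, E2.
    split; [now apply is_derive_deriv_nonneg|]. split; [now apply is_derive_deriv_nonneg|]. now split.
  - apply asymp_of_bigO. intros N. destruct (Hexp N) as [_ H].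
    refine (bigO_ext e _ _ _ _ H). refine (evt_imp _ _ _ (evt_ge 1)). intros t Ht.
    assert (Ehalf : Rpower t (1 / 2) = / e t ^ h).
    { rewrite ep_pow, <- Rpower_Ropp by exact Hh. f_equal. field. lra. }
    rewrite Ehalf. ring.
  - apply asymp_of_bigO. intros N. apply Hexp.
Qed.

End Existence.

(** * Leading-order conditions at a root of P *)

Section Cases.

Variables (h : nat) (sl d nu sg p1 : R).
Hypothesis Hh : (1 <= h <= 3)%nat.
Hypothesis Hsg : P0 sg d nu = 0.

Local Notation e := (ep h).
Let He := ep_le_1 h Hh.

Lemma root_shift psi : bigO e 2 (fun t => psi t - (sg + p1 * e t)) ->
  bigO e 2 (fun t => psi t - sg - p1 * e t) /\ bigO e 1 (fun t => psi t - sg).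
Proof.
  intros H. assert (H' : bigO e 2 (fun t => psi t - sg - p1 * e t)).
  { refine (bigO_ext_all e _ _ _ _ H). intros; ring. }
  split; [exact H'|].
  apply (bigO_ext_all e _ (fun t => (psi t - sg - p1 * e t) + p1 * e t ^ 1)); [intros; ring|].
  apply (bigO_plus e); [apply (bigO_weaken e He 1 2); [lia|exact H']|].
  apply (bigO_scal e He), (bigO_epow e He). lia.
Qed.

Lemma P0_near_root : bigO e 4 (fun t => P0 (sg + p1 * e t) d nu -
  (P1 sg d nu * (p1 * e t) + P2 sg d nu * (p1 * e t) ^ 2 / 2 + P3 sg d nu * (p1 * e t) ^ 3 / 6)).
Proof.
  apply (bigO_dominated e _ _ (fun t => (p1 * e t) ^ 4) (16 * Rabs d + 1)).
  - apply evt_all. intros t. rewrite <- RPow_abs.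
    pose proof (P0_taylor d nu sg (p1 * e t)) as H. rewrite Hsg, Rplus_0_l in H. exact H.
  - apply (bigO_ext_all e _ (fun t => p1 ^ 4 * e t ^ 4)); [intros; ring|].
    apply (bigO_scal e He), (bigO_epow e He). lia.
Qed.

Lemma P1_near_root psi : bigO e 1 (fun t => psi t - sg) -> bigO e 3 (fun t => P1 (psi t) d nu -
  (P1 sg d nu + P2 sg d nu * (psi t - sg) + P3 sg d nu * (psi t - sg) ^ 2 / 2)).
Proof.
  intros H. apply (bigO_dominated e _ _ (fun t => (psi t - sg) ^ 3) (16 * Rabs d + 1)).
  - apply evt_all. intros t. rewrite <- RPow_abs.
    pose proof (P1_taylor d nu sg (psi t - sg)) as X. replace (sg + (psi t - sg)) with (psi t) in X by ring. exact X.
  - apply (bigO_pow_le e He 1 3). exact H.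
Qed.

Lemma P2_near_root psi : bigO e 1 (fun t => psi t - sg) -> bigO e 1 (fun t => P2 (psi t) d nu - P2 sg d nu).
Proof.
  intros H.
  apply (bigO_ext_all e _ (fun t => (P2 (psi t) d nu - (P2 sg d nu + P3 sg d nu * (psi t - sg))) + P3 sg d nu * (psi t - sg)));
    [intros; ring|].
  apply (bigO_plus e); [|now apply bigO_scal].
  apply (bigO_weaken e He 1 2); [lia|].
  apply (bigO_dominated e _ _ (fun t => (psi t - sg) ^ 2) (16 * Rabs d + 1)).
  - apply evt_all. intros t. rewrite <- RPow_abs.
    pose proof (P2_taylor d nu sg (psi t - sg)) as X. replace (sg + (psi t - sg)) with (psi t) in X by ring. exact X.
  - apply (bigO_pow_le e He 1 2). exact H.
Qed.

End Cases.

Section Existence_by_root_order.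

Variables (lam nu d sg : R) (mu : R -> R) (muk : nat -> R).
Hypothesis Hlam : 0 < lam.
Hypothesis Hmu : smooth_nonneg mu.
Hypothesis Hmuk : asymp mu muk (fun k => - (1/2) - INR k).
Hypothesis Hd : d = muk 0%nat * sqrt lam.
Hypothesis Hsg : P0 sg d nu = 0.

(** Here h = 1 and A0 = P'(sigma): the leading balance is linear in p1. *)
Lemma simple_root_expansion p1 : P1 sg d nu <> 0 -> P1 sg d nu * p1 = - sqrt lam / 2 ->
  exists rho psi r p, MS_solution lam nu mu rho psi /\
    expansion 2 lam sg rho psi r p /\ r 1%nat = 0 /\ p 1%nat = p1.
Proof.
  intros HP1 Hp1. assert (Hh : (1 <= 1 <= 3)%nat) by lia.
  pose proof (ep_le_1 1 Hh) as He.
  destruct (expansion_exists 1 lam nu d sg p1 (P1 sg d nu) mu muk Hh Hlam Hmu Hmuk Hd HP1) as (rho & psi & r & p & H).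
  - apply (bigO_ext_all _ _ (fun t => (P0 (sg + p1 * ep 1 t) d nu - (P1 sg d nu * (p1 * ep 1 t) + P2 sg d nu * (p1 * ep 1 t) ^ 2 / 2 + P3 sg d nu * (p1 * ep 1 t) ^ 3 / 6))
       + (P2 sg d nu * p1 ^ 2 / 2 * ep 1 t ^ 2 + P3 sg d nu * p1 ^ 3 / 6 * ep 1 t ^ 3))).
    + intros t. replace (sqrt lam / 2) with (- (P1 sg d nu * p1)) by lra. field.
    + apply bigO_plus.
      * apply (bigO_weaken _ He 2 4); [lia|]. now apply P0_near_root.
      * apply bigO_plus; apply (bigO_scal _ He), (bigO_epow _ He); lia.
  - intros f Hf. destruct (root_shift 1 sg p1 Hh f Hf) as [_ Hf1].
    apply (bigO_ext_all _ _ (fun t => (P1 (f t) d nu - (P1 sg d nu + P2 sg d nu * (f t - sg) + P3 sg d nu * (f t - sg) ^ 2 / 2))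
       + (P2 sg d nu * (f t - sg) + P3 sg d nu / 2 * (f t - sg) ^ 2))).
    + intros t. simpl. field.
    + apply bigO_plus; [apply (bigO_weaken _ He 1 3); [lia|]; now apply P1_near_root|].
      apply bigO_plus; [now apply bigO_scal|]. apply (bigO_scal _ He).
      apply (bigO_weaken _ He 1 2); [lia|]. now apply (bigO_pow_le _ He 1 2).
  - intros f Hf. destruct (root_shift 1 sg p1 Hh f Hf) as [_ Hf1].
    apply (bigO_ext_all _ _ (fun t => (P2 (f t) d nu - P2 sg d nu) + P2 sg d nu)); [intros; ring|].
    apply bigO_plus; [apply (bigO_weaken _ He _ 1); [lia|]; now apply P2_near_root|apply bigO_const].
  - exists rho, psi, r, p. replace 2 with (2 * INR 1) by (simpl; ring). exact H.
Qed.

(** With h = 2 the leading balance is P'' p1^2 / 2 = - sqrt(lam) / 2, and A0 = P'' p1: for P'' < 0,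
    the choice p1 > 0 gives a saddle and p1 < 0 a centre. *)
Lemma double_root_expansion p1 : P1 sg d nu = 0 -> P2 sg d nu <> 0 -> P2 sg d nu * p1 ^ 2 = - sqrt lam ->
  exists rho psi r p, MS_solution lam nu mu rho psi /\
    expansion 4 lam sg rho psi r p /\ r 1%nat = 0 /\ p 1%nat = p1.
Proof.
  intros HP1 HP2 Hp1. assert (Hh : (1 <= 2 <= 3)%nat) by lia.
  pose proof (ep_le_1 2 Hh) as He.
  assert (Hsl : 0 < sqrt lam) by now apply sqrt_lt_R0.
  assert (HA0 : P2 sg d nu * p1 <> 0).
  { intros E. replace (P2 sg d nu * p1 ^ 2) with (P2 sg d nu * p1 * p1) in Hp1 by ring. rewrite E in Hp1. lra. }
  destruct (expansion_exists 2 lam nu d sg p1 (P2 sg d nu * p1) mu muk Hh Hlam Hmu Hmuk Hd HA0) as (rho & psi & r & p & H).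
  - apply (bigO_ext_all _ _ (fun t => (P0 (sg + p1 * ep 2 t) d nu - (P1 sg d nu * (p1 * ep 2 t) + P2 sg d nu * (p1 * ep 2 t) ^ 2 / 2 + P3 sg d nu * (p1 * ep 2 t) ^ 3 / 6))
       + P3 sg d nu * p1 ^ 3 / 6 * ep 2 t ^ 3)).
    + intros t. replace (sqrt lam / 2) with (- (P2 sg d nu * p1 ^ 2) / 2) by lra. rewrite HP1. field.
    + apply bigO_plus.
      * apply (bigO_weaken _ He 3 4); [lia|]. now apply P0_near_root.
      * apply (bigO_scal _ He), (bigO_epow _ He); lia.
  - intros f Hf. destruct (root_shift 2 sg p1 Hh f Hf) as [Hf2 Hf1].
    apply (bigO_ext_all _ _ (fun t => (P1 (f t) d nu - (P1 sg d nu + P2 sg d nu * (f t - sg) + P3 sg d nu * (f t - sg) ^ 2 / 2))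
       + (P2 sg d nu * (f t - sg - p1 * ep 2 t) + P3 sg d nu / 2 * (f t - sg) ^ 2))).
    + intros t. rewrite HP1. simpl. field.
    + apply bigO_plus; [apply (bigO_weaken _ He 2 3); [lia|]; now apply P1_near_root|].
      apply bigO_plus; [now apply bigO_scal|]. apply (bigO_scal _ He). now apply (bigO_pow_le _ He 1 2).
  - intros f Hf. destruct (root_shift 2 sg p1 Hh f Hf) as [_ Hf1].
    apply (bigO_ext_all _ _ (fun t => (P2 (f t) d nu - P2 sg d nu) + P2 sg d nu)); [intros; ring|].
    apply bigO_plus; [apply (bigO_weaken _ He _ 1); [lia|]; now apply P2_near_root|apply bigO_const].
  - exists rho, psi, r, p. replace 4 with (2 * INR 2) by (simpl; ring). exact H.
Qed.

(** With h = 3 the leading balance is P''' p1^3 / 6 = - sqrt(lam) / 2, and A0 = P''' p1^2 / 2, so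
    the sign of P''' decides between centre and saddle. *)
Lemma triple_root_expansion p1 : P1 sg d nu = 0 -> P2 sg d nu = 0 -> P3 sg d nu * p1 ^ 3 = - (3 * sqrt lam) ->
  exists rho psi r p, MS_solution lam nu mu rho psi /\
    expansion 6 lam sg rho psi r p /\ r 1%nat = 0 /\ p 1%nat = p1.
Proof.
  intros HP1 HP2 Hp1. assert (Hh : (1 <= 3 <= 3)%nat) by lia.
  pose proof (ep_le_1 3 Hh) as He.
  assert (Hsl : 0 < sqrt lam) by now apply sqrt_lt_R0.
  assert (HA0 : P3 sg d nu * p1 ^ 2 / 2 <> 0).
  { intros E. replace (P3 sg d nu * p1 ^ 3) with (P3 sg d nu * p1 ^ 2 / 2 * (2 * p1)) in Hp1 by field. rewrite E in Hp1. lra. }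
  destruct (expansion_exists 3 lam nu d sg p1 (P3 sg d nu * p1 ^ 2 / 2) mu muk Hh Hlam Hmu Hmuk Hd HA0) as (rho & psi & r & p & H).
  - apply (bigO_ext_all _ _ (fun t => P0 (sg + p1 * ep 3 t) d nu - (P1 sg d nu * (p1 * ep 3 t) + P2 sg d nu * (p1 * ep 3 t) ^ 2 / 2 + P3 sg d nu * (p1 * ep 3 t) ^ 3 / 6))).
    + intros t. replace (sqrt lam / 2) with (- (P3 sg d nu * p1 ^ 3) / 6) by lra. rewrite HP1, HP2. field.
    + now apply P0_near_root.
  - intros f Hf. destruct (root_shift 3 sg p1 Hh f Hf) as [Hf2 Hf1].
    (* (f - sg)^2 - (p1 e)^2 is factored; its factors are O(e^2) and O(e), which gives the order
       3. *)
    apply (bigO_ext_all _ _ (fun t => (P1 (f t) d nu - (P1 sg d nu + P2 sg d nu * (f t - sg) + P3 sg d nu * (f t - sg) ^ 2 / 2))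
       + P3 sg d nu / 2 * ((f t - sg - p1 * ep 3 t) * ((f t - sg) + p1 * ep 3 t ^ 1)))).
    + intros t. rewrite HP1, HP2. simpl. field.
    + apply bigO_plus; [now apply P1_near_root|]. apply (bigO_scal _ He).
      apply (bigO_mult _ He 2 1); [exact Hf2| |lia].
      apply bigO_plus; [exact Hf1|]. apply (bigO_scal _ He), (bigO_epow _ He); lia.
  - intros f Hf. destruct (root_shift 3 sg p1 Hh f Hf) as [_ Hf1].
    apply (bigO_ext_all _ _ (fun t => P2 (f t) d nu - P2 sg d nu)); [intros; rewrite HP2; ring|].
    now apply P2_near_root.
  - exists rho, psi, r, p. replace 6 with (2 * INR 3) by (simpl; ring). exact H.
Qed.

End Existence_by_root_order.

Lemma cbrt_pow3 x : x <> 0 -> cbrt x ^ 3 = x.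
Proof.
  intros Hx. assert (Hpos : forall y, 0 < y -> Rpower y (1/3) ^ 3 = y).
  { intros y Hy. rewrite <- Rpower_pow by apply exp_pos. rewrite Rpower_mult.
    replace (1 / 3 * INR 3) with 1 by (simpl; field). now apply Rpower_1. }
  unfold cbrt. destruct (Rle_dec 0 x) as [H|H].
  - apply Hpos. lra.
  - replace ((- Rpower (- x) (1/3)) ^ 3) with (- (Rpower (- x) (1/3) ^ 3)) by ring.
    rewrite Hpos by lra. ring.
Qed.

(** P'' + 4 P = -3 sin sigma and P''' + 4 P' = -3 cos sigma; a root of order four would make both
    vanish. *)
Lemma triple_root_P3_neq_0 s d nu : d <> 0 -> P0 s d nu = 0 -> P1 s d nu = 0 -> P2 s d nu = 0 -> P3 s d nu <> 0.
Proof.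
  unfold P0, P1, P2, P3. intros Hd H0 H1 H2 H3.
  assert (Hs : sin s = 0) by lra. assert (Hdc : d * cos (2 * s + nu) = 0) by lra.
  assert (Hc : cos s = 0) by lra.
  pose proof (sin2_cos2 s) as H. unfold Rsqr in H. rewrite Hs, Hc in H. lra.
Qed.


Theorem theorem2 :
  forall (lam nu : R) (mu : R -> R) (muk : nat -> R) (d sigma : R),
    0 < lam ->
    0 <= nu < PI ->
    smooth_nonneg mu ->
    (* mu(tau) ~ tau^{-1/2} (mu_0 + sum_{k>=1} mu_k tau^{-k}) *)
    asymp mu muk (fun k => - (1/2) - INR k) ->
    d = muk 0%nat * sqrt lam ->
    in_gamma d nu ->
    P0 sigma d nu = 0 ->
    (P1 sigma d nu <> 0 ->
       exists rho psi : R -> R, MS_solution lam nu mu rho psi /\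
                       ExpE1 lam d nu sigma rho psi) /\
    (P1 sigma d nu = 0 -> P2 sigma d nu < 0 ->
       let phi := sqrt (- sqrt lam / P2 sigma d nu) in
       (exists rho psi : R -> R, MS_solution lam nu mu rho psi /\
                        ExpE2 lam sigma phi rho psi) /\
       (exists rho psi : R -> R, MS_solution lam nu mu rho psi /\
                        ExpE2 lam sigma (- phi) rho psi)) /\
    (P1 sigma d nu = 0 -> P2 sigma d nu = 0 ->
       exists rho psi : R -> R, MS_solution lam nu mu rho psi /\
                       ExpE3 lam d nu sigma rho psi).
Proof.
  intros lam nu mu muk d sigma Hlam _ Hmu Hmuk Hd (_ & _ & Hd0) H0.
  assert (Hsl : 0 < sqrt lam) by now apply sqrt_lt_R0.
  split; [|split].
  - intros HP1.
    destruct (simple_root_expansion lam nu d sigma mu muk Hlam Hmu Hmuk Hd H0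
      (- sqrt lam / (2 * P1 sigma d nu)) HP1) as (rho & psi & r & p & HMS & Hexp & Hr & Hp); [now field|].
    exists rho, psi. split; [exact HMS|]. exists r, p. now split.
  - intros HP1 HP2 phi.
    assert (Hphi : phi ^ 2 = - sqrt lam / P2 sigma d nu).
    { unfold phi. apply pow2_sqrt.
      replace (- sqrt lam / P2 sigma d nu) with (sqrt lam / - P2 sigma d nu) by (field; lra).
      left. apply Rdiv_lt_0_compat; lra. }
    assert (HP2' : P2 sigma d nu <> 0) by lra.
    (* Only q^2 enters the leading balance, so both signs of phi are served at once. *)
    assert (Hexist : forall q, q ^ 2 = phi ^ 2 -> exists rho psi : R -> R,
       MS_solution lam nu mu rho psi /\ ExpE2 lam sigma q rho psi).
    { intros q Hq.
      destruct (double_root_expansion lam nu d sigma mu muk Hlam Hmu Hmuk Hd H0 q HP1 HP2')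
        as (rho & psi & r & p & HMS & Hexp & Hr & Hp); [rewrite Hq, Hphi; now field|].
      exists rho, psi. split; [exact HMS|]. exists r, p. now split. }
    split; apply Hexist; ring.
  - intros HP1 HP2.
    pose proof (triple_root_P3_neq_0 sigma d nu Hd0 H0 HP1 HP2) as HP3.
    set (chi := cbrt (3 * sqrt lam / P3 sigma d nu)).
    assert (Hchi : chi ^ 3 = 3 * sqrt lam / P3 sigma d nu).
    { apply cbrt_pow3. apply Rmult_integral_contrapositive_currified; [lra|now apply Rinv_neq_0_compat]. }
    destruct (triple_root_expansion lam nu d sigma mu muk Hlam Hmu Hmuk Hd H0 (- chi) HP1 HP2)
      as (rho & psi & r & p & HMS & Hexp & Hr & Hp).
    { replace ((- chi) ^ 3) with (- chi ^ 3) by ring. rewrite Hchi. now field. }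
    exists rho, psi. split; [exact HMS|]. exists r, p. now split.
Qed.
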